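(* Let $(S_t,t\ge0)$ be a drift-free subordinator whose Lévy measure $\nu$ has a continuous density on $]0,\infty[$ and satisfies conditions (L) and (R) stated in the context, and let $m_j=\int_0^\infty y^j\,\nu(\mathrm{d}y)$. Fix an integer $r\ge1$, let $K_{n,r}$ be the number of parts equal to $r$ in the regenerative composition $\mathcal C_n$ derived from $(S_t)$, and let $\widehat K_{\rho,r}$ be the number of parts equal to $r$ in the poissonised composition $\widehat{\mathcal C}_\rho$. Then, as $n\to\infty$, $K_{n,r}$ is asymptotically normal, i.e. $(K_{n,r}-\mathbb E K_{n,r})/\sqrt{\mathrm{var}\,K_{n,r}}$ converges in distribution to the standard normal law, and $$\mathbb E\,K_{n,r}=\frac{1}{m_1 r}\log n+O(1),\qquad \mathrm{var}\,K_{n,r}=\left(\frac{m_2}{r^2m_1^3}+\frac{1}{r\,m_1}\right)\log n+O(1).$$ The same is true for $\widehat K_{\rho,r}$ as $\rho\to\infty$ (with $n$ replaced by $\rho$).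
   Context: The subordinator has no killing. Condition (L): there are constants $c\in\mathbb R$ and $\epsilon>0$ such that $\nu[y,\infty]=-\log y+c-\gamma+O(y^{\epsilon})$ as $y\downarrow0$, where $\gamma=-\Gamma'(1)$ is Euler's constant. Condition (R): there is $\epsilon>0$ such that $\nu[y,\infty]=O(e^{-\epsilon y})$ as $y\to\infty$. Construction of the compositions: let $\widetilde S_t=1-\exp(-S_t)$, and let $\widetilde{\mathcal R}\subset[0,1]$ be the closed range of $(\widetilde S_t,t\ge0)$. The gaps of $\widetilde{\mathcal R}$ are the open interval components of $[0,1]\setminus\widetilde{\mathcal R}$. Let $u_1,\dots,u_n$ be i.i.d. uniform on $[0,1]$, independent of $(S_t)$. Two sample points are in the same block iff they fall in the same gap (almost surely every sample point falls in a gap). The composition $\mathcal C_n$ of $n$ is the sequence of sizes of the nonempty blocks, ordered from left to right. The poissonised composition $\widehat{\mathcal C}_\rho$ is defined in the same way, with the uniform sample replaced by the atoms of a homogeneous Poisson point process on $[0,1]$ with rate $\rho>0$, independent of $(S_t)$. Thus $K_{n,r}$ (respectively $\widehat K_{\rho,r}$) is the number of gaps containing exactly $r$ sample points (respectively exactly $r$ Poisson atoms). *)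

(* Defs.v *)
From HB Require Import structures.
From mathcomp Require Import all_boot all_order all_algebra finmap.
From mathcomp Require Import all_classical all_reals all_analysis.

Set Implicit Arguments.
Unset Strict Implicit.
Unset Printing Implicit Defensive.

Import Order.TTheory GRing.Theory Num.Theory.
Import numFieldNormedType.Exports.

Local Open Scope classical_set_scope.
Local Open Scope ring_scope.

(* The Landau notations need a bundled filter. *)
Canonical pinfty_filterType (R : realType) :=
  @FilterType R (pinfty_nbhs R) _.

Definition Gamma {R : realType} (x : R) : R :=
  \int[lebesgue_measure]_(t in `]0, +oo[) (t `^ (x - 1) * expR (- t)).

Definition euler_constant {R : realType} : R := - derive1 (@Gamma R) 1.

Definition mutually_independent {d d'} {Omega : measurableType d}
    {T : measurableType d'} {R : realType} (P : probability Omega R)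
    {I : choiceType} (X : I -> Omega -> T) : Prop :=
  forall (J : {fset I}) (B : I -> set T), (forall i, measurable (B i)) ->
    P (\bigcap_(i in [set` J]) X i @^-1` B i) =
      (\prod_(i <- J) P (X i @^-1` B i))%E.

Definition sigma_generated {d d'} {Omega : measurableType d}
    {T : measurableType d'} {I : Type} (D : set I) (X : I -> Omega -> T) :
    set (set Omega) :=
  <<s \bigcup_(i in D) preimage_set_system setT (X i) measurable >>.

Definition independent_systems {d} {Omega : measurableType d} {R : realType}
    (P : probability Omega R) (F G : set (set Omega)) : Prop :=
  forall A B, F A -> G B -> P (A `&` B) = (P A * P B)%E.

(** The points [x] with [mu [set x] = 0] are the continuity points of the
    distribution function of [mu]. Measurability is part of the definition since
    [P] is a total function on sets. *)
Definition converges_in_distribution {d} {Omega : measurableType d}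
    {R : realType} (P : probability Omega R) {I : Type} (F : set_system I)
    (X : I -> Omega -> R) (mu : probability (measurableTypeR R) R) : Prop :=
  (\forall i \near F, measurable_fun setT (X i)) /\
  forall x : R, mu [set x] = 0%E ->
    P [set w | X i w <= x] @[i --> F] --> mu `]-oo, x]%classic.

Definition asymptotically_normal {d} {Omega : measurableType d}
    {R : realType} (P : probability Omega R) {I : Type} (F : set_system I)
    (X : I -> Omega -> R) : Prop :=
  converges_in_distribution P F
    (fun i w => (X i w - fine 'E_P[X i]) / Num.sqrt (fine 'V_P[X i]))
    (normal_prob 0 1).

(** Processes are indexed by [R]; only the times [t >= 0] matter. There is no
    killing: the values are finite. *)
Record subordinator {d} {Omega : measurableType d} {R : realType}
    (P : probability Omega R) (S : R -> Omega -> R) : Prop := {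
  subordinator_measurable : forall t, 0 <= t -> measurable_fun setT (S t);
  subordinator_start : forall w, S 0 w = 0;
  subordinator_nondecreasing : forall w s t,
    0 <= s -> s <= t -> S s w <= S t w;
  subordinator_right_continuous : forall w t,
    0 <= t -> S u w @[u --> t^'+] --> S t w;
  subordinator_stationary : forall s t (B : set R),
    0 <= s -> 0 <= t -> measurable B ->
    P [set w | B (S (s + t) w - S s w)] = P [set w | B (S t w)];
  subordinator_independent_increments : forall t : nat -> R,
    0 <= t 0%N -> (forall i, t i <= t i.+1) ->
    mutually_independent P (fun (i : nat) w => S (t i.+1) w - S (t i) w)
}.

Record levy_measure {R : realType} (nu : {measure set R -> \bar R}) : Prop := {
  levy_measure_support : nu `]-oo, 0]%classic = 0%E;
  levy_measure_integrable :
    (\int[nu]_(y in `]0%R, +oo[) (Num.min 1 y)%:E < +oo)%E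
}.

(** [b] is the drift. *)
Definition levy_khintchine {d} {Omega : measurableType d} {R : realType}
    (P : probability Omega R) (S : R -> Omega -> R) (b : R)
    (nu : {measure set R -> \bar R}) : Prop :=
  forall t lam : R, 0 <= t -> 0 <= lam ->
    'E_P[fun w => expR (- (lam * S t w))]%E =
    (expR (- (t * (b * lam +
       \int[nu]_(y in `]0%R, +oo[) (1 - expR (- (lam * y)))))))%:E.

Definition driftless_subordinator {d} {Omega : measurableType d}
    {R : realType} (P : probability Omega R) (S : R -> Omega -> R)
    (nu : {measure set R -> \bar R}) : Prop :=
  [/\ subordinator P S, levy_measure nu & levy_khintchine P S 0 nu].

Definition has_continuous_density {R : realType}
    (nu : {measure set R -> \bar R}) : Prop :=
  exists f : R -> R, [/\ forall y, 0 < y -> 0 <= f y,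
    {in `]0, +oo[, continuous f} &
    forall A : set R, measurable A -> A `<=` `]0, +oo[%classic ->
      nu A = (\int[lebesgue_measure]_(y in A) (f y)%:E)%E].

(** The tails [nu `[y, +oo[] at [y > 0] are finite for a Levy measure, so that
    [fine] loses nothing. *)
Definition condition_L {R : realType} (nu : {measure set R -> \bar R}) : Prop :=
  exists c eps : R, 0 < eps /\
    (fun y : R => fine (nu `[y, +oo[%classic)) =
      (fun y : R => - ln y + c - euler_constant)
        +O_ (0^'+) (fun y : R => y `^ eps).

Definition condition_R {R : realType} (nu : {measure set R -> \bar R}) : Prop :=
  exists2 eps : R, 0 < eps &
    (fun y : R => fine (nu `[y, +oo[%classic)) =O_ +oo
      (fun y : R => expR (- (eps * y))).

Definition levy_moment {R : realType} (nu : {measure set R -> \bar R})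
    (j : nat) : R :=
  \int[nu]_(y in `]0%R, +oo[) (y ^+ j).

Definition closed_range {Omega : Type} {R : realType} (S : R -> Omega -> R)
    (w : Omega) : set R :=
  closure [set 1 - expR (- S t w) | t in `[0, +oo[%classic].

(** In [`[0, 1] `\` A], the intervals [[0, x[] and []x, 1]] are not gaps: only
    open intervals are. Almost surely they do not occur when [A] is the closed
    range of a subordinator mapped to [[0, 1]]. *)
Definition gaps {R : realType} (A : set R) : set (set R) :=
  [set G | (exists2 x : R, (`[0, 1]%classic `\` A) x &
              G = connected_component (`[0, 1]%classic `\` A) x) /\
           exists a b : R, G = `]a, b[%classic].

(** [nb_gaps A count r] is the number of gaps of [A] containing exactly [r]
    points of the sample whose number of points in a set is given by [count].
    It is only meaningful for [r >= 1] and finite samples: [fset_set] of an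
    infinite set is empty. *)
Definition nb_gaps {R : realType} (A : set R) (count : set R -> nat)
    (r : nat) : nat :=
  #|` fset_set [set G | gaps A G /\ count G = r]|.

Definition iid_uniform {d} {Omega : measurableType d} {R : realType}
    (P : probability Omega R) {n : nat} (u : 'I_n -> Omega -> R) : Prop :=
  [/\ forall i, measurable_fun setT (u i),
      forall i (B : set R), measurable B ->
        P (u i @^-1` B) = uniform_prob (@ltr01 R) B &
      mutually_independent P u].

Definition sample_count {Omega : Type} {R : realType} {n : nat}
    (u : 'I_n -> Omega -> R) (w : Omega) (A : set R) : nat :=
  #|[pred i : 'I_n | u i w \in A]|.

Definition nb_parts {Omega : Type} {R : realType} (S : R -> Omega -> R)
    {n : nat} (u : 'I_n -> Omega -> R) (r : nat) (w : Omega) : R :=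
  (nb_gaps (closed_range S w) (sample_count u w) r)%:R.

(** A point process is given by its random set [N w] of atoms. *)
Definition atom_count {Omega : Type} {R : realType} (N : Omega -> set R)
    (A : set R) (w : Omega) : nat :=
  #|` fset_set (N w `&` A)|.

(** The second argument of [poisson_prob] is a dummy. *)
Record poisson_process {d} {Omega : measurableType d} {R : realType}
    (P : probability Omega R) (rho : R) (N : Omega -> set R) : Prop := {
  poisson_process_finite : forall w, finite_set (N w);
  poisson_process_support : forall w, N w `<=` `[0, 1]%classic;
  poisson_process_measurable : forall A : set R, measurable A ->
    measurable_fun setT (atom_count N A);
  poisson_process_distribution : forall (A : set R) (B : set nat),
    measurable A -> A `<=` `[0, 1]%classic ->
    P (atom_count N A @^-1` B) =
      poisson_prob (rho * fine (lebesgue_measure A)) 0%N B;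
  poisson_process_independent : forall (k : nat) (A : 'I_k -> set R),
    (forall i, measurable (A i)) -> trivIset setT A ->
    mutually_independent P (fun i => atom_count N (A i))
}.

Definition nb_parts_poissonised {Omega : Type} {R : realType}
    (S : R -> Omega -> R) (N : Omega -> set R) (r : nat) (w : Omega) : R :=
  (nb_gaps (closed_range S w) ((atom_count N)^~ w) r)%:R.

(* Main.v *)
Require Import Defs.
From HB Require Import structures.
From mathcomp Require Import all_boot all_order all_algebra finmap.
From mathcomp Require Import all_classical all_reals all_analysis measurable_realfun.
From mathcomp Require Import ring lra zify.

Set Implicit Arguments.
Unset Strict Implicit.
Unset Printing Implicit Defensive.

Import Order.TTheory GRing.Theory Num.Theory.
Import numFieldNormedType.Exports.

Local Open Scope classical_set_scope.
Local Open Scope ring_scope.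

(* With [A] the thinning generator, [Phi(A)] acts on functions of the sample size
   and generates the chain removing the first part. The moments of [K_{n,r}] solve
   [Phi(A) g = b]; this is a renewal equation, solved up to [O(1)] by a maximum
   principle since [nu] is minorised by Lebesgue measure on a segment and the rate
   of [n -> n - r] is [1/r + O(n^-e)] by (L). For the CLT the test functions
   [G(m, t) = N(m / sqrt t)] solve the heat equation, so that along the chain
   [E G(m - K_n, s)] and [G(m - E K_n, s + var K_n)] differ by a controlled drift.
   The poissonised composition is the mixture of the [C_n] over the number of atoms. *)

(** All operators on functions of the sample size used here (thinning, its time integrals, [Phi(A)],
    averages over an interval of times) are multipliers in the basis ['C(n, j)]. They commute, and
    an identity between them is a scalar identity between symbols. The operator [K = levy_pot], with
    [A K = Phi(A)], carries the renewal argument: a right-hand side of order [n^-dl] makes [K d]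
    converge, and on functions with [K d] small a high power of the interval average contracts
    strictly in the norm weighted by [weight dl]. The remainder is then [O(n^-dl)] and not only
    [O(1)]. The variance needs this: the increments of the remainder of the mean enter the
    right-hand side of its equation and must be small when integrated against the rates. The
    recursion itself has to be extracted from the gaps of a random closed set. The subordinator is
    observed at the times [i / 2^k], where the occupancy of the cells has an explicit law. Absence
    of drift puts almost every sample point in a gap, and the limit in [k] turns the grid recursion
    into that of the rates. *)

(** * Multipliers in the binomial basis *)

Section Newton.
Variable R : comNzRingType.
Implicit Types (F G : nat -> R) (d g : nat -> R) (n j k : nat).

(** The [j]-th finite difference of [d] at 0: the coefficient of ['C(n, j)] in Newton's forward
    expansion of [d n]. *)
Definition newton d j : R :=
  \sum_(i < j.+1) (-1) ^+ (j - i) * 'C(j, i)%:R * d i.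

(* The operator acting on functions of [n] as multiplication by [F j] along
   the binomial coefficient ['C(n, j)]: if [F j = p ^+ j] it is the
   expectation of [d] at a binomial [(n, p)] variable. *)
Definition newton_op F d n : R :=
  \sum_(j < n.+1) F j * newton d j * 'C(n, j)%:R.

Definition delta k n : R := (k == n)%:R.

Lemma bin_trinomial n j k : (k <= j)%N -> (j <= n)%N ->
  ('C(n, j) * 'C(j, k) = 'C(n, k) * 'C(n - k, j - k))%N.
Proof.
move=> kj jn; have kn := leq_trans kj jn.
have h : (0 < k`! * (j - k)`! * (n - j)`!)%N by rewrite !muln_gt0 !fact_gt0.
apply/eqP; rewrite -(eqn_pmul2r h); apply/eqP.
have e1 := bin_fact jn; have e2 := bin_fact kj; have e3 := bin_fact kn.
have e4 : ('C(n - k, j - k) * ((j - k)`! * (n - j)`!) = (n - k)`!)%N.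
  have {1}-> : (n - j = (n - k) - (j - k))%N by rewrite subnBA // subnK.
  by apply: bin_fact; rewrite leq_sub2r.
transitivity (n`!).
  rewrite -e1 -e2; ring.
rewrite -e3 -e4; ring.
Qed.

(** Exchanging the two sums makes the coefficient of [d i] an alternating difference of [F], a
    binomial probability when [F j = p ^+ j]. Only the values [d i] with [i <= n] enter. *)
Lemma newton_opE F d n : newton_op F d n =
  \sum_(i < n.+1) 'C(n, i)%:R * d i *
    \sum_(l < (n - i).+1) 'C(n - i, l)%:R * (-1) ^+ l * F (i + l)%N.
Proof.
rewrite /newton_op /newton.
transitivity (\sum_(j < n.+1) \sum_(i < n.+1)
   F j * ((-1) ^+ (j - i) * 'C(j, i)%:R * d i) * 'C(n, j)%:R).
  apply: eq_bigr => j _; rewrite mulr_sumr mulr_suml. rewrite (big_ord_widen n.+1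
    (fun i => F j * ((-1) ^+ (j - i) * 'C(j, i)%:R * d i) * 'C(n, j)%:R)) //.
  rewrite big_mkcond /=; apply: eq_bigr => i _; case: ifPn => //.
  by rewrite -leqNgt => ji; rewrite bin_small // !(mulr0, mul0r).
rewrite exchange_big /=; apply: eq_bigr => i _.
have ini : (i <= n)%N by rewrite -ltnS.
rewrite -(big_mkord xpredT
  (fun j => F j * ((-1) ^+ (j - i) * 'C(j, i)%:R * d i) * 'C(n, j)%:R)).
rewrite (big_cat_nat (n := i)) //=; last exact: leqW.
rewrite big_nat_cond big1 ?add0r; last first.
  by move=> j /andP[/andP[_ ji] _]; rewrite (bin_small ji) !(mulr0, mul0r).
rewrite -{1}[X in \sum_(X <= _ < _) _]add0n big_addn big_mkord subSn //.
rewrite mulr_sumr; apply: eq_bigr => l _.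
have ln : (l + i <= n)%N by have := ltn_ord l; lia.
have := bin_trinomial (leq_addl l i) ln; rewrite addnK [(l + i)%N]addnC => e.
have := congr1 (fun m => m%:R : R) e; rewrite !natrM => {}e.
transitivity (F (i + l)%N * (-1) ^+ l * d i *
  ('C(n, (i + l)%N)%:R * 'C((i + l)%N, i)%:R)); first ring.
rewrite e; ring.
Qed.

Lemma newton_op_expr p d n : newton_op (fun j => p ^+ j) d n =
  \sum_(i < n.+1) 'C(n, i)%:R * p ^+ i * (1 - p) ^+ (n - i) * d i.
Proof.
rewrite newton_opE; apply: eq_bigr => i _.
rewrite exprDn.
transitivity ('C(n, i)%:R * d i * p ^+ i *
    \sum_(l < (n - i).+1) 'C(n - i, l)%:R * (-1) ^+ l * p ^+ l).
  rewrite -[RHS]mulrA; congr (_ * _); rewrite mulr_sumr.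
  by apply: eq_bigr => l _; rewrite exprD; ring.
transitivity ('C(n, i)%:R * d i * p ^+ i *
   \sum_(l < (n - i).+1) 1 ^+ (n - i - l) * (- p) ^+ l *+ 'C(n - i, l)).
  congr (_ * _); apply: eq_bigr => l _.
  by rewrite expr1n mul1r -mulr_natl [in RHS]exprNn; ring.
by ring.
Qed.

Lemma newton_op1 d n : newton_op (fun=> 1) d n = d n.
Proof.
transitivity (newton_op (fun j => 1 ^+ j) d n).
  by apply: eq_bigr => j _; rewrite expr1n.
rewrite newton_op_expr big_ord_recr /= big1 ?add0r.
  by rewrite binn subnn subrr !expr1n !mul1r.
by move=> i _; rewrite subrr expr0n subn_eq0 leqNgt ltn_ord /= !(mulr0, mul0r).
Qed.

(** The system is triangular with unit diagonal, so the coefficients are determined one after the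
    other. *)
Lemma newton_uniq d (c : nat -> R) : (forall n, d n = \sum_(j < n.+1) c j * 'C(n, j)%:R) ->
  forall j, newton d j = c j.
Proof.
move=> h j; elim/ltn_ind: j => j IH.
have := newton_op1 d j; rewrite [in RHS]h /newton_op.
rewrite big_ord_recr /= [RHS]big_ord_recr /= binn !mulr1 mul1r => e.
apply: (addrI (\sum_(i < j) c i * 'C(j, i)%:R)); rewrite -[RHS]e; congr (_ + _).
by apply: eq_bigr => i _; rewrite mul1r IH.
Qed.

Lemma newton_newton_op F d j : newton (newton_op F d) j = F j * newton d j.
Proof. by apply: (@newton_uniq _ (fun j => F j * newton d j)). Qed.

Lemma newton_opM F G d n :
  newton_op F (newton_op G d) n = newton_op (fun j => F j * G j) d n.
Proof. by apply: eq_bigr => j _; rewrite newton_newton_op mulrA. Qed.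

Lemma eq_newton_op F G d n : (forall j, (j <= n)%N -> F j = G j) ->
  newton_op F d n = newton_op G d n.
Proof. by move=> FG; apply: eq_bigr => j _; rewrite FG // -ltnS. Qed.

Lemma eq_newton_opr F d g n : (forall j, (j <= n)%N -> d j = g j) ->
  newton_op F d n = newton_op F g n.
Proof.
move=> dg; rewrite !newton_opE; apply: eq_bigr => i _.
by rewrite dg // -ltnS.
Qed.

Lemma newton_opZl c F d n :
  newton_op (fun j => c * F j) d n = c * newton_op F d n.
Proof. by rewrite mulr_sumr; apply: eq_bigr => j _; rewrite !mulrA. Qed.

Lemma newton_opBl F G d n :
  newton_op (fun j => F j - G j) d n = newton_op F d n - newton_op G d n.
Proof.
by rewrite -sumrB; apply: eq_bigr => j _; rewrite !mulrBl.
Qed.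

Lemma newton_opZ F c d n :
  newton_op F (fun k => c * d k) n = c * newton_op F d n.
Proof.
rewrite !newton_opE mulr_sumr; apply: eq_bigr => j _; ring.
Qed.

Lemma newton_opD F d g n :
  newton_op F (fun k => d k + g k) n = newton_op F d n + newton_op F g n.
Proof.
rewrite !newton_opE -big_split /=; apply: eq_bigr => j _; ring.
Qed.

Lemma newton_opB F d g n :
  newton_op F (fun k => d k - g k) n = newton_op F d n - newton_op F g n.
Proof.
rewrite !newton_opE -sumrB; apply: eq_bigr => j _; ring.
Qed.

Lemma newton_op_cst F c n : newton_op F (fun=> c) n = F 0%N * c.
Proof.
have nc j : newton (fun=> c) j = (j == 0%N)%:R * c.
  apply: (@newton_uniq _ (fun j => (j == 0%N)%:R * c)) => m; rewrite big_ord_recl bin0 /= mul1r mulr1 big1 ?addr0 //.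
  by move=> i _; rewrite !mul0r.
rewrite /newton_op big_ord_recl nc /= bin0 mul1r mulr1 big1 ?addr0 // => i _.
by rewrite nc /= !(mul0r, mulr0).
Qed.

(** Pascal's rule turns the backward difference into a sum over ['C(n.-1, j.-1)], and
    [n * 'C(n.-1, j.-1) = j * 'C(n, j)]. *)
Lemma newton_op_natr d n :
  newton_op (fun j => j%:R) d n = n%:R * (d n - d n.-1).
Proof.
case: n => [|n]; first by rewrite /newton_op big_ord1 mul0r !mul0r.
rewrite -{1}[d n.+1]newton_op1 -[d n.+1.-1]newton_op1 /newton_op /=.
rewrite [X in _ = _ * (_ - X)](_ : _ =
   \sum_(j < n.+2) 1 * newton d j * 'C(n, j)%:R); last first.
  by rewrite [RHS]big_ord_recr /= bin_small ?mulr0 ?addr0.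
rewrite -sumrB mulr_sumr; apply: eq_bigr => -[[|j] _] _ /=.
  by rewrite !bin0; ring.
rewrite -mulrBr mul1r binS natrD [X in _ = _ * (_ * X)]addrAC subrr add0r.
rewrite [RHS]mulrCA -natrM mul_bin_diag natrM binS natrD; ring.
Qed.

Lemma newton_op_rates F d n : newton_op F d n =
  \sum_(k < n.+1) newton_op F (delta k) n * d k.
Proof.
rewrite newton_opE; apply: eq_bigr => i _; rewrite newton_opE.
rewrite [X in _ = X * _](bigD1 i) //= [X in _ = (_ + X) * _]big1 ?addr0.
  rewrite /delta eqxx mulr1; ring.
by move=> k ki; rewrite /delta eq_sym (inj_eq val_inj) (negPf ki) mulr0 mul0r.
Qed.

End Newton.

(** * Thinning, its potential, and weights of power order *)

Section Calculus.
Variable R : realType.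
Implicit Types (F G : nat -> R) (d g : nat -> R) (n j k : nat) (x y dl : R).

Lemma is_derive_sumf (n : nat) (h : 'I_n -> R -> R) x (dh : 'I_n -> R) :
  (forall i, is_derive x 1 (h i) (dh i)) ->
  is_derive x 1 (fun y => \sum_(i < n) h i y) (\sum_(i < n) dh i).
Proof.
move=> hd; rewrite (_ : (fun y => _) = \sum_(i < n) h i); last first.
  by apply/funext => y; rewrite fct_sumE.
exact: is_derive_sum.
Qed.

Lemma le_of_eq x y : x = y -> x <= y.
Proof. by move=> ->. Qed.

Lemma ge0_derive_nondecreasing (f df : R -> R) (a b : R) : a <= b ->
  (forall z, a <= z <= b -> is_derive z 1 f (df z)) ->
  (forall z, a <= z <= b -> 0 <= df z) -> f a <= f b.
Proof.
move=> ab hd h0.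
have [z||c] := @MVT_segment R f df a b ab.
- by rewrite in_itv /= => /andP[/ltW az /ltW zb]; apply: hd; rewrite az.
- apply: derivable_within_continuous => z; rewrite in_itv /= => abz.
  by have [] := hd _ abz.
rewrite in_itv /= => abc e; rewrite -subr_ge0 e mulr_ge0 ?subr_ge0 //.
exact: h0.
Qed.

Lemma le_derive_increment (f df g dg : R -> R) (a b : R) : a <= b ->
  (forall z, a <= z <= b -> is_derive z 1 f (df z)) ->
  (forall z, a <= z <= b -> is_derive z 1 g (dg z)) ->
  (forall z, a <= z <= b -> df z <= dg z) -> f b - f a <= g b - g a.
Proof.
move=> ab hf hg h; rewrite -subr_ge0.
have -> : g b - g a - (f b - f a) = (g - f) b - (g - f) a by rewrite !fctE; ring.
rewrite subr_ge0; apply: (@ge0_derive_nondecreasing _ (fun z => dg z - df z)) => // z zab.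
  by have := hf _ zab; have := hg _ zab => ? ?; apply: is_deriveB.
by rewrite subr_ge0 h.
Qed.

(** Expectation of [d] at a binomial variable of parameters [n] and [expR (- y)]: each point
    survives up to time [y] independently. *)
Definition thinning y d n : R := newton_op (fun j => expR (- (j%:R * y))) d n.

(** Minus the generator of the death process in which each point dies at unit rate; its symbol is
    [j]. *)
Definition thinning_gen d n : R := n%:R * (d n - d n.-1).

Definition pot_symbol y j : R :=
  if j == 0%N then y else (1 - expR (- (j%:R * y))) / j%:R.

(* [\int_0^y thinning u d n du], by integration of the symbol *)
Definition potential y d n : R := newton_op (pot_symbol y) d n.

Lemma thinningE y d n : thinning y d n = \sum_(i < n.+1)
  'C(n, i)%:R * expR (- y) ^+ i * (1 - expR (- y)) ^+ (n - i) * d i.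
Proof.
rewrite -newton_op_expr; apply: eq_newton_op => j _.
by rewrite -mulrN -expRM_natl.
Qed.

Lemma thinning_ge0 y d n : 0 <= y -> (forall k, (k <= n)%N -> 0 <= d k) ->
  0 <= thinning y d n.
Proof.
move=> y0 d0; rewrite thinningE; apply: sumr_ge0 => i _.
rewrite !mulr_ge0 ?ler0n ?exprn_ge0 ?expR_ge0 ?d0 -1?ltnS //.
by rewrite subr_ge0 -expR0 ler_expR oppr_le0.
Qed.

Lemma le_thinning y d g n : 0 <= y -> (forall k, (k <= n)%N -> d k <= g k) ->
  thinning y d n <= thinning y g n.
Proof.
move=> y0 dg; rewrite -subr_ge0 -newton_opB; apply: thinning_ge0 => // k kn.
by rewrite subr_ge0 dg.
Qed.

Lemma thinning_cst y c n : thinning y (fun=> c) n = c.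
Proof. by rewrite /thinning newton_op_cst mul0r oppr0 expR0 mul1r. Qed.

Lemma thinning0 d n : thinning 0 d n = d n.
Proof.
rewrite -[RHS]newton_op1; apply: eq_newton_op => j _.
by rewrite mulr0 oppr0 expR0.
Qed.

Lemma is_derive_newton_op (F : R -> nat -> R) (dF : nat -> R) y d n :
  (forall j, is_derive y 1 (F ^~ j) (dF j)) ->
  is_derive y 1 (fun z => newton_op (F z) d n) (newton_op dF d n).
Proof.
move=> hF; apply: is_derive_sumf => i.
rewrite (_ : (fun z => _) = (newton d i * 'C(n, i)%:R) \*: (F ^~ (i : nat))); last first.
  by apply/funext => z /=; rewrite /GRing.scale /=; ring.
apply: is_derive_eq.
by rewrite /GRing.scale /=; ring.
Qed.

Lemma is_derive_expRN (c y : R) :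
  is_derive y 1 (fun z => expR (- (c * z))) (- c * expR (- (c * y))).
Proof.
have -> : (fun z => expR (- (c * z))) = expR \o ( (- c) \*: (@id R)).
  by apply/funext => z /=; rewrite /GRing.scale /= mulNr.
have h : is_derive y 1 (- c \*: (@id R)) (- c).
  by apply: is_derive_eq; rewrite /GRing.scale /= mulr1.
have h2 := is_derive_expR ((- c \*: (@id R)) y).
have h3 := is_derive1_comp h2 h.
apply: is_derive_eq.
by rewrite mulrC; congr (_ * expR _); rewrite /= /GRing.scale /= mulNr.
Qed.

Lemma is_derive_expRM (c y : R) :
  is_derive y 1 (fun z => expR (c * z)) (c * expR (c * y)).
Proof.
have := is_derive_expRN (- c) y; rewrite !mulNr !opprK; congr is_derive.
by apply/funext => z; rewrite mulNr opprK.
Qed.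

Lemma thinning_genE d n : thinning_gen d n = newton_op (fun j => j%:R) d n.
Proof. by rewrite newton_op_natr. Qed.

Lemma is_derive_thinning y d n : is_derive y 1 (fun z => thinning z d n)
  (- thinning y (thinning_gen d) n).
Proof.
have -> : - thinning y (thinning_gen d) n =
    newton_op (fun j => - j%:R * expR (- (j%:R * y))) d n.
  rewrite /thinning -mulN1r -newton_opZl.
  rewrite (eq_newton_opr _ (fun j _ => thinning_genE d j)) newton_opM.
  by apply: eq_newton_op => j _; ring.
by apply: is_derive_newton_op => j; exact: is_derive_expRN.
Qed.

Lemma is_derive_potential y d n :
  is_derive y 1 (fun z => potential z d n) (thinning y d n).
Proof.
apply: is_derive_newton_op => -[|j].
  by rewrite mul0r oppr0 expR0; exact: is_derive_id.
rewrite /pot_symbol /=.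
rewrite (_ : (fun z => _) = (j.+1%:R^-1) \*: (cst 1 - (fun z => expR (- (j.+1%:R * z))))); last first.
  by apply/funext => z /=; rewrite /GRing.scale /= mulrC.
have := is_derive_expRN j.+1%:R y => ?.
apply: is_derive_eq.
by rewrite /GRing.scale /= sub0r mulNr opprK mulrA mulVf ?mul1r // pnatr_eq0.
Qed.

Lemma potential0 d n : potential 0 d n = 0.
Proof.
rewrite /potential /newton_op big1 // => j _; rewrite /pot_symbol.
by rewrite mulr0 oppr0 expR0 subrr mul0r if_same !mul0r.
Qed.

Lemma le_potential_time x y d n : 0 <= x -> x <= y ->
  (forall k, (k <= n)%N -> 0 <= d k) -> potential x d n <= potential y d n.
Proof.
move=> x0 xy d0.
apply: (@ge0_derive_nondecreasing (fun z => potential z d n) (fun z => thinning z d n)) => //.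
  by move=> z _; exact: is_derive_potential.
by move=> z /andP[xz _]; rewrite thinning_ge0 // (le_trans x0).
Qed.

Lemma potential_ge0 y d n : 0 <= y -> (forall k, (k <= n)%N -> 0 <= d k) ->
  0 <= potential y d n.
Proof. by move=> y0 d0; rewrite -(potential0 d n) le_potential_time. Qed.

Lemma le_potential y d g n : 0 <= y -> (forall k, (k <= n)%N -> d k <= g k) ->
  potential y d n <= potential y g n.
Proof.
move=> y0 dg; rewrite -subr_ge0 -newton_opB; apply: potential_ge0 => // k kn.
by rewrite subr_ge0 dg.
Qed.

Lemma potential_cst y c n : potential y (fun=> c) n = y * c.
Proof. by rewrite /potential newton_op_cst. Qed.

(** The integrated form of the differential equation of thinning; on symbols,
    [1 - e^(-j y) = j * pot_symbol y j]. *)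
Lemma subr_thinning y d n :
  d n - thinning y d n = potential y (thinning_gen d) n.
Proof.
rewrite /potential (eq_newton_opr _ (fun j _ => thinning_genE d j)).
rewrite newton_opM -{1}[d n]newton_op1 -newton_opBl; apply: eq_newton_op => -[|j] _.
  by rewrite mul0r oppr0 expR0 subrr mulr0.
by rewrite /pot_symbol /= mulfVK // pnatr_eq0.
Qed.

(** Equal to [n! Gamma(1 + dl) / Gamma(n + 1 + dl)], of order [n^-dl]. It replaces the power because
    the thinning generator acts on it exactly. *)
Definition weight dl n : R := \prod_(j < n) (j.+1%:R / (j.+1%:R + dl)).

Definition hsum n : R := \sum_(j < n) (j.+1%:R)^-1.

Section Weight.
Variable dl : R.
Hypothesis dl0 : 0 <= dl.

Let den n : 0 < n.+1%:R + dl.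
by rewrite (lt_le_trans (ltr0Sn R n)) // lerDl. Qed.

Lemma weight0 : weight dl 0 = 1. Proof. by rewrite /weight big_ord0. Qed.

Lemma weightS n : weight dl n.+1 * (n.+1%:R + dl) = weight dl n * n.+1%:R.
Proof.
by rewrite /weight big_ord_recr /= -mulrA divfK // gt_eqF.
Qed.

Lemma weight_gt0 n : 0 < weight dl n.
Proof. by apply: prodr_gt0 => i _; rewrite divr_gt0. Qed.

Lemma weight_nonincreasing m n : (m <= n)%N -> weight dl n <= weight dl m.
Proof.
move=> /subnK <-; elim: (n - m)%N => // k IH; rewrite addSn.
apply: le_trans IH; rewrite /weight big_ord_recr /= ler_piMr //.
  exact/ltW/weight_gt0.
by rewrite ler_pdivrMr // mul1r lerDl.
Qed.

Lemma weight_le1 n : weight dl n <= 1.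
Proof. by rewrite -weight0 weight_nonincreasing. Qed.

(** The recursion [weightS] gives the eigenvalue [- dl]; at [n = 0], where the generator vanishes,
    [delta] corrects it. *)
Lemma thinning_gen_weight n :
  thinning_gen (weight dl) n = - dl * (weight dl n - delta R 0 n).
Proof.
case: n => [|n]; first by rewrite /thinning_gen weight0 /delta !subrr !mulr0.
rewrite /thinning_gen /delta /= subr0 mulrBr [_ * weight dl n]mulrC -weightS; ring.
Qed.

Lemma le_delta0_weight n : delta R 0 n <= weight dl n.
Proof. by case: n => [|n]; rewrite ?weight0 // /delta /= ltW ?weight_gt0. Qed.

(* The weight is an eigenfunction of the generator, except at [n = 0]. *)
Lemma thinning_weight y n : 0 <= y ->
  thinning y (weight dl) n <= expR (dl * y) * weight dl n.
Proof.
move=> y0.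
(* Rescaled by its eigenvalue the thinned weight has derivative [- dl] times a probability of
   extinction, up to a positive factor, hence decreases. *)
pose f z := expR (- (dl * z)) * thinning z (weight dl) n.
pose df z := - (dl * expR (- (dl * z)) * thinning z (delta R 0) n).
have fd (z : R) : is_derive z 1 f (df z).
  have h1 := is_derive_expRN dl z. have h2 := is_derive_thinning z (weight dl) n.
  apply: is_derive_eq. rewrite /df /GRing.scale /=.
  have -> : thinning z (thinning_gen (weight dl)) n =
     - dl * (thinning z (weight dl) n - thinning z (delta R 0) n).
    rewrite /thinning -newton_opB -newton_opZ.
    by apply: eq_newton_opr => j _; rewrite thinning_gen_weight.
  ring.
have : f y <= f 0.
  rewrite -lerN2.
  apply: (@ge0_derive_nondecreasing (- f) (fun z => - df z)) => // z /andP[z0 _].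
  rewrite opprK !mulr_ge0 ?expR_ge0 //. by apply: thinning_ge0 => // k _; rewrite ler0n.
by rewrite /f thinning0 mulr0 oppr0 expR0 mul1r expRN ler_pdivrMl ?expR_gt0.
Qed.

End Weight.

Lemma potential_weight dl y n : 0 < dl -> 0 <= y ->
  potential y (weight dl) n <= (expR (dl * y) - 1) / dl * weight dl n.
Proof.
move=> dl0 y0.
have := @le_derive_increment (fun z => potential z (weight dl) n)
  (fun z => thinning z (weight dl) n)
  (fun z => weight dl n / dl * expR (- (- dl * z)))
  (fun z => expR (dl * z) * weight dl n) 0 y y0.
rewrite potential0 subr0 mulr0 oppr0 expR0 mulr1 => h.
apply: (le_trans (h _ _ _)) => [z _|z _|z /andP[z0 _]|].
- exact: is_derive_potential.
- have := is_derive_expRN (- dl) z => ?.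
  rewrite (_ : (fun z => _) = (weight dl n / dl) \*: (fun z => expR (- (- dl * z)))) //.
  apply: is_derive_eq; rewrite /GRing.scale /= opprK mulNr opprK. by field; rewrite gt_eqF.
- by apply: thinning_weight => //; exact: ltW.
rewrite mulNr opprK; apply: le_of_eq; by field; rewrite gt_eqF.
Qed.

(** Harmonic numbers serve as an exact logarithm: away from 0 they solve [A H = 1], so that thinning
    up to time [y] lowers them by [y], up to the potential of [delta 0]. *)
Lemma thinning_gen_harmonic n :
  thinning_gen hsum n = 1 - delta R 0 n.
Proof.
case: n => [|n]; first by rewrite /thinning_gen /delta mul0r subrr.
rewrite /thinning_gen /delta /= subr0 /hsum big_ord_recr /=.
by rewrite addrAC subrr add0r divff // pnatr_eq0.
Qed.

Lemma harmonic_thinning y n :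
  hsum n - thinning y hsum n = y - potential y (delta R 0) n.
Proof.
rewrite subr_thinning -[X in X - _]mulr1 -(potential_cst y 1 n) -newton_opB.
by apply: eq_newton_opr => j _; rewrite thinning_gen_harmonic.
Qed.

Lemma le_weight (d1 d2 : R) n : 0 <= d1 -> d1 <= d2 -> weight d2 n <= weight d1 n.
Proof.
move=> d10 d12; apply: ler_prod => i _.
have h : 0 < i.+1%:R + d1 :> R by rewrite (lt_le_trans (ltr0Sn R i)) // lerDl.
have h' : 0 < i.+1%:R + d2 :> R by rewrite (lt_le_trans h) // lerD2l.
by rewrite divr_ge0 ?(ltW h') //= ler_pM2l ?ltr0Sn // lef_pV2 ?posrE // lerD2l.
Qed.

(** Factor by factor, [(j + d1)(j + d2) <= j (j + d3)] for [j >= 1]. It lets one exponent be spent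
    as two smaller ones. *)
Lemma weightM (d1 d2 d3 : R) n : 0 <= d1 -> 0 <= d2 -> d1 + d2 + d1 * d2 <= d3 ->
  weight d3 n <= weight d1 n * weight d2 n.
Proof.
move=> d10 d20 h; rewrite /weight -big_split /=; apply: ler_prod => i _.
have d30 : 0 <= d3 by rewrite (le_trans _ h) // !addr_ge0 // mulr_ge0.
have hp (e : R) : 0 <= e -> 0 < i.+1%:R + e.
  by move=> e0; rewrite (lt_le_trans (ltr0Sn R i)) // lerDl.
rewrite divr_ge0 ?(ltW (hp _ _)) //= mulf_div ler_pdivrMr ?hp // mulrAC.
rewrite ler_pdivlMr ?mulr_gt0 ?hp //.
have i1 : 1 <= i.+1%:R :> R by rewrite ler1n.
rewrite -mulrA ler_pM2l ?ltr0Sn //.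
have : 0 <= (d3 - (d1 + d2 + d1 * d2)) * i.+1%:R by rewrite mulr_ge0 ?subr_ge0.
have : 0 <= d1 * d2 * (i.+1%:R - 1) by rewrite !mulr_ge0 ?subr_ge0.
nra.
Qed.

Lemma harmonic_ge0 n : 0 <= hsum n.
Proof. by apply: sumr_ge0 => i _; rewrite invr_ge0. Qed.

Lemma harmonic_le m n : (m <= n)%N -> hsum m <= hsum n.
Proof.
move=> /subnK <-; elim: (n - m)%N => // k IH; rewrite addSn.
by apply: (le_trans IH); rewrite /hsum big_ord_recr /= lerDl invr_ge0.
Qed.

(** The ratio is the product of [1 + dl / j] over [m < j <= n], bounded below by its first-order
    expansion. *)
Lemma weight_harmonic_incr dl m n : 0 <= dl -> (m <= n)%N ->
  1 + dl * (hsum n - hsum m) <= weight dl m / weight dl n.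
Proof.
move=> dl0 /subnK <-; elim: (n - m)%N => [|k IH].
  by rewrite add0n subrr mulr0 addr0 divff // gt_eqF // weight_gt0.
rewrite addSn; set p := (k + m)%N in IH *.
have p0 : 0 < p.+1%:R :> R by rewrite ltr0Sn.
have -> : weight dl m / weight dl p.+1 = weight dl m / weight dl p * (1 + dl / p.+1%:R).
  have e := weightS dl0 p. have -> : weight dl p.+1 = weight dl p / (1 + dl / p.+1%:R).
    apply: (@mulIf _ (p.+1%:R + dl)); first by rewrite gt_eqF // ltr_wpDr.
    rewrite e; field; rewrite !gt_eqF ?ltr_wpDr // ?ltr_pwDl //.
  field; rewrite !gt_eqF ?weight_gt0 ?ltr_wpDr //.
have -> : hsum p.+1 = hsum p + p.+1%:R^-1.
  by rewrite /hsum big_ord_recr.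
have hm : hsum m <= hsum p by rewrite harmonic_le // /p leq_addl.
have q0 : 0 <= dl / p.+1%:R by rewrite divr_ge0.
have := ler_wpM2r (addr_ge0 ler01 q0) IH.
have : 0 <= dl * (hsum p - hsum m) * (dl / p.+1%:R).
  by rewrite mulr_ge0 // mulr_ge0 // subr_ge0.
move=> h1 h2; apply: le_trans h2; rewrite -subr_ge0; apply: (le_trans h1).
by apply: le_of_eq; ring.
Qed.

Lemma weight_harmonic dl n : 0 < dl -> weight dl n * hsum n <= dl^-1.
Proof.
move=> dl0; have := weight_harmonic_incr (ltW dl0) (leq0n n).
rewrite weight0 {2}/hsum big_ord0 subr0.
rewrite ler_pdivlMr ?weight_gt0 ?(ltW dl0) // => h.
rewrite -div1r ler_pdivlMr //.
by have := weight_gt0 (ltW dl0) n; nra.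
Qed.

(** By the eigenvalue equation, the hypothesis bounds the increments of [Z] by [C / dl] times the
    decrements of the weight. So [Z - c w] increases, [Z + c w] decreases, and the supremum of the
    former separates them. *)
Lemma generator_eq_lim dl (Z : nat -> R) (C : R) : 0 < dl -> 0 <= C ->
  (forall n, (0 < n)%N -> `|thinning_gen Z n| <= C * weight dl n) ->
  exists Zoo, forall n, `|Z n - Zoo| <= C / dl * weight dl n.
Proof.
move=> dl0 C0 h; pose c := C / dl.
have c0 : 0 <= c by rewrite divr_ge0 // ltW.
have step n : `|Z n.+1 - Z n| <= c * (weight dl n - weight dl n.+1).
  have := h n.+1 isT; rewrite /thinning_gen /= normrM ger0_norm //.
  rewrite mulrC -ler_pdivlMr ?ltr0Sn // => /le_trans; apply.
  apply: le_of_eq; have := weightS (ltW dl0) n => e.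
  apply: (@mulfI _ (dl * n.+1%:R)); first by rewrite mulf_neq0 // gt_eqF.
  transitivity (c * dl * (weight dl n * n.+1%:R - weight dl n.+1 * n.+1%:R)).
    have q0 : (n.+1%:R : R) != 0 by rewrite pnatr_eq0. have dl1 : dl != 0 by rewrite gt_eqF.
    move: e q0; rewrite /c; move: (n.+1%:R : R) => q e q0.
    by rewrite -e; field; rewrite ?q0 ?dl1.
  ring.
have lo m n : (m <= n)%N -> Z m - c * weight dl m <= Z n - c * weight dl n.
  move=> /subnK <-; elim: (n - m)%N => // k IH; apply: (le_trans IH); rewrite addSn.
  have := step (k + m)%N; rewrite ler_norml => /andP[]; lra.
have hi m n : (m <= n)%N -> Z n + c * weight dl n <= Z m + c * weight dl m.
  move=> /subnK <-; elim: (n - m)%N => // k IH; apply: le_trans IH; rewrite addSn.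
  have := step (k + m)%N; rewrite ler_norml => /andP[]; lra.
have lh m n : Z m - c * weight dl m <= Z n + c * weight dl n.
  have [mn|/ltnW nm] := leqP m n.
    apply: (le_trans (lo _ _ mn)); have := weight_gt0 (ltW dl0) n; nra.
  apply: (le_trans _ (hi _ _ nm)); have := weight_gt0 (ltW dl0) m; nra.
pose E := [set Z n - c * weight dl n | n in setT].
have supE : has_sup E.
  split; first by exists (Z 0%N - c * weight dl 0%N); exists 0%N.
  by exists (Z 0%N + c * weight dl 0%N) => _ [n _ <-]; exact: lh.
exists (sup E) => n; rewrite -/c ler_norml; apply/andP; split.
  have : sup E <= Z n + c * weight dl n.
    by apply: ge_sup => [|_ [m _ <-]]; [case: supE | exact: lh].
  lra.
have : Z n - c * weight dl n <= sup E by apply: ub_le_sup; [case: supE | exists n].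
lra.
Qed.

End Calculus.

(** * Integrals against the Lévy measure and the operator [Phi(A)] *)

Notation exp_integrable nu dl :=
  (nu.-integrable `]0, +oo[ (EFin \o (fun y => expR (dl * y) - 1))).

Section LevyFunctional.
Variable R : realType.
Variables (nu : {measure set R -> \bar R}) (dl0 : R).
Hypotheses (dl0_gt0 : 0 < dl0) (nu_exp : exp_integrable nu dl0).
Implicit Types (F G : nat -> R) (d : nat -> R) (g : R -> R) (n j k : nat) (c x y dl : R).

Definition levy_int (g : R -> R) : R := \int[nu]_(y in `]0, +oo[) g y.

(** Domination by one function, of order [y] near 0 and exponential at infinity. The class is stable
    under linear combinations and contains all integrands below, so that integrability comes with
    membership. *)
Definition levy_dom (g : R -> R) : Prop :=
  measurable_fun setT g /\
  exists C, forall y, 0 < y -> `|g y| <= C * (expR (dl0 * y) - 1).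

Let pos_ray : measurable (`]0, +oo[%classic : set R).
exact: measurable_itv. Qed.

Let expM1_ge0 y : 0 < y -> 0 <= expR (dl0 * y) - 1.
by move=> y0; rewrite subr_ge0 -expR0 ler_expR mulr_ge0 // ltW. Qed.

Lemma levy_dom_integrable g : levy_dom g ->
  nu.-integrable `]0, +oo[ (EFin \o g).
Proof.
move=> [mg [C hC]].
have iC := integrableZl pos_ray C nu_exp.
apply: (le_integrable pos_ray _ _ iC).
  by apply/measurable_EFinP; exact: measurable_funS mg.
move=> y; rewrite /= in_itv /= andbT => y0.
by rewrite lee_fin (le_trans (hC _ y0)) // ler_norm.
Qed.

Lemma levy_domD g1 g2 : levy_dom g1 -> levy_dom g2 ->
  levy_dom (fun y => g1 y + g2 y).
Proof.
move=> [m1 [C1 h1]] [m2 [C2 h2]]; split; first exact: measurable_funD.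
exists (C1 + C2) => y y0; rewrite (le_trans (ler_normD _ _)) // mulrDl.
by rewrite lerD ?h1 ?h2.
Qed.

Lemma levy_domZ c g : levy_dom g -> levy_dom (fun y => c * g y).
Proof.
move=> [m1 [C1 h1]]; split; first exact: measurable_funM.
by exists (`|c| * C1) => y y0; rewrite normrM -mulrA ler_wpM2l ?h1.
Qed.

Lemma levy_domB g1 g2 : levy_dom g1 -> levy_dom g2 ->
  levy_dom (fun y => g1 y - g2 y).
Proof.
move=> h1 /(levy_domZ (- 1)) h2.
have := levy_domD h1 h2; congr levy_dom.
by apply/funext => y; rewrite mulN1r.
Qed.

Lemma levy_dom0 : levy_dom (fun=> 0).
Proof. by split => //; exists 0 => y _; rewrite normr0 mul0r. Qed.

Lemma levy_dom_sum (n : nat) (h : nat -> R -> R) :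
  (forall i, levy_dom (h i)) ->
  levy_dom (fun y => \sum_(i < n) h i y).
Proof.
move=> hh; elim: n => [|n IH].
  have := levy_dom0; congr levy_dom. by apply/funext => y; rewrite big_ord0.
have := levy_domD IH (hh n); congr levy_dom.
by apply/funext => y; rewrite big_ord_recr.
Qed.

Lemma levy_dom_le g1 g2 C : measurable_fun setT g1 -> levy_dom g2 ->
  (forall y, 0 < y -> `|g1 y| <= C * `|g2 y|) -> levy_dom g1.
Proof.
move=> mg [_ [C2 h2]] h; split => //; exists (`|C| * C2) => y y0.
rewrite (le_trans (h _ y0)) // -mulrA (@le_trans _ _ (`|C| * `|g2 y|)) //.
  by rewrite ler_wpM2r // ler_norm.
by rewrite ler_wpM2l // h2.
Qed.

Lemma levy_dom_exp dl : dl <= dl0 -> levy_dom (fun y => expR (dl * y) - 1).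
Proof.
move=> h; split.
  by apply: measurable_funB => //; apply: measurableT_comp => //.
exists (1 + `|dl| / dl0) => y y0.
have e1 : dl0 * y <= expR (dl0 * y) - 1.
  by have := expR_ge1Dx (dl0 * y); lra.
have [d0|d0] := leP 0 dl.
  rewrite ger0_norm; last by rewrite subr_ge0 -expR0 ler_expR mulr_ge0 // ltW.
  rewrite (@le_trans _ _ (expR (dl0 * y) - 1)) //.
    by rewrite lerD2r ler_expR ler_wpM2r // ltW.
  by rewrite ler_peMl ?expM1_ge0 // lerDl divr_ge0 // ltW.
rewrite ler0_norm; last first.
  by rewrite subr_le0 -expR0 ler_expR mulr_le0_ge0 // ltW.
have := expR_ge1Dx (dl * y) => h1.
have : 0 <= `|dl| / dl0 * (expR (dl0 * y) - 1 - dl0 * y).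
  by rewrite mulr_ge0 ?subr_ge0 // divr_ge0 // ltW.
rewrite ltr0_norm // => h2.
have := expM1_ge0 y0 => h3.
have e2 : - dl / dl0 * (expR (dl0 * y) - 1 - dl0 * y) =
          - dl / dl0 * (expR (dl0 * y) - 1) + dl * y.
  by field; rewrite gt_eqF.
rewrite e2 in h2; lra.
Qed.

Lemma levy_dom_id : levy_dom (fun y => y).
Proof.
apply: (@levy_dom_le _ (fun y => expR (dl0 * y) - 1) dl0^-1) => //.
  exact: levy_dom_exp.
move=> y y0; rewrite (ger0_norm (ltW y0)) (ger0_norm (expM1_ge0 y0)) ler_pdivlMl //.
by have := expR_ge1Dx (dl0 * y); lra.
Qed.

Lemma levy_dom_expN (c : R) : 0 <= c -> levy_dom (fun y => 1 - expR (- (c * y))).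
Proof.
move=> c0; have h : - c <= dl0 by apply: le_trans (ltW dl0_gt0); rewrite oppr_le0.
have := levy_domZ (-1) (levy_dom_exp h); congr levy_dom.
by apply/funext => y; rewrite mulN1r opprB mulNr.
Qed.

Lemma levy_intD g1 g2 : levy_dom g1 -> levy_dom g2 ->
  levy_int (fun y => g1 y + g2 y) = levy_int g1 + levy_int g2.
Proof. by move=> h1 h2; apply: RintegralD => //; exact: levy_dom_integrable. Qed.

Lemma levy_intZ c g : levy_dom g ->
  levy_int (fun y => c * g y) = c * levy_int g.
Proof. by move=> h1; apply: RintegralZl => //; exact: levy_dom_integrable. Qed.

Lemma levy_intB g1 g2 : levy_dom g1 -> levy_dom g2 ->
  levy_int (fun y => g1 y - g2 y) = levy_int g1 - levy_int g2.
Proof.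
move=> h1 h2.
rewrite (_ : (fun y => _) = (fun y => g1 y + (-1) * g2 y)); last first.
  by apply/funext => y; rewrite mulN1r.
by rewrite levy_intD ?levy_intZ ?mulN1r //; exact: levy_domZ.
Qed.

Lemma levy_int0 : levy_int (fun=> 0) = 0.
Proof. by rewrite /levy_int Rintegral_cst // mul0r. Qed.

Lemma levy_int_sum (n : nat) (h : nat -> R -> R) :
  (forall i, levy_dom (h i)) ->
  levy_int (fun y => \sum_(i < n) h i y) = \sum_(i < n) levy_int (h i).
Proof.
move=> hh; elim: n => [|n IH].
  rewrite big_ord0 -[RHS]levy_int0; congr levy_int. by apply/funext => y; rewrite big_ord0.
rewrite big_ord_recr /= -IH -levy_intD //; last exact: levy_dom_sum.
by congr levy_int; apply/funext => y; rewrite big_ord_recr.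
Qed.

Lemma le_levy_int g1 g2 : levy_dom g1 -> levy_dom g2 ->
  (forall y, 0 < y -> g1 y <= g2 y) -> levy_int g1 <= levy_int g2.
Proof.
move=> h1 h2 h; apply: le_Rintegral => //; try exact: levy_dom_integrable.
by move=> y; rewrite /= in_itv /= andbT => /h.
Qed.

Lemma eq_levy_int g1 g2 : (forall y, 0 < y -> g1 y = g2 y) ->
  levy_int g1 = levy_int g2.
Proof.
move=> h; apply: eq_Rintegral => y; rewrite inE /= in_itv /= andbT; exact: h.
Qed.

Lemma levy_int_ge0 g : (forall y, 0 < y -> 0 <= g y) -> 0 <= levy_int g.
Proof.
by move=> h; apply: Rintegral_ge0 => y; rewrite /= in_itv /= andbT => /h.
Qed.

Lemma ler_norm_levy_int g1 g2 : levy_dom g1 -> levy_dom g2 ->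
  (forall y, 0 < y -> `|g1 y| <= g2 y) -> `|levy_int g1| <= levy_int g2.
Proof.
move=> h1 h2 h; rewrite ler_norml; apply/andP; split.
  rewrite -mulN1r -levy_intZ //; apply: le_levy_int => //.
    exact: levy_domZ.
  by move=> y /h; rewrite ler_norml mulN1r => /andP[].
by apply: le_levy_int => // y /h; rewrite ler_norml => /andP[].
Qed.

Lemma levy_dom_newton (F : R -> nat -> R) d n :
  (forall j, levy_dom (F ^~ j)) ->
  levy_dom (fun y => newton_op (F y) d n).
Proof.
move=> hF.
apply: (@levy_dom_sum n.+1 (fun j y => F y j * newton d j * 'C(n, j)%:R)) => j.
have := levy_domZ (newton d j * 'C(n, j)%:R) (hF j); congr levy_dom.
by apply/funext => y; ring.
Qed.

Lemma levy_int_newton (F : R -> nat -> R) d n :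
  (forall j, levy_dom (F ^~ j)) ->
  levy_int (fun y => newton_op (F y) d n) =
  newton_op (fun j => levy_int (F ^~ j)) d n.
Proof.
move=> hF; rewrite /newton_op.
rewrite (@levy_int_sum n.+1 (fun j y => F y j * newton d j * 'C(n, j)%:R)).
  apply: eq_bigr => j _; rewrite -mulrA [RHS]mulrC -levy_intZ //.
  by congr levy_int; apply/funext => y; ring.
move=> j.
have := levy_domZ (newton d j * 'C(n, j)%:R) (hF j); congr levy_dom.
by apply/funext => y; ring.
Qed.

Definition laplace_exp (c : R) : R := levy_int (fun y => 1 - expR (- (c * y))).

(* The generator of the composition chain is [- levy_op]. *)
Definition levy_op d n : R := newton_op (fun j => laplace_exp j%:R) d n.

Lemma subr_thinning_newton d n y : d n - thinning y d n =
  newton_op (fun j => 1 - expR (- (j%:R * y))) d n.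
Proof. by rewrite newton_opBl newton_op1. Qed.

Lemma levy_dom_thinning d n : levy_dom (fun y => d n - thinning y d n).
Proof.
rewrite (_ : (fun y => _) = (fun y => newton_op (fun j => 1 - expR (- (j%:R * y))) d n)).
  by apply: levy_dom_newton => j; exact: levy_dom_expN.
by apply/funext => y; exact: subr_thinning_newton.
Qed.

Lemma levy_opE d n : levy_op d n = levy_int (fun y => d n - thinning y d n).
Proof.
rewrite /levy_op /laplace_exp -levy_int_newton //.
  by apply: eq_levy_int => y _; rewrite subr_thinning_newton.
by move=> j; exact: levy_dom_expN.
Qed.

Lemma levy_dom_pot_symbol j : levy_dom ((@pot_symbol R) ^~ j).
Proof.
case: j => [|j]; first exact: levy_dom_id.
have := levy_domZ j.+1%:R^-1 (levy_dom_expN (ler0n R j.+1)).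
by congr levy_dom; apply/funext => y; rewrite /pot_symbol /= mulrC.
Qed.

Lemma levy_dom_potential d n : levy_dom (fun y => potential y d n).
Proof. by apply: levy_dom_newton; exact: levy_dom_pot_symbol. Qed.

(** Its symbol is [Phi(j) / j], and the first moment of [nu] at [j = 0]: the quotient of [Phi(A)] by
    [A]. By Fubini its kernel is thinning integrated against the tail of [nu]. *)
Definition levy_pot d n : R := levy_int (fun y => potential y d n).

Lemma levy_potE d n : levy_pot d n =
  newton_op (fun j => levy_int ((@pot_symbol R) ^~ j)) d n.
Proof. by apply: levy_int_newton; exact: levy_dom_pot_symbol. Qed.

Lemma generator_levy_pot d n :
  thinning_gen (levy_pot d) n = levy_op d n.
Proof.
rewrite thinning_genE (eq_newton_opr _ (fun j _ => levy_potE d j)) newton_opM.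
apply: eq_newton_op => j _; rewrite /laplace_exp.
rewrite -levy_intZ; last exact: levy_dom_pot_symbol.
apply: eq_levy_int => y _; rewrite /pot_symbol; case: j => [|j] /=.
  by rewrite !mul0r oppr0 expR0 subrr.
by rewrite mulrC divfK // pnatr_eq0.
Qed.

Lemma levy_op_harmonic n :
  levy_op (@hsum R) n =
  levy_int (fun y => y) - levy_pot (delta R 0) n.
Proof.
rewrite levy_opE -levy_intB; [|exact: levy_dom_id|exact: levy_dom_potential].
by apply: eq_levy_int => y _; rewrite harmonic_thinning.
Qed.

(** [delta 0] lies below the weight, and the potential of the weight is at most
    [(e^(dl y) - 1) / dl] times the weight. *)
Lemma levy_pot_delta dl n : 0 < dl -> dl <= dl0 ->
  0 <= levy_pot (delta R 0) n <=
    levy_int (fun y => expR (dl * y) - 1) / dl * weight dl n.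
Proof.
move=> dl_gt0 dll; apply/andP; split.
  apply: levy_int_ge0 => y y0; apply: potential_ge0 => [|k _]; first exact: ltW.
  by rewrite ler0n.
rewrite -mulrA mulrC -levy_intZ; last exact: levy_dom_exp.
apply: le_levy_int => [||y y0].
- exact: levy_dom_potential.
- by apply: levy_domZ; exact: levy_dom_exp.
apply: (@le_trans _ _ (potential y (weight dl) n)).
  by apply: le_potential => [|k _]; [exact: ltW | rewrite le_delta0_weight // ltW].
apply: (le_trans (potential_weight n dl_gt0 (ltW y0))).
by apply: le_of_eq; ring.
Qed.

(** Convexity in [dl], obtained by comparing derivatives in [y]. It makes the loss in the maximum
    principle of order [dl]. *)
Lemma levy_int_exp_le dl : 0 <= dl -> dl <= dl0 ->
  levy_int (fun y => expR (dl * y) - 1) <=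
  dl / dl0 * levy_int (fun y => expR (dl0 * y) - 1).
Proof.
move=> h0 h1; rewrite -levy_intZ; last exact: levy_dom_exp.
apply: le_levy_int => [||y y0].
- exact: levy_dom_exp.
- by apply: levy_domZ; exact: levy_dom_exp.
pose c := dl / dl0.
have c0 : 0 <= c by rewrite divr_ge0 // ltW.
have c1 : c <= 1 by rewrite ler_pdivrMr // mul1r.
pose f z := c * expR (dl0 * z) - expR (dl * z).
have : f 0 <= f y.
  apply: (@ge0_derive_nondecreasing _ f (fun z => dl * (expR (dl0 * z) - expR (dl * z)))).
  - exact: ltW.
  - move=> z _.
    have a1 := is_derive_expRM dl0 z; have a2 := is_derive_expRM dl z.
    have -> : f = (c \*: (fun z => expR (dl0 * z))) - (fun z => expR (dl * z)) by [].
    apply: is_derive_eq; rewrite /GRing.scale /= /c. by field; rewrite gt_eqF.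
  - move=> z /andP[z0 _]; rewrite mulr_ge0 // subr_ge0 ler_expR ler_wpM2r //.
by rewrite /f !mulr0 expR0 mulr1; rewrite -/c; lra.
Qed.

End LevyFunctional.

(** * The maximum principle and the powers of the interval average *)

Lemma minor_times_spec (R : realType) (a L s e : R) : 0 <= a -> 0 < L -> 0 <= s -> L <= e - s ->
  [/\ 0 <= e + (a + L) - L / 4, e + (a + L) - L / 4 <= e + (a + L), 0 <= e + a,
      e + a <= e + (a + L) - L / 4 & [/\ 0 <= s + a, s + a <= s + a + L / 4,
      0 <= s + a + L / 4, s + a + L / 4 <= s + (a + L) & s + (a + L) <= e + a]].
Proof. by move=> a0 L0 s0 se; split; [lra|lra|lra|lra|split; lra]. Qed.

Lemma minor_length_spec (R : realType) (a L s e M : R) : L * (1 + M / 2) <= e - s ->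
  L * (1 + (M + 1) / 2) <= e + (a + L) - L / 4 - (s + a + L / 4).
Proof. by move=> h; lra. Qed.

Section Renewal.
Variable R : realType.
Variables (nu : {measure set R -> \bar R}) (dl0 : R).
Hypotheses (dl0_gt0 : 0 < dl0) (nu_exp : exp_integrable nu dl0).
Variables (al be eta : R).
Hypotheses (al_gt0 : 0 < al) (al_be : al < be) (eta_gt0 : 0 < eta).
(* On [`[al, be]] the measure [nu] has a density bounded below by [eta]. *)
Hypothesis nu_minor : forall k kappa : R -> R, levy_dom dl0 k ->
  (forall y, 0 < y -> 0 <= k y) ->
  (forall y, al <= y <= be -> is_derive y 1 kappa (k y)) ->
  (forall y, derivable k y 1) ->
  eta * (kappa be - kappa al) <= levy_int nu k.
Implicit Types (d g : nat -> R) (n j k : nat) (x y dl : R).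

Let L : R := be - al.
Let lam : R := eta * L.
Let m1 : R := levy_int nu (fun y => y).
Let psi dl : R := levy_int nu (fun y => expR (dl * y) - 1).

Let L_gt0 : 0 < L. by rewrite subr_gt0. Qed.
Let lam_gt0 : 0 < lam. by rewrite mulr_gt0. Qed.

(** Symbol of the average of [thinning y] over [y] uniform on [[al, be]]. *)
Definition unif_symbol j : R := (pot_symbol be j - pot_symbol al j) / (be - al).

Definition unif_op m d n : R := newton_op (fun j => unif_symbol j ^+ m) d n.

Lemma unif_op0 d n : unif_op 0 d n = d n.
Proof. by rewrite -[RHS]newton_op1; apply: eq_newton_op => j _; rewrite expr0. Qed.

Lemma unif_op1 d n : unif_op 1 d n = (potential be d n - potential al d n) / L.
Proof.
rewrite /potential -newton_opBl mulrC -newton_opZl.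
by apply: eq_newton_op => j _; rewrite expr1 /unif_symbol mulrC.
Qed.

Lemma unif_opD m p d n : unif_op m (unif_op p d) n = unif_op (m + p) d n.
Proof. by rewrite /unif_op newton_opM; apply: eq_newton_op => j _; rewrite exprD. Qed.

Lemma unif_opS m d n : unif_op m (unif_op 1 d) n = unif_op m.+1 d n.
Proof. by rewrite unif_opD addn1. Qed.

Lemma le_unif_op m d g n : (forall k, (k <= n)%N -> d k <= g k) ->
  unif_op m d n <= unif_op m g n.
Proof.
elim: m d g n => [|m IH] d g n dg; first by rewrite !unif_op0 dg.
rewrite -!unif_opS; apply: IH => k kn; rewrite !unif_op1.
rewrite ler_pM2r ?invr_gt0 // -subr_ge0.
have -> : potential be g k - potential al g k - (potential be d k - potential al d k) =
  potential be (fun i => g i - d i) k - potential al (fun i => g i - d i) k.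
  by rewrite /potential !newton_opB; ring.
rewrite subr_ge0 le_potential_time // ?ltW // => i ik.
by rewrite subr_ge0 dg // (leq_trans ik).
Qed.

Lemma unif_op_cst m c n : unif_op m (fun=> c) n = c.
Proof.
rewrite /unif_op newton_op_cst /unif_symbol /pot_symbol /= divff ?expr1n ?mul1r //.
by rewrite gt_eqF.
Qed.

Lemma unif_op_weight m dl n : 0 < dl ->
  unif_op m (weight dl) n <= expR (dl * be) ^+ m * weight dl n.
Proof.
move=> dl_gt0; elim: m => [|m IH]; first by rewrite unif_op0 expr0 mul1r.
rewrite -unif_opS.
apply: (@le_trans _ _ (unif_op m (fun k => expR (dl * be) * weight dl k) n)).
  apply: le_unif_op => k _; rewrite unif_op1 ler_pdivrMr //.
  have := @le_derive_increment _ (fun z => potential z (weight dl) k)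
    (fun z => thinning z (weight dl) k)
    (fun z => (expR (dl * be) * weight dl k) * z) (fun z => expR (dl * be) * weight dl k)
    al be (ltW al_be).
  rewrite -mulrBr; apply => [z _|z _|z /andP[az zb]].
  - exact: is_derive_potential.
  - have -> : (fun z => (expR (dl * be) * weight dl k) * z) =
      (expR (dl * be) * weight dl k) \*: (@id R) by [].
    by apply: is_derive_eq; rewrite /GRing.scale /= mulr1.
  - have z0 : 0 <= z by rewrite (le_trans _ az) // ltW.
    apply: (le_trans (thinning_weight (ltW dl_gt0) k z0)).
    by rewrite ler_wpM2r ?(ltW (weight_gt0 (ltW dl_gt0) _)) // ler_expR ler_pM2l.
by rewrite /unif_op newton_opZ exprS -mulrA ler_pM2l ?expR_gt0.
Qed.

(* Maximum principle for [lam + Phi_1(A)], where [Phi_1] is the Laplace exponent of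
   [nu] minus [eta] times the Lebesgue measure on [`[al, be]]. *)
Lemma max_principle dl M (G B : R) g : 0 < dl -> dl <= dl0 -> psi dl < lam ->
  (forall n, (n <= M)%N -> `|unif_op 1 g n| <= G * weight dl n) ->
  (forall n, (n <= M)%N -> `|levy_op nu g n| <= B * weight dl n) ->
  forall n, (n <= M)%N -> `|g n| <= (lam * G + B) / (lam - psi dl) * weight dl n.
Proof.
move=> dl_gt0 dll psil hG hB.
have w0 n : 0 < weight dl n by rewrite weight_gt0 // ltW.
pose q (i : 'I_M.+1) := `|g i| / weight dl i.
pose i0 := [arg max_(i > ord0) q i]%O.
have hi0 n : (n <= M)%N -> `|g n| <= q i0 * weight dl n.
  move=> nM; rewrite -ler_pdivrMr //. have := nM; rewrite -ltnS => nM1.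
  by rewrite /i0; case: arg_maxP => // i _ /(_ (Ordinal nM1) isT).
(* Stated for any [g'] with the modulus of [g], so as to apply to whichever of [g] and [- g] is
   nonnegative at the maximising index [i0]. *)
have key g' : (forall n, (n <= M)%N -> `|g' n| = `|g n|) ->
    (forall n, (n <= M)%N -> `|unif_op 1 g' n| <= G * weight dl n) ->
    (forall n, (n <= M)%N -> `|levy_op nu g' n| <= B * weight dl n) ->
    0 <= g' i0 -> q i0 * (lam - psi dl) <= lam * G + B.
  move=> gg' hG' hB' g0; set n0 := (i0 : nat) in g0 *; set q0 := q i0.
  have n0M : (n0 <= M)%N by rewrite /n0 -ltnS ltn_ord. have gq : g' n0 = q0 * weight dl n0.
    by rewrite -[LHS]ger0_norm // gg' // /q0 /q divfK // gt_eqF.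
  have q0_ge0 : 0 <= q0 by rewrite /q0 /q divr_ge0 // ltW.
  (* At the index where [|g| / weight] is maximal, thinning cannot exceed [q0 w e^(dl y)], so [k] is
     nonnegative. The lower bound on [nu] applied to [k] is the inequality sought. *)
  pose k y := q0 * weight dl n0 * (expR (dl * y) - 1) + (g' n0 - thinning y g' n0).
  pose kappa y := q0 * weight dl n0 / dl * expR (dl * y) - potential y g' n0.
  have kE y : k y = q0 * weight dl n0 * expR (dl * y) - thinning y g' n0.
    by rewrite /k gq; ring.
  have hk : levy_dom dl0 k.
    apply: levy_domD; last exact: levy_dom_thinning. by apply: levy_domZ; exact: levy_dom_exp.
  have k0 y : 0 < y -> 0 <= k y.
    move=> y0; rewrite kE subr_ge0.
    apply: (@le_trans _ _ (thinning y (fun n => q0 * weight dl n) n0)).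
      apply: le_thinning => [|j jn]; first exact: ltW.
      apply: le_trans (hi0 _ (leq_trans jn n0M)). by rewrite -gg' ?ler_norm // (leq_trans jn).
    rewrite /thinning newton_opZ -mulrA ler_wpM2l // mulrC.
    exact: (thinning_weight (ltW dl_gt0) _ (ltW y0)).
  have dk y : al <= y <= be -> is_derive y 1 kappa (k y).
    move=> _; rewrite kE.
    have a1 := is_derive_expRM dl y; have a2 := is_derive_potential y g' n0.
    have -> : kappa = (q0 * weight dl n0 / dl) \*: (fun y => expR (dl * y)) -
      (fun y => potential y g' n0) by [].
    apply: is_derive_eq; rewrite /GRing.scale /=. by field; rewrite gt_eqF.
  have k' y : derivable k y 1.
    have a1 := is_derive_expRM dl y; have a2 := is_derive_thinning y g' n0.
    have -> : k = (q0 * weight dl n0) \*: (fun y => expR (dl * y)) - (fun y => thinning y g' n0).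
      by apply/funext => z; rewrite kE.
    by apply: derivableB.
  have := nu_minor hk k0 dk k'. rewrite (levy_intD nu_exp); first last.
  - exact: levy_dom_thinning.
  - by apply: levy_domZ; exact: levy_dom_exp.
  rewrite (levy_intZ nu_exp); last exact: levy_dom_exp.
  rewrite -(levy_opE dl0_gt0 nu_exp) -/(psi dl) => h1.
  have h2 : q0 * weight dl n0 * L - L * unif_op 1 g' n0 <= kappa be - kappa al.
    rewrite unif_op1 mulrCA divff ?mulr1; last by rewrite gt_eqF.
    have -> : kappa be - kappa al = q0 * weight dl n0 *
      ((expR (dl * be) - expR (dl * al)) / dl) - (potential be g' n0 - potential al g' n0).
      by rewrite /kappa; ring.
    rewrite lerD2r; apply: ler_wpM2l; first by rewrite mulr_ge0 ?(ltW (w0 _)).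
    rewrite ler_pdivlMr // /L mulrBl.
    have -> : expR (dl * be) = expR (dl * al) * expR (dl * (be - al)).
      by rewrite -expRD; congr expR; ring.
    have e1 := expR_ge1Dx (dl * (be - al)). have e2 := expR_ge1Dx (dl * al).
    have : 0 <= dl * (be - al) by rewrite mulr_ge0 ?subr_ge0 ?ltW.
    have : 0 <= dl * al by rewrite mulr_ge0 // ltW. nra.
  have := hG' _ n0M; have := hB' _ n0M; rewrite !ler_norml => /andP[_ h3] /andP[_ h4].
  have h5 : eta * (q0 * weight dl n0 * L - L * unif_op 1 g' n0) <=
    q0 * weight dl n0 * psi dl + levy_op nu g' n0. by apply: le_trans h1; rewrite ler_pM2l.
  have h6 : lam * unif_op 1 g' n0 <= lam * (G * weight dl n0) by rewrite ler_pM2l.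
  rewrite -(ler_pM2r (w0 n0)). rewrite /lam in h6 *; lra.
have qb : q i0 * (lam - psi dl) <= lam * G + B.
  have [g0|g0] := leP 0 (g i0); first exact: (key g).
  apply: (key (fun n => (-1) * g n)) => [n _|n nM|n nM|].
  - by rewrite mulN1r normrN.
  - by rewrite /unif_op newton_opZ mulN1r normrN; exact: hG.
  - by rewrite /levy_op newton_opZ mulN1r normrN; exact: hB.
  - by rewrite mulN1r oppr_ge0 ltW.
move=> n nM; apply: (le_trans (hi0 _ nM)).
by rewrite ler_wpM2r ?(ltW (w0 _)) // ler_pdivlMr // subr_gt0.
Qed.

(** Symbol of the integral of [potential] over [[0, y]]; its mixed second differences give the
    convolution of two interval averages. *)
Definition potential2_symbol y j : R :=
  if j == 0%N then y ^+ 2 / 2 else (y - (1 - expR (- (j%:R * y))) / j%:R) / j%:R.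

Lemma is_derive_potential2 y d n :
  is_derive y 1 (fun z => newton_op (potential2_symbol z) d n) (potential y d n).
Proof.
apply: is_derive_newton_op => -[|j].
  rewrite /potential2_symbol /pot_symbol /=.
  have -> : (fun z : R => z ^+ 2 / 2) = (2^-1 \*: (@id R * @id R)).
    by apply/funext => z; rewrite !fctE /GRing.scale /= mulrC.
  by apply: is_derive_eq; rewrite /GRing.scale /= !mulr1; field.
rewrite /potential2_symbol /pot_symbol /=.
have h := is_derive_expRN j.+1%:R y.
have -> : (fun z => (z - (1 - expR (- (j.+1%:R * z))) / j.+1%:R) / j.+1%:R) =
  j.+1%:R^-1 \*: (@id R - j.+1%:R^-1 \*: (cst 1 - (fun z => expR (- (j.+1%:R * z))))).
  apply/funext => z. change ((z - (1 - expR (- (j.+1%:R * z))) / j.+1%:R) / j.+1%:R =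
    j.+1%:R^-1 * (z - j.+1%:R^-1 * (1 - expR (- (j.+1%:R * z))))).
  by ring.
apply: is_derive_eq; rewrite /GRing.scale /= sub0r.
have : (j.+1%:R : R) != 0 by rewrite pnatr_eq0.
move: (j.+1%:R : R) => J J0; by field.
Qed.

Lemma unif_op_potential s e d n :
  potential e (unif_op 1 d) n - potential s (unif_op 1 d) n =
  (newton_op (potential2_symbol (e + be)) d n - newton_op (potential2_symbol (e + al)) d n
   - (newton_op (potential2_symbol (s + be)) d n
      - newton_op (potential2_symbol (s + al)) d n)) / L.
Proof.
rewrite /potential /unif_op !newton_opM -!newton_opBl mulrC -newton_opZl.
apply: eq_newton_op => j _; rewrite expr1 /unif_symbol -/L /potential2_symbol.
have L1 : L != 0 by rewrite gt_eqF.
case: j => [|j]; rewrite /pot_symbol /=.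
  have -> : be - al = L by []. have -> : be = L + al by rewrite /L; ring. by field.
have : (j.+1%:R : R) != 0 by rewrite pnatr_eq0.
move: (j.+1%:R : R) => J J0; rewrite !mulrDr !opprD !expRD.
by field; rewrite J0 L1.
Qed.

(** Convolving the indicators of [[s, e]] and [[al, be]] gives a trapezoid. Cut by [L / 4] at each
    end it stays above a quarter of its plateau, so each further power lengthens the interval by
    [L / 2] and divides [c] by 4. *)
Lemma unif_op_minor m : exists c s e, [/\ 0 < c, 0 <= s, L * (1 + m%:R / 2) <= e - s &
  forall d n, (forall k, (k <= n)%N -> 0 <= d k) ->
    c * (potential e d n - potential s d n) <= unif_op m.+1 d n].
Proof.
elim: m => [|m [c [s [e [c0 s0 se IH]]]]].
  exists L^-1, al, be; split; rewrite ?invr_gt0 ?(ltW al_gt0) //.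
    by rewrite mul0r addr0 mulr1.
  by move=> d n _; rewrite unif_op1 mulrC.
have L0 := L_gt0.
have se1 : L <= e - s.
  by apply: le_trans se; rewrite ler_peMr ?(ltW L0) // lerDl divr_ge0.
have eb : be = al + L by rewrite /L; ring.
exists (c / 4), (s + al + L / 4), (e + be - L / 4); split.
- by rewrite divr_gt0.
- have := ltW al_gt0; lra.
- have -> : m.+1%:R = m%:R + 1 :> R by rewrite -natr1.
  rewrite eb; exact: minor_length_spec.
move=> d n d0; rewrite -unif_opS.
have U0 k : (k <= n)%N -> 0 <= unif_op 1 d k.
  move=> kn; rewrite -(unif_op_cst 1 0 k); apply: le_unif_op => i ik.
  by rewrite d0 // (leq_trans ik).
apply: le_trans (IH _ _ U0); rewrite unif_op_potential -mulrA ler_pM2l //.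
set V := fun z => newton_op (potential2_symbol z) d n.
set P := fun z => potential z d n.
have incr a b C : 0 <= a -> a <= b -> P b <= C -> V b - V a <= C * (b - a).
  move=> a0 ab hC; rewrite mulrBr.
  apply: (@le_derive_increment _ V P (fun z => C * z) (fun=> C)) => // [z _|z _|z /andP[az zb]].
  - exact: is_derive_potential2.
  - have -> : (fun z : R => C * z) = C \*: (@id R) by [].
    by apply: is_derive_eq; rewrite /GRing.scale /= mulr1.
  - by apply: le_trans hC; apply: le_potential_time => //; exact: le_trans az.
have incr' a b C : 0 <= a -> a <= b -> C <= P a -> C * (b - a) <= V b - V a.
  move=> a0 ab hC; rewrite mulrBr.
  apply: (@le_derive_increment _ (fun z => C * z) (fun=> C) V P) => // [z _|z _|z /andP[az zb]].
  - have -> : (fun z : R => C * z) = C \*: (@id R) by [].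
    by apply: is_derive_eq; rewrite /GRing.scale /= mulr1.
  - exact: is_derive_potential2.
  - by apply: (le_trans hC); apply: le_potential_time.
have al0 := ltW al_gt0.
(* Both integrals of [P] run over windows of length [L], split into [L / 4] and [3 L / 4]; the
   longer pieces compensate because [s + be <= e + al]. *)
have i1 := @incr' (e + be - L / 4) (e + be) (P (e + be - L / 4)).
have i2 := @incr' (e + al) (e + be - L / 4) (P (e + al)).
have i3 := @incr (s + al) (s + al + L / 4) (P (s + al + L / 4)).
have i4 := @incr (s + al + L / 4) (s + be) (P (s + be)).
have [t1 t2 t3 t4 [t5 t6 t7 t8 t9]] := minor_times_spec al0 L0 s0 se1.
rewrite -eb in t1 t2 t3 t4 t5 t6 t7 t8 t9.
have i5 : P (s + be) <= P (e + al).
  by apply: le_potential_time => //; rewrite (le_trans t7).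
have {}i1 := i1 t1 t2 (lexx _).
have {}i2 := i2 t3 t4 (lexx _).
have {}i3 := i3 t5 t6 (lexx _).
have {}i4 := i4 t7 t8 (lexx _).
have i6 : P (s + be) * (3 / 4 * L) <= P (e + al) * (3 / 4 * L) by rewrite ler_wpM2r // mulr_ge0 ?(ltW L0) // divr_ge0.
rewrite ler_pdivlMr //.
move: i1 i2 i3 i4.
have -> : e + be - (e + be - L / 4) = L / 4 by ring.
have -> : e + be - L / 4 - (e + al) = 3 / 4 * L by rewrite eb; field.
have -> : s + al + L / 4 - (s + al) = L / 4 by ring.
have -> : s + be - (s + al + L / 4) = 3 / 4 * L by rewrite eb; field.
move=> i1 i2 i3 i4.
change (4^-1 * (P (e + be - L / 4) - P (s + al + L / 4)) * L <=
  V (e + be) - V (e + al) - (V (s + be) - V (s + al))).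
move: (P (e + be - L / 4)) (P (s + al + L / 4)) (P (e + al)) (P (s + be)) i1 i2 i3 i4 i6.
move: (V (e + be)) (V (e + al)) (V (s + be)) (V (s + al)) (V (e + be - L / 4)) (V (s + al + L / 4)).
clear; move=> v1 v2 v3 v4 v5 v6 p1 p2 p3 p4 i1 i2 i3 i4 i6.
lra.
Qed.

End Renewal.

(** * The renewal theorem with a polynomial remainder *)

Lemma square_dominates (R : realType) (a x : R) : 0 < a -> a <= x -> 2 <= x * x ->
  a * x <= 2 * (x * x - 1).
Proof. by move=> a0 ax x2; nra. Qed.

Lemma quarter_eighth (R : realType) (c : R) : 0 < c ->
  (1 + c / 8) * (1 - c / 4) <= 1 - c / 8.
Proof. by move=> c0; nra. Qed.

Lemma factor_bound (R : realType) (a b c eps : R) : 0 < c -> a <= 1 + eps ->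
  b <= (1 + eps) * (c / 2) -> eps * (1 + c / 2) = c / 8 -> a - c + b <= 1 - c / 4.
Proof. by move=> c0 h1 h2 h3; lra. Qed.

Lemma contraction_bound (R : realType) (D T K C3 CN rho : R) :
  D <= T * (D * K + C3) + CN -> D * (T * K) <= D * rho ->
  D * (1 - rho) <= T * C3 + CN.
Proof.
move=> h1 h2; have e : T * (D * K + C3) = D * (T * K) + T * C3 by ring.
by rewrite e in h1; rewrite mulrBr mulr1; lra.
Qed.

Section RenewalTheorem.
Variable R : realType.
Variables (nu : {measure set R -> \bar R}) (dl0 : R).
Hypotheses (dl0_gt0 : 0 < dl0) (nu_exp : exp_integrable nu dl0).
Variables (al be eta : R).
Hypotheses (al_gt0 : 0 < al) (al_be : al < be) (eta_gt0 : 0 < eta).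
(* On [`[al, be]] the measure [nu] has a density bounded below by [eta]. *)
Hypothesis nu_minor : forall k kappa : R -> R, levy_dom dl0 k ->
  (forall y, 0 < y -> 0 <= k y) ->
  (forall y, al <= y <= be -> is_derive y 1 kappa (k y)) ->
  (forall y, derivable k y 1) ->
  eta * (kappa be - kappa al) <= levy_int nu k.
Implicit Types (d g : nat -> R) (n j k : nat) (x y dl : R).

Let L : R := be - al.
Let lam : R := eta * L.
Let m1 : R := levy_int nu (fun y => y).
Let psi dl : R := levy_int nu (fun y => expR (dl * y) - 1).

Let L_gt0 : 0 < L. by rewrite subr_gt0. Qed.
Let lam_gt0 : 0 < lam. by rewrite mulr_gt0. Qed.

Lemma laplace_exp0 : laplace_exp nu 0 = 0.
Proof.
rewrite /laplace_exp -[RHS](levy_int0 nu).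
by apply: eq_levy_int => y _; rewrite mul0r oppr0 expR0 subrr.
Qed.

Lemma levy_op_at0 d : levy_op nu d 0 = 0.
Proof. by rewrite /levy_op /newton_op big_ord1 mulr0n laplace_exp0 !mul0r. Qed.

Lemma levy_op_subc d c n : levy_op nu (fun k => d k - c) n = levy_op nu d n.
Proof.
by rewrite /levy_op newton_opB newton_op_cst mulr0n laplace_exp0 mul0r subr0.
Qed.

(** Integral of thinning over [[s, s + 1]]. The kernel of [levy_pot], the tail of [nu], may blow up
    at 0; convolved with a unit window it becomes bounded, hence comparable with Lebesgue
    measure. *)
Definition unit_op s d n : R := potential (s + 1) d n - potential s d n.

Lemma unit_opE s d n : unit_op s d n =
  newton_op (fun j => pot_symbol (s + 1) j - pot_symbol s j) d n.
Proof. by rewrite newton_opBl. Qed.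

Lemma unit_op_ge0 s d n : 0 <= s -> (forall k, (k <= n)%N -> 0 <= d k) ->
  0 <= unit_op s d n.
Proof. by move=> s0 d0; rewrite subr_ge0 le_potential_time // lerDl. Qed.

Lemma unit_op_cst s c n : unit_op s (fun=> c) n = c.
Proof. by rewrite /unit_op !potential_cst; ring. Qed.

Lemma le_unit_op s d g n : 0 <= s -> (forall k, (k <= n)%N -> d k <= g k) ->
  unit_op s d n <= unit_op s g n.
Proof.
move=> s0 dg; rewrite -subr_ge0 !unit_opE -newton_opB -unit_opE.
by apply: unit_op_ge0 => // k kn; rewrite subr_ge0 dg.
Qed.

Lemma unit_op_weight s dl n : 0 <= s -> 0 < dl ->
  weight dl n <= unit_op s (weight dl) n <= expR (dl * (s + 1)) * weight dl n.
Proof.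
move=> s0 dl_gt0; apply/andP; split.
  rewrite -{1}(unit_op_cst s (weight dl n) n); apply: le_unit_op => // k kn.
  by rewrite weight_nonincreasing // ltW.
have := @le_derive_increment _ (fun z => potential z (weight dl) n)
    (fun z => thinning z (weight dl) n)
    (fun z => (expR (dl * (s + 1)) * weight dl n) * z)
    (fun z => expR (dl * (s + 1)) * weight dl n) s (s + 1).
rewrite lerDl ler01 -mulrBr addrAC subrr add0r mulr1; apply => // [z _|z _|z /andP[az zb]].
- exact: is_derive_potential.
- have -> : (fun z => (expR (dl * (s + 1)) * weight dl n) * z) =
    (expR (dl * (s + 1)) * weight dl n) \*: (@id R) by [].
  by apply: is_derive_eq; rewrite /GRing.scale /= mulr1.
- have z0 : 0 <= z by rewrite (le_trans _ az).
  apply: (le_trans (thinning_weight (ltW dl_gt0) n z0)).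
  by rewrite ler_wpM2r ?(ltW (weight_gt0 (ltW dl_gt0) _)) // ler_expR ler_pM2l.
Qed.

Lemma unit_op_norm s dl n G g : 0 <= s -> 0 < dl -> 0 <= G ->
  (forall k, (k <= n)%N -> `|g k| <= G * weight dl k) ->
  `|unit_op s g n| <= G * expR (dl * (s + 1)) * weight dl n.
Proof.
move=> s0 dl_gt0 G0 hg; have /andP[_ h] := unit_op_weight n s0 dl_gt0.
apply: (@le_trans _ _ (G * unit_op s (weight dl) n)); last by rewrite -mulrA ler_wpM2l.
have e c : c * unit_op s (weight dl) n = unit_op s (fun k => c * weight dl k) n.
  by rewrite !unit_opE newton_opZ.
rewrite ler_norml; apply/andP; split.
  rewrite -mulNr e; apply: le_unit_op => // k kn.
  by have := hg k kn; rewrite ler_norml mulNr => /andP[].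
rewrite e; apply: le_unit_op => // k kn.
by have := hg k kn; rewrite ler_norml => /andP[].
Qed.

(** [levy_pot] with the jumps cut at [A]: its kernel lives on [[0, A]], within reach of a finite
    power of the interval average. *)
Let trunc_symbol A j : R := levy_int nu (fun y => pot_symbol (Num.min y A) j).

Definition trunc_op A d n : R := newton_op (trunc_symbol A) d n.

Lemma pot_symbol_bound (z : R) j : 0 <= z -> 0 <= pot_symbol z j <= z.
Proof.
case: j => [|j] z0; rewrite /pot_symbol /= ?z0 ?lexx //.
rewrite divr_ge0 //=; last first.
  by rewrite subr_ge0 -expR0 ler_expR oppr_le0 mulr_ge0.
rewrite ler_pdivrMr // [leRHS]mulrC; have := expR_ge1Dx (- (j.+1%:R * z)); lra.
Qed.

Lemma levy_dom_trunc A j : 0 < A ->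
  levy_dom dl0 (fun y => pot_symbol (Num.min y A) j).
Proof.
move=> A0; have mm : measurable_fun setT (fun y : R => Num.min y A).
  exact: measurable_minr.
apply: (@levy_dom_le _ dl0 _ (fun y => y) 1).
- case: j => [|j]; rewrite /pot_symbol /= //.
  apply: measurable_funM => //; apply: measurable_funB => //.
  apply: measurableT_comp => //; apply: measurableT_comp => //. exact: measurable_funM.
- exact: levy_dom_id.
move=> y y0; have m0 : 0 <= Num.min y A by rewrite le_min !ltW.
have /andP[h1 h2] := pot_symbol_bound j m0.
rewrite mul1r !ger0_norm ?(ltW y0) // (le_trans h2) // ge_min lexx //.
Qed.

Lemma levy_dom_trunc_op A d n : 0 < A ->
  levy_dom dl0 (fun y => potential (Num.min y A) d n).
Proof.
move=> A0; apply: levy_dom_newton => j; exact: levy_dom_trunc.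
Qed.

Lemma trunc_opE A d n : 0 < A ->
  trunc_op A d n = levy_int nu (fun y => potential (Num.min y A) d n).
Proof.
move=> A0; rewrite /trunc_op -(levy_int_newton nu_exp) //.
by move=> j; exact: levy_dom_trunc.
Qed.

Let mass A : R := levy_int nu (fun y => Num.min y A).

Lemma levy_dom_min A : 0 < A -> levy_dom dl0 (fun y => Num.min y A).
Proof. by move=> A0; exact: (@levy_dom_trunc A 0%N). Qed.

(** A translation of the unit window by at most [A] keeps it inside [[s, s + 1 + A]]. *)
Lemma trunc_unit_le A s d n : 0 < A -> 0 <= s -> (forall k, (k <= n)%N -> 0 <= d k) ->
  trunc_op A (unit_op s d) n <=
  mass A * (potential (s + 1 + A) d n - potential s d n).
Proof.
move=> A0 s0 d0; rewrite trunc_opE // mulrC -(levy_intZ nu_exp); last first.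
  exact: levy_dom_min.
apply: (le_levy_int nu_exp) => [||y y0].
- exact: levy_dom_trunc_op.
- by apply: levy_domZ; exact: levy_dom_min.
set z := Num.min y A; have z0 : 0 <= z by rewrite le_min !ltW.
have zA : z <= A by rewrite ge_min lexx orbT.
set C := potential _ _ _ - _.
have := @le_derive_increment _ (fun u => potential u (unit_op s d) n)
  (fun u => thinning u (unit_op s d) n) (fun u => C * u) (fun=> C) 0 z z0.
rewrite potential0 mulr0 !subr0; apply => [u _|u _|u /andP[u0 uz]].
- exact: is_derive_potential.
- have -> : (fun z : R => C * z) = C \*: (@id R) by [].
  by apply: is_derive_eq; rewrite /GRing.scale /= mulr1.
have -> : thinning u (unit_op s d) n = potential (s + 1 + u) d n - potential (s + u) d n.
  rewrite /thinning (eq_newton_opr _ (fun j _ => unit_opE s d j)) newton_opM /potential -newton_opBl.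
  apply: eq_newton_op => -[|j] _; rewrite /pot_symbol /=.
    by rewrite mul0r oppr0 expR0; ring.
  by rewrite !mulrDr !opprD !expRD; ring.
apply: lerB; apply: le_potential_time => //; rewrite ?addr_ge0 //.
  by rewrite lerD2l (le_trans uz).
by rewrite lerDl.
Qed.

(** Thinning lowers the sample size and the weight is nonincreasing, so averages of the weight are
    at least its value at [n]. *)
Lemma trunc_unit_weight A s dl n : 0 < A -> 0 <= s -> 0 < dl ->
  mass A * weight dl n <= trunc_op A (unit_op s (weight dl)) n.
Proof.
move=> A0 s0 dl_gt0; rewrite trunc_opE // mulrC -(levy_intZ nu_exp); last first.
  exact: levy_dom_min.
apply: (le_levy_int nu_exp) => [||y y0].
- by apply: levy_domZ; exact: levy_dom_min.
- exact: levy_dom_trunc_op.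
set z := Num.min y A; have z0 : 0 <= z by rewrite le_min !ltW.
rewrite mulrC -(potential_cst z (weight dl n) n); apply: le_potential => // k kn.
have /andP[h _] := unit_op_weight k s0 dl_gt0.
by apply: le_trans h; rewrite weight_nonincreasing // ltW.
Qed.

Let tail del A : R :=
  levy_int nu (fun y => (expR (del * y) - expR (del * Num.min y A)) / del).

Lemma levy_dom_tail del A : 0 < A -> 0 < del -> del <= dl0 ->
  levy_dom dl0 (fun y => (expR (del * y) - expR (del * Num.min y A)) / del).
Proof.
move=> A0 del0 dell.
apply: (@levy_dom_le _ dl0 _ (fun y => expR (del * y) - 1) del^-1).
- apply: measurable_funM => //; apply: measurable_funB => //.
    by apply: measurableT_comp => //; apply: measurable_funM.
  apply: measurableT_comp => //; apply: measurable_funM => //; exact: measurable_minr.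
- exact: levy_dom_exp.
have di : 0 < del^-1 by rewrite invr_gt0.
move=> y y0; rewrite normrM [leLHS]mulrC (gtr0_norm di) ler_pM2l //.
have m0 : 0 <= Num.min y A by rewrite le_min !ltW.
have h1 : expR (del * Num.min y A) <= expR (del * y).
  by rewrite ler_expR ler_pM2l // ge_min lexx.
have h2 : 1 <= expR (del * Num.min y A).
  by rewrite -expR0 ler_expR mulr_ge0 // ltW.
by rewrite !ger0_norm ?subr_ge0 ?(le_trans h2) // lerD2l lerN2.
Qed.

(** The two operators differ by thinning over the times between [min y A] and [y], where it
    multiplies the weight by at most [e^(del u)] at time [u]. *)
Lemma trunc_op_tail A dl del n G g : 0 < A -> 0 < dl -> dl <= del -> del <= dl0 -> 0 <= G ->
  (forall k, (k <= n)%N -> `|g k| <= G * weight dl k) ->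
  `|levy_pot nu g n - trunc_op A g n| <= G * tail del A * weight dl n.
Proof.
move=> A0 dl_gt0 dld deld G0 hg.
have del0 : 0 < del by exact: lt_le_trans dld.
rewrite trunc_opE // /levy_pot -(levy_intB nu_exp); first last.
- exact: levy_dom_trunc_op.
- exact: levy_dom_potential.
rewrite mulrAC -(levy_intZ nu_exp); last exact: levy_dom_tail.
apply: (ler_norm_levy_int nu_exp) => [||y y0].
- apply: levy_domB => //; first exact: levy_dom_potential.
  exact: levy_dom_trunc_op.
- by apply: levy_domZ; exact: levy_dom_tail.
set z := Num.min y A; have z0 : 0 <= z by rewrite le_min !ltW.
have zy : z <= y by rewrite ge_min lexx.
have pos h : (forall k, (k <= n)%N -> 0 <= h k) -> 0 <= potential y h n - potential z h n.
  by move=> h0; rewrite subr_ge0 le_potential_time.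
have lin a b : potential y (fun k => a * weight dl k + b * g k) n -
  potential z (fun k => a * weight dl k + b * g k) n =
  a * (potential y (weight dl) n - potential z (weight dl) n) +
  b * (potential y g n - potential z g n). by rewrite /potential !newton_opD !newton_opZ; ring.
apply: (@le_trans _ _ (G * (potential y (weight dl) n - potential z (weight dl) n))).
  rewrite ler_norml; apply/andP; split.
    have := @pos (fun k => G * weight dl k + 1 * g k); rewrite lin mul1r => h.
    suff : 0 <= G * (potential y (weight dl) n - potential z (weight dl) n) +
      (potential y g n - potential z g n) by lra.
    apply: h => k kn. by have := hg k kn; rewrite ler_norml mul1r => /andP[]; lra.
  have := @pos (fun k => G * weight dl k + (-1) * g k); rewrite lin mulN1r => h.
  rewrite -subr_ge0; apply: h => k kn.
  by have := hg k kn; rewrite ler_norml mulN1r => /andP[]; lra.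
rewrite -mulrA ler_wpM2l //.
have := @le_derive_increment _ (fun u => potential u (weight dl) n)
  (fun u => thinning u (weight dl) n)
  (fun u => weight dl n / del * expR (del * u)) (fun u => weight dl n * expR (del * u)) z y zy.
rewrite -mulrBr => h; apply: (le_trans (h _ _ _)) => [u _|u _|u /andP[zu uy]|].
- exact: is_derive_potential.
- have a1 := is_derive_expRM del u.
  have -> : (fun u => weight dl n / del * expR (del * u)) =
    (weight dl n / del) \*: (fun u => expR (del * u)) by [].
  by apply: is_derive_eq; rewrite /GRing.scale /=; field; rewrite gt_eqF.
- have u0 : 0 <= u by exact: le_trans zu.
  apply: (le_trans (thinning_weight (ltW dl_gt0) n u0)); rewrite mulrC.
  by rewrite ler_wpM2l ?(ltW (weight_gt0 (ltW dl_gt0) _)) // ler_expR ler_wpM2r.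
by apply: le_of_eq; ring.
Qed.

(** Beyond [A], the exponent [del = dl0 / 2] leaves a factor [e^(- del A)] to spare against the
    integrable [e^(dl0 y)]. *)
Lemma tail_small del eps : 0 < del -> 2 * del = dl0 -> 0 < eps ->
  exists A, [/\ 1 <= A & tail del A <= eps].
Proof.
move=> del0 deld eps0.
pose Psi := psi dl0.
have Psi0 : 0 <= Psi.
  apply: levy_int_ge0 => y y0. by rewrite subr_ge0 -expR0 ler_expR mulr_ge0 // ltW.
(* The part [1 + dl0^-1] gives [e^(dl0 y) >= 2] beyond [A]; the last term makes [e^(- del A)] small
   through [e^-x <= 1 / (1 + x)]. *)
pose A := 1 + dl0^-1 + (2 * Psi / del / eps) / del.
have X0 : 0 <= 2 * Psi / del / eps by rewrite divr_ge0 ?(ltW eps0) // divr_ge0 ?(ltW del0) // mulr_ge0.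
have A1 : 1 + dl0^-1 <= A by rewrite lerDl divr_ge0 // ltW.
have A0 : 0 < A by rewrite (lt_le_trans _ A1) // addr_gt0 // invr_gt0.
exists A; split; first by rewrite (le_trans _ A1) // lerDl invr_ge0 ltW.
apply: (@le_trans _ _ (2 * expR (- (del * A)) / del * Psi)).
  rewrite /Psi /psi -(levy_intZ nu_exp); last exact: levy_dom_exp.
  apply: (le_levy_int nu_exp) => [||y y0].
  - by apply: levy_dom_tail => //; rewrite -deld ler_peMl ?ler1n // ltW.
  - by apply: levy_domZ; exact: levy_dom_exp. rewrite mulrAC ler_pM2r ?invr_gt0 //.
  have [yA|/ltW Ay] := leP y A.
    rewrite subrr mulr_ge0 // ?mulr_ge0 ?expR_ge0 // subr_ge0 -expR0 ler_expR.
    by rewrite mulr_ge0 // ltW.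
  apply: (@le_trans _ _ (expR (del * y))); first by rewrite gerBl expR_ge0.
  have e1 : expR (dl0 * y) = expR (del * y) * expR (del * y).
    by rewrite -expRD -mulrDl -deld; congr expR; ring.
  have e2 : expR (- (del * A)) = (expR (del * A))^-1 by rewrite expRN.
  have h1 : expR (del * A) <= expR (del * y) by rewrite ler_expR ler_pM2l.
  have h2 : 2 <= expR (dl0 * y).
    apply: (@le_trans _ _ (1 + dl0 * y)); last exact: expR_ge1Dx.
    have : dl0 * (1 + dl0^-1) <= dl0 * y by rewrite ler_pM2l // (le_trans A1).
    by rewrite mulrDr mulfV ?gt_eqF // mulr1; have := dl0_gt0; lra.
  have ea := expR_gt0 (del * A). rewrite e2 -(ler_pM2l ea).
  have -> : expR (del * A) * (2 * (expR (del * A))^-1 * (expR (dl0 * y) - 1)) =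
     2 * (expR (dl0 * y) - 1) by field; rewrite gt_eqF.
  by rewrite e1; apply: square_dominates => //; rewrite -e1.
have h : expR (- (del * A)) * (1 + del * A) <= 1.
  by rewrite expRN mulrC ler_pdivrMr ?expR_gt0 // mul1r expR_ge1Dx.
have h3 : 2 * Psi / del <= eps * (del * A).
  have -> : del * A = del * (1 + dl0^-1) + 2 * Psi / del / eps.
    by rewrite /A; field; rewrite !gt_eqF.
  rewrite mulrDr [eps * (_ / eps)]mulrC divfK ?gt_eqF // lerDr.
  by rewrite !mulr_ge0 ?(ltW eps0) ?(ltW del0) // addr_ge0 // invr_ge0 ltW.
have h4 : 2 * Psi / del <= eps * (1 + del * A) by rewrite mulrDr; lra.
have -> : 2 * expR (- (del * A)) / del * Psi = expR (- (del * A)) * (2 * Psi / del) by ring.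
apply: (@le_trans _ _ (expR (- (del * A)) * (eps * (1 + del * A)))).
  by rewrite ler_wpM2l ?expR_ge0.
by rewrite mulrCA ler_piMr // ltW.
Qed.

(** The lower bound on [nu] applied to [1 - e^-y], which is at least [1 - e^-al] on [[al, be]]. *)
Lemma laplace1_gt0 : 0 < levy_int nu (fun y => 1 - expR (- (1 * y))).
Proof.
pose kappa y : R := y + expR (- (1 * y)).
have hk y : is_derive y 1 kappa (1 - expR (- (1 * y))).
  have a1 := is_derive_expRN 1 y. have -> : kappa = @id R + (fun y => expR (- (1 * y))) by [].
  by apply: is_derive_eq; rewrite mulN1r.
have hk' (y : R) : derivable (fun y : R => 1 - expR (- (1 * y))) y 1.
  have a1 := is_derive_expRN 1 y.
  have -> : (fun y : R => 1 - expR (- (1 * y))) = cst 1 - (fun y => expR (- (1 * y))) by [].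
  by apply: derivableB.
have := @nu_minor (fun y => 1 - expR (- (1 * y))) kappa
  (levy_dom_expN dl0_gt0 ler01) _ (fun y _ => hk y) hk'.
move=> h; apply: lt_le_trans (h _); last first.
  by move=> y y0; rewrite mul1r subr_ge0 -expR0 ler_expR oppr_le0 ltW.
rewrite mulr_gt0 //.
have := @le_derive_increment _ (fun y => (1 - expR (- al)) * y) (fun=> 1 - expR (- al))
  kappa (fun y => 1 - expR (- (1 * y))) al be (ltW al_be).
rewrite -mulrBr => h1; apply: lt_le_trans (h1 _ _ _).
- by rewrite mulr_gt0 ?subr_gt0 // -expR0 ltr_expR oppr_lt0.
- move=> z _; have -> : (fun y : R => (1 - expR (- al)) * y) = (1 - expR (- al)) \*: (@id R) by [].
  by apply: is_derive_eq; rewrite /GRing.scale /= mulr1.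
- by move=> z /andP[az _]; rewrite lerD2l lerN2 ler_expR lerN2 mul1r.
Qed.

Let lap1 : R := levy_int nu (fun y => 1 - expR (- (1 * y))).

Lemma le_lap1_mass A : 1 <= A -> lap1 <= mass A.
Proof.
move=> A1; apply: (le_levy_int nu_exp) => [||y y0].
- exact: levy_dom_expN.
- by apply: levy_dom_min; exact: lt_le_trans A1.
rewrite le_min mul1r; have := expR_ge1Dx (- y) => h; rewrite (_ : _ - _ <= y) //=; last lra.
by apply: le_trans A1; rewrite gerBl expR_ge0.
Qed.

Lemma m1_gt0 : 0 < m1.
Proof.
apply: lt_le_trans laplace1_gt0 _; apply: (le_levy_int nu_exp) => [||y y0].
- exact: levy_dom_expN.
- exact: levy_dom_id.
by rewrite mul1r; have := expR_ge1Dx (- y); lra.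
Qed.

(** The power of the average dominates [p] times [trunc_op A] composed with [unit_op s]. The
    difference [B] is positive and has lost mass [c]; the part removed is close to a smoothing of
    [levy_pot d], which is small by assumption. Hence the [- c] in front of [D]. *)
Lemma unif_op_contract m A c s e dl del M D C2 d :
  0 < c -> 0 <= s -> 1 + A <= e - s ->
  (forall d n, (forall k, (k <= n)%N -> 0 <= d k) ->
    c * (potential e d n - potential s d n) <= unif_op al be m d n) ->
  1 <= A -> 0 < dl -> dl <= del -> del <= dl0 -> 0 <= D -> 0 <= C2 ->
  (forall n, (n <= M)%N -> `|d n| <= D * weight dl n) ->
  (forall n, `|levy_pot nu d n| <= C2 * weight dl n) ->
  forall n, (n <= M)%N -> `|unif_op al be m d n| <=
   (D * (expR (dl * be) ^+ m - c + c / mass A * expR (dl * (s + 1)) * tail del A)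
    + c / mass A * expR (dl * (s + 1)) * C2) * weight dl n.
Proof.
move=> c0 s0 se minor A1 dl_gt0 dld deld D0 C20 hd hK n nM.
have A0 : 0 < A by exact: lt_le_trans A1.
have w0 k : 0 < weight dl k by rewrite weight_gt0 // ltW.
have mass0 : 0 < mass A by rewrite (lt_le_trans laplace1_gt0) // le_lap1_mass.
pose p := c / mass A.
have p0 : 0 < p by rewrite divr_gt0.
have pm : p * mass A = c by rewrite /p divfK // gt_eqF.
pose B g := unif_op al be m g n - p * trunc_op A (unit_op s g) n.
have B_ge0 g : (forall k, (k <= n)%N -> 0 <= g k) -> 0 <= B g.
  move=> g0; rewrite subr_ge0; apply: le_trans (minor _ _ g0).
  apply: (@le_trans _ _ (p * (mass A * (potential (s + 1 + A) g n - potential s g n)))).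
    by rewrite ler_pM2l // trunc_unit_le.
  rewrite mulrA pm ler_pM2l // lerD2r le_potential_time //; last lra.
  by rewrite !addr_ge0 // ltW.
have B_lin a b f g : B (fun k => a * f k + b * g k) = a * B f + b * B g.
  rewrite /B /unif_op /trunc_op !(eq_newton_opr _ (fun j _ => unit_opE s _ j)) !newton_opM.
  by rewrite !newton_opD !newton_opZ; ring.
have hB : `|B d| <= D * B (weight dl).
  rewrite ler_norml; apply/andP; split.
    have := @B_ge0 (fun k => D * weight dl k + 1 * d k); rewrite B_lin mul1r => h.
    suff : 0 <= D * B (weight dl) + B d by lra.
    apply: h => k kn; have := hd k (leq_trans kn nM).
    by rewrite ler_norml mul1r => /andP[]; lra.
  have := @B_ge0 (fun k => D * weight dl k + (-1) * d k); rewrite B_lin mulN1r => h.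
  rewrite -subr_ge0; apply: h => k kn; have := hd k (leq_trans kn nM).
  by rewrite ler_norml mulN1r => /andP[]; lra.
have hBw : B (weight dl) <= (expR (dl * be) ^+ m - c) * weight dl n.
  rewrite mulrBl -pm lerB //; first exact: unif_op_weight.
  by rewrite -mulrA ler_pM2l // trunc_unit_weight.
have h1 : `|unit_op s (levy_pot nu d) n| <= C2 * expR (dl * (s + 1)) * weight dl n.
  by apply: unit_op_norm => // k _; exact: hK.
have h2 : unit_op s (levy_pot nu d) n = levy_pot nu (unit_op s d) n.
  rewrite unit_opE (levy_potE dl0_gt0 nu_exp).
  rewrite (eq_newton_opr _ (fun j _ => levy_potE dl0_gt0 nu_exp d j)).
  rewrite (eq_newton_opr _ (fun j _ => unit_opE s d j)) !newton_opM.
  by apply: eq_newton_op => j _; rewrite mulrC.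
have h3 : `|levy_pot nu (unit_op s d) n - trunc_op A (unit_op s d) n| <=
  D * expR (dl * (s + 1)) * tail del A * weight dl n.
  apply: (@trunc_op_tail A dl del) => // [|k kn]; first by rewrite mulr_ge0 // expR_ge0.
  apply: unit_op_norm => // i ik; apply: hd. by rewrite (leq_trans ik) // (leq_trans kn).
have -> : unif_op al be m d n = B d
   - p * (levy_pot nu (unit_op s d) n - trunc_op A (unit_op s d) n)
   + p * levy_pot nu (unit_op s d) n by rewrite /B; ring.
rewrite h2 in h1.
apply: (@le_trans _ _ (`|B d| + p * `|levy_pot nu (unit_op s d) n - trunc_op A (unit_op s d) n|
  + p * `|levy_pot nu (unit_op s d) n|)).
  apply: (le_trans (ler_normD _ _)); rewrite normrM (gtr0_norm p0) lerD2r.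
  by apply: (le_trans (ler_normB _ _)); rewrite normrM (gtr0_norm p0).
apply: (@le_trans _ _ (D * ((expR (dl * be) ^+ m - c) * weight dl n) +
  p * (D * expR (dl * (s + 1)) * tail del A * weight dl n) +
  p * (C2 * expR (dl * (s + 1)) * weight dl n))). apply: lerD; last by rewrite ler_pM2l.
  apply: lerD; last by rewrite ler_pM2l. by apply: (le_trans hB); rewrite ler_wpM2l.
by apply: le_of_eq; rewrite -/p; ring.
Qed.

(** Each application of the maximum principle undoes one average at the price of a factor
    [lam / (lam - psi dl)]. The constant must not depend on the range [M]. *)
Lemma iter_max_principle dl B d i : 0 < dl -> dl <= dl0 -> psi dl < lam -> 0 <= B ->
  (forall n, `|levy_op nu d n| <= B * weight dl n) ->
  exists C, forall M X, (forall n, (n <= M)%N -> `|unif_op al be i d n| <= X * weight dl n) ->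
    forall n, (n <= M)%N -> `|d n| <= ((lam / (lam - psi dl)) ^+ i * X + C) * weight dl n.
Proof.
move=> dl_gt0 dll psil B0 hB; have w0 k : 0 < weight dl k by rewrite weight_gt0 // ltW.
elim: i => [|i [C IH]].
  by exists 0 => M X h n nM; rewrite expr0 mul1r addr0 -(unif_op0 al be d n) h.
exists ((lam / (lam - psi dl)) ^+ i * (B * expR (dl * be) ^+ i / (lam - psi dl)) + C).
move=> M X h n nM.
have hU k : (k <= M)%N -> `|unif_op al be i d k| <=
    (lam * X + B * expR (dl * be) ^+ i) / (lam - psi dl) * weight dl k.
  apply: (max_principle dl0_gt0 nu_exp al_gt0 al_be eta_gt0 nu_minor) => // {}k kM.
    by rewrite unif_opD add1n h.
  have -> : levy_op nu (unif_op al be i d) k = unif_op al be i (levy_op nu d) k.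
    by rewrite /levy_op /unif_op !newton_opM; apply: eq_newton_op => j _; rewrite mulrC.
  apply: (@le_trans _ _ (B * unif_op al be i (weight dl) k)).
    rewrite /unif_op -newton_opZ -!/(unif_op al be i _ k).
    rewrite ler_norml; apply/andP; split.
      rewrite -mulN1r /unif_op -newton_opZ -!/(unif_op al be i _ k).
      apply: le_unif_op => // j jk; have := hB j. by rewrite ler_norml mulN1r => /andP[].
    by apply: le_unif_op => // j jk; have := hB j; rewrite ler_norml => /andP[].
  by rewrite -mulrA ler_wpM2l // unif_op_weight.
apply: (le_trans (IH _ _ hU n nM)); rewrite ler_pM2r //.
by apply: le_of_eq; rewrite exprS; ring.
Qed.

Lemma theta_le x k : 0 <= x -> x <= 2^-1 -> (1 / (1 - x)) ^+ k <= expR (2 * x * k%:R).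
Proof.
move=> x0 x1; rewrite [2 * x * _]mulrC expRM_natl lerXn2r ?nnegrE ?expR_ge0 ?divr_ge0 //; first lra.
have h : 0 < 1 - x by lra.
rewrite ler_pdivrMr //; have := expR_ge1Dx (2 * x) => h2.
have : (1 + 2 * x) * (1 - x) <= expR (2 * x) * (1 - x) by rewrite ler_pM2r.
by apply: le_trans; nra.
Qed.

(** Let [d] be [g] minus its logarithmic part and a constant chosen so that [levy_pot d] is small.
    The weighted norm [D] of [d] over the indices up to [n] satisfies [D (1 - rho) <= C] with
    [rho < 1] and [C] independent of [n]. *)
Theorem renewal (g : nat -> R) (b0 dlb C : R) : 0 < dlb ->
  (forall n, (0 < n)%N -> `|levy_op nu g n - b0| <= C * weight dlb n) ->
  exists2 dl, 0 < dl & exists c C', forall n,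
    `|g n - b0 / m1 * hsum R n - c| <= C' * weight dl n.
Proof.
move=> dlb0 hg; have m10 := m1_gt0.
pose del := dl0 / 2.
have del0 : 0 < del by rewrite divr_gt0.
have deld : del <= dl0 by have := dl0_gt0; rewrite /del; lra.
have [A [A1 tA]] := @tail_small del (lap1 / 2) del0 ltac:(by rewrite /del; field)
  ltac:(by rewrite divr_gt0 // laplace1_gt0).
have L0 := L_gt0.
(* Enough powers for the interval of [unif_op_minor] to have length at least [1 + A]. *)
pose m := Num.trunc (2 * (1 + A) / L).
have hm : 1 + A <= L * (1 + m%:R / 2).
  have : 2 * (1 + A) / L < m.+1%:R by rewrite truncnS_gt. rewrite ltr_pdivrMr // => h.
  have -> : L * (1 + m%:R / 2) = L + m%:R * L / 2 by ring.
  have e : m.+1%:R * L = m%:R * L + L by rewrite -natr1; ring. by rewrite e in h; lra.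
have [c [s [e [c0 s0 se minor]]]] := unif_op_minor al_gt0 al_be m.
have se' : 1 + A <= e - s by exact: le_trans se.
(* The solution of [eps * (1 + c / 2) = c / 8], as [factor_bound] requires. *)
pose eps := c / (8 + 4 * c).
have eps0 : 0 < eps by rewrite divr_gt0 // addr_gt0 // mulr_gt0.
have lp0 := laplace1_gt0.
have massl : lap1 <= mass A by exact: le_lap1_mass.
have mass0 : 0 < mass A by exact: lt_le_trans massl.
pose Cpsi := psi dl0 / dl0.
have psi0 : 0 <= psi dl0.
  apply: levy_int_ge0 => y y0. by rewrite subr_ge0 -expR0 ler_expR mulr_ge0 // ltW.
have Cpsi0 : 0 <= Cpsi by rewrite divr_ge0 // ltW.
(* Sum of the exponents through which the constants deteriorate with [dl]: once
   [dl * Lam <= ln (1 + eps)], each such factor is at most [1 + eps]. *)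
pose Lam := be * m.+1%:R + (s + 1) + 2 * (Cpsi / lam) * m.+1%:R + 2 * (Cpsi / lam).
have be0 : 0 < be by exact: lt_trans al_be.
have l0 := lam_gt0.
have cl0 : 0 <= Cpsi / lam by rewrite divr_ge0 // ltW.
have clm0 : 0 <= 2 * (Cpsi / lam) * m.+1%:R by rewrite mulr_ge0 // mulr_ge0.
have bem0 : 0 <= be * m.+1%:R by rewrite mulr_ge0 // ltW.
have Lam0 : 0 < Lam.
  have := bem0. have := clm0. by rewrite /Lam; lra.
pose dl := Num.min (Num.min dlb del) (Num.min (2^-1 / Lam) (ln (1 + eps) / Lam)).
have ln0 : 0 < ln (1 + eps) by rewrite ln_gt0 // ltrDl.
have dl_gt0 : 0 < dl by rewrite !lt_min dlb0 del0 !divr_gt0.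
have dl1 : dl <= dlb by rewrite !ge_min lexx.
have dl2 : dl <= del by rewrite !ge_min lexx orbT.
have dl3 : dl * Lam <= 2^-1 by rewrite -ler_pdivlMr // !ge_min lexx !orbT.
have dl4 : dl * Lam <= ln (1 + eps) by rewrite -ler_pdivlMr // !ge_min lexx !orbT.
have dll : dl <= dl0 by exact: le_trans deld.
have hpsi : psi dl <= dl * Cpsi.
  have := levy_int_exp_le dl0_gt0 nu_exp (ltW dl_gt0) dll.
  by rewrite -/(psi _) -/(psi _) /Cpsi; congr (_ <= _); ring.
have small z : z <= Lam -> expR (dl * z) <= 1 + eps.
  move=> zL; rewrite -[leRHS]lnK ?posrE ?addr_gt0 // ler_expR (le_trans _ dl4) //.
  by rewrite ler_pM2l.
have x1 : dl * (Cpsi / lam) <= 2^-1.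
  apply: le_trans dl3; rewrite ler_pM2l //. have := bem0. have := clm0. by rewrite /Lam; lra.
have psil : psi dl < lam.
  apply: (le_lt_trans hpsi).
  by move: x1; rewrite mulrA ler_pdivrMr // => h; apply: (le_lt_trans h); lra.
pose theta := lam / (lam - psi dl).
have theta_ge0 : 0 <= theta by rewrite divr_ge0 ?subr_ge0 ?ltW.
have h_theta : theta ^+ m.+1 <= 1 + eps.
  apply: (@le_trans _ _ (expR (dl * (2 * (Cpsi / lam) * m.+1%:R)))); last first.
    apply: small; rewrite /Lam. have := bem0. lra.
  have -> : dl * (2 * (Cpsi / lam) * m.+1%:R) = 2 * (dl * (Cpsi / lam)) * m.+1%:R by ring.
  apply: le_trans (theta_le m.+1 _ x1); last by rewrite mulr_ge0 // ltW.
  have h1 : 0 < 1 - dl * (Cpsi / lam) by lra.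
  apply: lerXn2r; rewrite ?nnegrE //; first by rewrite divr_ge0 // ltW.
  rewrite /theta ler_pdivrMr ?subr_gt0 // mulrAC ler_pdivlMr // mul1r.
  have -> : lam * (1 - dl * (Cpsi / lam)) = lam - dl * Cpsi by field; rewrite gt_eqF.
  by rewrite lerD2l lerN2.
pose d0 n := g n - b0 / m1 * hsum R n.
have C0 : 0 <= C.
  have := hg 1%N isT => /(le_trans (normr_ge0 _)); rewrite pmulr_lge0 //.
  by rewrite weight_gt0 // ltW.
have w0 k : 0 < weight dl k by rewrite weight_gt0 // ltW.
pose C1 := C + `|b0 / m1| * (psi dl / dl).
have psi_ge0 : 0 <= psi dl.
  apply: levy_int_ge0 => y y0. by rewrite subr_ge0 -expR0 ler_expR mulr_ge0 // ltW.
have C10 : 0 <= C1 by rewrite addr_ge0 // mulr_ge0 // divr_ge0 // ltW.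
have hd0 n : (0 < n)%N -> `|levy_op nu d0 n| <= C1 * weight dl n.
  move=> n0.
  have -> : levy_op nu d0 n = (levy_op nu g n - b0) + b0 / m1 * levy_pot nu (delta R 0) n.
    rewrite /d0 /levy_op newton_opB newton_opZ -/(levy_op nu g n) -/(levy_op nu _ n).
    rewrite (levy_op_harmonic dl0_gt0 nu_exp) -/m1. by field; rewrite gt_eqF.
  apply: (le_trans (ler_normD _ _)); rewrite mulrDl lerD //.
    by apply: (le_trans (hg n n0)); rewrite ler_wpM2l // le_weight // ltW.
  rewrite normrM -mulrA ler_wpM2l //.
  have /andP[h1 h2] := levy_pot_delta dl0_gt0 nu_exp n dl_gt0 dll. by rewrite ger0_norm.
(* [A] applied to [levy_pot d0] is [Phi(A) d0], which is small, so [levy_pot d0] has a limit. *)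
have [Zoo hZ] := @generator_eq_lim _ dl (levy_pot nu d0) C1 dl_gt0 C10
  ltac:(by move=> n n0; rewrite (generator_levy_pot dl0_gt0 nu_exp); exact: hd0).
(* [levy_pot] multiplies constants by [m1], so subtracting [c'] from [d0] removes the limit
   [Zoo]. *)
pose c' := Zoo / m1.
pose d n := d0 n - c'.
have dK n : levy_pot nu d n = levy_pot nu d0 n - Zoo.
  rewrite !(levy_potE dl0_gt0 nu_exp) newton_opB newton_op_cst.
  by congr (_ - _); rewrite -/m1 /c' mulrC divfK // gt_eqF.
have dop n : `|levy_op nu d n| <= C1 * weight dl n.
  have -> : levy_op nu d n = levy_op nu d0 n.
    exact: levy_op_subc.
  case: n => [|n]; last exact: hd0. by rewrite levy_op_at0 normr0 mulr_ge0 // ltW.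
have [CN hN] := iter_max_principle m.+1 dl_gt0 dll psil C10 dop.
pose p := c / mass A.
have p0 : 0 < p by rewrite divr_gt0.
pose C3 := p * expR (dl * (s + 1)) * (C1 / dl).
pose rho := Num.max 0 (1 - c / 8).
have rho1 : rho < 1 by rewrite gt_max ltr01 /= gtrBl divr_gt0.
exists dl => //; exists c', ((theta ^+ m.+1 * C3 + CN) / (1 - rho)) => n.
pose q (i : 'I_n.+1) := `|d i| / weight dl i.
pose i0 := [arg max_(i > ord0) q i]%O.
pose D := q i0.
have hD k : (k <= n)%N -> `|d k| <= D * weight dl k.
  move=> kn; rewrite -ler_pdivrMr //. have := kn; rewrite -ltnS => kn1.
  by rewrite /D /i0; case: arg_maxP => // i _ /(_ (Ordinal kn1) isT).
have D0 : 0 <= D by rewrite /D /q divr_ge0 // ltW.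
have tail0 : 0 <= tail del A.
  apply: levy_int_ge0 => y y0; rewrite divr_ge0 ?(ltW del0) // subr_ge0.
  by rewrite ler_expR ler_pM2l // ge_min lexx.
have hU := unif_op_contract c0 s0 se' minor A1 dl_gt0 dl2 deld D0 (divr_ge0 C10 (ltW dl_gt0)) hD
  (fun k => ltac:(rewrite dK; exact: hZ k)).
have hDD := hN _ _ hU.
have DD : D <= theta ^+ m.+1 * (D * (expR (dl * be) ^+ m.+1 - c +
   p * expR (dl * (s + 1)) * tail del A) + C3) + CN.
  rewrite /D /q ler_pdivrMr //; exact: (hDD i0 (ltn_ord i0)).
have k1 : expR (dl * be) ^+ m.+1 - c + p * expR (dl * (s + 1)) * tail del A <= 1 - c / 4.
  have h1 : expR (dl * be) ^+ m.+1 <= 1 + eps.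
    rewrite -expRM_natl mulrC -mulrA; apply: small; rewrite /Lam. have := clm0. lra.
  have h2 : expR (dl * (s + 1)) <= 1 + eps.
    apply: small; rewrite /Lam. have := clm0. have := bem0. lra.
  have h3 : p * tail del A <= c / 2.
    rewrite /p mulrAC ler_pdivrMr // mulrAC -mulrA ler_pM2l //.
    by apply: (le_trans tA); rewrite ler_pM2r ?invr_gt0.
  have h4 : p * expR (dl * (s + 1)) * tail del A <= (1 + eps) * (c / 2).
    have -> : p * expR (dl * (s + 1)) * tail del A = expR (dl * (s + 1)) * (p * tail del A) by ring.
    by apply: ler_pM => //; rewrite ?expR_ge0 // mulr_ge0 // ltW.
  have h5 : eps * (1 + c / 2) = c / 8.
    by rewrite /eps; field; rewrite gt_eqF // addr_gt0 // mulr_gt0.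
  exact: (factor_bound c0 h1 h4 h5).
have k2 : theta ^+ m.+1 * (expR (dl * be) ^+ m.+1 - c +
   p * expR (dl * (s + 1)) * tail del A) <= rho.
  set X := (X in _ * X <= _) in k1 *; set T := theta ^+ m.+1 in h_theta *.
  have T0 : 0 <= T by rewrite exprn_ge0. have [X0|/ltW X0] := leP X 0.
    by apply: (@le_trans _ _ 0); [rewrite mulr_ge0_le0 | rewrite le_max lexx].
  apply: (@le_trans _ _ ((1 + eps) * (1 - c / 4))); first exact: ler_pM.
  rewrite le_max; apply/orP; right. have h5 : eps <= c / 8.
    by rewrite /eps ler_pM2l // lef_pV2 ?posrE ?addr_gt0 ?mulr_gt0 // lerDl mulr_ge0 // ltW.
  have h6 : 0 <= 1 - c / 4 by exact: le_trans X0 k1.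
  have : (1 + eps) * (1 - c / 4) <= (1 + c / 8) * (1 - c / 4) by rewrite ler_wpM2r // lerD2l.
  by move/le_trans; apply; exact: quarter_eighth.
have Dfin : D <= (theta ^+ m.+1 * C3 + CN) / (1 - rho).
  rewrite ler_pdivlMr ?subr_gt0 //. exact: (contraction_bound DD (ler_wpM2l D0 k2)).
have -> : g n - b0 / m1 * hsum R n - c' = d n by [].
by apply: (le_trans (hD n (leqnn n))); rewrite ler_pM2r.
Qed.

End RenewalTheorem.

(** * Transition rates and moments of one jump *)

Lemma three_bounds (R : realType) (m a b c ca cb cc : R) : 0 <= a <= ca -> 0 <= b <= cb ->
  0 <= c <= cc -> `|m - a - 2 * b + c - m| <= ca + 2 * cb + cc.
Proof.
move=> /andP[a0 a1] /andP[b0 b1] /andP[c0 c1]; rewrite ler_norml; apply/andP; split; lra.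
Qed.

Section Rates.
Variable R : realType.
Variables (nu : {measure set R -> \bar R}) (dl0 : R).
Hypotheses (dl0_gt0 : 0 < dl0) (nu_exp : exp_integrable nu dl0).
Implicit Types (d g : nat -> R) (n j k i : nat) (x y dl : R).

Let psi dl : R := levy_int nu (fun y => expR (dl * y) - 1).
Let m1 : R := levy_int nu (fun y => y).
Let H := @hsum R.

(** For [i < n] an off-diagonal entry of [- Phi(A)]: the integral over [nu] of the probability that
    [i] of the [n] points survive thinning. *)
Definition rate n i : R := - newton_op (fun j => laplace_exp nu j%:R) (delta R i) n.

Lemma levy_op_rate g n : levy_op nu g n = \sum_(i < n) rate n i * (g n - g i).
Proof.
have e0 : levy_op nu (fun=> 1) n = 0.
  rewrite (levy_opE dl0_gt0 nu_exp) -[RHS](levy_int0 nu); congr levy_int.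
  by apply/funext => y; rewrite thinning_cst subrr.
rewrite /levy_op newton_op_rates in e0; rewrite /levy_op newton_op_rates.
transitivity (\sum_(i < n.+1) rate n i * (g n - g i)).
  transitivity (\sum_(i < n.+1) rate n i * (g n - g i) +
    g n * \sum_(k < n.+1) newton_op (fun j => laplace_exp nu j%:R) (delta R k) n * 1).
    rewrite mulr_sumr -big_split; apply: eq_bigr => i _; rewrite /rate /=; ring.
  by rewrite e0 mulr0 addr0.
by rewrite big_ord_recr /= subrr mulr0 addr0.
Qed.

Lemma rate_ge0 n i : (i < n)%N -> 0 <= rate n i.
Proof.
move=> ni; have -> : rate n i = levy_int nu (fun y => thinning y (delta R i) n).
  rewrite /rate -/(levy_op nu (delta R i) n) (levy_opE dl0_gt0 nu_exp).
  rewrite -mulN1r -(levy_intZ nu_exp); last exact: levy_dom_thinning.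
  by apply: eq_levy_int => y _; rewrite {1}/delta (ltn_eqF ni) sub0r mulN1r opprK.
apply: levy_int_ge0 => y y0; apply: thinning_ge0 => [|k _]; first exact: ltW.
exact: ler0n.
Qed.

Lemma sum_rate n : \sum_(i < n) rate n i = laplace_exp nu n%:R.
Proof.
have := levy_op_rate (delta R n) n; rewrite {1}/levy_op newton_opE (bigD1 ord_max) //=.
rewrite /delta eqxx binn subnn big_ord1 bin0 !mul1r addn0 big1 ?addr0.
  move=> ->; apply: eq_bigr => i _; rewrite eq_sym (ltn_eqF (ltn_ord i)) subr0 mulr1 //.
by move=> i /negPf h; rewrite eq_sym -(inj_eq val_inj) /= in h; rewrite h mulr0 mul0r.
Qed.

Lemma le_sum_rate n f g : (forall i, (i < n)%N -> f i <= g i) ->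
  \sum_(i < n) rate n i * f i <= \sum_(i < n) rate n i * g i.
Proof.
by move=> fg; apply: ler_sum => i _; rewrite ler_wpM2l ?rate_ge0 // fg.
Qed.

Lemma levy_op_weight dl n : 0 < dl -> dl <= dl0 ->
  - (psi dl * weight dl n) <= levy_op nu (weight dl) n.
Proof.
move=> dl_gt0 dll; rewrite (levy_opE dl0_gt0 nu_exp) mulrC -mulNr -(levy_intZ nu_exp).
  apply: (le_levy_int nu_exp) => [||y y0].
  - by apply: levy_domZ; exact: levy_dom_exp.
  - exact: levy_dom_thinning. have := thinning_weight (ltW dl_gt0) n (ltW y0); lra.
exact: levy_dom_exp.
Qed.

Lemma sum_rate_weight dl n : 0 < dl -> dl <= dl0 ->
  \sum_(i < n) rate n i * weight dl i <= (laplace_exp nu n%:R + psi dl) * weight dl n.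
Proof.
move=> dl_gt0 dll; have := levy_op_weight n dl_gt0 dll.
rewrite levy_op_rate; under eq_bigr do rewrite mulrBr.
rewrite sumrB -mulr_suml sum_rate; lra.
Qed.

Lemma sum_rate_weight_ratio dl n : 0 < dl -> dl <= dl0 ->
  \sum_(i < n) rate n i * (weight dl i / weight dl n - 1) <= psi dl.
Proof.
move=> dl_gt0 dll; have w0 := weight_gt0 (ltW dl_gt0) n.
rewrite -(ler_pM2r w0) mulr_suml.
have := levy_op_weight n dl_gt0 dll; rewrite levy_op_rate lerNl.
apply: le_trans; rewrite -sumrN; apply: le_of_eq; apply: eq_bigr => i _.
by rewrite -mulrA mulrBl divfK ?gt_eqF // mul1r -mulrN opprB.
Qed.

(** Factor by factor, from [(1 + z)^3 <= 1 + 7 z] for [0 <= z <= 1]. *)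
Lemma weight_cubic dl m n : 0 <= dl -> dl <= 1 -> (m <= n)%N ->
  (weight dl m / weight dl n) ^+ 3 <= weight (7 * dl) m / weight (7 * dl) n.
Proof.
move=> dl_ge0 dl1 /subnK <-; have d7 : 0 <= 7 * dl by rewrite mulr_ge0.
elim: (n - m)%N => [|k IH].
  by rewrite add0n !divff ?gt_eqF ?weight_gt0 // expr1n.
rewrite addSn; set p := (k + m)%N in IH *.
have p1 : 1 <= p.+1%:R :> R by rewrite ler1n.
have p0 : 0 < p.+1%:R :> R by rewrite ltr0Sn.
have rec e : 0 <= e -> weight e m / weight e p.+1 = weight e m / weight e p * (1 + e / p.+1%:R).
  move=> e0; have h := weightS e0 p. have -> : weight e p.+1 = weight e p / (1 + e / p.+1%:R).
    apply: (@mulIf _ (p.+1%:R + e)); first by rewrite gt_eqF // ltr_wpDr.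
    rewrite h; field; rewrite !gt_eqF ?ltr_wpDr // ?ltr_pwDl //.
  by field; rewrite !gt_eqF ?weight_gt0 ?ltr_wpDr.
rewrite !rec // exprMn; apply: ler_pM => //.
- by rewrite exprn_ge0 // divr_ge0 // ltW // weight_gt0.
- by rewrite exprn_ge0 // addr_ge0 // divr_ge0.
set z := dl / p.+1%:R; have z0 : 0 <= z by rewrite divr_ge0.
have z1 : z <= 1 by rewrite ler_pdivrMr // mul1r (le_trans dl1).
have -> : 7 * dl / p.+1%:R = 7 * z by rewrite /z mulrA.
have -> : (1 + z) ^+ 3 = 1 + 3 * z + 3 * z * z + z * z * z by ring.
have : z * z <= z by rewrite ler_piMr.
have : z * z * z <= z by rewrite -mulrA ler_piMr // mulr_ile1.
lra.
Qed.

(** With [x = H n - H i], the ratio of weights is at least [1 + dl x]. Its cube controls [x^2] and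
    [x^3], and is bounded by a ratio of exponent [7 dl] whose excess over 1 has bounded sum against
    the rates. *)
Lemma harmonic_moments : exists C, forall n,
  \sum_(i < n) rate n i * (H n - H i) ^+ 2 <= C /\
  \sum_(i < n) rate n i * (H n - H i) ^+ 3 <= C.
Proof.
pose dl := Num.min 1 dl0 / 7.
have mm : 0 < Num.min 1 dl0 by rewrite lt_min ltr01.
have dl_gt0 : 0 < dl by rewrite divr_gt0.
have dl1 : dl <= 1.
  rewrite ler_pdivrMr // mul1r; apply: (@le_trans _ _ 1); first by rewrite ge_min lexx.
  by rewrite ler1n.
have dl7 : 7 * dl <= dl0.
  by rewrite /dl mulrCA divff ?mulr1 ?pnatr_eq0 // ge_min lexx orbT.
have d7 : 0 < 7 * dl by rewrite mulr_gt0.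
pose C2 := psi (7 * dl) / (3 * dl ^+ 2); pose C3 := psi (7 * dl) / dl ^+ 3.
have key n i : (i < n)%N -> 3 * dl ^+ 2 * (H n - H i) ^+ 2 + dl ^+ 3 * (H n - H i) ^+ 3 <=
    weight (7 * dl) i / weight (7 * dl) n - 1.
  move=> ni; have h := weight_cubic (ltW dl_gt0) dl1 (ltnW ni).
  have h1 := weight_harmonic_incr (ltW dl_gt0) (ltnW ni).
  have x0 : 0 <= H n - H i by rewrite subr_ge0 harmonic_le // ltnW.
  rewrite -/(H n) -/(H i) in h1; set x := H n - H i in x0 h1 *.
  have h2 : (1 + dl * x) ^+ 3 <= (weight dl i / weight dl n) ^+ 3.
    apply: lerXn2r => //; rewrite nnegrE.
      by rewrite addr_ge0 // mulr_ge0 // ltW.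
    by rewrite divr_ge0 // ltW // weight_gt0 // ltW.
  have := le_trans h2 h.
  have -> : (1 + dl * x) ^+ 3 = 1 + 3 * (dl * x) + 3 * dl ^+ 2 * x ^+ 2 + dl ^+ 3 * x ^+ 3 by ring.
  have : 0 <= dl * x by rewrite mulr_ge0 // ltW. lra.
have sumb n := sum_rate_weight_ratio n d7 dl7.
have psi0 : 0 <= psi (7 * dl).
  apply: levy_int_ge0 => y y0. have : 0 <= 7 * dl * y by rewrite mulr_ge0 ?(ltW d7) ?(ltW y0).
  by have := expR_ge1Dx (7 * dl * y); lra.
exists (C2 + C3) => n; split.
  apply: (@le_trans _ _ C2); last by rewrite lerDl divr_ge0 // exprn_ge0 // ltW.
  rewrite ler_pdivlMr ?mulr_gt0 ?exprn_gt0 // mulr_suml.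
  apply: le_trans (sumb n); apply: ler_sum => i _.
  rewrite -mulrA ler_wpM2l ?rate_ge0 //; apply: le_trans (key _ _ (ltn_ord i)).
  rewrite mulrC lerDl mulr_ge0 ?exprn_ge0 ?(ltW dl_gt0) //.
  by rewrite subr_ge0 harmonic_le // ltnW.
apply: (@le_trans _ _ C3); last by rewrite lerDr divr_ge0 // mulr_ge0 // exprn_ge0 // ltW.
rewrite ler_pdivlMr ?exprn_gt0 // mulr_suml.
apply: le_trans (sumb n); apply: ler_sum => i _.
rewrite -mulrA ler_wpM2l ?rate_ge0 //; apply: le_trans (key _ _ (ltn_ord i)).
by rewrite mulrC lerDr mulr_ge0 ?sqr_ge0 // mulr_ge0 // sqr_ge0.
Qed.

Lemma weight1 n : weight 1 n = n.+1%:R^-1 :> R.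
Proof.
elim: n => [|n IH]; first by rewrite weight0 invr1.
have := weightS (@ler01 R) n; rewrite IH => h.
apply: (@mulIf _ (n.+1%:R + 1)); first by rewrite natr1 pnatr_eq0.
by rewrite h natr1 !mulVf ?pnatr_eq0.
Qed.

Lemma le_potential_dominated dl C y g n : 0 < dl -> 0 <= y -> 0 <= C ->
  (forall k, (k <= n)%N -> g k <= C * weight dl k) ->
  potential y g n <= C * ((expR (dl * y) - 1) / dl * weight dl n).
Proof.
move=> dl_gt0 y0 C0 hg.
apply: (@le_trans _ _ (potential y (fun k => C * weight dl k) n)).
  exact: le_potential.
by rewrite /potential newton_opZ ler_wpM2l // potential_weight.
Qed.

Lemma levy_dom_sqr : levy_dom dl0 (fun y : R => y ^+ 2).
Proof.
apply: (@levy_dom_le _ dl0 _ (fun y => expR (dl0 * y) - 1) (4 / dl0 ^+ 2)).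
- exact: exprn_measurable.
- exact: levy_dom_exp.
move=> y y0; rewrite ger0_norm ?sqr_ge0 // ger0_norm; last first.
  by rewrite subr_ge0 -expR0 ler_expR mulr_ge0 // ltW.
have -> : dl0 * y = dl0 * y / 2 + dl0 * y / 2 by field.
rewrite expRD mulrAC ler_pdivlMr ?exprn_gt0 // -exprMn.
have := expR_ge1Dx (dl0 * y / 2).
have : 0 < dl0 * y by rewrite mulr_gt0.
rewrite [y * dl0]mulrC; set z := dl0 * y; set E := expR _ => z0 E0; nra.
Qed.

Lemma levy_op_potential d n : levy_op nu d n = levy_pot nu (thinning_gen d) n.
Proof.
rewrite (levy_opE dl0_gt0 nu_exp); congr levy_int.
by apply/funext => y; exact: subr_thinning.
Qed.

(** With [H2] the sum of the [1 / j^2], one has [A (H^2 + H2) = 2 H]. So [Phi(A)] of [H^2] reduces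
    to [levy_pot H], explicit up to the remainder [e3]. *)
Lemma harmonic_second_moment : exists2 dl, 0 < dl & exists C, forall n,
  `|\sum_(i < n) rate n i * (H n - H i) ^+ 2 - levy_int nu (fun y => y ^+ 2)|
    <= C * weight dl n.
Proof.
pose dl := Num.min 1 dl0 / 3.
have mm : 0 < Num.min 1 dl0 by rewrite lt_min ltr01.
have dl_gt0 : 0 < dl by rewrite divr_gt0.
have mm1 : Num.min 1 dl0 <= 1 by rewrite ge_min lexx.
have mm2 : Num.min 1 dl0 <= dl0 by rewrite ge_min lexx orbT.
have dl1 : dl <= 1 by rewrite /dl; lra.
have dl3 : 3 * dl <= dl0 by rewrite /dl; lra.
have dll : dl <= dl0 by lra.
have dl3' : 0 < 3 * dl by rewrite mulr_gt0.
pose H2 n : R := \sum_(j < n) (j.+1%:R ^+ 2)^-1.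
(* Remainder of the second-order expansion of the potential of [H] in [y]; its derivative is the
   potential of [delta 0], which gives its sign and its size. *)
pose e3 n y := potential y H n - y * H n + y ^+ 2 / 2.
have m2ok := levy_dom_sqr.
have e3ok n : levy_dom dl0 (e3 n).
  apply: levy_domD.
    apply: levy_domB => //; first exact: levy_dom_potential.
    have := levy_domZ (H n) (levy_dom_id dl0_gt0); congr levy_dom.
    by apply/funext => y; rewrite mulrC.
  have := levy_domZ 2^-1 m2ok; congr levy_dom. by apply/funext => y; rewrite mulrC.
have psi_ge0 e : 0 <= e -> 0 <= psi e.
  move=> e0; apply: levy_int_ge0 => y y0. by rewrite subr_ge0 -expR0 ler_expR mulr_ge0 // ltW.
have e3b n y : 0 < y -> 0 <= e3 n y <= (expR (dl * y) - 1) * (weight dl n / dl ^+ 2).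
  move=> y0. have d3 (z : R) : is_derive z 1 (e3 n) (potential z (delta R 0) n).
    have h := is_derive_potential z H n.
    have -> : e3 n = (fun z => potential z H n) - (H n \*: (@id R)) + 2^-1 \*: (@id R * @id R).
      by apply/funext => t; rewrite !fctE /e3 /GRing.scale /= [t * _]mulrC [_ / 2]mulrC.
    apply: is_derive_eq; rewrite /GRing.scale /= !mulr1.
    have := harmonic_thinning z n; rewrite -/H => e.
    have -> : potential z (delta R 0) n = z - (H n - thinning z H n) by rewrite e; ring.
    by field.
  have e30 : e3 n 0 = 0 by rewrite /e3 potential0 mul0r subr0 add0r expr0n mul0r.
  apply/andP; split.
    rewrite -e30; apply: (@ge0_derive_nondecreasing _ (e3 n) (fun z => potential z (delta R 0) n)).
    - exact: ltW.
    - by move=> z /andP[z0 _]; apply: potential_ge0 => // k _; exact: ler0n.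
  have := @le_derive_increment _ (e3 n) (fun z => potential z (delta R 0) n)
    (fun z => weight dl n / dl ^+ 2 * expR (dl * z))
    (fun z => weight dl n / dl * expR (dl * z)) 0 y (ltW y0).
  rewrite e30 subr0 mulr0 expR0 -mulrBr => h; rewrite [leRHS]mulrC; apply: h.
  - move=> z _; have h := is_derive_expRM dl z.
    have -> : (fun z => weight dl n / dl ^+ 2 * expR (dl * z)) =
      (weight dl n / dl ^+ 2) \*: (fun z => expR (dl * z)) by [].
    by apply: is_derive_eq; rewrite /GRing.scale /=; field; rewrite gt_eqF.
  - move=> z /andP[z0 _].
    have := @le_potential_dominated dl 1 z (delta R 0) n dl_gt0 z0 ler01.
    rewrite mul1r => h; apply: (le_trans (h _)).
      by move=> k _; rewrite mul1r le_delta0_weight // ltW.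
    rewrite mulrAC [leRHS]mulrAC ler_pM2r ?invr_gt0 // [leRHS]mulrC.
    by rewrite ler_pM2r ?weight_gt0 ?(ltW dl_gt0) // gerBl.
have HH n : \sum_(i < n) rate n i * (H n - H i) ^+ 2 =
    levy_int nu (fun y => y ^+ 2) - 2 * H n * levy_pot nu (delta R 0) n
    - 2 * levy_int nu (e3 n) + levy_op nu H2 n.
  have h2 : levy_op nu (fun k => H k ^+ 2 + H2 k) n = 2 * levy_pot nu H n.
    rewrite levy_op_potential.
    rewrite !(levy_potE dl0_gt0 nu_exp) -newton_opZ; apply: eq_newton_opr => k _.
    case: k => [|k]; first by rewrite /thinning_gen mul0r /H /hsum big_ord0 mulr0.
    rewrite /thinning_gen /H /H2 /hsum /= !big_ord_recr /=.
    set h := \sum_(i < k) _; set hh := \sum_(i < k) _. by field; rewrite addrC natr1 pnatr_eq0.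
  have h3 : levy_pot nu H n = m1 * H n - levy_int nu (fun y => y ^+ 2) / 2 +
      levy_int nu (e3 n).
    have i1 : levy_int nu (fun y => y * H n) = m1 * H n.
      rewrite mulrC -(levy_intZ nu_exp); last exact: levy_dom_id.
      by congr levy_int; apply/funext => y; rewrite mulrC.
    have i2 : levy_int nu (fun y => y ^+ 2 / 2) = levy_int nu (fun y => y ^+ 2) / 2.
      rewrite mulrC -(levy_intZ nu_exp) //.
      by congr levy_int; apply/funext => y; rewrite mulrC.
    have k1 : levy_dom dl0 (fun y => y * H n).
      have := levy_domZ (H n) (levy_dom_id dl0_gt0); congr levy_dom.
      by apply/funext => y; rewrite mulrC.
    have k2 : levy_dom dl0 (fun y => y ^+ 2 / 2).
      have := levy_domZ 2^-1 m2ok; congr levy_dom. by apply/funext => y; rewrite mulrC.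
    rewrite /e3 (levy_intD nu_exp) //; last first.
      by apply: levy_domB => //; exact: levy_dom_potential.
    rewrite (levy_intB nu_exp) //; last exact: levy_dom_potential.
    by rewrite i1 i2 /levy_pot; ring.
  have h4 := levy_op_harmonic dl0_gt0 nu_exp n; rewrite -/m1 -/H in h4.
  have h5 : levy_op nu (fun k => H k ^+ 2) n = 2 * levy_pot nu H n - levy_op nu H2 n.
    by rewrite -h2 /levy_op newton_opD; ring.
  have -> : \sum_(i < n) rate n i * (H n - H i) ^+ 2 =
     2 * H n * levy_op nu H n - levy_op nu (fun k => H k ^+ 2) n.
    rewrite !levy_op_rate mulr_sumr -sumrB; apply: eq_bigr => i _; ring.
  by rewrite h5 h4 h3; field.
pose C := 2 * (psi (3 * dl) / (3 * dl) / dl) + 2 * (psi dl / dl ^+ 2) + 2 * (psi dl / dl).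
exists dl => //; exists C => n; rewrite HH.
have w0 := weight_gt0 (ltW dl_gt0) n.
(* The factor [H n] is absorbed by spending a weight of exponent [3 dl] as two weights of exponent
   [dl]. *)
have b1 : 0 <= 2 * H n * levy_pot nu (delta R 0) n <= 2 * (psi (3 * dl) / (3 * dl) / dl) * weight dl n.
  have /andP[p1 p2] := levy_pot_delta dl0_gt0 nu_exp n dl3' dl3.
  have Hn := harmonic_ge0 R n; rewrite -/H in Hn.
  apply/andP; split; first by rewrite mulr_ge0 // mulr_ge0.
  have ww : weight (3 * dl) n <= weight dl n * weight dl n.
    apply: weightM; rewrite ?(ltW dl_gt0) //. have : dl * dl <= dl by rewrite ler_piMr // ltW.
    lra.
  have Hw : weight dl n * H n <= dl^-1 by exact: weight_harmonic.
  pose Q := psi (3 * dl) / (3 * dl). have q0 : 0 <= Q by rewrite divr_ge0 ?psi_ge0 // ltW.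
  have k1 : levy_pot nu (delta R 0) n <= Q * (weight dl n * weight dl n).
    by apply: (le_trans p2); rewrite ler_wpM2l.
  apply: (@le_trans _ _ (2 * H n * (Q * (weight dl n * weight dl n)))).
    by rewrite ler_wpM2l // mulr_ge0.
  have -> : 2 * H n * (Q * (weight dl n * weight dl n)) =
    2 * Q * weight dl n * (weight dl n * H n) by ring.
  have -> : 2 * (psi (3 * dl) / (3 * dl) / dl) * weight dl n = 2 * Q * weight dl n * dl^-1.
    by rewrite /Q; ring.
  by rewrite ler_wpM2l // mulr_ge0 ?(ltW w0) // mulr_ge0.
have b2 : 0 <= levy_int nu (e3 n) <= psi dl / dl ^+ 2 * weight dl n.
  apply/andP; split; first by apply: levy_int_ge0 => y /e3b - /(_ n) /andP[].
  have -> : psi dl / dl ^+ 2 * weight dl n = weight dl n / dl ^+ 2 * psi dl by ring.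
  rewrite -(levy_intZ nu_exp); last exact: levy_dom_exp. apply: (le_levy_int nu_exp) => //.
    by apply: levy_domZ; exact: levy_dom_exp.
  by move=> y y0; have /andP[_] := e3b n y y0; rewrite mulrC.
have b3 : 0 <= levy_op nu H2 n <= 2 * (psi dl / dl) * weight dl n.
  have AH2 k : 0 <= thinning_gen H2 k <= 2 * weight dl k.
    case: k => [|k]; first by rewrite /thinning_gen mul0r lexx weight0 mulr1 /=.
    have -> : thinning_gen H2 k.+1 = k.+1%:R^-1.
      rewrite /thinning_gen /H2 big_ord_recr /= addrAC subrr add0r.
      by rewrite expr2 invfM mulrA divff ?mul1r // pnatr_eq0.
    rewrite invr_ge0 ler0n /=. apply: (@le_trans _ _ (2 * weight 1 k.+1)); last first.
      by rewrite ler_pM2l // le_weight // ltW.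
    rewrite weight1 ler_pdivlMr ?ltr0Sn // mulrC ler_pdivrMr ?ltr0Sn //.
    by rewrite -natrM ler_nat mul2n -addnn addnS ltnS leq_addr.
  rewrite levy_op_potential /levy_pot; apply/andP; split.
    apply: levy_int_ge0 => y y0; apply: potential_ge0 => [|k _]; first exact: ltW.
    by have /andP[] := AH2 k.
  have -> : 2 * (psi dl / dl) * weight dl n = 2 * weight dl n / dl * psi dl by ring.
  rewrite -(levy_intZ nu_exp); last exact: levy_dom_exp.
  apply: (le_levy_int nu_exp) => [||y y0].
  - exact: levy_dom_potential.
  - by apply: levy_domZ; exact: levy_dom_exp.
  have := @le_potential_dominated dl 2 y (thinning_gen H2) n dl_gt0 (ltW y0) ltac:(by []).
  move=> h; apply: (le_trans (h _)); first by move=> k _; have /andP[] := AH2 k.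
  by apply: le_of_eq; ring.
have -> : C * weight dl n = 2 * (psi (3 * dl) / (3 * dl) / dl) * weight dl n +
  2 * (psi dl / dl ^+ 2 * weight dl n) + 2 * (psi dl / dl) * weight dl n by rewrite /C; ring.
exact: three_bounds.
Qed.

End Rates.

(** * Mean and variance of the number of parts along the chain *)

Lemma part_count_bound (r n : nat) : (r <= n)%N -> (n.+1 <= r.+1 * (n - r).+1)%N.
Proof. by move=> rn; nia. Qed.

Lemma cube_split (R : realType) (e h w : R) : 0 <= e -> e <= 1 -> 0 <= h -> 0 <= w -> w <= 1 ->
  (e + h + w) ^+ 2 + (e + h + w) ^+ 3 <= 18 * (e + h ^+ 2 + w) + 18 * h ^+ 3.
Proof.
move=> e0 e1 h0 w0 w1.
have a1 : e ^+ 2 <= e by rewrite expr2 ler_piMr.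
have a2 : w ^+ 2 <= w by rewrite expr2 ler_piMr.
have a3 : e ^+ 3 <= e by rewrite exprS ler_piMr // expr2 mulr_ile1.
have a4 : w ^+ 3 <= w by rewrite exprS ler_piMr // expr2 mulr_ile1.
have sq : (e + h + w) ^+ 2 <= 3 * (e ^+ 2 + h ^+ 2 + w ^+ 2).
  have := sqr_ge0 (e - h); have := sqr_ge0 (e - w); have := sqr_ge0 (h - w).
  rewrite !expr2; lra.
have cb (x y z : R) : 0 <= x -> 0 <= y -> 0 <= z ->
    (x + y + z) ^+ 3 <= 9 * (x ^+ 3 + y ^+ 3 + z ^+ 3).
  move=> x0 y0 z0. have p (u v : R) : 0 <= u -> 0 <= v -> 0 <= (u + v) * (u - v) ^+ 2.
    by move=> u0 v0; rewrite mulr_ge0 ?addr_ge0 ?sqr_ge0.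
  have q1 : 0 <= x * (y - z) ^+ 2 by rewrite mulr_ge0 ?sqr_ge0.
  have q2 : 0 <= y * (x - z) ^+ 2 by rewrite mulr_ge0 ?sqr_ge0.
  have q3 : 0 <= z * (x - y) ^+ 2 by rewrite mulr_ge0 ?sqr_ge0.
  have := p x y x0 y0; have := p x z x0 z0; have := p y z y0 z0 => p1 p2 p3.
  have -> : (x + y + z) ^+ 3 = 9 * (x ^+ 3 + y ^+ 3 + z ^+ 3)
    - (4 * ((x + y) * (x - y) ^+ 2 + (x + z) * (x - z) ^+ 2 + (y + z) * (y - z) ^+ 2)
    + (x * (y - z) ^+ 2 + y * (x - z) ^+ 2 + z * (x - y) ^+ 2)) by ring.
  lra.
have := cb e h w e0 h0 w0.
have h3 : 0 <= h ^+ 3 by rewrite exprn_ge0.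
have h2 : 0 <= h ^+ 2 by rewrite exprn_ge0.
lra.
Qed.

Section CompositionChain.
Variable R : realType.
Variables (nu : {measure set R -> \bar R}) (dl0 : R).
Hypotheses (dl0_gt0 : 0 < dl0) (nu_exp : exp_integrable nu dl0).
Variables (al be eta : R).
Hypotheses (al_gt0 : 0 < al) (al_be : al < be) (eta_gt0 : 0 < eta).
Hypothesis nu_minor : forall k kappa : R -> R, levy_dom dl0 k ->
  (forall y, 0 < y -> 0 <= k y) ->
  (forall y, al <= y <= be -> is_derive y 1 kappa (k y)) ->
  (forall y, derivable k y 1) ->
  eta * (kappa be - kappa al) <= levy_int nu k.
Variable r : nat.
Hypothesis r_gt0 : (0 < r)%N.
Implicit Types (d g : nat -> R) (n j k i : nat) (x y dl : R).

Let H := @hsum R.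
Let Phi n : R := laplace_exp nu n%:R.
Let m1 : R := levy_int nu (fun y => y).
Let m2 : R := levy_int nu (fun y => y ^+ 2).
Let al1 : R := r%:R^-1 / m1.

Definition part_rate n : R := if (r <= n)%N then rate nu n (n - r) else 0.

Hypothesis part_rate_lim : exists2 dl, 0 < dl & exists C, forall n, (0 < n)%N ->
  `|part_rate n - r%:R^-1| <= C * weight dl n.
Hypothesis total_rate : forall dl, 0 < dl -> exists C, forall n,
  Phi n * weight dl n <= C.

(* [pi n k] is the probability that the composition of [n] has [k] parts [r]. *)
Variable pi : nat -> nat -> R.
Definition part_mean (h : nat -> R) n : R := \sum_(k < n.+1) pi n k * h k.
Hypotheses (pi_ge0 : forall n k, 0 <= pi n k) (pi_sum : forall n, part_mean (fun=> 1) n = 1).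
Hypothesis pi_rec : forall h n, (0 < n)%N -> \sum_(i < n) rate nu n i *
  (part_mean h n - part_mean (fun k => h ((n - i == r) + k)%N) i) = 0.

Definition part_expect n : R := part_mean (fun k => k%:R) n.
Definition part_variance n : R := part_mean (fun k => (k%:R - part_expect n) ^+ 2) n.

Let a := part_expect.
Let V := part_variance.
Let e n i : R := (n - i == r)%N%:R.
(** Change of the conditional expectation of the number of parts at a jump from [n] to [i]: a
    martingale increment, centred under the rates. *)
Let xi n i : R := e n i + a i - a n.

Lemma part_meanD h h' n : part_mean (fun k => h k + h' k) n = part_mean h n + part_mean h' n.
Proof. by rewrite -big_split; apply: eq_bigr => k _; rewrite mulrDr. Qed.

Lemma part_meanZ c h n : part_mean (fun k => c * h k) n = c * part_mean h n.
Proof. by rewrite mulr_sumr; apply: eq_bigr => k _; rewrite mulrCA. Qed.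

Lemma part_mean_cst c n : part_mean (fun=> c) n = c.
Proof.
transitivity (part_mean (fun=> c * 1) n); first by rewrite mulr1.
by rewrite part_meanZ pi_sum mulr1.
Qed.

Lemma eq_part_mean h h' n : (forall k, h k = h' k) -> part_mean h n = part_mean h' n.
Proof. by move=> hh; apply: eq_bigr => k _; rewrite hh. Qed.

Lemma sum_rate_part n (f : nat -> R) : \sum_(i < n) rate nu n i * (e n i * f i) =
  part_rate n * f (n - r)%N.
Proof.
rewrite /part_rate; case: (leqP r n) => rn.
  have nr : (n - r < n)%N by rewrite ltn_subrL r_gt0 (leq_trans r_gt0).
  rewrite (bigD1 (Ordinal nr)) //= big1 ?addr0.
    by rewrite /e subKn // eqxx mul1r.
  move=> i /eqP ir; rewrite /e; case: eqP => [h|_]; last by rewrite mul0r mulr0.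
  by case: ir; apply/val_inj; rewrite /= -h subKn // ltnW.
rewrite mul0r big1 // => i _; rewrite /e; case: eqP => [h|_]; last by rewrite mul0r mulr0.
by move: rn; rewrite -h ltnNge leq_subr.
Qed.

Lemma sum_rate_xi n : \sum_(i < n) rate nu n i * xi n i = 0.
Proof.
case: n => [|n]; first by rewrite big_ord0.
apply/eqP; rewrite -oppr_eq0 -sumrN; apply/eqP.
rewrite -[RHS](pi_rec (fun k => k%:R) (ltn0Sn n)); apply: eq_bigr => i _.
rewrite -/(part_expect n.+1) -/(a n.+1).
have -> : part_mean (fun k => ((n.+1 - i == r) + k)%N%:R) i = e n.+1 i + a i.
  under eq_part_mean do rewrite natrD. by rewrite part_meanD part_mean_cst.
by rewrite /xi; ring.
Qed.

(** Since [xi] is centred, only the creation of a part of size [r] contributes. *)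
Lemma levy_op_mean n : levy_op nu a n = part_rate n.
Proof.
have := sum_rate_part n (fun=> 1); rewrite mulr1 => <-.
transitivity (\sum_(i < n) rate nu n i * (e n i * 1) - \sum_(i < n) rate nu n i * xi n i).
  rewrite (levy_op_rate dl0_gt0 nu_exp) -sumrB. by apply: eq_bigr => i _; rewrite /xi; ring.
by rewrite sum_rate_xi subr0.
Qed.

Lemma part_variance_shift n c : part_mean (fun k => (k%:R - c) ^+ 2) n =
  V n + (a n - c) ^+ 2.
Proof.
have -> : part_mean (fun k => (k%:R - c) ^+ 2) n = part_mean
  (fun k => (k%:R - a n) ^+ 2 + (2 * (a n - c) * k%:R + (c ^+ 2 - a n ^+ 2))) n.
  by apply: eq_part_mean => k; ring.
rewrite part_meanD part_meanD part_meanZ part_mean_cst -/(part_expect n) -/(a n).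
by rewrite -/(part_variance n) -/(V n); ring.
Qed.

(** The recursion for the second moment around [a n]: after the jump to [i] the mean has moved by
    [xi n i], which adds its square to [V i]. *)
Lemma sum_rate_variance n : \sum_(i < n) rate nu n i * (V n - V i) =
  \sum_(i < n) rate nu n i * xi n i ^+ 2.
Proof.
case: n => [|n]; first by rewrite !big_ord0.
apply/eqP; rewrite -subr_eq0 -sumrB; apply/eqP.
rewrite -[RHS](pi_rec (fun k => (k%:R - a n.+1) ^+ 2) (ltn0Sn n)).
apply: eq_bigr => i _; rewrite -mulrBr; congr (_ * _).
rewrite -/(part_variance n.+1) -/(V n.+1).
have -> : part_mean (fun k => (((n.+1 - i == r) + k)%N%:R - a n.+1) ^+ 2) i =
  part_mean (fun k => (k%:R - (a n.+1 - e n.+1 i)) ^+ 2) i.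
  by apply: eq_part_mean => k; rewrite natrD /e; congr (_ ^+ 2); ring.
by rewrite part_variance_shift /xi; ring.
Qed.

Lemma levy_op_variance n : levy_op nu V n = \sum_(i < n) rate nu n i * xi n i ^+ 2.
Proof. by rewrite (levy_op_rate dl0_gt0 nu_exp) sum_rate_variance. Qed.

Theorem part_expect_asymp : exists2 dl, 0 < dl & exists c C, forall n,
  `|a n - al1 * H n - c| <= C * weight dl n.
Proof.
have [dl dl_gt0 [C hC]] := part_rate_lim.
apply: (renewal dl0_gt0 nu_exp al_gt0 al_be eta_gt0 nu_minor dl_gt0 (C := C)) => n n0.
by rewrite levy_op_mean hC.
Qed.

(** [Phi n] grows more slowly than any power, so it is paid for by a part of the exponent. *)
Lemma total_rate_weight dl : 0 < dl -> exists2 dl', 0 < dl' & exists2 C, 0 <= C &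
  forall n, Phi n * weight dl n <= C * weight dl' n.
Proof.
move=> dl_gt0; pose t := Num.min 1 dl / 3.
have mm : 0 < Num.min 1 dl by rewrite lt_min ltr01.
have mm1 : Num.min 1 dl <= 1 by rewrite ge_min lexx.
have mm2 : Num.min 1 dl <= dl by rewrite ge_min lexx orbT.
have t0 : 0 < t by rewrite divr_gt0.
have t1 : t <= 1 by rewrite /t; lra.
have t3 : 3 * t <= dl by rewrite /t; lra.
have [C hC] := total_rate t0.
exists t => //; exists `|C| => // n.
have w0 := weight_gt0 (ltW t0) n.
have ww : weight dl n <= weight t n * weight t n.
  apply: weightM; rewrite ?(ltW t0) //. have : t * t <= t by rewrite ler_piMr // ltW. lra.
have P0 : 0 <= Phi n.
  apply: levy_int_ge0 => y y0. by rewrite subr_ge0 -expR0 ler_expR oppr_le0 mulr_ge0 // ltW.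
apply: (@le_trans _ _ (Phi n * weight t n * weight t n)).
  by rewrite -mulrA ler_wpM2l.
by rewrite ler_pM2r // (le_trans (hC n)) // ler_norm.
Qed.

Lemma weight_sqrt dl : 0 < dl -> exists2 t, 0 < t <= dl & forall n,
  weight dl n <= weight t n * weight t n.
Proof.
move=> dl_gt0; pose t := Num.min 1 dl / 3.
have mm : 0 < Num.min 1 dl by rewrite lt_min ltr01.
have mm1 : Num.min 1 dl <= 1 by rewrite ge_min lexx.
have mm2 : Num.min 1 dl <= dl by rewrite ge_min lexx orbT.
have t0 : 0 < t by rewrite divr_gt0.
have t1 : t <= 1 by rewrite /t; lra.
have t3 : 3 * t <= dl by rewrite /t; lra.
exists t; first by rewrite t0 /=; lra.
move=> n; apply: weightM; rewrite ?(ltW t0) //.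
have : t * t <= t by rewrite ler_piMr // ltW.
lra.
Qed.

Lemma sum_rate_weight_small dl : 0 < dl -> exists2 dl', 0 < dl' & exists2 C, 0 <= C &
  forall n, \sum_(i < n) rate nu n i * weight dl i <= C * weight dl' n.
Proof.
move=> dl_gt0; pose t := Num.min dl dl0.
have t0 : 0 < t by rewrite lt_min dl_gt0.
have tdl : t <= dl by rewrite ge_min lexx.
have tl : t <= dl0 by rewrite ge_min lexx orbT.
have [t' t'0 [C C0 hC]] := total_rate_weight t0.
pose ps := levy_int nu (fun y => expR (t * y) - 1).
have ps0 : 0 <= ps.
  apply: levy_int_ge0 => y y0. by rewrite subr_ge0 -expR0 ler_expR mulr_ge0 // ltW.
pose u := Num.min t t'.
have u0 : 0 < u by rewrite lt_min t0.
exists u => //; exists (C + ps); first exact: addr_ge0.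
move=> n; apply: (@le_trans _ _ (\sum_(i < n) rate nu n i * weight t i)).
  by apply: (le_sum_rate dl0_gt0 nu_exp) => i _; rewrite le_weight // ltW.
apply: (le_trans (sum_rate_weight dl0_gt0 nu_exp n t0 tl)); rewrite !mulrDl lerD //.
  apply: (le_trans (hC n)); rewrite ler_wpM2l // le_weight ?(ltW u0) //.
  by rewrite ge_min lexx orbT.
by rewrite ler_wpM2l // le_weight ?(ltW u0) // ge_min lexx.
Qed.

(** Removing a part of fixed size moves [H] by [O(1 / n)] only. Hence the indicator and the
    logarithmic part of [xi] are asymptotically orthogonal. *)
Lemma part_harmonic_incr n : part_rate n * (H n - H (n - r)%N) <=
  part_rate n * (r%:R * (r%:R + 1) * weight 1 n).
Proof.
rewrite /part_rate; case: (leqP r n) => rn; last by rewrite !mul0r.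
rewrite ler_wpM2l ?(rate_ge0 dl0_gt0 nu_exp) ?ltn_subrL ?r_gt0 ?(leq_trans r_gt0) //.
have HS k : H k.+1 = H k + k.+1%:R^-1 by rewrite /H /hsum big_ord_recr.
have key k : H (n - r + k)%N - H (n - r)%N <= k%:R * (n - r).+1%:R^-1.
  elim: k => [|k IH]; first by rewrite addn0 subrr mul0r. rewrite addnS HS.
  have : (n - r + k).+1%:R^-1 <= (n - r).+1%:R^-1 :> R.
    by rewrite lef_pV2 ?posrE ?ltr0Sn // ler_nat ltnS leq_addr.
  have -> : k.+1%:R = k%:R + 1 :> R by rewrite natr1.
  by move=> h; rewrite mulrDl mul1r addrAC lerD.
have := key r; rewrite subnK // => /le_trans; apply.
rewrite weight1 -mulrA ler_wpM2l // -[leLHS]mul1r ler_pdivrMr ?ltr0Sn // mulrAC.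
rewrite ler_pdivlMr ?ltr0Sn // mul1r natr1 -natrM ler_nat.
exact: part_count_bound.
Qed.

Lemma part_rate_ge0 n : 0 <= part_rate n.
Proof. rewrite /part_rate; case: leqP => // rn; apply: (rate_ge0 dl0_gt0 nu_exp); rewrite ltn_subrL r_gt0 (leq_trans r_gt0) //. Qed.

Lemma part_rate_bounded : exists2 C, 0 <= C & forall n, part_rate n <= C.
Proof.
have [dl dl_gt0 [C hC]] := part_rate_lim.
exists (`|C| + r%:R^-1); first by rewrite addr_ge0 // invr_ge0.
case=> [|n]; first by rewrite /part_rate leqNgt r_gt0 /= addr_ge0 // invr_ge0.
have := hC n.+1 isT; rewrite ler_norml => /andP[_].
have w0 := weight_gt0 (ltW dl_gt0) n.+1; have w1 := weight_le1 (ltW dl_gt0) n.+1.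
have : C * weight dl n.+1 <= `|C|.
  apply: (@le_trans _ _ (`|C| * weight dl n.+1)); first by rewrite ler_pM2r // ler_norm.
  by rewrite ler_piMr.
lra.
Qed.

(** Limit of the sum of [xi^2] against the rates: a part of size [r] appears at rate about [1 / r],
    and the logarithm of the remaining size contributes [m2 * al1^2]. Divided by [m1] it is the
    variance coefficient. *)
Let q : R := r%:R^-1 + m2 * al1 ^+ 2.

Let err i : R := a i - al1 * H i.

Lemma xiE n i : xi n i = (e n i - al1 * (H n - H i)) + (err i - err n).
Proof. by rewrite /xi /err; ring. Qed.

Lemma sum_rate_main : exists2 dl, 0 < dl & exists C, forall n, (0 < n)%N ->
  `|\sum_(i < n) rate nu n i * (e n i - al1 * (H n - H i)) ^+ 2 - q| <= C * weight dl n.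
Proof.
have [d1 d1_gt0 [C1 hC1]] := part_rate_lim.
have [d2 d2_gt0 [C2 hC2]] := harmonic_second_moment dl0_gt0 nu_exp.
have [C3 C30 hC3] := part_rate_bounded.
pose dl := Num.min 1 (Num.min d1 d2).
have dl_gt0 : 0 < dl by rewrite !lt_min ltr01 d1_gt0.
have l1 : dl <= 1 by rewrite ge_min lexx.
have l2 : dl <= d1 by rewrite !ge_min lexx !orbT.
have l3 : dl <= d2 by rewrite !ge_min lexx !orbT.
pose D := 2 * `|al1| * C3 * (r%:R * (r%:R + 1)).
exists dl => //; exists (`|C1| + D + al1 ^+ 2 * `|C2|) => n n0.
have e2 i : e n i * e n i = e n i by rewrite /e; case: eqP; rewrite ?mulr1 ?mulr0.
have -> : \sum_(i < n) rate nu n i * (e n i - al1 * (H n - H i)) ^+ 2 =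
  part_rate n - 2 * al1 * (part_rate n * (H n - H (n - r)%N)) +
  al1 ^+ 2 * \sum_(i < n) rate nu n i * (H n - H i) ^+ 2.
  have h1 : part_rate n = \sum_(i < n) rate nu n i * (e n i * 1).
    by rewrite (sum_rate_part n (fun=> 1)) mulr1.
  have h2 := sum_rate_part n (fun i => H n - H i).
  rewrite -h2 h1 !mulr_sumr -sumrB -big_split; apply: eq_bigr => i _ /=.
  have -> : (e n i - al1 * (H n - H i)) ^+ 2 = e n i * e n i - 2 * e n i * (al1 * (H n - H i)) + (al1 * (H n - H i)) ^+ 2 by ring.
  by rewrite e2; ring.
have w0 (d : R) : 0 < d -> 0 < weight d n by move=> d0; rewrite weight_gt0 // ltW.
have b1 : `|part_rate n - r%:R^-1| <= `|C1| * weight dl n.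
  apply: (le_trans (hC1 n n0)); apply: (@le_trans _ _ (`|C1| * weight d1 n)).
    by rewrite ler_pM2r ?w0 // ler_norm.
  by rewrite ler_wpM2l // le_weight // ltW.
have b2 : `|\sum_(i < n) rate nu n i * (H n - H i) ^+ 2 - m2| <= `|C2| * weight dl n.
  apply: (le_trans (hC2 n)); apply: (@le_trans _ _ (`|C2| * weight d2 n)).
    by rewrite ler_pM2r ?w0 // ler_norm.
  by rewrite ler_wpM2l // le_weight // ltW.
have b3 : `|2 * al1 * (part_rate n * (H n - H (n - r)%N))| <= D * weight dl n.
  have p0 : 0 <= part_rate n * (H n - H (n - r)%N).
    by rewrite mulr_ge0 ?part_rate_ge0 // subr_ge0 harmonic_le // leq_subr.
  rewrite normrM (ger0_norm p0) normrM (@ger0_norm _ 2) // /D -[leRHS]mulrA -[leRHS]mulrA.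
  rewrite ler_wpM2l ?mulr_ge0 //; apply: (le_trans (part_harmonic_incr n)).
  apply: ler_pM => //; first exact: part_rate_ge0.
    by rewrite !mulr_ge0 ?addr_ge0 // ltW // w0.
  by rewrite ler_wpM2l ?mulr_ge0 ?addr_ge0 // le_weight // ltW.
have -> : part_rate n - 2 * al1 * (part_rate n * (H n - H (n - r)%N)) +
  al1 ^+ 2 * (\sum_(i < n) rate nu n i * (H n - H i) ^+ 2) - q =
  (part_rate n - r%:R^-1) - 2 * al1 * (part_rate n * (H n - H (n - r)%N)) +
  al1 ^+ 2 * (\sum_(i < n) rate nu n i * (H n - H i) ^+ 2 - m2). by rewrite /q; ring.
apply: (le_trans (ler_normD _ _)); rewrite [leRHS]mulrDl lerD //.
  by apply: (le_trans (ler_normB _ _)); rewrite [leRHS]mulrDl lerD.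
by rewrite normrM ger0_norm ?sqr_ge0 // -mulrA ler_wpM2l ?sqr_ge0.
Qed.

Lemma err_incr : exists2 dl, 0 < dl & exists2 C, 0 <= C & forall n i, (i < n)%N ->
  `|err i - err n| <= C * weight dl i.
Proof.
have [dl dl_gt0 [c [C hC]]] := part_expect_asymp.
have w0 i : 0 < weight dl i by rewrite weight_gt0 // ltW.
exists dl => //; exists (2 * `|C|) => [|n i ni]; first by rewrite mulr_ge0.
have hC' k : `|err k - c| <= `|C| * weight dl k.
  by apply: (le_trans (hC k)); rewrite ler_pM2r // ler_norm.
have -> : err i - err n = (err i - c) - (err n - c) by ring.
apply: (le_trans (ler_normB _ _)).
have : weight dl n <= weight dl i by rewrite weight_nonincreasing ?(ltnW ni) // ltW.
have := hC' i; have := hC' n => h1 h2 h3.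
have : `|C| * weight dl n <= `|C| * weight dl i by rewrite ler_wpM2l.
lra.
Qed.

Lemma sum_rate_err : exists2 dl, 0 < dl & exists2 C, 0 <= C & forall n,
  \sum_(i < n) rate nu n i * (err i - err n) ^+ 2 <= C * weight dl n.
Proof.
have [dl dl_gt0 [C C0 hC]] := err_incr.
have [d' d'_gt0 [C' C'0 hC']] := sum_rate_weight_small dl_gt0.
have w0 i : 0 < weight dl i by rewrite weight_gt0 // ltW.
exists d' => //; exists (C ^+ 2 * C') => [|n]; first by rewrite mulr_ge0 // exprn_ge0.
rewrite -mulrA; apply: (@le_trans _ _ (C ^+ 2 * \sum_(i < n) rate nu n i * weight dl i)); last first.
  by rewrite ler_wpM2l // exprn_ge0.
rewrite mulr_sumr; under [leRHS]eq_bigr do rewrite mulrCA.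
apply: (@le_sum_rate _ nu dl0 dl0_gt0 nu_exp n (fun i => (err i - err n) ^+ 2)
  (fun i => C ^+ 2 * weight dl i)) => i ni.
rewrite -real_normK ?num_real //; apply: (@le_trans _ _ ((C * weight dl i) ^+ 2)).
  by apply: lerXn2r; rewrite ?nnegrE ?hC // mulr_ge0 // ltW.
rewrite exprMn ler_wpM2l ?exprn_ge0 // expr2 ler_piMr ?(ltW (w0 _)) //.
by rewrite weight_le1 // ltW.
Qed.

Theorem part_variance_asymp : exists2 dl, 0 < dl & exists c C, forall n,
  `|V n - q / m1 * H n - c| <= C * weight dl n.
Proof.
have [d1 d1_gt0 [C1 hC1]] := sum_rate_main.
have [d2 d2_gt0 [C2 C20 hC2]] := sum_rate_err.
have [d3 /andP[d3_gt0 d32] hd3] := weight_sqrt d2_gt0.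
have w0 (d : R) n : 0 < d -> 0 < weight d n by move=> d0; rewrite weight_gt0 // ltW.
pose dl := Num.min d1 d3.
have dl_gt0 : 0 < dl by rewrite lt_min d1_gt0.
have l1 : dl <= d1 by rewrite ge_min lexx.
have l3 : dl <= d3 by rewrite ge_min lexx orbT.
pose M := `|q| + `|C1|.
apply: (renewal dl0_gt0 nu_exp al_gt0 al_be eta_gt0 nu_minor dl_gt0
  (C := `|C1| + M + 2 * C2)) => n n0.
rewrite levy_op_variance.
set u := fun i => e n i - al1 * (H n - H i); set v := fun i => err i - err n.
have -> : \sum_(i < n) rate nu n i * xi n i ^+ 2 - q =
  (\sum_(i < n) rate nu n i * u i ^+ 2 - q) +
  (\sum_(i < n) rate nu n i * (2 * (u i * v i)) + \sum_(i < n) rate nu n i * v i ^+ 2).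
  rewrite addrAC -!big_split /=; congr (_ - _); apply: eq_bigr => i _.
  by rewrite xiE -/(u i) -/(v i); ring.
have b1 : `|\sum_(i < n) rate nu n i * u i ^+ 2 - q| <= `|C1| * weight dl n.
  apply: (le_trans (hC1 n n0)); apply: (@le_trans _ _ (`|C1| * weight d1 n)).
    by rewrite ler_pM2r ?w0 // ler_norm.
  by rewrite ler_wpM2l // le_weight // ltW.
have ub : \sum_(i < n) rate nu n i * u i ^+ 2 <= M.
  have := b1; rewrite ler_norml => /andP[_].
  have : `|C1| * weight dl n <= `|C1| by rewrite ler_piMr // weight_le1 // ltW.
  by have := ler_norm q; rewrite /M; lra.
(* The sum of [v^2] is at most [C2 * t^2]. With [t] as the balancing factor, both halves of the
   bound on [2 u v] are of order [t]. *)
set t := weight d3 n; have t0 : 0 < t by exact: w0.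
have vb : \sum_(i < n) rate nu n i * v i ^+ 2 <= C2 * (t * t).
  by apply: (le_trans (hC2 n)); rewrite ler_wpM2l.
have v0 : 0 <= \sum_(i < n) rate nu n i * v i ^+ 2.
  by apply: sumr_ge0 => i _; rewrite mulr_ge0 ?sqr_ge0 ?(rate_ge0 dl0_gt0 nu_exp).
(* AM-GM: [2 |u v| <= t u^2 + v^2 / t] *)
have amgm x y : `|2 * (x * y)| <= t * x ^+ 2 + t^-1 * y ^+ 2.
  have ti : t * t^-1 = 1 by rewrite mulfV // gt_eqF.
  have s1 : 0 <= t * (x + t^-1 * y) ^+ 2 by rewrite mulr_ge0 ?sqr_ge0 // ltW.
  have s2 : 0 <= t * (x - t^-1 * y) ^+ 2 by rewrite mulr_ge0 ?sqr_ge0 // ltW.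
  have r1 : t * (x + t^-1 * y) ^+ 2 = t * x ^+ 2 + (t * t^-1) * (2 * (x * y)) + (t * t^-1) * t^-1 * y ^+ 2 by ring.
  have r2 : t * (x - t^-1 * y) ^+ 2 = t * x ^+ 2 - (t * t^-1) * (2 * (x * y)) + (t * t^-1) * t^-1 * y ^+ 2 by ring.
  rewrite r1 ti !mul1r in s1; rewrite r2 ti !mul1r in s2.
  rewrite ler_norml; apply/andP; split; lra.
have cross : `|\sum_(i < n) rate nu n i * (2 * (u i * v i))| <= t * M + C2 * t.
  apply: (le_trans (ler_norm_sum _ _ _)).
  apply: (@le_trans _ _ (\sum_(i < n) rate nu n i * (t * u i ^+ 2 + t^-1 * v i ^+ 2))).
    apply: ler_sum => i _; rewrite normrM ger0_norm ?(rate_ge0 dl0_gt0 nu_exp) //.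
    by rewrite ler_wpM2l ?(rate_ge0 dl0_gt0 nu_exp).
  have -> : \sum_(i < n) rate nu n i * (t * u i ^+ 2 + t^-1 * v i ^+ 2) =
    t * (\sum_(i < n) rate nu n i * u i ^+ 2) + t^-1 * (\sum_(i < n) rate nu n i * v i ^+ 2).
    by rewrite !mulr_sumr -big_split; apply: eq_bigr => i _ /=; ring.
  rewrite lerD ?ler_pM2l //. rewrite mulrC ler_pdivrMr // -mulrA; exact: vb.
have tw : t <= weight dl n by rewrite le_weight // ltW.
have M0 : 0 <= M by rewrite addr_ge0.
have t1 : t <= 1 by rewrite weight_le1 // ltW.
apply: (le_trans (ler_normD _ _)); rewrite mulrDl mulrDl -addrA lerD //.
apply: (le_trans (ler_normD _ _)); rewrite (ger0_norm v0).
have g1 : t * M <= M * weight dl n by rewrite mulrC ler_wpM2l.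
have g2 : C2 * t <= C2 * weight dl n by rewrite ler_wpM2l.
have g3 : C2 * (t * t) <= C2 * t by rewrite ler_wpM2l // ler_piMr // ltW.
by have := lerD cross vb; lra.
Qed.

(** These are the error terms of one step of the heat expansion. Both increments are at most
    [B * t n i], where [t] adds an indicator, an increment of [H] and a weight; its square and cube
    have bounded sums against the rates. *)
Lemma chain_moments : exists C, forall n,
  \sum_(i < n) rate nu n i * (`|xi n i| ^+ 3 + `|xi n i| * `|V i - V n| + (V i - V n) ^+ 2) <= C.
Proof.
have [d1 d1_gt0 [C1 C10 hC1]] := err_incr.
have [dv dv_gt0 [cv [Cv hCv]]] := part_variance_asymp.
have [CH hCH] := harmonic_moments dl0_gt0 nu_exp.
have [C3 C30 hC3] := part_rate_bounded.
pose dl := Num.min d1 dv.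
have dl_gt0 : 0 < dl by rewrite lt_min d1_gt0.
have l1 : dl <= d1 by rewrite ge_min lexx.
have l3 : dl <= dv by rewrite ge_min lexx orbT.
have [d' d'_gt0 [C' C'0 hC']] := sum_rate_weight_small dl_gt0.
have w0 i : 0 < weight dl i by rewrite weight_gt0 // ltW.
pose B := 1 + `|al1| + C1 + `|q / m1| + 2 * `|Cv|.
have B0 : 0 <= B.
  by have := normr_ge0 al1; have := normr_ge0 (q / m1); have := normr_ge0 Cv; rewrite /B; lra.
pose t n i := e n i + (H n - H i) + weight dl i.
have e01 n i : 0 <= e n i <= 1 by rewrite /e; case: eqP; rewrite ?lexx ?ler01.
have H0 n i : (i < n)%N -> 0 <= H n - H i by move=> ni; rewrite subr_ge0 harmonic_le // ltnW.
have xb n i : (i < n)%N -> `|xi n i| <= B * t n i.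
  move=> ni; rewrite xiE; apply: (le_trans (ler_normD _ _)).
  have /andP[e0 e1] := e01 n i; have h0 := H0 n i ni; have ww := w0 i.
  have : `|e n i - al1 * (H n - H i)| <= e n i + `|al1| * (H n - H i).
    by apply: (le_trans (ler_normB _ _)); rewrite normrM (ger0_norm e0) (ger0_norm h0).
  have : `|err i - err n| <= C1 * weight dl i.
    by apply: (le_trans (hC1 n i ni)); rewrite ler_wpM2l // le_weight // ltW.
  have k1 : 0 <= (B - 1) * e n i.
    by rewrite mulr_ge0 //; have := normr_ge0 al1; have := normr_ge0 (q / m1); have := normr_ge0 Cv; rewrite /B; lra.
  have k2 : 0 <= (B - `|al1|) * (H n - H i).
    by rewrite mulr_ge0 //; have := normr_ge0 (q / m1); have := normr_ge0 Cv; rewrite /B; lra.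
  have k3 : 0 <= (B - C1) * weight dl i.
    by rewrite mulr_ge0 ?(ltW ww) //; have := normr_ge0 al1; have := normr_ge0 (q / m1); have := normr_ge0 Cv; rewrite /B; lra.
  rewrite /t !mulrDr; rewrite !mulrBl in k1 k2 k3; lra.
have vb n i : (i < n)%N -> `|V i - V n| <= B * t n i.
  move=> ni; have /andP[e0 e1] := e01 n i; have h0 := H0 n i ni; have ww := w0 i.
  have -> : V i - V n = (V i - q / m1 * H i - cv) - (V n - q / m1 * H n - cv) - q / m1 * (H n - H i) by ring.
  apply: (le_trans (ler_normB _ _)); rewrite normrM (ger0_norm h0).
  have b1 k : (i <= k)%N -> `|V k - q / m1 * H k - cv| <= `|Cv| * weight dl i.
    move=> ik; apply: (le_trans (hCv k)); apply: (@le_trans _ _ (`|Cv| * weight dv k)).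
      by rewrite ler_wpM2r ?ler_norm // ltW // weight_gt0 // ltW.
    rewrite ler_wpM2l //; apply: (@le_trans _ _ (weight dl k)); first by rewrite le_weight // ltW.
    by rewrite weight_nonincreasing // ltW.
  have := ler_normB (V i - q / m1 * H i - cv) (V n - q / m1 * H n - cv).
  have := b1 i (leqnn i); have := b1 n (ltnW ni). have k1 : 0 <= B * e n i by rewrite mulr_ge0.
  have k2 : 0 <= (B - `|q / m1|) * (H n - H i).
    by rewrite mulr_ge0 //; have := normr_ge0 al1; have := normr_ge0 Cv; rewrite /B; lra.
  have k3 : 0 <= (B - 2 * `|Cv|) * weight dl i.
    by rewrite mulr_ge0 ?(ltW ww) //; have := normr_ge0 al1; have := normr_ge0 (q / m1); rewrite /B; lra.
  rewrite /t !mulrDr; rewrite !mulrBl in k2 k3; lra.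
pose D := B ^+ 3 + 2 * B ^+ 2.
have D0 : 0 <= D by rewrite addr_ge0 ?mulr_ge0 ?exprn_ge0.
exists (D * (18 * (C3 + CH + C' * 1) + 18 * CH)) => n.
apply: (@le_trans _ _ (D * \sum_(i < n) rate nu n i * (t n i ^+ 2 + t n i ^+ 3))).
  rewrite mulr_sumr; under [leRHS]eq_bigr do rewrite mulrCA.
  apply: (@le_sum_rate _ nu dl0 dl0_gt0 nu_exp n
    (fun i => `|xi n i| ^+ 3 + `|xi n i| * `|V i - V n| + (V i - V n) ^+ 2)
    (fun i => D * (t n i ^+ 2 + t n i ^+ 3))) => i ni.
  have x1 := xb n i ni; have x2 := vb n i ni. have t0 : 0 <= t n i.
    by have /andP[e0 e1] := e01 n i; apply: addr_ge0; [apply: addr_ge0 => //; exact: H0 | exact: ltW].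
  have y1 : `|xi n i| ^+ 3 <= (B * t n i) ^+ 3 by apply: lerXn2r; rewrite ?nnegrE ?mulr_ge0.
  have y2 : `|xi n i| * `|V i - V n| <= (B * t n i) * (B * t n i) by apply: ler_pM.
  have y3 : (V i - V n) ^+ 2 <= (B * t n i) ^+ 2.
    by rewrite -real_normK ?num_real //; apply: lerXn2r; rewrite ?nnegrE ?mulr_ge0.
  have z1 : 0 <= B ^+ 3 * t n i ^+ 2 by rewrite mulr_ge0 ?exprn_ge0.
  have z2 : 0 <= B ^+ 2 * t n i ^+ 3 by rewrite mulr_ge0 ?exprn_ge0.
  have -> : D * (t n i ^+ 2 + t n i ^+ 3) = (B * t n i) ^+ 3 + (B * t n i) * (B * t n i)
     + (B * t n i) ^+ 2 + B ^+ 3 * t n i ^+ 2 + 2 * (B ^+ 2 * t n i ^+ 3) by rewrite /D; ring.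
  lra.
rewrite ler_wpM2l //.
apply: (@le_trans _ _ (\sum_(i < n) rate nu n i *
  (18 * (e n i + (H n - H i) ^+ 2 + weight dl i) + 18 * (H n - H i) ^+ 3))).
  apply: (@le_sum_rate _ nu dl0 dl0_gt0 nu_exp n (fun i => t n i ^+ 2 + t n i ^+ 3)
    (fun i => 18 * (e n i + (H n - H i) ^+ 2 + weight dl i) + 18 * (H n - H i) ^+ 3)) => i ni.
  have /andP[e0 e1] := e01 n i; have h0 := H0 n i ni.
  have ww := ltW (w0 i); have w1 := weight_le1 (ltW dl_gt0) i. exact: cube_split.
have s1 : \sum_(i < n) rate nu n i * e n i <= C3.
  have := sum_rate_part n (fun=> 1); under eq_bigr do rewrite mulr1. by rewrite mulr1 => ->.
have s2 := (hCH n).1; have s3 := (hCH n).2.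
have s4 : \sum_(i < n) rate nu n i * weight dl i <= C' * 1.
  by apply: (le_trans (hC' n)); rewrite ler_wpM2l // weight_le1 // ltW.
have -> : \sum_(i < n) rate nu n i *
  (18 * (e n i + (H n - H i) ^+ 2 + weight dl i) + 18 * (H n - H i) ^+ 3) =
  18 * (\sum_(i < n) rate nu n i * e n i + \sum_(i < n) rate nu n i * (H n - H i) ^+ 2
   + \sum_(i < n) rate nu n i * weight dl i) + 18 * \sum_(i < n) rate nu n i * (H n - H i) ^+ 3.
  rewrite -!big_split /= !mulr_sumr -big_split /=; apply: eq_bigr => i _; ring.
rewrite /H in s2 s3 *; lra.
Qed.

End CompositionChain.

(** * Gaps and grid cells as partitions of a finite sample *)

(** A partition of the sample is encoded by a function that separates its blocks; [eq_class_count]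
    then compares gaps with grid cells without any bijection between them. *)
Definition class_count (T U : eqType) (f : T -> U) (s : seq T) r : nat :=
  size (undup [seq f x | x <- s & count (fun y => f y == f x) s == r]).

Lemma size_undup_map (T U V : eqType) (f : T -> U) (g : T -> V) (s : seq T) :
  {in s &, forall x y, (f x == f y) = (g x == g y)} ->
  size (undup (map f s)) = size (undup (map g s)).
Proof.
elim: s => //= x s IH fg.
have IHs := IH (fun y z ys zs => fg y z (mem_behead (s := x :: s) ys) (mem_behead (s := x :: s) zs)).
have -> : (f x \in map f s) = (g x \in map g s).
  apply/mapP/mapP => -[y ys e]; exists y => //; apply/eqP; move/eqP: e;
    by rewrite fg ?inE ?eqxx // ys orbT.
by case: ifP => //= _; rewrite IHs.
Qed.

Lemma eq_class_count (T U V : eqType) (f : T -> U) (g : T -> V) (s : seq T) r :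
  {in s &, forall x y, (f x == f y) = (g x == g y)} ->
  class_count f s r = class_count g s r.
Proof.
move=> fg; rewrite /class_count.
have -> : [seq x <- s | count (fun y => f y == f x) s == r] =
    [seq x <- s | count (fun y => g y == g x) s == r].
  apply: eq_in_filter => x xs; congr (_ == _); apply: eq_in_count => y ys; exact: fg.
by apply: size_undup_map => x y; rewrite !mem_filter => /andP[_ xs] /andP[_ ys]; apply: fg.
Qed.

Lemma sum_class_count (T : eqType) (f : T -> nat) (s : seq T) l r : (0 < r)%N ->
  {in s, forall x, (f x < l)%N} ->
  (\sum_(i < l) (count (fun y => f y == i) s == r) = class_count f s r)%N.
Proof.
move=> r0 fl.
rewrite -(big_mkord xpredT (fun i => nat_of_bool (count (fun y => f y == i) s == r))).
rewrite /index_iota subn0 -big_mkcond /= sum1_count -size_filter.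
apply/perm_size/uniq_perm; rewrite ?filter_uniq ?iota_uniq ?undup_uniq // => i.
rewrite mem_filter mem_iota /= add0n mem_undup; apply/andP/mapP => [[/eqP ci il]|[x]].
  have : has (fun y => f y == i) s by rewrite has_count ci.
  by case/hasP => x xs /eqP fx; exists x => //; rewrite mem_filter fx ci eqxx.
by rewrite mem_filter => /andP[ci xs] ->; rewrite ci fl.
Qed.

Section Gaps.
Variables (R : realType) (D : set R).
Hypotheses (D0 : D 0) (D1 : forall x, D x -> 0 <= x <= 1).
Implicit Types (x y z : R) (s : seq R).

Let A : set R := closure D.
Let C x := connected_component (`[0, 1]%classic `\` A) x.

(** Points above the whole range are discarded by the last condition: their component reaches 1 and
    is no open interval. All is phrased with [D] and not its closure, with a view to the reduction
    to dyadic times. *)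
Definition in_gap x := [/\ 0 <= x, exists2 e : R, 0 < e & forall z, D z -> e <= `|z - x| &
  exists2 z, D z & x < z].

Let closure_far x : ~ A x -> exists2 e : R, 0 < e & forall z, D z -> e <= `|z - x|.
move=> nA; have : open (~` A) by apply: closed_openC; exact: closed_closure.
move=> oA; have /nbhs_ballP[e e0 he] : nbhs x (~` A) by apply: open_nbhs_nbhs; split.
exists e => // z Dz; rewrite leNgt; apply/negP => zx.
by apply: (he z); [rewrite /ball /= distrC | exact: subset_closure].
Qed.

Let far_closure x : (exists2 e : R, 0 < e & forall z, D z -> e <= `|z - x|) -> ~ A x.
move=> [e e0 he] Ax; have [z [Dz]] := Ax _ (nbhsx_ballx x e e0).
by rewrite /ball /= distrC ltNge he.
Qed.

Let A01 x : A x -> 0 <= x <= 1.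
move=> Ax; have : closed (`[0, 1]%classic : set R) by exact: interval_closed.
move=> cl; have : closure (`[0, 1]%classic : set R) x.
  by apply: closure_subset Ax => z /D1; rewrite /= in_itv.
by rewrite -(closure_id _).1 //= in_itv.
Qed.

Let below x := A `&` [set z | z <= x].
Let above x := A `&` [set z | x <= z].

Let closed_A : closed A. exact: closed_closure. Qed.

Let A0 : A 0. exact: subset_closure. Qed.

Let supP x : 0 <= x -> ~ A x ->
  [/\ A (sup (below x)), sup (below x) < x & forall z, A z -> z <= x -> z <= sup (below x)].
move=> x0 nA; have hs : has_sup (below x) by split; [exists 0; split | exists x => z []].
have ub z : A z -> z <= x -> z <= sup (below x) by move=> Az zx; apply: ub_le_sup => //; case: hs.
have As : A (sup (below x)).
  by move/closure_id: closed_A => ->; apply: closure_subset (closure_sup hs.1 hs.2) => z [].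
split=> //; rewrite lt_neqAle; apply/andP; split; first by apply/eqP => e; apply: nA; rewrite -e.
by apply: ge_sup; [case: hs | move=> z []].
Qed.

Let infP x : ~ A x -> (exists2 z, D z & x < z) ->
  [/\ A (inf (above x)), x < inf (above x) & forall z, A z -> x <= z -> inf (above x) <= z].
move=> nA [z0 Dz0 xz0]; have hs : has_inf (above x).
  by split; [exists z0; split; [exact: subset_closure | exact: ltW] | exists x => z []].
have lb z : A z -> x <= z -> inf (above x) <= z by move=> Az zx; apply: ge_inf => //; case: hs.
have As : A (inf (above x)).
  move/closure_id: closed_A => -> B /nbhs_ballP[e e0 he].
  have [z [Az xz] zi] := inf_adherent e0 hs.
  exists z; split=> //; apply: he; rewrite /ball /= distrC ger0_norm ?subr_ge0 ?lb //.
  by rewrite ltrBlDl.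
split=> //; rewrite lt_neqAle; apply/andP; split; first by apply/eqP => e; apply: nA; rewrite e.
by apply: lb_le_inf; [case: hs | move=> z []].
Qed.

Let in_gap_component x : in_gap x -> C x = `]sup (below x), inf (above x)[%classic.
move=> [x0 /far_closure nA xz]; have [Aa ax la] := supP x0 nA; have [Ab bx lb] := infP nA xz.
have /andP[a0 _] := A01 Aa; have /andP[_ b1] := A01 Ab.
have Cx : C x x.
  by apply: connected_component_refl; split=> //=; rewrite in_itv /= x0 /= (le_trans (ltW bx)).
have /connected_intervalP Ci : connected (C x) by exact: component_connected.
have CA z : C x z -> ~ A z by move=> /connected_component_sub [].
rewrite eqEsubset; split.
  move=> z Cz; rewrite /= in_itv /=; apply/andP; split; rewrite ltNge; apply/negP => h.
  - by apply: (CA _ _ Aa); apply: (Ci z x) => //; rewrite h ltW.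
  - by apply: (CA _ _ Ab); apply: (Ci x z) => //; rewrite h ltW.
apply: connected_component_max; first by rewrite /= in_itv /= ax bx.
  move=> z; rewrite /= in_itv /= => /andP[az zb]; split.
    by rewrite /= in_itv /= (le_trans a0 (ltW az)) (le_trans (ltW zb) b1).
  move=> Az; have [zx|xz'] := leP z x; first by move: (la z Az zx); rewrite leNgt az.
  by move: (lb z Az (ltW xz')); rewrite leNgt zb.
by apply/connected_intervalP; exact: interval_is_interval.
Qed.

Let in_gap_self x : in_gap x -> C x x.
move=> h; rewrite in_gap_component //; case: h => [x0 /far_closure nA xz].
have [_ ax _] := supP x0 nA; have [_ bx _] := infP nA xz.
by rewrite /= in_itv /= ax bx.
Qed.

Let gaps_component x : in_gap x -> gaps A (C x).
move=> h; split; last by do 2!eexists; exact: in_gap_component.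
by exists x => //; apply: connected_component_sub (in_gap_self h).
Qed.

Let gaps_in_gap G x : gaps A G -> G x -> in_gap x /\ G = C x.
move=> [[x0 _ G0] [a [b Gab]]] Gx.
have GC : G = C x by rewrite G0; apply: same_connected_component; rewrite -G0.
have [x01 nA] : (`[0, 1]%classic `\` A) x by move: Gx; rewrite G0; exact: connected_component_sub.
move: x01; rewrite /= in_itv /= => /andP[xge0 xle1].
split=> //; split=> //; first exact: closure_far.
(* With no point of [D] above [x] the component contains 1, and an open interval containing 1 leaves
   [[0, 1]]. *)
apply: contrapT => nex.
have sub : `[x, 1]%classic `<=` G.
  rewrite GC; apply: connected_component_max; first by rewrite /= in_itv /= lexx.
    move=> z; rewrite /= in_itv /= => /andP[xz z1]; split.
      by rewrite /= in_itv /= (le_trans xge0 xz).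
    move=> Az; apply: nA; have [->//|ne] := eqVneq x z.
    exfalso; have lt : x < z by rewrite lt_neqAle ne.
    have [z' [Dz']] := Az _ (nbhsx_ballx z (z - x) (ltac:(by rewrite subr_gt0))).
    rewrite /ball /= => zz'; apply: nex; exists z' => //.
    by move: (le_lt_trans (ler_norm _) zz'); rewrite ltrD2l ltrN2.
  by apply/connected_intervalP; exact: interval_is_interval.
have : G 1 by apply: sub; rewrite /= in_itv /= lexx xle1.
have GS : G `<=` `[0, 1]%classic by rewrite GC => z /connected_component_sub [].
rewrite Gab /= in_itv /= => /andP[a1 b1].
have : G ((1 + b) / 2) by rewrite Gab /= in_itv /=; apply/andP; split; lra.
by move=> /GS; rewrite /= in_itv /= => /andP[_]; rewrite leNgt (midf_lt b1).1.
Qed.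

Lemma same_gap x y : in_gap x -> in_gap y -> x <= y ->
  (C x == C y) <-> ~ exists2 z, D z & x < z < y.
Proof.
move=> hx hy xy; split=> [/eqP e [z Dz /andP[xz zy]]|nex].
  have /connected_intervalP Ci : connected (C x) by exact: component_connected.
  have : C x z by apply: (Ci x y); rewrite ?ltW //; [exact: in_gap_self | rewrite e; exact: in_gap_self].
  by move=> /connected_component_sub [_]; apply; exact: subset_closure.
apply/eqP/same_connected_component.
have sub : `[x, y]%classic `<=` C x.
  apply: connected_component_max; first by rewrite /= in_itv /= lexx.
    case: (hx) => x0 /far_closure nAx _; case: (hy) => y0 /far_closure nAy [z' Dz' yz'].
    move=> z; rewrite /= in_itv /= => /andP[xz zy]; split.
      have /andP[_ z1] := D1 Dz'.
      by rewrite /= in_itv /= (le_trans x0 xz) (le_trans zy) // (le_trans (ltW yz')).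
    move=> Az; have xz1 : x < z by rewrite lt_neqAle xz andbT; apply/eqP => e; apply: nAx; rewrite e.
    have zy1 : z < y by rewrite lt_neqAle zy andbT; apply/eqP => e; apply: nAy; rewrite -e.
    have nb : nbhs z (`]x, y[%classic : set R).
      by apply: open_nbhs_nbhs; split; [exact: interval_open | rewrite /= in_itv /= xz1].
    have [z'' [Dz'']] := Az _ nb; rewrite /= in_itv /= => h. by apply: nex; exists z''.
  by apply/connected_intervalP; exact: interval_is_interval.
by apply: sub; rewrite /= in_itv /= lexx xy.
Qed.

(** For [r >= 1] every counted gap contains a sample point, so the possibly infinite family of gaps
    can be replaced by the classes of a finite list. *)
Lemma nb_gaps_class_count s r : (0 < r)%N ->
  nb_gaps A (fun B => count (fun x => x \in B) s) r =
  class_count C [seq x <- s | `[< in_gap x >]] r.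
Proof.
move=> r0; rewrite /nb_gaps /class_count.
set t := [seq x <- s | `[< in_gap x >]].
have tP x : x \in t -> in_gap x by rewrite mem_filter => /andP[/asboolP].
have cnt x : in_gap x -> count (fun y => C y == C x) t = count (fun y => y \in C x) s.
  move=> hx; rewrite count_filter; apply: eq_in_count => y ys /=.
  apply/andP/idP => [[/eqP e /asboolP hy]|].
    by rewrite inE -e; exact: in_gap_self.
  rewrite inE => Cy; have [hy e] := gaps_in_gap (gaps_component hx) Cy.
  by split; [rewrite e | apply/asboolP].
rewrite -card_fseq; congr (#|` _ |).
rewrite -[RHS]set_fsetK; congr fset_set; rewrite eqEsubset; split=> G /=.
  move=> [gG cG]; have : has (fun x => x \in G) s by rewrite has_count cG.
  case/hasP => x xs; rewrite inE => Gx; have [hx GC] := gaps_in_gap gG Gx.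
  rewrite inE GC; apply/mapP; exists x => //; rewrite mem_filter cnt // -GC cG eqxx /=.
  by rewrite mem_filter xs andbT; apply/asboolP.
rewrite inE => /mapP[x]; rewrite mem_filter => /andP[/eqP cx xt ->].
by have hx := tP _ xt; split; [exact: gaps_component | rewrite -cnt].
Qed.

Variables (p : nat -> R) (l : nat).
Hypotheses (p_ndec : {homo p : i j / (i <= j)%N >-> i <= j}) (p0 : p 0%N = 0) (Dp : forall i, D (p i)).

Definition cell_count s r : nat := (\sum_(i < l) (count (fun x => (p i < x <= p i.+1)%R) s == r))%N.

Let cell x : nat := find (fun z => x <= z) (mkseq p l.+1).

Let cell_leq x i : (i <= l)%N -> (cell x <= i)%N = (x <= p i).
move=> il; apply/idP/idP => [ci|xi].
  have : has (fun z => x <= z) (mkseq p l.+1) by rewrite has_find size_mkseq (leq_ltn_trans ci).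
  move/(nth_find 0); rewrite -/(cell x) nth_mkseq ?(leq_ltn_trans ci) // => h.
  exact: le_trans h (p_ndec ci).
rewrite leqNgt; apply/negP => /(before_find 0).
by rewrite nth_mkseq ?ltnS // xi.
Qed.

(** Grid points belong to [D], so no grid point splits a gap; conversely the last hypothesis puts a
    grid point between any two points of different gaps. *)
Lemma cell_count_class_count s r : (0 < r)%N -> {in s, forall x, in_gap x} ->
  {in s, forall x, x < p l} ->
  {in s &, forall x y, (exists2 z, D z & x < z < y) -> exists2 i, (i <= l)%N & x < p i < y} ->
  cell_count s r = class_count C s r.
Proof.
move=> r0 sgap sl ssep.
have cpos x : x \in s -> (0 < cell x <= l)%N.
  move=> xs; rewrite (cell_leq _ (leqnn l)) (ltW (sl _ xs)) andbT ltnNge (cell_leq _ (leq0n l)) p0.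
  rewrite -ltNge; have [x0 [e e0 he] _] := sgap _ xs; rewrite lt_neqAle x0 andbT.
  by apply/eqP => h; move: (he _ D0); rewrite -h subrr normr0 leNgt e0.
transitivity (class_count (fun x => (cell x).-1) s r).
  rewrite -(sum_class_count (l := l)) //; last first.
    by move=> x xs; have /andP[c0 cl] := cpos _ xs; rewrite -ltnS prednK.
  apply: eq_bigr => i _; congr (nat_of_bool (_ == _)); apply: eq_in_count => x xs.
  rewrite ltNge -(cell_leq x (ltnW (ltn_ord i))) -(cell_leq x (ltn_ord i)) -ltnNge; have /andP[c0 cl] := cpos _ xs.
  by rewrite -(eqn_add2r 1) !addn1 prednK // eq_sym eqn_leq.
apply: eq_class_count.
suff key x y : x \in s -> y \in s -> x <= y -> ((cell x).-1 == (cell y).-1) = (C x == C y).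
  move=> x y xs ys; have [xy|/ltW yx] := leP x y; first exact: key.
  by rewrite eq_sym key // eq_sym.
move=> xs ys xy; have /andP[cx0 cxl] := cpos _ xs; have /andP[cy0 cyl] := cpos _ ys.
have -> : ((cell x).-1 == (cell y).-1) = (cell x == cell y).
  by rewrite -(eqn_add2r 1) !addn1 !prednK.
apply/idP/idP => [/eqP cc|/(same_gap (sgap _ xs) (sgap _ ys) xy) nex].
  apply/(same_gap (sgap _ xs) (sgap _ ys) xy) => /(ssep x y xs ys)[i il /andP[xi iy]].
  by move: iy; rewrite ltNge -cell_leq // -cc cell_leq // ltW.
rewrite eqn_leq; apply/andP; split.
  by rewrite cell_leq // (le_trans xy) // -cell_leq.
rewrite cell_leq // leNgt; apply/negP => py; apply: nex; exists (p (cell x)) => //.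
rewrite py andbT lt_neqAle -cell_leq // leqnn andbT; apply/eqP => h.
have [_ [e e0 he] _] := sgap _ xs.
by move: (he _ (Dp (cell x))); rewrite -h subrr normr0 leNgt e0.
Qed.

End Gaps.

(** * Bounded random variables and decoupling under independence *)

Section BoundedExpectation.
Context d (Omega : measurableType d) (R : realType) (P : probability Omega R).
Implicit Types (f g : Omega -> R) (c : R) (A : set Omega).

Definition bmfun f :=
  measurable_fun setT f /\ exists C : R, forall w, `|f w| <= C.

Definition mean f : R := fine 'E_P[f].

Definition prb A : R := fine (P A).

Lemma prbE A : measurable A -> (prb A)%:E = P A.
Proof. by move=> mA; rewrite fineK //; exact: fin_num_measure. Qed.

Lemma bmfun_cst c : bmfun (fun=> c).
Proof. by split=> //; exists `|c|. Qed.

Lemma bmfunD f g : bmfun f -> bmfun g ->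
  bmfun (fun w => f w + g w).
Proof.
move=> [mf [C hC]] [mg [C' hC']]; split; first exact: measurable_funD.
by exists (C + C') => w; rewrite (le_trans (ler_normD _ _)) ?lerD.
Qed.

Lemma bmfunM f g : bmfun f -> bmfun g ->
  bmfun (fun w => f w * g w).
Proof.
move=> [mf [C hC]] [mg [C' hC']]; split; first exact: measurable_funM.
by exists (C * C') => w; rewrite normrM ler_pM.
Qed.

Lemma bmfunZ c f : bmfun f -> bmfun (fun w => c * f w).
Proof. by apply: bmfunM; exact: bmfun_cst. Qed.

Lemma bmfun_sum (I : Type) (s : seq I) (Q : pred I) (F : I -> Omega -> R) :
  (forall i, Q i -> bmfun (F i)) ->
  bmfun (fun w => \sum_(i <- s | Q i) F i w).
Proof.
move=> hF; elim: s => [|i s IH].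
  by under eq_fun do rewrite big_nil; exact: bmfun_cst.
under eq_fun do rewrite big_cons.
by have [Qi|_] := boolP (Q i) => //; apply: bmfunD => //; exact: hF.
Qed.

Lemma bmfun_prod (I : Type) (s : seq I) (Q : pred I) (F : I -> Omega -> R) :
  (forall i, Q i -> bmfun (F i)) ->
  bmfun (fun w => \prod_(i <- s | Q i) F i w).
Proof.
move=> hF; elim: s => [|i s IH].
  by under eq_fun do rewrite big_nil; exact: bmfun_cst.
under eq_fun do rewrite big_cons.
by have [Qi|_] := boolP (Q i) => //; apply: bmfunM => //; exact: hF.
Qed.

Lemma bmfun_indic A : measurable A -> bmfun (\1_A : Omega -> R).
Proof.
move=> mA; split; first exact: measurable_indic.
by exists 1 => w; rewrite indicE; case: (_ \in _); rewrite ?normr1 ?normr0.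
Qed.

Lemma bmfun_Lfun f : bmfun f -> P.-integrable setT (EFin \o f).
Proof.
move=> [mf [C hC]]; apply: measurable_bounded_integrable => //.
  exact: le_lt_trans (probability_le1 P measurableT) (ltry _).
by exists C; split; [exact: num_real | move=> y /ltW Cy w _; exact: le_trans (hC w) Cy].
Qed.

Lemma mean_EFin f : bmfun f -> (mean f)%:E = (\int[P]_w (f w)%:E)%E.
Proof.
move=> bf; rewrite /mean unlock fineK //.
by apply: integrable_fin_num => //; exact: bmfun_Lfun.
Qed.

Lemma meanD f g : bmfun f -> bmfun g ->
  mean (fun w => f w + g w) = mean f + mean g.
Proof.
move=> bf bg; apply: EFin_inj; rewrite mean_EFin ?EFinD ?mean_EFin //; last exact: bmfunD.
by rewrite -integralD_EFin //; exact: bmfun_Lfun.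
Qed.

Lemma meanZ c f : bmfun f -> mean (fun w => c * f w) = c * mean f.
Proof.
move=> bf; apply: EFin_inj; rewrite mean_EFin ?EFinM ?mean_EFin //; last exact: bmfunZ.
under eq_integral do rewrite EFinM.
by rewrite integralZl //; exact: bmfun_Lfun.
Qed.

Lemma mean_cst c : mean (fun=> c) = c.
Proof. by rewrite /mean expectation_cst. Qed.

Lemma mean_indic A : measurable A -> mean (\1_A) = prb A.
Proof. by move=> mA; rewrite /mean expectation_indic. Qed.

Lemma eq_mean f g : (forall w, f w = g w) -> mean f = mean g.
Proof. by move=> /funext ->. Qed.

Lemma mean_sum (I : Type) (s : seq I) (Q : pred I) (F : I -> Omega -> R) :
  (forall i, Q i -> bmfun (F i)) ->
  mean (fun w => \sum_(i <- s | Q i) F i w) = \sum_(i <- s | Q i) mean (F i).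
Proof.
move=> hF; elim: s => [|i s IH].
  by rewrite big_nil -[RHS](mean_cst 0); apply: eq_mean => w; rewrite big_nil.
rewrite big_cons; case: ifPn => Qi; last first.
  by rewrite -IH; apply: eq_mean => w; rewrite big_cons (negbTE Qi).
rewrite -IH -meanD; [|exact: hF|exact: bmfun_sum].
by apply: eq_mean => w; rewrite big_cons Qi.
Qed.

Lemma le_mean f g : bmfun f -> bmfun g ->
  (forall w, f w <= g w) -> mean f <= mean g.
Proof.
move=> bf bg fg; rewrite -lee_fin !mean_EFin //.
apply: le_integral => [|||w _]; rewrite ?lee_fin //; exact: bmfun_Lfun.
Qed.

Lemma ler_norm_mean f : bmfun f -> `|mean f| <= mean (fun w => `|f w|).
Proof.
move=> bf; have bn : bmfun (fun w => `|f w|).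
  case: bf => mf [C hC]; split; first exact: measurableT_comp.
  by exists C => w; rewrite normr_id.
rewrite ler_norml; apply/andP; split; last by apply: le_mean => // w; exact: ler_norm.
rewrite -mulN1r -meanZ //; apply: le_mean => //; first exact: bmfunZ.
by move=> w; rewrite mulN1r lerNl -normrN ler_norm.
Qed.

Lemma mean_cvg (F : nat -> Omega -> R) f C : (forall n, measurable_fun setT (F n)) ->
  (forall n w, `|F n w| <= C) -> (forall w, F n w @[n --> \oo] --> f w) ->
  mean (F n) @[n --> \oo] --> mean f.
Proof.
move=> mF FC Ff.
have bF n : bmfun (F n) by split=> //; exists C => w; exact: FC.
have mf : measurable_fun setT f by exact: (@measurable_fun_cvg _ _ _ setT F f).
have bf : bmfun f.
  split=> //; exists C => w; apply: (cvgr_to_le (cvg_norm (Ff w))).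
  by apply: nearW => n; exact: FC.
have Ffe : \forall x \ae P, [set: Omega] x -> (EFin \o F n) x @[n --> \oo] --> (EFin \o f) x.
  by apply: aeW => w _; apply: cvg_EFin; [exact: nearW | exact: Ff].
have FCe : \forall x \ae P, forall n, [set: Omega] x -> (`|(EFin \o F n) x| <= (EFin \o cst C) x)%E.
  by apply: aeW => w n _; rewrite lee_fin; exact: FC.
have mFe n : measurable_fun setT (EFin \o F n) by apply/measurable_EFinP; exact: mF.
have mfe : measurable_fun setT (EFin \o f) by apply/measurable_EFinP.
have [_ _] := dominated_convergence measurableT mFe mfe Ffe
  (bmfun_Lfun (bmfun_cst C)) FCe.
move=> h; apply: fine_cvg; rewrite -/(mean f) mean_EFin //.
by apply: cvg_trans h; apply: near_eq_cvg; apply: nearW => n; rewrite unlock.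
Qed.

Lemma prb_ge0 A : 0 <= prb A. Proof. exact: fine_ge0. Qed.

Lemma prb_le1 A : measurable A -> prb A <= 1.
Proof. by move=> mA; rewrite -lee_fin prbE // probability_le1. Qed.

Lemma le_prb A B : measurable A -> measurable B -> A `<=` B -> prb A <= prb B.
Proof. by move=> mA mB AB; rewrite -lee_fin !prbE // le_measure // inE. Qed.

Lemma prbU A B : measurable A -> measurable B -> prb (A `|` B) <= prb A + prb B.
Proof. by move=> mA mB; rewrite -lee_fin EFinD !prbE ?measureU2 //; exact: measurableU. Qed.

Lemma prb_sum (I : Type) (s : seq I) (Q : pred I) (F : I -> set Omega) A :
  measurable A -> (forall i, Q i -> measurable (F i)) ->
  (forall w, \1_A w = \sum_(i <- s | Q i) \1_(F i) w :> R) ->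
  prb A = \sum_(i <- s | Q i) prb (F i).
Proof.
move=> mA mF AF; rewrite -mean_indic // (eq_mean AF) mean_sum; last first.
  by move=> i Qi; apply: bmfun_indic; exact: mF.
by apply: eq_bigr => i Qi; rewrite mean_indic //; exact: mF.
Qed.

End BoundedExpectation.

Section Decoupling.
Context d (Omega : measurableType d) (R : realType) (P : probability Omega R).
Variables F G : set (set Omega).
Hypotheses (mF : F `<=` measurable) (mG : G `<=` measurable) (FG : independent_systems P <<s F>> <<s G>>).

Let OF : measurableType _ := g_sigma_algebraType F.
Let OG : measurableType _ := g_sigma_algebraType G.

Let sub H : H `<=` measurable -> <<s H>> `<=` @measurable _ Omega.
by move=> mH; apply: smallest_sub => //; exact: sigma_algebra_measurable. Qed.

Let mid H : H `<=` measurable -> measurable_fun setT (id : Omega -> g_sigma_algebraType H).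
by move=> mH _ A mA; rewrite setTI; exact: (sub mH mA). Qed.

Let mdiag : measurable_fun setT ((fun w => (w, w)) : Omega -> OF * OG).
by apply: measurable_fun_pair; exact: mid. Qed.

Let idF : Omega -> OF := id.
HB.instance Definition _ := isMeasurableFun.Build _ _ _ _ idF (mid mF).
Let idG : Omega -> OG := id.
HB.instance Definition _ := isMeasurableFun.Build _ _ _ _ idG (mid mG).
Let diag : Omega -> OF * OG := fun w => (w, w).
HB.instance Definition _ := isMeasurableFun.Build _ _ _ _ diag mdiag.

(** Freezing: by independence the diagonal map into the product of [Omega] under [<<s F>>] and
    [Omega] under [<<s G>>] has a product law, and Tonelli's theorem integrates one argument with
    the other fixed. *)
Lemma decoupling (f : OF * OG -> \bar R) : measurable_fun setT f -> (forall z, (0 <= f z)%E) ->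
  (\int[P]_w f (w, w) = \int[P]_w \int[P]_w' f (w, w'))%E.
Proof.
move=> mf f0.
have rect A B : measurable A -> measurable B ->
    distribution P diag (A `*` B) = (distribution P idF A * distribution P idG B)%E.
  by move=> mA mB; apply: FG.
have E1 : (\int[P]_w f (w, w) = \int[distribution P diag]_z f z)%E.
  by rewrite ge0_integral_distribution.
rewrite E1; transitivity (\int[distribution P idF \x distribution P idG]_z f z)%E.
  by apply: eq_measure_integral => A mA _; apply/esym; exact: (product_measure_unique rect mA).
rewrite fubini_tonelli1 // ge0_integral_distribution //; last 2 first.
- exact: measurable_fun_fubini_tonelli_F.
- by move=> x; apply: integral_ge0.
apply: eq_integral => w _; rewrite /= /fubini_F.
rewrite ge0_integral_distribution //.
by apply: measurableT_comp mf _; exact: measurable_pair1.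
Qed.

Variable C : set (OF * OG).
Hypothesis mC : measurable C.

Let mslice w : @measurable _ Omega [set w' | C (w, w')].
have /(sub mG) := @measurable_xsection _ _ OF OG C w mC.
by congr (@measurable _ _); apply/funext => w'; apply/propext; rewrite /xsection /= inE.
Qed.

Let inner w : P [set w' | C (w, w')] = (\int[P]_w' (\1_C (w, w'))%:E)%E.
rewrite -[LHS](@expectation_indic _ _ _ P) // unlock.
by apply: eq_integral => w' _; rewrite !indicE; congr (_%:R%:E); apply/idP/idP; rewrite !inE.
Qed.

Lemma bmfun_section : bmfun (fun w : Omega => prb P [set w' | C (w, w')]).
Proof.
split; last first.
  by exists 1 => w; rewrite ger0_norm ?prb_ge0 // prb_le1.
apply/measurable_EFinP.
rewrite (_ : EFin \o _ = fubini_F (distribution P idG) (EFin \o \1_C) \o idF).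
  apply: measurableT_comp (mid mF); apply: measurable_fun_fubini_tonelli_F.
    by apply/measurable_EFinP; exact: measurable_indic.
  by move=> z; rewrite lee_fin indicE.
apply/funext => w; rewrite /= prbE // inner /fubini_F ge0_integral_distribution //.
  apply/measurable_EFinP; apply: measurableT_comp (measurable_pair1 _); exact: measurable_indic.
by move=> w'; rewrite lee_fin indicE.
Qed.

Lemma prb_decoupling :
  prb P [set w | C (w, w)] = mean P (fun w : Omega => prb P [set w' | C (w, w')]).
Proof.
rewrite /mean unlock; congr fine.
transitivity (\int[P]_w (\1_C (w, w))%:E)%E.
  rewrite -[LHS](@expectation_indic _ _ _ P) ?unlock; last first.
    by have := mdiag measurableT mC; rewrite setTI.
  by apply: eq_integral => w _; rewrite !indicE; congr (_%:R%:E); apply/idP/idP; rewrite !inE.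
rewrite (decoupling (f := EFin \o \1_C)) /=; last 2 first.
- by apply/measurable_EFinP; exact: measurable_indic.
- by move=> z; rewrite lee_fin indicE.
by apply: eq_integral => w _; rewrite prbE.
Qed.
End Decoupling.

(** * Occupancy of a fixed grid by uniform and by Poisson points *)

(** Cells are filled from left to right. [z] is the probability of the current cell given that a
    point is not in an earlier one; [i] of the remaining points fall there, and the count moves by
    one if [i = r]. *)
Fixpoint occupancy (R : comNzRingType) r (zs : seq R) n (psi : nat -> R) : R :=
  if zs is z :: zs' then
    \sum_(i < n.+1) 'C(n, i)%:R * z ^+ i * (1 - z) ^+ (n - i) *
      occupancy r zs' (n - i)%N (fun k => psi ((i == r :> nat) + k)%N)
  else psi 0%N.

Lemma mutually_independentT (d d' : measure_display) (Omega : measurableType d)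
    (T : measurableType d') (R : realType) (P : probability Omega R)
    (I : finType) (X : I -> Omega -> T) (B : I -> set T) : mutually_independent P X ->
  (forall i, measurable (B i)) ->
  P [set w | forall i, B i (X i w)] = (\prod_i P (X i @^-1` B i))%E.
Proof.
move=> hX mB; have := hX [fset i in enum I]%fset B mB.
have -> : \bigcap_(i in [set` [fset i in enum I]%fset]) X i @^-1` B i =
    [set w | forall i, B i (X i w)].
  apply/seteqP; split=> w h i.
  - by apply: h; rewrite /= inE mem_enum.
  - by move=> _; exact: h.
move=> ->; apply: perm_big; apply: uniq_perm; rewrite ?fset_uniq ?index_enum_uniq // => i.
by rewrite mem_index_enum inE mem_enum.
Qed.

Lemma measurable_indicE (d : measure_display) (Omega : measurableType d) (R : realType) (A : set Omega) :
  measurable_fun setT (\1_A : Omega -> R) -> measurable A.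
Proof.
move=> /(_ measurableT [set 1] (measurable_set1 _)); rewrite setTI.
congr measurable; apply/seteqP; split=> w; rewrite /= indicE.
  by case: (boolP (w \in A)) => [|_ /eqP]; rewrite ?inE // eq_sym oner_eq0.
by move=> Aw; rewrite mem_set.
Qed.

Lemma mem_bool (T : Type) (f : T -> bool) x : (x \in [set y | f y]) = f x.
Proof. by apply/idP/idP; rewrite inE. Qed.

Section UniformCells.
Context d (Omega : measurableType d) (R : realType) (P : probability Omega R).
Variables (n : nat) (u : 'I_n -> Omega -> R).
Hypothesis hu : iid_uniform P u.
Variables (r : nat) (p : nat -> R).
Hypotheses (p_ndec : forall i, p i <= p i.+1) (p_ge0 : forall i, 0 <= p i) (p_lt1 : forall i, p i < 1).
Implicit Types (x y : R) (a m i : nat) (j : 'I_n) (w : Omega) (J : {set 'I_n}) (B : 'I_n -> set R) (Q : pred nat).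

Let z i : R := (p i.+1 - p i) / (1 - p i).

Let mu j : measurable_fun setT (u j). by case: hu. Qed.

Lemma prb_uniform j (A : set R) : measurable A ->
  P (u j @^-1` A) = lebesgue_measure (A `&` `[0, 1]%classic).
Proof.
move=> mA; have [_ -> // _] := hu.
rewrite /uniform_prob integral_uniform_pdf.
transitivity (\int[lebesgue_measure]_(x in A `&` `[0%R, 1%R]) (cst 1%E x))%E.
  apply: eq_integral => x; rewrite inE /= in_itv /= => -[_ x01].
  by rewrite /uniform_pdf x01 subr0 invr1.
by rewrite integral_cst ?mul1e //; exact: measurableI.
Qed.

Let lam j (A : set R) : R := prb P (u j @^-1` A).

Lemma uniform_itv j x y : 0 <= x -> x <= y -> y <= 1 -> lam j `]x, y]%classic = y - x.
Proof.
move=> x0 xy y1; rewrite /lam /prb prb_uniform //.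
rewrite (_ : _ `&` _ = `]x, y]%classic); last first.
  apply/seteqP; split=> t; rewrite /= !in_itv /=; first by case.
  by move=> /andP[xt ty]; rewrite xt ty (le_trans x0 (ltW xt)) (le_trans ty y1).
rewrite lebesgue_measure_itv /= lte_fin; case: ltP => //= yx.
by apply/esym/eqP; rewrite subr_eq0 eq_le yx xy.
Qed.

Lemma uniform_itvy j x : 0 <= x -> x <= 1 -> lam j `]x, +oo[%classic = 1 - x.
Proof.
move=> x0 x1; rewrite /lam /prb prb_uniform //.
rewrite (_ : _ `&` _ = `]x, 1%R]%classic); last first.
  apply/seteqP; split=> t; rewrite /= !in_itv /= ?andbT; first by case=> -> /andP[].
  by move=> /andP[xt ty]; rewrite xt ty (le_trans x0 (ltW xt)).
rewrite lebesgue_measure_itv /= lte_fin; case: ltP => //= yx.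
by apply/esym/eqP; rewrite subr_eq0 eq_le yx x1.
Qed.

Let in_cell i w : {set 'I_n} := [set j | p i < u j w <= p i.+1].
Let cells J a m w : nat := (\sum_(i <- iota a m) (#|J :&: in_cell i w| == r))%N.

(** The induction needs more general events: points outside [J] are already placed, in sets recorded
    by [B], so that independence is invoked only once every point is placed. *)
Let E J B a m Q : set Omega :=
  [set w | [forall j, if j \in J then p a < u j w else u j w \in B j] && Q (cells J a m w)].

Let B' (I : {set 'I_n}) B a (j : 'I_n) : set R := if j \in I then `]p a, p a.+1]%classic else B j.

Let step J B a m Q w : \1_(E J B a m.+1 Q) w = \sum_(I in powerset J)
  \1_(E (J :\: I) (B' I B a) a.+1 m (fun k => Q ((#|I| == r) + k)%N)) w :> R.
have key (I : {set 'I_n}) : I \subset J ->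
    (w \in E (J :\: I) (B' I B a) a.+1 m (fun k => Q ((#|I| == r) + k)%N)) =
    (I == J :&: in_cell a w) && (w \in E J B a m.+1 Q).
  move=> IJ; have hall : [forall j, if j \in J :\: I then p a.+1 < u j w else u j w \in B' I B a j] =
      (I == J :&: in_cell a w) && [forall j, if j \in J then p a < u j w else u j w \in B j].
    apply/forallP/andP => [h|[/eqP -> /forallP h] j]; last first.
      move: (h j); rewrite /B' !inE; case: (j \in J) => //= pj.
      rewrite pj andbT /=; case: (leP (u j w) (p a.+1)) => //= h1.
      by rewrite inE /= in_itv /= pj h1.
    split; last first.
      apply/forallP => j; move: (h j); rewrite /B' !inE.
      case: (boolP (j \in I)) => [jI|jI]; first by rewrite /= (fintype.subsetP IJ _ jI) inE /= in_itv /= => /andP[].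
      by case: (j \in J) => //= pj; exact: le_lt_trans (p_ndec a) pj.
    apply/eqP/setP => j; move: (h j); rewrite /B' !inE.
    case: (boolP (j \in I)) => [jI|jI]; first by rewrite /= (fintype.subsetP IJ _ jI) inE /= in_itv /= => ->.
    by case: (j \in J) => //= pj; rewrite leNgt pj andbF.
  rewrite /E !mem_bool hall; case: eqP => //= ->; case: forallP => //= h.
  rewrite /cells /= big_cons; congr (Q (_ + _)%N); rewrite !big_seq; apply: eq_bigr => i.
  rewrite mem_iota => /andP[ai _]; congr (nat_of_bool (_ == _)); apply: eq_card => j; rewrite !inE.
  case: (j \in J); rewrite ?andbF //= andbT; case: (boolP (_ && (u j w <= p i.+1))); rewrite ?andbF //.
  move=> /andP[pj _]; rewrite andbT negb_and -!ltNge orbC; apply/orP; left.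
  apply: le_lt_trans pj; elim: i ai {h} => // i IH; rewrite ltnS leq_eqVlt => /predU1P[->//|/IH h].
  exact: le_trans h (p_ndec i).
rewrite [LHS]indicE; case: (boolP (w \in E J B a m.+1 Q)) => [wE|wE].
  have IJ : J :&: in_cell a w \in powerset J by rewrite inE subsetIl.
  rewrite (bigD1 _ IJ) /= indicE key ?subsetIl // eqxx wE big1 ?addr0 // => I /andP[pI /negbTE ne].
  have IJ' : I \subset J by rewrite -powersetE; exact: pI. by rewrite indicE key // ne.
by rewrite big1 // => I; rewrite inE => IJ; rewrite indicE key // (negbTE wE) andbF.
Qed.

Let E0 J B a Q : E J B a 0 Q = [set w | forall j, (if j \in J then `]p a, +oo[%classic else B j) (u j w)] `&`
  [set w | Q 0%N].
apply/seteqP; split=> w; rewrite /E /= /cells big_nil.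
  move=> /andP[/forallP h q]; split=> // j; move: (h j).
  by case: ifP => _; rewrite ?inE //= in_itv /= andbT.
move=> [h ->]; rewrite andbT; apply/forallP => j; move: (h j).
by case: ifP => _; rewrite ?inE //= in_itv /= andbT.
Qed.

Let mB' I B a : (forall j, measurable (B j)) -> forall j, measurable (B' I B a j).
by move=> mB j; rewrite /B'; case: ifP. Qed.

Let mE J B a m Q : (forall j, measurable (B j)) -> measurable (E J B a m Q).
elim: m J B a Q => [|m IH] J B a Q mB; last first.
  apply: (@measurable_indicE _ _ R). have /funext -> := step J B a m Q.
  suff : bmfun (fun w => \sum_(I in powerset J)
    \1_(E (J :\: I) (B' I B a) a.+1 m (fun k => Q ((#|I| == r) + k)%N)) w : R) by case.
  apply: bmfun_sum => I _. by apply: bmfun_indic; apply: IH; exact: mB'.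
rewrite E0; apply: measurableI; last by case: (Q 0%N); rewrite ?set_true ?set_false.
rewrite (_ : [set w | _] = \bigcap_(j in setT) (u j @^-1` (if j \in J then `]p a, +oo[%classic else B j))).
  apply: fin_bigcap_measurable => // j _; rewrite -[X in measurable X]setTI; apply: mu => //.
  by case: ifP.
by apply/seteqP; split=> w h j; [move=> _; exact: (h j) | exact: (h j)].
Qed.

Let prb_E J B a m Q : (forall j, measurable (B j)) ->
  prb P (E J B a m Q) = \prod_(j | j \notin J) lam j (B j) * (1 - p a) ^+ #|J| *
    occupancy r [seq z i | i <- iota a m] #|J| (fun k => (Q k)%:R).
elim: m J B a Q => [|m IH] J B a Q mB.
  rewrite E0 /=; case: (Q 0%N); last first.
    by rewrite (_ : [set _ | false] = set0) ?setI0 /prb ?measure0 ?mulr0 //; apply/seteqP; split.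
  rewrite (_ : [set _ | true] = setT) ?setIT ?mulr1; last by apply/seteqP; split.
  rewrite /prb (mutually_independentT (X := u) (B := fun j => if j \in J then _ else _)); last 2 first.
  - by case: hu.
  - by move=> j; case: ifP.
  rewrite (eq_bigr (fun j => (lam j (if j \in J then `]p a, +oo[%classic else B j))%:E)); last first.
    move=> j _; rewrite /lam prbE //; rewrite -[X in measurable X]setTI; apply: mu => //.
    by case: ifP.
  rewrite prodEFin /= (bigID (fun j => j \notin J)) /=; congr (_ * _).
    by apply: eq_bigr => j /negbTE ->.
  rewrite (eq_bigr (fun=> 1 - p a)); last first.
    by move=> j; rewrite negbK => ->; rewrite uniform_itvy // ltW.
  by rewrite (eq_bigl (mem J)) ?prodr_const // => j; rewrite negbK.
rewrite (prb_sum P _ _ (step J B a m Q)); last 2 first.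
- exact: mE.
- by move=> I _; apply: mE; exact: mB'.
have term (I : {set 'I_n}) : I \in powerset J ->
    prb P (E (J :\: I) (B' I B a) a.+1 m (fun k => Q ((#|I| == r) + k)%N)) =
    \prod_(j | j \notin J) lam j (B j) * (1 - p a) ^+ #|J| *
    (z a ^+ #|I| * (1 - z a) ^+ (#|J| - #|I|) * occupancy r [seq z i | i <- iota a.+1 m] (#|J| - #|I|)%N
      (fun k => (Q ((#|I| == r) + k)%N)%:R)).
  rewrite inE => IJ; rewrite IH; last exact: mB'.
  rewrite cardsD (finset.setIidPr IJ) !mulrA; congr (_ * _). have cI := subset_leq_card IJ.
  have pa : 1 - p a != 0 by rewrite subr_eq0 eq_sym lt_eqF.
  have e1 : z a * (1 - p a) = p a.+1 - p a by rewrite /z divfK.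
  have e2 : (1 - z a) * (1 - p a) = 1 - p a.+1 by rewrite mulrBl e1 mul1r; ring.
  have -> : (1 - p a) ^+ #|J| = (1 - p a) ^+ #|I| * (1 - p a) ^+ (#|J| - #|I|) by rewrite -exprD subnKC.
  rewrite -e2 (bigID (fun j => j \notin J)) /=.
  have -> : \prod_(j | (j \notin J :\: I) && (j \notin J)) lam j (B' I B a j) =
      \prod_(j | j \notin J) lam j (B j).
    apply: eq_big => j; rewrite !inE negb_and negbK; case: (boolP (j \in J)) => //=; rewrite ?andbF ?orbT //.
    by move=> jJ _; rewrite /B' ifN //; apply: contra jJ; exact: (fintype.subsetP IJ).
  have -> : \prod_(j | (j \notin J :\: I) && ~~ (j \notin J)) lam j (B' I B a j) =
      (z a * (1 - p a)) ^+ #|I|.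
    rewrite -prodr_const; apply: eq_big => j; rewrite !inE negb_and !negbK.
      by case: (boolP (j \in I)) => //= jI; rewrite ?andNb // (fintype.subsetP IJ).
    case: (boolP (j \in I)) => //= jI; rewrite ?andNb // => _.
    by rewrite /B' jI e1 uniform_itv // ltW.
  rewrite !exprMn_comm; try exact: mulrC. by ring.
rewrite (eq_bigr _ term) -mulr_sumr; congr (_ * _).
(* Subsets [I] of equal size contribute equally; counting them gives the binomial coefficient of
   [occupancy]. *)
rewrite (partition_big (fun I : {set 'I_n} => inord #|I| : 'I_#|J|.+1) xpredT) //=.
apply: eq_bigr => i _.
rewrite (eq_bigr (fun=> z a ^+ i * (1 - z a) ^+ (#|J| - i) *
  occupancy r [seq z i | i <- iota a.+1 m] (#|J| - i)%N (fun k => (Q ((i == r :> nat) + k)%N)%:R))); last first.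
  move=> I; rewrite inE => /andP[IJ /eqP <-]; rewrite inordK // ltnS. exact: subset_leq_card.
rewrite sumr_const -[RHS]mulrA -[RHS]mulrA mulr_natl [in RHS]mulrA; congr (_ *+ _).
rewrite -cards_draws; apply: eq_card => I; rewrite !inE.
transitivity ((I \subset J) && (inord #|I| == i)); first by rewrite -powersetE.
by case: (boolP (I \subset J)) => //= IJ; rewrite -val_eqE /= inordK // ltnS subset_leq_card.
Qed.

Lemma uniform_cell_count l Q : (0 < r)%N -> measurable [set w | [forall j, p 0%N < u j w] &&
    Q (cell_count p l [seq u j w | j <- enum 'I_n] r)] /\
  prb P [set w | [forall j, p 0%N < u j w] && Q (cell_count p l [seq u j w | j <- enum 'I_n] r)] =
  (1 - p 0%N) ^+ n * occupancy r [seq z i | i <- iota 0 l] n (fun k => (Q k)%:R).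
Proof.
move=> r0.
set A := [set w | _].
have -> : A = E (finset.setTfor 'I_n) (fun=> setT) 0 l Q.
  apply/funext => w; apply/propext; rewrite /A /E /=. have -> : [forall j, p 0%N < u j w] =
      [forall j, if j \in finset.setTfor 'I_n then p 0%N < u j w else u j w \in setT].
    by apply: eq_forallb => j; rewrite finset.in_setT.
  have -> : cell_count p l [seq u j w | j <- enum 'I_n] r = cells (finset.setTfor 'I_n) 0 l w => //.
  rewrite /cell_count /cells -[in RHS](subn0 l) -/(index_iota 0 l) big_mkord; apply: eq_bigr => i _; congr (nat_of_bool (_ == r)).
  rewrite count_map -sum1_count -sum1_card big_enum_cond /=; apply: eq_bigl => j.
  by rewrite !inE.
split; first exact: mE.
rewrite prb_E // big1 ?mul1r ?cardsT ?card_ord // => j.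
by rewrite finset.in_setT.
Qed.

End UniformCells.

Definition poisson_w (R : realType) (lam : R) k : R := lam ^+ k / k`!%:R * expR (- lam).

(** Splitting a Poisson variable by independent marks: two independent Poisson weights make the
    weight of their sum times a binomial probability. *)
Lemma poisson_w_split (R : realType) (lam z : R) n i : (i <= n)%N ->
  poisson_w (lam * z) i * poisson_w (lam * (1 - z)) (n - i) =
  poisson_w lam n * ('C(n, i)%:R * z ^+ i * (1 - z) ^+ (n - i)).
Proof.
move=> ni; have := bin_fact ni; move/(congr1 (fun k => k%:R : R)); rewrite !natrM => e.
have f1 : i`!%:R != 0 :> R by rewrite pnatr_eq0 -lt0n fact_gt0.
have f2 : (n - i)`!%:R != 0 :> R by rewrite pnatr_eq0 -lt0n fact_gt0.
have f3 : n`!%:R != 0 :> R by rewrite pnatr_eq0 -lt0n fact_gt0.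
have -> : 'C(n, i)%:R = n`!%:R / (i`!%:R * (n - i)`!%:R) :> R by rewrite -e mulfK // mulf_neq0.
rewrite /poisson_w.
have -> : lam ^+ n = lam ^+ i * lam ^+ (n - i) by rewrite -exprD subnKC.
have -> : expR (- lam) = expR (- (lam * z)) * expR (- (lam * (1 - z))).
  by rewrite -expRD; congr expR; ring.
by rewrite !exprMn; field; rewrite f1 f2.
Qed.

Section PoissonCells.
Context d (Omega : measurableType d) (R : realType) (P : probability Omega R).
Variables (rho : R) (N : Omega -> set R).
Hypothesis hN : poisson_process P rho N.
Variables (r : nat) (p : nat -> R).
Hypotheses (p_ndec : forall i, p i <= p i.+1) (p_ge0 : forall i, 0 <= p i) (p_lt1 : forall i, p i < 1).
Implicit Types (x y : R) (a n m i : nat) (w : Omega) (Q : pred nat) (c : nat -> nat) (A B : set R).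

Let z i : R := (p i.+1 - p i) / (1 - p i).

Let cell i : set R := `]p i, p i.+1]%classic.
Let rest i : set R := `]p i, 1%R]%classic.

Let cellE i x : cell i x = (p i < x <= p i.+1) :> Prop.
by rewrite /cell /= in_itv. Qed.

Let restE i x : rest i x = (p i < x <= 1) :> Prop.
by rewrite /rest /= in_itv. Qed.

Let mcell i : measurable (cell i). exact: measurable_itv. Qed.
Let mrest i : measurable (rest i). exact: measurable_itv. Qed.

Let finN w A : finite_set (N w `&` A).
by apply: sub_finite_set (poisson_process_finite hN w) => x []. Qed.

Lemma atom_countU A B w : A `&` B = set0 -> atom_count N (A `|` B) w = (atom_count N A w + atom_count N B w)%N.
Proof.
move=> AB; rewrite /atom_count setIUr fset_setU // cardfsU.
rewrite -fset_setI // (_ : N w `&` A `&` (N w `&` B) = set0) ?fset_set0 ?cardfs0 ?subn0 //.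
by rewrite setIACA setIid AB setI0.
Qed.

Lemma prb_atom_count A k : 0 < rho -> measurable A -> A `<=` `[0, 1]%classic ->
  prb P [set w | atom_count N A w = k] = poisson_w (rho * fine (lebesgue_measure A)) k.
Proof.
move=> rho0 mA A01; rewrite /prb.
have -> : [set w | atom_count N A w = k] = atom_count N A @^-1` [set k] by [].
rewrite (poisson_process_distribution hN [set k] mA A01) /poisson_prob.
have L0 : 0 <= rho * fine (lebesgue_measure A) by rewrite mulr_ge0 ?fine_ge0 // ltW.
case: ifPn => [lt0|].
  by rewrite esum_set1 /poisson_pmf ?lt0 // lee_fin mulr_ge0 ?expR_ge0 ?divr_ge0 ?exprn_ge0 ?ler0n.
rewrite lt_neqAle L0 andbT negbK => /eqP <-.
rewrite /poisson_w oppr0 expR0 mulr1 diracE expr0n; case: k => [|k] /=.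
  by rewrite mem_set // fact0 divr1.
by rewrite memNset // mul0r.
Qed.

Hypothesis rho0 : 0 < rho.

Let fine_itv x y : x <= y -> fine (lebesgue_measure `]x, y]%classic) = y - x.
move=> xy; rewrite lebesgue_measure_itv /= lte_fin; case: ltP => //= yx.
by apply/esym/eqP; rewrite subr_eq0 eq_le yx xy.
Qed.

Let sub01 x y : 0 <= x -> y <= 1 -> `]x, y]%classic `<=` `[0, 1]%classic.
by move=> x0 y1 t; rewrite /= !in_itv /= => /andP[xt ty]; rewrite (le_trans x0 (ltW xt)) (le_trans ty y1).
Qed.

Let prb_cell i k : prb P [set w | atom_count N (cell i) w = k] = poisson_w (rho * (p i.+1 - p i)) k.
by rewrite prb_atom_count // ?fine_itv //; apply: sub01 => //; exact: ltW. Qed.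

Let prb_rest i k : prb P [set w | atom_count N (rest i) w = k] = poisson_w (rho * (1 - p i)) k.
by rewrite prb_atom_count // ?fine_itv //; [exact: ltW | exact: sub01]. Qed.

Let cells a m w : nat := (\sum_(i <- iota a m) (atom_count N (cell i) w == r))%N.

(** [c] records the counts in the cells before [a], and [n] the count to the right of [p a]. These
    sets are disjoint, hence their counts independent. *)
Let E c a n m Q : set Omega := [set w | [&& [forall i : 'I_a, atom_count N (cell i) w == c i],
  atom_count N (rest a) w == n & Q (cells a m w)]].

Let upd c a k i := if i == a then k else c i.

Let rest_cell a w : atom_count N (rest a) w = (atom_count N (cell a) w + atom_count N (rest a.+1) w)%N.
rewrite -atom_countU; last first.
  apply/seteqP; split=> x //; rewrite /setI /= cellE restE => -[/andP[_ h] /andP[h' _]].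
  by move: (lt_le_trans h' h); rewrite ltxx.
congr (atom_count N _ w); apply/seteqP; split=> x; rewrite /setU /= !restE cellE.
  by move=> /andP[h ->]; case: (leP x (p a.+1)) => h'; [left; rewrite h | right].
move=> [/andP[-> h]|/andP[h ->]]; first by rewrite (le_trans h) // ltW.
by rewrite (le_lt_trans (p_ndec a) h).
Qed.

Let step c a n m Q w : \1_(E c a n m.+1 Q) w = \sum_(k < n.+1)
  \1_(E (upd c a k) a.+1 (n - k) m (fun j => Q ((k == r :> nat) + j)%N)) w :> R.
have key k : (k <= n)%N -> (w \in E (upd c a k) a.+1 (n - k) m (fun j => Q ((k == r) + j)%N)) =
    (atom_count N (cell a) w == k) && (w \in E c a n m.+1 Q).
  move=> kn; rewrite /E !mem_bool.
  have -> : [forall i : 'I_a.+1, atom_count N (cell i) w == upd c a k i] =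
      (atom_count N (cell a) w == k) && [forall i : 'I_a, atom_count N (cell i) w == c i].
    apply/forallP/andP => [h|[ha /forallP h] i].
      split; first by have := h ord_max; rewrite /upd eqxx.
      by apply/forallP => i; have := h (widen_ord (leqnSn a) i); rewrite /upd /= (ltn_eqF (ltn_ord i)).
    rewrite /upd; have [->//|ne] := eqVneq (nat_of_ord i) a.
    have ia : (i < a)%N by rewrite ltn_neqAle ne -ltnS ltn_ord. exact: h (Ordinal ia).
  have [ca|] := eqVneq (atom_count N (cell a) w) k => //=; rewrite (rest_cell a) ca -(eqn_add2l k) subnKC //.
  by rewrite {2}/cells /= big_cons ca.
rewrite [LHS]indicE; case: (boolP (w \in E c a n m.+1 Q)) => wE; last first.
  by rewrite big1 // => k _; rewrite indicE key -1?ltnS // (negbTE wE) andbF.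
have cn : (atom_count N (cell a) w < n.+1)%N.
  by move: wE; rewrite mem_bool => /and3P[_ /eqP <- _]; rewrite ltnS rest_cell leq_addr.
rewrite (bigD1 (Ordinal cn)) //= indicE key -1?ltnS // eqxx wE big1 ?addr0 // => k.
rewrite -val_eqE /= => ne; rewrite indicE key -1?ltnS // eq_sym (negbTE ne) //.
Qed.

Let A a (i : 'I_a.+1) : set R := if (i < a)%N then cell i else rest a.

Let mA a (i : 'I_a.+1) : measurable (A i).
by rewrite /A; case: ifP => _; [exact: mcell | exact: mrest]. Qed.

Let p_le i j : (i <= j)%N -> p i <= p j.
elim: j => [|j IH]; first by rewrite leqn0 => /eqP ->.
by rewrite leq_eqVlt => /predU1P[->//|/IH h]; exact: le_trans h (p_ndec j).
Qed.

Let A_itv a (i : 'I_a.+1) x : A i x -> p i < x /\ ((i < a)%N -> x <= p i.+1).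
rewrite /A; case: ifP => [ia|/negbT]; rewrite ?cellE ?restE.
  by move=> /andP[].
by rewrite -leqNgt => ai /andP[h _]; rewrite (_ : nat_of_ord i = a) //; apply/eqP; rewrite eqn_leq ai -ltnS ltn_ord.
Qed.

Let trivA a : trivIset setT (@A a).
apply/trivIsetP => i j _ _ ij; apply/seteqP; split=> x //= -[/A_itv[xi xi'] /A_itv[xj xj']].
have [h|h|/val_inj h] := ltngtP i j; last by rewrite h eqxx in ij.
- have := xi' (leq_trans h (ltn_ord j)).
  by rewrite leNgt (le_lt_trans (p_le h) xj).
- have := xj' (leq_trans h (ltn_ord i)).
  by rewrite leNgt (le_lt_trans (p_le h) xi).
Qed.

Let E0 c a n Q : E c a n 0 Q = [set w | forall i : 'I_a.+1,
  [set (if (i < a)%N then c i else n)] (atom_count N (A i) w)] `&` [set w | Q 0%N].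
apply/seteqP; split=> w; rewrite /E /A /= /cells big_nil.
  move=> /and3P[/forallP h /eqP rn q]; split=> // i.
  by case: ifP => [ia|_ //]; apply/eqP; exact: (h (Ordinal ia)).
move=> [h ->]; rewrite andbT; apply/andP; split; last by have := h ord_max; rewrite ltnn => ->.
by apply/forallP => i; have := h (widen_ord (leqnSn a) i); rewrite /= ltn_ord => ->.
Qed.

Let m_atom (B : set R) k : measurable B -> measurable [set w | atom_count N B w = k].
by move=> mB; have := poisson_process_measurable hN mB measurableT (Y := [set k]) I; rewrite setTI.
Qed.

Let mE c a n m Q : measurable (E c a n m Q).
elim: m c a n Q => [|m IH] c a n Q; last first.
  apply: (@measurable_indicE _ _ R); have /funext -> := step c a n m Q.
  suff : bmfun (fun w => \sum_(k < n.+1)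
    \1_(E (upd c a k) a.+1 (n - k) m (fun j => Q ((k == r :> nat) + j)%N)) w : R) by case.
  by apply: bmfun_sum => k _; apply: bmfun_indic.
rewrite E0; apply: measurableI; last by case: (Q 0%N); rewrite ?set_true ?set_false.
rewrite (_ : [set w | _] = \bigcap_(i in [set: 'I_a.+1])
  [set w | atom_count N (A i) w = if (i < a)%N then c i else n]).
  by apply: fin_bigcap_measurable => // i _; apply: m_atom; exact: mA.
by apply/seteqP; split=> w h i; [move=> _; exact: (h i) | exact: (h i)].
Qed.

Let prb_E c a n m Q : prb P (E c a n m Q) =
  \prod_(i < a) poisson_w (rho * (p i.+1 - p i)) (c i) * poisson_w (rho * (1 - p a)) n *
    occupancy r [seq z i | i <- iota a m] n (fun k => (Q k)%:R).
elim: m c a n Q => [|m IH] c a n Q.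
  rewrite E0 /=; case: (Q 0%N); last first.
    by rewrite (_ : [set _ | false] = set0) ?setI0 /prb ?measure0 ?mulr0 //; apply/seteqP; split.
  rewrite (_ : [set _ | true] = setT) ?setIT ?mulr1; last by apply/seteqP; split.
  rewrite /prb (mutually_independentT (X := fun i : 'I_a.+1 => atom_count N (A i))
    (B := fun i : 'I_a.+1 => [set (if (i < a)%N then c i else n)])) //; last first.
    by apply: (poisson_process_independent hN); [exact: mA | exact: trivA].
  rewrite (eq_bigr (fun i : 'I_a.+1 => (prb P
    [set w | atom_count N (A i) w = if (i < a)%N then c i else n])%:E)); last first.
    by move=> i _; rewrite prbE //; apply: m_atom; exact: mA.
  rewrite prodEFin /= big_ord_recr /=; congr (_ * _); last by rewrite /A ltnn prb_rest.
  by apply: eq_bigr => i _; rewrite /A /= ltn_ord prb_cell.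
rewrite (prb_sum P _ _ (step c a n m Q)) //.
rewrite /= mulr_sumr; apply: eq_bigr => k _.
have ua : upd c a k a = k by rewrite /upd eqxx.
rewrite IH big_ord_recr /= ua.
have -> : \prod_(i < a) poisson_w (rho * (p i.+1 - p i)) (upd c a k i) =
    \prod_(i < a) poisson_w (rho * (p i.+1 - p i)) (c i).
  by apply: eq_bigr => i _; rewrite /upd (ltn_eqF (ltn_ord i)).
have pa : 1 - p a != 0 by rewrite subr_eq0 eq_sym lt_eqF.
have e1 : rho * (p a.+1 - p a) = rho * (1 - p a) * z a by rewrite /z -mulrA (mulrC (1 - p a)) divfK.
have e2 : rho * (1 - p a.+1) = rho * (1 - p a) * (1 - z a) by rewrite (mulrBr _ 1 (z a)) -e1; ring.
rewrite e1 e2 -(mulrA (\prod_(i < a) _)) poisson_w_split -1?ltnS //.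
by move: (poisson_w _ n) (\prod_(i < a) _) => pw pp; rewrite !mulrA.
Qed.

Lemma poisson_cell_count n l Q : measurable [set w | (atom_count N `]p 0%N, 1%R]%classic w == n) &&
    Q (cell_count p l (enum_fset (fset_set (N w))) r)] /\
  prb P [set w | (atom_count N `]p 0%N, 1%R]%classic w == n) &&
    Q (cell_count p l (enum_fset (fset_set (N w))) r)] =
  poisson_w (rho * (1 - p 0%N)) n * occupancy r [seq z i | i <- iota 0 l] n (fun k => (Q k)%:R).
Proof.
set B := [set w | _].
have -> : B = E (fun=> 0%N) 0 n l Q.
  apply/funext => w; apply/propext; rewrite /B /E /=.
  have -> : [forall i : 'I_0, atom_count N (cell i) w == 0%N] by apply/forallP => -[].
  have -> : cell_count p l (enum_fset (fset_set (N w))) r = cells 0 l w => //.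
  rewrite /cell_count /cells -[in RHS](subn0 l) -/(index_iota 0 l) big_mkord.
  apply: eq_bigr => i _; congr (nat_of_bool (_ == r)). rewrite /atom_count -size_filter.
  have -> : fset_set (N w `&` cell i) =
      [fset x in [seq x <- enum_fset (fset_set (N w)) | p i < x <= p i.+1]]%fset.
    apply/fsetP => x; rewrite !inE in_fset_set // mem_filter; apply/idP/andP.
      rewrite inE => -[Nx]; rewrite cellE => h; split=> //.
      by rewrite in_fset_set ?inE //; exact: (poisson_process_finite hN).
    case=> h; rewrite in_fset_set ?inE; last exact: (poisson_process_finite hN).
    by split=> //; rewrite cellE.
  by rewrite card_fseq undup_id // filter_uniq // fset_uniq.
by split; [exact: mE | rewrite prb_E big_ord0 mul1r].
Qed.

End PoissonCells.

(** * Law of the cells of a random grid, and its limit *)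

Lemma cvgr_sum (R : realType) (T I : Type) (G : set_system T) (FG : Filter G) (s : seq I) (Q : pred I)
    (f : I -> T -> R) (l : I -> R) : (forall i, Q i -> f i x @[x --> G] --> l i) ->
  (\sum_(i <- s | Q i) f i x) @[x --> G] --> \sum_(i <- s | Q i) l i.
Proof.
move=> hf; elim: s => [|i s IH].
  by rewrite big_nil; under eq_fun do rewrite big_nil; exact: cvg_cst.
rewrite big_cons; under eq_fun do rewrite big_cons.
by have [Qi|_] := boolP (Q i) => //; apply: cvgD => //; exact: hf.
Qed.

Section CellLaw.
Variables (R : realType) (F : nat -> R) (r : nat).
Implicit Types (n m j k : nat) (psi : nat -> R).

(** With [F j] the Laplace transform at [j] of one increment, this is the probability that exactly
    [j] of [n] points lie beyond the first cell. *)
Definition cell_weight n j : R := newton_op F (delta R j) n.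

Fixpoint cell_law m n psi : R :=
  if m is m'.+1 then \sum_(j < n.+1) cell_weight n j *
    cell_law m' j (fun k => psi ((n - j == r) + k)%N)
  else psi 0%N.

Hypothesis F0 : F 0%N = 1.

Lemma sum_cell_weight n (g : nat -> R) : \sum_(j < n.+1) cell_weight n j * g j = newton_op F g n.
Proof. by rewrite newton_op_rates; apply: eq_bigr => j _; rewrite mulrC. Qed.

Lemma sum_cell_weight1 n : \sum_(j < n.+1) cell_weight n j = 1.
Proof.
transitivity (\sum_(j < n.+1) cell_weight n j * 1); first by apply: eq_bigr => j _; rewrite mulr1.
by rewrite (sum_cell_weight n (fun=> 1)) newton_op_cst F0 mul1r.
Qed.

Lemma cell_law_sum m n (I : Type) (s : seq I) (psi : I -> nat -> R) (c : I -> R) :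
  cell_law m n (fun k => \sum_(i <- s) c i * psi i k) = \sum_(i <- s) c i * cell_law m n (psi i).
Proof.
elim: m n psi => //= m IH n psi.
under eq_bigr do rewrite IH mulr_sumr.
rewrite exchange_big /=; apply: eq_bigr => i _.
by rewrite mulr_sumr; apply: eq_bigr => j _; rewrite mulrCA.
Qed.

Hypotheses (r_gt0 : (0 < r)%N) (w_ge0 : forall n j, 0 <= cell_weight n j).

Lemma shift_le n j k : (j <= n)%N -> (k <= j)%N -> ((n - j == r) + k <= n)%N.
Proof.
move=> jn kj; case: eqP => /= [e|_]; last by rewrite add0n (leq_trans kj).
by rewrite add1n (leq_ltn_trans kj) // ltnNge -subn_eq0 e -lt0n.
Qed.

Lemma eq_cell_law m n psi psi' : (forall k, (k <= n)%N -> psi k = psi' k) ->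
  cell_law m n psi = cell_law m n psi'.
Proof.
elim: m n psi psi' => [|m IH] n psi psi' h; first exact: h.
apply: eq_bigr => j _; congr (_ * _); apply: IH => k kj; apply: h.
by apply: shift_le => //; rewrite -ltnS.
Qed.

(** The weights sum to 1 and the term [j = n], an empty cell, is moved to the other side; as [r > 0]
    such a cell is not counted. *)
Lemma cell_law_step m n psi : \sum_(j < n) cell_weight n j *
  (cell_law m n psi - cell_law m j (fun k => psi ((n - j == r) + k)%N)) =
  cell_law m n psi - cell_law m.+1 n psi.
Proof.
have := sum_cell_weight1 n; rewrite big_ord_recr /= => /eqP; rewrite eq_sym -subr_eq => /eqP e.
rewrite big_ord_recr /= subnn eq_sym (gtn_eqF r_gt0) /=.
under eq_bigr do rewrite mulrBr.
rewrite sumrB -mulr_suml -e; rewrite (_ : (fun k => psi (0 + k)%N) = psi) //; ring.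
Qed.

Lemma newton_natr j : newton (fun k => k%:R : R) j = (j == 1%N)%:R.
Proof.
apply: (@newton_uniq _ _ (fun j => (j == 1%N)%:R)) => n; case: n => [|n].
  by rewrite big_ord1 mul0r.
rewrite (bigD1 (Ordinal (erefl : (1 < n.+2)%N))) //= bin1 mul1r big1 ?addr0 // => i.
by rewrite -val_eqE /= => /negbTE ->; rewrite mul0r.
Qed.

Lemma sum_cell_weight_natr n : \sum_(j < n.+1) cell_weight n j * j%:R = n%:R * F 1%N.
Proof.
rewrite (sum_cell_weight n (fun j => j%:R)) /newton_op; case: n => [|n].
  by rewrite big_ord1 newton_natr mulr0 !mul0r.
rewrite (bigD1 (Ordinal (erefl : (1 < n.+2)%N))) //= bin1 newton_natr mulr1 big1 ?addr0 1?mulrC // => i.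
by rewrite -val_eqE /= newton_natr => /negbTE ->; rewrite mulr0 mul0r.
Qed.

(** One more cell matters only if a point remains beyond the first [m] cells, and the mean number of
    such points is [n * F 1 ^+ m]. *)
Lemma cell_law_lipschitz m n psi M : (forall k, `|psi k| <= M) ->
  `|cell_law m.+1 n psi - cell_law m n psi| <= 2 * M * n%:R * F 1%N ^+ m.
Proof.
elim: m n psi => [|m IH] n psi hM.
  rewrite expr0 mulr1 distrC -cell_law_step (le_trans (ler_norm_sum _ _ _)) //.
  have M0 : 0 <= 2 * M by rewrite mulr_ge0 // (le_trans _ (hM 0%N)).
  apply: (@le_trans _ _ (\sum_(j < n) cell_weight n j * (2 * M))).
    apply: ler_sum => j _; rewrite normrM ger0_norm // ler_wpM2l //.
    by rewrite /= (le_trans (ler_normB _ _)) // mulr_natl mulr2n lerD.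
  rewrite -mulr_suml mulrC ler_wpM2l //; case: n => [|n]; first by rewrite big_ord0.
  rewrite (@le_trans _ _ 1) ?ler1n //.
  by rewrite -(sum_cell_weight1 n.+1) [leRHS]big_ord_recr /= lerDl.
have -> : cell_law m.+2 n psi - cell_law m.+1 n psi = \sum_(j < n.+1) cell_weight n j *
    (cell_law m.+1 j (fun k => psi ((n - j == r) + k)%N) - cell_law m j (fun k => psi ((n - j == r) + k)%N)).
  by rewrite [LHS]/= -sumrB; apply: eq_bigr => j _; rewrite -mulrBr.
rewrite (le_trans (ler_norm_sum _ _ _)) //.
apply: (@le_trans _ _ (\sum_(j < n.+1) cell_weight n j * (2 * M * j%:R * F 1%N ^+ m))).
  by apply: ler_sum => j _; rewrite normrM ger0_norm // ler_wpM2l // IH.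
have -> : \sum_(j < n.+1) cell_weight n j * (2 * M * j%:R * F 1%N ^+ m) =
    2 * M * F 1%N ^+ m * \sum_(j < n.+1) cell_weight n j * j%:R.
  by rewrite mulr_sumr; apply: eq_bigr => j _; ring.
rewrite sum_cell_weight_natr exprS; apply: le_of_eq; ring.
Qed.

End CellLaw.

Section CellLawLimit.
Variables (R : realType) (nu : {measure set R -> \bar R}) (r : nat).
Let Phi j : R := laplace_exp nu j%:R.
Let step k : R := 2%:R ^- k.
Let F k j : R := expR (- (step k * Phi j)).
(** [4^k] cells of duration [2^-k] cover the times up to [2^k]: the mesh tends to 0 and the horizon
    to infinity. *)
Let L k n psi := cell_law (F k) r (4 ^ k) n psi.
Hypotheses (r_gt0 : (0 < r)%N) (w_ge0 : forall k n j, 0 <= cell_weight (F k) n j) (Phi0 : Phi 0%N = 0).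
Hypothesis Phi1 : 0 < Phi 1%N.

Let step_gt0 k : 0 < step k. by rewrite invr_gt0 exprn_gt0. Qed.

Let cvg_step : step k @[k --> \oo] --> (0 : R).
have h : `|2^-1 : R| < 1 by rewrite ger0_norm ?invr_ge0 // invf_lt1 // ltr1n.
apply: cvg_trans (cvg_geometric 1 h); apply: near_eq_cvg; apply: nearW => k.
by rewrite /= mul1r exprVn.
Qed.

Let expRN_bound (x : R) : 0 <= x -> 1 - x <= expR (- x) <= 1 - x + x ^+ 2.
move=> x0; apply/andP; split; first exact: expR_ge1Dx.
rewrite expRN -(ler_pM2l (expR_gt0 x)) mulfV ?gt_eqF ?expR_gt0 //.
have h1 : 1 + x <= expR x by exact: expR_ge1Dx.
have h2 : 0 <= 1 - x + x ^+ 2 by rewrite (_ : _ + _ = (x - 2^-1) ^+ 2 + 3 / 4) ?addr_ge0 ?sqr_ge0 //; field.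
apply: le_trans (ler_wpM2r h2 h1).
have h3 : 0 <= x ^+ 3 by rewrite exprn_ge0.
by rewrite (_ : _ * _ = 1 + x ^+ 3) ?lerDl //; ring.
Qed.

Hypothesis Phi_ge0 : forall j, 0 <= Phi j.

Let cvg_F j : (2%:R ^+ k * (F k j - 1)) @[k --> \oo] --> - Phi j.
apply: (@squeeze_cvgr _ _ _ _ (fun=> - Phi j) (fun k => - Phi j + step k * Phi j ^+ 2)); last first.
- rewrite -[X in _ --> X]addr0; apply: cvgD; first exact: cvg_cst.
  by rewrite -(mul0r (Phi j ^+ 2)); apply: cvgMl.
- exact: cvg_cst.
apply: nearW => k; have x0 : 0 <= step k * Phi j by rewrite mulr_ge0 // ltW.
have /andP[l u] := expRN_bound x0.
have p2 : 0 <= 2%:R ^+ k :> R by rewrite exprn_ge0.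
have ps : 2%:R ^+ k * step k = 1 by rewrite /step mulfV // expf_neq0.
apply/andP; split.
  have := ler_wpM2l p2 l; rewrite mulrBr mulrA ps mul1r mulr1 /F mulrBr mulr1.
  by move=> h; rewrite lerBrDl.
have := ler_wpM2l p2 u; rewrite mulrDr mulrBr exprMn mulrA [X in _ + X]mulrA ps mul1r mulr1.
rewrite expr2 [X in _ + X * _]mulrA ps mul1r /F mulrBr mulr1; lra.
Qed.

Lemma cvg_cell_weight n j : (j < n)%N ->
  (2%:R ^+ k * cell_weight (F k) n j) @[k --> \oo] --> rate nu n j.
Proof.
move=> jn.
have -> : (fun k => 2%:R ^+ k * cell_weight (F k) n j) =
    (fun k => newton_op (fun i => 2%:R ^+ k * (F k i - 1)) (delta R j) n).
  apply/funext => k; rewrite newton_opZl newton_opBl newton_op1.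
  by rewrite {2}/delta (ltn_eqF jn) subr0.
have -> : rate nu n j = newton_op (fun i => - Phi i) (delta R j) n.
  rewrite /rate -[LHS]mulN1r -newton_opZl; apply: eq_newton_op => i _; exact: mulN1r.
apply: cvgr_sum => i _; apply: cvgMl; apply: cvgMl; exact: cvg_F.
Qed.

(** The mass beyond the horizon is [e^(- 2^k Phi(1))], negligible even after multiplication by
    [2^k]. *)
Let cvg_error C : (2%:R ^+ k * (C * F k 1%N ^+ (4 ^ k))) @[k --> \oo] --> 0.
have P2 : Phi 1%N ^+ 2 != 0 by rewrite expf_neq0 // gt_eqF.
pose D := `|C| * (4 / Phi 1%N ^+ 2).
have b k : `|2%:R ^+ k * (C * F k 1%N ^+ (4 ^ k))| <= D * step k.
  have e : F k 1%N ^+ (4 ^ k) = expR (- (2%:R ^+ k * Phi 1%N)).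
    rewrite /F -expRM_natl; congr expR; rewrite (_ : (4 ^ k)%:R = 2%:R ^+ k * 2%:R ^+ k) /step; last first.
      by rewrite natrX -exprMn -natrM.
    by rewrite mulrN; congr (- _); field; rewrite expf_neq0.
  set t : R := 2%:R ^+ k * Phi 1%N in e. have t0 : 0 < t by rewrite mulr_gt0 // exprn_gt0.
  have ht : t ^+ 2 / 4 <= expR t.
    have h1 : t / 2 <= expR (t / 2) by apply: le_trans (expR_ge1Dx _); rewrite lerDr.
    rewrite (_ : t = t / 2 + t / 2); last by field.
    rewrite expRD; apply: le_trans (ler_pM _ _ h1 h1); try by rewrite divr_ge0 // ltW.
    by apply: le_of_eq; field.
  have t2 : 0 < t ^+ 2 / 4 by rewrite divr_gt0 // exprn_gt0.
  have p0 : 0 < 2%:R ^+ k :> R by rewrite exprn_gt0.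
  rewrite e expRN !normrM (ger0_norm (ltW p0)) (@ger0_norm _ (expR t)^-1) ?invr_ge0 ?expR_ge0 //.
  rewrite (_ : D * step k = 2%:R ^+ k * (`|C| * (t ^+ 2 / 4)^-1)); last first.
    by rewrite /D /t /step; field; rewrite gt_eqF // expf_neq0.
  by rewrite ler_wpM2l ?(ltW p0) // ler_wpM2l // lef_pV2 // posrE expR_gt0.
apply/norm_cvg0P; apply: (@squeeze_cvgr _ _ _ _ (fun=> 0) (fun k => D * step k)).
- by apply: nearW => k; rewrite normr_ge0 b.
- exact: cvg_cst.
- by rewrite -(mulr0 D); apply: cvgMr.
Qed.

(** The exact identity [cell_law_step] multiplied by [2^k]: the weights tend to the rates, and the
    right-hand side, the effect of one more cell, to 0. *)
Lemma cell_law_recursion (pi : nat -> (nat -> R) -> R) n psi M : (forall k, `|psi k| <= M) ->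
  (forall j h, (j <= n)%N -> (forall k, `|h k| <= M) -> L k j h @[k --> \oo] --> pi j h) ->
  \sum_(j < n) rate nu n j * (pi n psi - pi j (fun k => psi ((n - j == r) + k)%N)) = 0.
Proof.
move=> hM hL.
have c1 : (2%:R ^+ k * (L k n psi - cell_law (F k) r (4 ^ k).+1 n psi)) @[k --> \oo] -->
    \sum_(j < n) rate nu n j * (pi n psi - pi j (fun k => psi ((n - j == r) + k)%N)).
  have -> : (fun k => 2%:R ^+ k * (L k n psi - cell_law (F k) r (4 ^ k).+1 n psi)) =
      (fun k => \sum_(j < n) (2%:R ^+ k * cell_weight (F k) n j) *
        (L k n psi - L k j (fun i => psi ((n - j == r) + i)%N))).
    apply/funext => k; rewrite -cell_law_step // ?mulr_sumr; last first.
      by rewrite /F Phi0 mulr0 oppr0 expR0.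
    by apply: eq_bigr => j _; rewrite mulrA.
  apply: cvgr_sum => j _; apply: cvgM; first exact: cvg_cell_weight.
  by apply: cvgB; apply: hL => //; exact: ltnW.
have c2 : (2%:R ^+ k * (L k n psi - cell_law (F k) r (4 ^ k).+1 n psi)) @[k --> \oo] --> 0.
  apply/norm_cvg0P; apply: (@squeeze_cvgr _ _ _ _ (fun=> 0)
    (fun k => 2%:R ^+ k * ((2 * M * n%:R) * F k 1%N ^+ (4 ^ k)))); last 2 first.
  - exact: cvg_cst.
  - exact: cvg_error.
  apply: nearW => k; rewrite normr_ge0 normrM ger0_norm ?exprn_ge0 // ler_wpM2l ?exprn_ge0 //.
  by rewrite distrC cell_law_lipschitz // /F Phi0 mulr0 oppr0 expR0.
exact: cvg_unique c1 c2.
Qed.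

End CellLawLimit.

(** * The grid cut out by a subordinator *)

Lemma prod_dist (R : realDomainType) (I : Type) (s : seq I) (x y : I -> R) :
  (forall i, 0 <= x i <= 1) -> (forall i, 0 <= y i <= 1) ->
  `|\prod_(i <- s) x i - \prod_(i <- s) y i| <= \sum_(i <- s) `|x i - y i|.
Proof.
move=> hx hy; elim: s => [|i s IH]; first by rewrite !big_nil subrr normr0.
rewrite !big_cons.
have -> : x i * \prod_(j <- s) x j - y i * \prod_(j <- s) y j =
    (x i - y i) * \prod_(j <- s) x j + y i * (\prod_(j <- s) x j - \prod_(j <- s) y j) by ring.
rewrite (le_trans (ler_normD _ _)) // !normrM lerD //.
  rewrite ler_piMr // ger0_norm ?prodr_ge0 //; last by move=> j _; case/andP: (hx j).
  by apply: prodr_ile1 => j _; exact: hx.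
have /andP[y0 y1] := hy i; apply: le_trans IH; rewrite ger0_norm // ler_piMl //.
Qed.

Lemma ge0_le_dist (R : realType) (x y : R) (C : R) :
  (forall M, (0 < M)%N -> `|x - y| <= C / M%:R) -> x = y.
Proof.
move=> h; apply/eqP; rewrite -subr_eq0 -normr_le0; apply/ler_addgt0Pl => e e0; rewrite addr0.
have C0 : 0 <= C by have := h 1%N isT; rewrite divr1; exact: le_trans.
have hb := archi_boundP (divr_ge0 C0 (ltW e0)).
have M0 : (0 < Num.bound (C / e))%N by rewrite -(ltr_nat R) (le_lt_trans _ hb) // divr_ge0 // ltW.
apply: le_trans (h _ M0) _.
by rewrite ler_pdivrMr ?ltr0n // mulrC -ler_pdivrMr // ltW.
Qed.

Section Quantization.
Variable R : realType.

(** A combination of indicators of half-lines, within [1 / M] of [x]. Independence yields the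
    product formula for such events, and uniform approximation extends it to expectations. *)
Definition quantize M (x : R) : R := M%:R^-1 * \sum_(q < M) (q.+1%:R / M%:R <= x)%R%:R.

Lemma quantize_bound M (x : R) : (0 < M)%N -> 0 <= x <= 1 ->
  0 <= quantize M x <= 1 /\ `|x - quantize M x| <= M%:R^-1.
Proof.
move=> M0 /andP[x0 x1]; have M0' : 0 < M%:R :> R by rewrite ltr0n.
pose k := Num.truncn (M%:R * x).
have Mx0 : 0 <= M%:R * x by rewrite mulr_ge0 // ltW.
have /andP[kx xk] := truncn_itv Mx0; rewrite -/k in kx xk.
have kM : (k <= M)%N.
  by rewrite -(ler_nat R) (le_trans kx) // -[leRHS]mulr1 ler_wpM2l // ltW.
have q_k : quantize M x = k%:R / M%:R.
  rewrite /quantize mulrC; congr (_ / _).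
  have -> : \sum_(q < M) (q.+1%:R / M%:R <= x)%R%:R = \sum_(q < M) (q < k)%N%:R :> R.
    apply: eq_bigr => q _; congr (nat_of_bool _)%:R.
    rewrite ler_pdivrMr // mulrC; apply/idP/idP => h.
      by rewrite -ltnS -(ltr_nat R) (le_lt_trans h).
    by rewrite (le_trans _ kx) // ler_nat.
  rewrite -natr_sum; congr (_%:R). transitivity (\sum_(q < M | (q < k)%N) 1)%N.
    by rewrite [RHS]big_mkcond; apply: eq_bigr => q _; case: ifP.
  by rewrite -(big_ord_widen _ (fun=> 1%N) kM) sum1_card card_ord.
rewrite q_k; split.
  by rewrite divr_ge0 //= ler_pdivrMr // mul1r ler_nat.
rewrite -(ler_pM2l M0') mulfV ?gt_eqF // -[M%:R as X in X * _]ger0_norm ?(ltW M0') //.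
rewrite -normrM mulrBr mulrCA mulfV ?gt_eqF // mulr1 ger0_norm ?subr_ge0 //.
by rewrite lerBlDl -natr1 in xk *; rewrite ltW.
Qed.
End Quantization.

Section IndependentProduct.
Context d (Omega : measurableType d) (R : realType) (P : probability Omega R).
Variables (l : nat) (X : 'I_l -> Omega -> R).
Hypotheses (mX : forall i, measurable_fun setT (X i)) (X01 : forall i w, 0 <= X i w <= 1).
Hypothesis indep : forall t : 'I_l -> R,
  prb P [set w | forall i, t i <= X i w] = \prod_i prb P [set w | t i <= X i w].

Let mge (i : 'I_l) (t : R) : measurable [set w | t <= X i w].
have := mX i measurableT (measurable_itv `[t, +oo[); rewrite setTI.
by congr measurable; apply/seteqP; split=> w; rewrite /= in_itv /= andbT.
Qed.

Let bX i : bmfun (X i).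
by split=> //; exists 1 => w; have /andP[h ?] := X01 i w; rewrite ger0_norm. Qed.

Let XM M i w := quantize M (X i w).

Let XM_indic M i w : XM M i w = \sum_(q < M) M%:R^-1 * \1_[set w | q.+1%:R / M%:R <= X i w] w.
rewrite /XM /quantize mulr_sumr; apply: eq_bigr => q _; congr (_ * _).
by rewrite indicE mem_bool.
Qed.

Let bXM M i : bmfun (XM M i).
have /funext -> := XM_indic M i; apply: bmfun_sum => q _.
by apply: bmfunZ; exact: bmfun_indic.
Qed.

Let mean_XM M i : mean P (XM M i) = \sum_(q < M) M%:R^-1 * prb P [set w | q.+1%:R / M%:R <= X i w].
have /funext -> := XM_indic M i; rewrite mean_sum; last first.
  by move=> q _; apply: bmfunZ; exact: bmfun_indic.
by apply: eq_bigr => q _; rewrite meanZ ?mean_indic //; exact: bmfun_indic.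
Qed.

Let mean_prod_XM M : mean P (fun w => \prod_i XM M i w) = \prod_i mean P (XM M i).
rewrite (eq_bigr _ (fun i _ => mean_XM M i)) bigA_distr_bigA /=.
have e w : \prod_i XM M i w = \sum_(f : {ffun 'I_l -> 'I_M})
    M%:R^-1 ^+ l * \1_[set w | forall i, (f i).+1%:R / M%:R <= X i w] w.
  rewrite (eq_bigr _ (fun i _ => XM_indic M i w)) bigA_distr_bigA /=.
  apply: eq_bigr => f _; rewrite big_split /= prodr_const card_ord; congr (_ * _).
  rewrite indicE; case: (boolP (w \in _)) => [|/negP h].
    by rewrite inE => h; rewrite big1 // => i _; rewrite indicE mem_bool h.
  have /existsNP[i /negP hi] : ~ forall i, (f i).+1%:R / M%:R <= X i w by move=> h'; apply: h; rewrite inE.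
  by rewrite (bigD1 i) //= indicE mem_bool (negbTE hi) mul0r.
have mf (f : {ffun 'I_l -> 'I_M}) : measurable [set w | forall i, (f i).+1%:R / M%:R <= X i w].
  rewrite (_ : [set w | _] = \bigcap_(i in setT) [set w | (f i).+1%:R / M%:R <= X i w]).
    by apply: fin_bigcap_measurable; [exact: finite_finset | move=> i _; exact: mge].
  by apply/seteqP; split=> w h i; [move=> _; exact: (h i) | exact: (h i)].
rewrite (eq_mean P e) mean_sum; last first.
  by move=> f _; apply: bmfunZ; exact: bmfun_indic.
apply: eq_bigr => f _; rewrite meanZ ?mean_indic //; last exact: bmfun_indic.
by rewrite indep big_split /= prodr_const card_ord.
Qed.

Lemma mean_prod : mean P (fun w => \prod_i X i w) = \prod_i mean P (X i).
Proof.
apply: (@ge0_le_dist _ _ _ (2 * l%:R)) => M M0.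
have m01 f : bmfun f -> (forall w, 0 <= f w <= 1) -> 0 <= mean P f <= 1.
  move=> bf f01; rewrite -{1}(mean_cst P 0) -(mean_cst P 1).
  by rewrite !le_mean //; try (exact: bmfun_cst); move=> w; case/andP: (f01 w).
have bd i w := (quantize_bound M0 (X01 i w)).
have e1 : `|mean P (fun w => \prod_i X i w) - mean P (fun w => \prod_i XM M i w)| <= l%:R / M%:R.
  have b1 : bmfun (fun w => \prod_i X i w) by apply: bmfun_prod.
  have b2 : bmfun (fun w => -1 * \prod_i XM M i w).
    by apply: bmfunZ; apply: bmfun_prod => i _; exact: bXM.
  rewrite -mulN1r -meanZ; last by apply: bmfun_prod => i _; exact: bXM.
  rewrite -meanD // (le_trans (ler_norm_mean P (bmfunD b1 b2))) //.
  rewrite -(mean_cst P (l%:R / M%:R)); apply: le_mean.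
  - have [m3 [C hC]] := bmfunD b1 b2; split; first exact: measurableT_comp.
    by exists C => w; rewrite normr_id.
  - exact: bmfun_cst.
  move=> w; rewrite mulN1r (le_trans (prod_dist _ _ _)) //; first by move=> i; case: (bd i w).
  rewrite (@le_trans _ _ (\sum_(i < l) M%:R^-1)) //.
    by apply: ler_sum => i _; case: (bd i w).
  by rewrite sumr_const card_ord mulr_natl.
have e2 : `|\prod_i mean P (XM M i) - \prod_i mean P (X i)| <= l%:R / M%:R.
  rewrite (le_trans (prod_dist _ _ _)) //.
  - by move=> i; apply: m01 => // w; case: (bd i w).
  - by move=> i; apply: m01.
  rewrite (@le_trans _ _ (\sum_(i < l) M%:R^-1)) //; last by rewrite sumr_const card_ord mulr_natl.
  apply: ler_sum => i _; rewrite -[X in _ - X]mul1r -[X in X * mean _ _]opprK mulNr opprK.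
  rewrite -meanZ // -meanD //; last exact: bmfunZ.
  rewrite (le_trans (ler_norm_mean P _)) //; first by apply: bmfunD => //; exact: bmfunZ.
  rewrite -(mean_cst P M%:R^-1); apply: le_mean.
  - have [m3 [C hC]] := bmfunD (bXM M i) (bmfunZ (-1) (bX i)).
    split; first exact: measurableT_comp. by exists C => w; rewrite normr_id.
  - exact: bmfun_cst. by move=> w; rewrite mulN1r distrC; case: (bd i w).
rewrite mean_prod_XM in e1.
have := ler_distD (\prod_i mean P (XM M i)) (mean P (fun w => \prod_i X i w)) (\prod_i mean P (X i)).
by move/le_trans; apply; rewrite (le_trans (lerD e1 e2)) // -mulrDl; apply: le_of_eq; ring.
Qed.
End IndependentProduct.

Lemma eq_law_mean (d : measure_display) (Omega : measurableType d) (R : realType) (P : probability Omega R)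
    (X Y : Omega -> R) (f : R -> R) : measurable_fun setT X -> measurable_fun setT Y ->
  (forall B, measurable B -> P (X @^-1` B) = P (Y @^-1` B)) ->
  measurable_fun setT f -> (forall x, 0 <= f x) -> mean P (f \o X) = mean P (f \o Y).
Proof.
move=> mX mY XY mf f0; rewrite /mean unlock; congr fine.
have mfe : measurable_fun setT (EFin \o f) by apply/measurable_EFinP.
have f0e : {in [set: R], forall y, (0 <= (EFin \o f) y)%E} by move=> y _; rewrite lee_fin.
have h := ge0_integral_pushforward mX P measurableT mfe f0e.
have h' := ge0_integral_pushforward mY P measurableT mfe f0e.
transitivity (\int[P]_(x in X @^-1` [set: R]) ((EFin \o f) \o X) x)%E; first by [].
transitivity (\int[P]_(x in Y @^-1` [set: R]) ((EFin \o f) \o Y) x)%E; last by [].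
by rewrite -h -h'; apply: eq_measure_integral => A mA _; exact: XY.
Qed.

Lemma thinning_delta (R : realType) (y : R) j n : (j <= n)%N ->
  thinning y (delta R j) n = 'C(n, j)%:R * expR (- y) ^+ j * (1 - expR (- y)) ^+ (n - j).
Proof.
move=> jn; rewrite thinningE (bigD1 (Ordinal (jn : (j < n.+1)%N))) //= /delta eqxx mulr1.
rewrite big1 ?addr0 // => i; rewrite -val_eqE /= eq_sym => /negbTE ->; exact: mulr0.
Qed.

Lemma thinning_delta_itv (R : realType) (y : R) j n : 0 <= y -> 0 <= thinning y (delta R j) n <= 1.
Proof.
move=> y0; apply/andP; split; first by apply: thinning_ge0 => // k _; exact: ler0n.
rewrite -(thinning_cst y 1 n); apply: le_thinning => // k _.
by rewrite /delta lern1 leq_b1.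
Qed.

Lemma mutually_independent_ord (d d' : measure_display) (Omega : measurableType d)
    (T : measurableType d') (R : realType) (P : probability Omega R)
    (X : nat -> Omega -> T) (B : nat -> set T) a : mutually_independent P X ->
  (forall i, measurable (B i)) ->
  P [set w | forall i : 'I_a, B i (X i w)] = (\prod_(i < a) P (X i @^-1` B i))%E.
Proof.
move=> hX mB; have := hX [fset i in iota 0 a]%fset B mB.
have -> : \bigcap_(i in [set` [fset i in iota 0 a]%fset]) X i @^-1` B i =
    [set w | forall i : 'I_a, B i (X i w)].
  apply/seteqP; split=> w h i.
  - by apply: h; rewrite /= inE mem_iota /= add0n ltn_ord.
  - by rewrite /= inE mem_iota /= add0n => ia; exact: (h (Ordinal ia)).
move=> ->; rewrite -(big_mkord xpredT (fun i => P (X i @^-1` B i))).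
apply: perm_big; apply: uniq_perm; rewrite ?fset_uniq ?iota_uniq // => i.
by rewrite inE mem_index_iota mem_iota.
Qed.

Section SubordinatorCells.
Context d (Omega : measurableType d) (R : realType) (P : probability Omega R).
Variables (S : R -> Omega -> R) (nu : {measure set R -> \bar R}).
Hypothesis hS : driftless_subordinator P S nu.
Variables (h : R) (r : nat).
Hypothesis h_gt0 : 0 < h.
Implicit Types (n m j k i a : nat) (psi : nat -> R) (w : Omega).

Let sub : subordinator P S. by case: hS. Qed.
Let t i : R := h * i%:R.

Let t_ge0 i : 0 <= t i. by rewrite mulr_ge0 // ltW. Qed.
Let t_ndec i j : (i <= j)%N -> t i <= t j. by move=> ij; rewrite ler_pM2l // ler_nat. Qed.

Definition grid_point i w : R := 1 - expR (- S (h * i%:R) w).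
Let p := grid_point.
Let xi i w : R := S (t i.+1) w - S (t i) w.
Let F j : R := expR (- (h * laplace_exp nu j%:R)).

Lemma subordinator_ge0 (s : R) w : 0 <= s -> 0 <= S s w.
Proof.
by move=> s0; rewrite -(subordinator_start sub w); exact: (subordinator_nondecreasing sub).
Qed.

Let mS (s : R) : 0 <= s -> measurable_fun setT (S s).
exact: (subordinator_measurable sub). Qed.

Let xi_ge0 i w : 0 <= xi i w.
by rewrite subr_ge0; apply: (subordinator_nondecreasing sub) => //; exact: t_ndec. Qed.

Let mxi i : measurable_fun setT (xi i).
by apply: measurable_funB; exact: mS. Qed.

Lemma grid_point0 w : p 0%N w = 0.
Proof. by rewrite /p /grid_point mulr0 (subordinator_start sub) oppr0 expR0 subrr. Qed.

Lemma grid_point_ndec i j w : (i <= j)%N -> p i w <= p j w.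
Proof.
move=> ij; rewrite lerD2l lerN2 ler_expR lerN2.
by apply: (subordinator_nondecreasing sub); [exact: t_ge0 | exact: t_ndec].
Qed.

Lemma grid_point_itv i w : 0 <= p i w < 1.
Proof.
rewrite /p /grid_point subr_ge0 -[X in _ <= X]expR0 ler_expR oppr_le0 subordinator_ge0 ?t_ge0 //=.
by rewrite ltrBlDr ltrDl expR_gt0.
Qed.

Let z i w : R := (p i.+1 w - p i w) / (1 - p i w).

(** The conditional fraction of a cell depends on one increment only: this is where regeneration
    enters. *)
Let zE i w : z i w = 1 - expR (- xi i w).
rewrite /z /p /grid_point /xi /t.
set a := S _ w; set b := S _ w.
have -> : 1 - (1 - expR (- b)) = expR (- b) by ring.
have -> : 1 - expR (- a) - (1 - expR (- b)) = expR (- b) * (1 - expR (- (a - b))).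
  by rewrite mulrBr mulr1 -expRD (_ : - b - (a - b) = - a); ring.
by rewrite mulrC mulKf ?expR_eq0.
Qed.

Let law_xi i (f : R -> R) : measurable_fun setT f -> (forall x, 0 <= f x) ->
  mean P (f \o xi i) = mean P (f \o S h).
move=> mf f0; apply: eq_law_mean => //; first by apply: mS; exact: ltW.
move=> B mB; have := subordinator_stationary sub (t_ge0 i) (ltW h_gt0) mB.
by rewrite (_ : t i + h = t i.+1) // /t -natr1 mulrDr mulr1.
Qed.

Lemma mean_increment_exp i (c : R) : 0 <= c ->
  mean P (fun w => expR (- (c * xi i w))) = expR (- (h * laplace_exp nu c)).
Proof.
move=> c0; have mf : measurable_fun setT (fun x : R => expR (- (c * x))).
  by apply: measurableT_comp => //; apply: measurableT_comp => //; exact: measurable_funM.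
transitivity (mean P ((fun x => expR (- (c * x))) \o S h)).
  by rewrite -(law_xi i) // => x; exact: expR_ge0.
have [_ _ lk] := hS; rewrite /mean.
have -> : (fun x => expR (- (c * x))) \o S h = (fun w => expR (- (c * S h w))) by [].
by rewrite lk ?(ltW h_gt0) // mul0r add0r.
Qed.

Let mean_exp i j : mean P (fun w => expR (- (j%:R * xi i w))) = F j.
by rewrite mean_increment_exp. Qed.

Let thin n j x : R := thinning x (delta R j) n.

Let mthin n j : measurable_fun setT (thin n j).
rewrite /thin /thinning /newton_op.
apply: measurable_sum => i; apply: measurable_funM => //; apply: measurable_funM => //.
by apply: measurableT_comp => //; apply: measurableT_comp => //; exact: measurable_funM.
Qed.

Let bexp i j : bmfun (fun w => expR (- (j%:R * xi i w))).
split.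
  by apply: measurableT_comp => //; apply: measurableT_comp => //; exact: measurable_funM.
exists 1 => w; rewrite ger0_norm ?expR_ge0 // -[leRHS]expR0 ler_expR oppr_le0 mulr_ge0 // ler0n.
Qed.

Let mean_thin i n j : mean P (thin n j \o xi i) = cell_weight F n j.
rewrite /cell_weight /newton_op.
transitivity (mean P (fun w => \sum_(k < n.+1) (newton (delta R j) k * 'C(n, k)%:R) *
    expR (- (k%:R * xi i w)))).
  by apply: eq_mean => w; apply: eq_bigr => k _ /=; rewrite -mulrA mulrC.
rewrite mean_sum; last by move=> k _; exact: bmfunZ.
by apply: eq_bigr => k _; rewrite meanZ // mean_exp -mulrA mulrC.
Qed.

Lemma cell_weight_ge0 n j : 0 <= cell_weight F n j.
Proof.
rewrite -(mean_thin 0) -(mean_cst P 0); apply: le_mean; first exact: bmfun_cst.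
  split; first by apply: measurableT_comp; [exact: mthin | exact: mxi].
  by exists 1 => w; have /andP[a b] := thinning_delta_itv j n (xi_ge0 0 w); rewrite /= ger0_norm.
by move=> w; have /andP[] := thinning_delta_itv j n (xi_ge0 0 w).
Qed.

Let bz i : bmfun (z i).
have /funext -> := zE i; have -> : (fun w => 1 - expR (- xi i w)) =
    (fun w => 1 + -1 * expR (- (1%:R * xi i w))).
  by apply/funext => w; rewrite mul1r mulN1r.
by apply: bmfunD; [exact: bmfun_cst | exact: bmfunZ].
Qed.

Let bX (f : Omega -> R) n : bmfun f -> bmfun (fun w => f w ^+ n).
move=> bf; elim: n => [|n IH].
  under eq_fun do rewrite expr0; exact: bmfun_cst.
under eq_fun do rewrite exprS; exact: bmfunM.
Qed.

Lemma bmfun_occupancy (s : seq nat) n psi :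
  bmfun (fun w => occupancy r [seq z i w | i <- s] n psi).
Proof.
elim: s n psi => [|i s IH] n psi /=; first exact: bmfun_cst.
apply: bmfun_sum => k _; apply: bmfunM => //.
apply: bmfunM.
  by apply: bmfunZ; exact: bX.
apply: bX; rewrite (_ : (fun w => _) = (fun w => 1 + -1 * z i w)).
  by apply: bmfunD; [exact: bmfun_cst | exact: bmfunZ].
by apply/funext => w; rewrite mulN1r.
Qed.

(** The sum is reindexed by the number [j] of points beyond the cell, which turns the binomial
    probability into [thinning] of [delta j]. *)
Let occupancy_cons i zs n psi w : occupancy r (z i w :: zs) n psi =
  \sum_(j < n.+1) thin n j (xi i w) * occupancy r zs j (fun k => psi ((n - j == r) + k)%N).
rewrite /= (reindex_inj rev_ord_inj) /=; apply: eq_bigr => j _.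
have jn : (j <= n)%N by rewrite -ltnS.
rewrite subSS subKn // /thin thinning_delta // zE bin_sub //; congr (_ * _).
by rewrite (_ : 1 - (1 - _) = expR (- xi i w)); [ring | ring].
Qed.

Let mean_base a (f : nat -> R -> R) : (forall i, measurable_fun setT (f i)) ->
  (forall i w, 0 <= f i (xi i w) <= 1) ->
  mean P (fun w => \prod_(i < a) f i (xi i w)) = \prod_(i < a) mean P (f i \o xi i).
move=> mf f01; apply: (mean_prod (X := fun (i : 'I_a) w => f i (xi i w))).
- by move=> i; exact: measurableT_comp.
- by [].
move=> u.
have mB (i : nat) (v : R) : measurable [set x | v <= f i x].
  have := mf i measurableT _ (measurable_itv `[v, +oo[); rewrite setTI.
  by congr measurable; apply/seteqP; split=> x; rewrite /= in_itv /= andbT.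
pose B (i : nat) : set R := if insub i is Some i' then [set x | u i' <= f i x] else setT.
have mB' i : measurable (B i) by rewrite /B; case: insubP.
have ind := subordinator_independent_increments sub (t_ge0 0) (fun i => t_ndec (leqnSn i)).
have e (i : 'I_a) w : (u i <= f i (xi i w)) = (B i (xi i w)) :> Prop by rewrite /B valK.
have me (i : 'I_a) : measurable [set w | u i <= f i (xi i w)].
  rewrite (_ : [set w | _] = xi i @^-1` B i); last by apply/funext => w; exact: e.
  by have := mxi i measurableT (mB' i); rewrite setTI.
apply: EFin_inj; rewrite prbE; last first.
  rewrite (_ : [set w | _] = \bigcap_(i in setT) [set w | u i <= f i (xi i w)]).
    by apply: fin_bigcap_measurable; [exact: finite_finset | move=> i _; exact: me].
  by apply/seteqP; split=> w hw i; [move=> _; exact: (hw i) | exact: (hw i)].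
rewrite -prodEFin (eq_bigr (fun i : 'I_a => P (xi i @^-1` B i))); last first.
  by move=> i _; rewrite prbE //; congr (P _); apply/funext => w; exact: e.
rewrite -(mutually_independent_ord a ind mB'); congr (P _).
by apply/funext => w; apply/propext; split=> hw i; have := hw i; rewrite /= e.
Qed.

(** The factors [f i] store what the cells already treated have contributed, so that independence of
    the increments is used once, when no cell is left. *)
Let mean_occupancy_aux m a n psi (f : nat -> R -> R) : (forall i, measurable_fun setT (f i)) ->
  (forall i w, 0 <= f i (xi i w) <= 1) ->
  mean P (fun w => \prod_(i < a) f i (xi i w) * occupancy r [seq z i w | i <- iota a m] n psi) =
  \prod_(i < a) mean P (f i \o xi i) * cell_law F r m n psi.
move=> mf f01; elim: m a n psi f mf f01 => [|m IH] a n psi f mf f01.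
  rewrite /= -mean_base //; under eq_fun do rewrite mulrC.
  rewrite meanZ 1?mulrC //; apply: bmfun_prod => i _. split; first exact: measurableT_comp.
  by exists 1 => w; have /andP[? ?] := f01 i w; rewrite ger0_norm.
pose f' j i := if i == a then thin n j else f i.
have mf' j i : measurable_fun setT (f' j i) by rewrite /f'; case: eqP.
have f01' j i w : 0 <= f' j i (xi i w) <= 1.
  by rewrite /f'; case: eqP => // _; exact: thinning_delta_itv.
have e w : \prod_(i < a) f i (xi i w) * occupancy r [seq z i w | i <- iota a m.+1] n psi =
    \sum_(j < n.+1) \prod_(i < a.+1) f' j i (xi i w) *
      occupancy r [seq z i w | i <- iota a.+1 m] j (fun k => psi ((n - j == r) + k)%N).
  have -> : [seq z i w | i <- iota a m.+1] = z a w :: [seq z i w | i <- iota a.+1 m] by [].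
  rewrite occupancy_cons mulr_sumr; apply: eq_bigr => j _.
  rewrite big_ord_recr /= /f' eqxx mulrA; congr (_ * _ * _).
  by apply: eq_bigr => i _; rewrite (ltn_eqF (ltn_ord i)).
rewrite (eq_mean P e) mean_sum; last first.
  move=> j _; apply: bmfunM; last exact: bmfun_occupancy.
  apply: bmfun_prod => i _; split; first exact: measurableT_comp.
  by exists 1 => w; have /andP[? ?] := f01' j i w; rewrite ger0_norm.
rewrite /= mulr_sumr; apply: eq_bigr => j _.
rewrite IH // big_ord_recr /= -mulrA; congr (_ * _).
  by apply: eq_bigr => i _; rewrite /f' (ltn_eqF (ltn_ord i)).
by rewrite /f' eqxx mean_thin.
Qed.

Lemma mean_occupancy l n psi :
  mean P (fun w => occupancy r [seq (p i.+1 w - p i w) / (1 - p i w) | i <- iota 0 l] n psi) =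
  cell_law F r l n psi.
Proof.
have h1 : forall i : nat, measurable_fun setT (fun _ : R => 1 : R) by [].
have h2 : forall (i : nat) w, 0 <= (1 : R) <= 1 by move=> i w; rewrite ler01 lexx.
have := @mean_occupancy_aux l 0 n psi (fun _ _ => 1) h1 h2.
by rewrite [X in _ = X * _]big_ord0 mul1r => <-; apply: eq_mean => w; rewrite big_ord0 mul1r.
Qed.

End SubordinatorCells.

(** * Dyadic approximation of the gaps and measurability *)

Lemma measurable_finite_pred (d : measure_display) (T : measurableType d) (J : finType)
    (b : J -> T -> bool) (Q : {ffun J -> bool} -> bool) :
  (forall i, measurable [set x | b i x]) -> measurable [set x | Q [ffun i => b i x]].
Proof.
move=> mb.
rewrite (_ : [set x | _] = \bigcup_(f in [set f | Q f]) \bigcap_(i in [set: J]) [set x | b i x = f i]).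
  apply: fin_bigcup_measurable; first exact: finite_finset.
  move=> f _; apply: fin_bigcap_measurable; first exact: finite_finset.
  move=> i _; case: (f i); first exact: mb.
  rewrite (_ : [set x | _] = ~` [set x | b i x]); first exact: measurableC.
  by apply/seteqP; split=> x /=; [move=> -> | move/negP/negbTE].
apply/seteqP; split=> x /= => [Qx|[f Qf hf]].
  by exists [ffun i => b i x] => // i _; rewrite /= ffunE.
rewrite (_ : [ffun i => b i x] = f) //; apply/ffunP => i; rewrite ffunE; exact: (hf i I).
Qed.

Lemma eventually_all_seq (T : eqType) (s : seq T) (Q : nat -> T -> Prop) :
  (forall x, x \in s -> exists k0, forall k, (k0 <= k)%N -> Q k x) ->
  exists k0, forall k, (k0 <= k)%N -> forall x, x \in s -> Q k x.
Proof.
elim: s => [|x s IH] h; first by exists 0%N.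
have [k1 h1] := h x (mem_head _ _).
have [|k2 h2] := IH; first by move=> y ys; apply: h; rewrite inE ys orbT.
exists (maxn k1 k2) => k; rewrite geq_max => /andP[kk1 kk2] y; rewrite inE => /predU1P[->|ys].
  exact: h1.
exact: h2.
Qed.

Lemma measurable_natr (d : measure_display) (T : measurableType d) (R : realType) (f : T -> nat) :
  (forall m, measurable [set x | f x = m]) -> measurable_fun setT (fun x => (f x)%:R : R).
Proof.
move=> mf _ B mB; rewrite setTI.
rewrite (_ : _ @^-1` _ = \bigcup_(m in [set m : nat | B m%:R]) [set x | f x = m]).
  exact: bigcup_measurable.
by apply/seteqP; split=> x /= => [Bx|[m Bm ->] //]; exists (f x).
Qed.

Lemma measurable_le_set (d : measure_display) (T : measurableType d) (R : realType) (f g : T -> R) :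
  measurable_fun setT f -> measurable_fun setT g -> measurable [set x | f x <= g x].
Proof.
move=> mf mg; have := measurable_fun_ler mf mg measurableT (Y := [set true]) I.
by rewrite setTI; congr measurable; apply/seteqP; split.
Qed.

Lemma measurable_lt_set (d : measure_display) (T : measurableType d) (R : realType) (f g : T -> R) :
  measurable_fun setT f -> measurable_fun setT g -> measurable [set x | f x < g x].
Proof.
move=> mf mg; have := measurable_fun_ltr mf mg measurableT (Y := [set true]) I.
by rewrite setTI; congr measurable; apply/seteqP; split.
Qed.

Lemma measurable_cells (d : measure_display) (T : measurableType d) (R : realType) (n l r : nat)
    (a y : nat -> T -> R) (A : nat -> set T) (Q : pred nat) :
  (forall i, measurable_fun setT (a i)) -> (forall j, (j < n)%N -> measurable_fun setT (y j)) ->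
  (forall j, (j < n)%N -> measurable (A j)) ->
  measurable [set x | Q (cell_count (a^~ x) l
    [seq y j x | j <- iota 0 n & `[< A j x >]] r)].
Proof.
move=> ma my mA.
pose b (ij : 'I_l * 'I_n) x := [&& `[< A ij.2 x >], a ij.1 x < y ij.2 x & y ij.2 x <= a ij.1.+1 x].
rewrite (_ : [set x | _] = [set x | (fun f : {ffun 'I_l * 'I_n -> bool} =>
  Q (\sum_(i < l) ((\sum_(j < n) f (i, j)) == r))%N) [ffun ij => b ij x]]).
  apply: (@measurable_finite_pred _ _ _ b (fun f : {ffun 'I_l * 'I_n -> bool} =>
    Q (\sum_(i < l) ((\sum_(j < n) f (i, j)) == r))%N)) => -[i j]; rewrite /b /=.
  rewrite (_ : [set x | _] = A j `&` ([set x | a i x < y j x] `&` [set x | y j x <= a i.+1 x])).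
    apply: measurableI; first exact: mA.
    by apply: measurableI; [apply: measurable_lt_set | apply: measurable_le_set] => //; exact: my.
  apply/seteqP; split=> x /=; first by move=> /and3P[/asboolP ? ? ?].
  by move=> [h [h1 h2]]; rewrite h1 h2 andbT andbT; apply/asboolP.
apply/funext => x /=; congr (is_true (Q _)); rewrite /cell_count; apply: eq_bigr => i _.
congr (nat_of_bool (_ == r)); rewrite count_map count_filter -sum1_count big_mkcond /=.
rewrite -[iota 0 n]/(iota 0 n) -{1}(subn0 n) -/(index_iota 0 n) big_mkord.
apply: eq_bigr => j _; rewrite ffunE /b /=; case: (asbool _); rewrite ?andbF ?andbT //=.
Qed.

Section Dyadic.
Context d (Omega : measurableType d) (R : realType) (P : probability Omega R).
Variables (S : R -> Omega -> R) (nu : {measure set R -> \bar R}).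
Hypothesis hS : driftless_subordinator P S nu.
Implicit Types (x y : R) (k i : nat) (w : Omega).

Let sub : subordinator P S. by case: hS. Qed.

Definition transformed_range w : set R := [set 1 - expR (- S t w) | t in `[0, +oo[%classic].
Definition dyadic_point k i w : R := grid_point S (2%:R ^- k) i w.
Let p := dyadic_point.

Lemma transformed_range_itv w x : transformed_range w x -> 0 <= x <= 1.
Proof.
move=> [t]; rewrite /= in_itv /= andbT => t0 <-.
have s0 : 0 <= S t w.
  by rewrite -(subordinator_start sub w); exact: (subordinator_nondecreasing sub).
rewrite subr_ge0 -[X in _ <= X]expR0 ler_expR oppr_le0 s0 /=.
by rewrite lerBlDr lerDl expR_ge0.
Qed.

Let step_gt0 k : 0 < 2%:R ^- k :> R. by rewrite invr_gt0 exprn_gt0. Qed.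

Lemma dyadic_point_range k i w : transformed_range w (p k i w).
Proof. by exists (2%:R ^- k * i%:R) => //=; rewrite in_itv /= andbT mulr_ge0 // ltW. Qed.

Lemma dyadic_refine k m i w : p (k + m) (i * 2 ^ m) w = p k i w.
Proof.
rewrite /p /dyadic_point /grid_point; congr (1 - expR (- S _ w)).
rewrite exprD natrM natrX invfM -!mulrA; congr (_ * _).
by rewrite mulrCA mulVf ?mulr1 // expf_neq0.
Qed.

(** By right continuity a dyadic time shortly after [t] is still mapped below [y]; by monotonicity
    it is mapped above [x]. *)
Lemma dyadic_between w x y : (exists2 z, transformed_range w z & x < z < y) ->
  exists k i, x < p k i w < y.
Proof.
move=> [_ [t t0 <-] /andP[xz zy]]; move: t0; rewrite /= in_itv /= andbT => t0.
set z := 1 - expR (- S t w) in xz zy.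
have /cvgrPdist_lt hc : (fun u => 1 - expR (- S u w)) u @[u --> t^'+] --> z.
  apply: cvgB; first exact: cvg_cst. apply: continuous_cvg; first exact: continuous_expR.
  by apply: cvgN; exact: (subordinator_right_continuous sub).
have := hc (y - z); rewrite subr_gt0 => /(_ zy) [e /= e0 he].
have hb := archi_boundP (ltW (divr_gt0 ltr01 e0)); rewrite div1r in hb.
pose k := Num.bound e^-1.
have ke : 2%:R ^- k < e.
  rewrite invf_plt ?posrE ?exprn_gt0 //; apply: lt_le_trans hb _.
  by rewrite -natrX ler_nat ltnW // ltn_expl.
pose i := (Num.truncn (2%:R ^+ k * t)).+1.
have p2 : 0 < 2%:R ^+ k :> R by rewrite exprn_gt0.
have /andP[i1 i2] := truncn_itv (mulr_ge0 (ltW p2) t0).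
have t1 : t < 2%:R ^- k * i%:R by rewrite -(ltr_pM2l p2) mulrA mulfV ?gt_eqF // mul1r.
have t2 : 2%:R ^- k * i%:R <= t + 2%:R ^- k.
  rewrite -(ler_pM2l p2) mulrA mulfV ?gt_eqF // mul1r mulrDr mulfV ?gt_eqF //.
  by rewrite /i -natr1 lerD2r.
exists k, i; apply/andP; split.
  apply: lt_le_trans xz _; rewrite lerD2l lerN2 ler_expR lerN2.
  by apply: (subordinator_nondecreasing sub) => //; exact: ltW.
have := he (2%:R ^- k * i%:R); rewrite /ball_ /= distrC ger0_norm ?subr_ge0 ?(ltW t1) //.
rewrite ltrBlDl => /(_ (le_lt_trans t2 _)); rewrite ltrD2l => /(_ ke t1).
rewrite distrC => h; have := le_lt_trans (ler_norm _) h.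
by rewrite ltrD2r.
Qed.

Lemma dyadic_between_near w x y : (exists2 z, transformed_range w z & x < z < y) ->
  exists k0, forall k, (k0 <= k)%N -> exists2 i, (i <= 4 ^ k)%N & x < p k i w < y.
Proof.
(* At a level [k' >= k + i] the time [i / 2^k] has index [i * 2^(k' - k)], at most [4^k'] because
   [i <= 2^k']. *)
move=> /dyadic_between[k [i h]]; exists (k + i)%N => k' kk'.
exists (i * 2 ^ (k' - k))%N; last first.
  have kk : (k <= k')%N := leq_trans (leq_addr i k) kk'.
  by have := dyadic_refine k (k' - k) i w; rewrite subnKC // => ->.
have -> : (4 = 2 * 2)%N by [].
rewrite expnMn leq_mul // ?leq_exp2l ?leq_subr //.
by rewrite (leq_trans (ltnW (ltn_expl i (isT : 1 < 2)%N))) // leq_exp2l // (leq_trans _ kk') // leq_addl.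
Qed.

(** The range is replaced by countably many random points, which makes the event measurable. *)
Lemma in_gap_dyadic w x : in_gap (transformed_range w) x <->
  [/\ 0 <= x, exists m, forall k i, m.+1%:R^-1 <= `|p k i w - x| & exists k i, x < p k i w].
Proof.
split=> -[x0 far ex]; split=> //.
- have [e e0 he] := far; have hb := archi_boundP (ltW (divr_gt0 ltr01 e0)); rewrite div1r in hb.
  exists (Num.bound e^-1) => k i; have me : (Num.bound e^-1).+1%:R^-1 <= e.
    rewrite invf_ple ?posrE ?ltr0n //; apply: ltW; apply: lt_le_trans hb _. by rewrite ler_nat.
  by apply: le_trans me (he _ (dyadic_point_range k i w)).
- have [z zD xz] := ex; have [|k [i /andP[h _]]] := @dyadic_between w x (z + 1); last by exists k, i.
  by exists z => //; rewrite xz ltrDl ltr01.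
- have [m hm] := far; exists m.+1%:R^-1; first by rewrite invr_gt0.
  move=> z zD; rewrite leNgt; apply/negP; rewrite ltr_distl => h.
  have [|k [i]] := @dyadic_between w (x - m.+1%:R^-1) (x + m.+1%:R^-1); first by exists z.
  by rewrite -ltr_distl ltNge hm.
- by have [k [i h]] := ex; exists (p k i w) => //; exact: dyadic_point_range.
Qed.

Lemma measurable_dyadic_point k i : measurable_fun setT (p k i).
Proof.
apply: measurable_funB => //; apply: measurableT_comp => //; apply: measurableT_comp => //.
by apply: (subordinator_measurable sub); rewrite mulr_ge0 // ltW.
Qed.

Lemma measurable_in_gap (y : Omega -> R) : measurable_fun setT y ->
  measurable [set w | in_gap (transformed_range w) (y w)].
Proof.
move=> my.
rewrite (_ : [set w | _] = [set w | 0 <= y w] `&`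
  (\bigcup_m \bigcap_k \bigcap_i [set w | m.+1%:R^-1 <= `|p k i w - y w|]) `&`
  (\bigcup_k \bigcup_i [set w | y w < p k i w])).
  apply: measurableI; first apply: measurableI.
  - by apply: measurable_le_set.
  - apply: bigcupT_measurable => m; apply: bigcapT_measurable => k; apply: bigcapT_measurable => i.
    apply: measurable_le_set => //; apply: measurableT_comp => //.
    by apply: measurable_funB => //; exact: measurable_dyadic_point.
  - apply: bigcupT_measurable => k; apply: bigcupT_measurable => i.
    by apply: measurable_lt_set => //; exact: measurable_dyadic_point.
apply/seteqP; split=> w /=; rewrite in_gap_dyadic.
  move=> [y0 [m hm] [k [i h]]]; split; last by exists k => //; exists i.
  by split=> //; exists m => // k' _ i' _; exact: hm.
move=> [[y0 [m _ hm]] [k _ [i _ h]]]; split=> //; last by exists k, i.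
by exists m => k' i'; exact: (hm k' I i' I).
Qed.

(** Finitely many pairs of sample points have to be separated and finitely many points exceeded, so
    one level [k0] serves for all. *)
Lemma cell_count_nb_gaps w (s : seq R) r : (0 < r)%N -> exists k0, forall k, (k0 <= k)%N ->
  cell_count (fun i => p k i w) (4 ^ k) [seq x <- s | `[< in_gap (transformed_range w) x >]] r =
  nb_gaps (closed_range S w) (fun B => count (fun x => x \in B) s) r.
Proof.
move=> r0; set t := [seq x <- s | _].
have tP x : x \in t -> in_gap (transformed_range w) x by rewrite mem_filter => /andP[/asboolP].
have [k1 h1] : exists k0, forall k, (k0 <= k)%N -> forall x, x \in t -> x < p k (4 ^ k) w.
  apply: eventually_all_seq => x /tP [_ _ [z zD xz]].
  have [|k0 hk] := @dyadic_between_near w x (z + 1); first by exists z => //; rewrite xz ltrDl ltr01.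
  exists k0 => k /hk [i ik /andP[h _]]; apply: lt_le_trans h _.
  exact: (grid_point_ndec hS (step_gt0 k) w ik).
have [k2 h2] : exists k0, forall k, (k0 <= k)%N -> forall x, x \in t -> forall y, y \in t ->
    (exists2 z, transformed_range w z & x < z < y) -> exists2 i, (i <= 4 ^ k)%N & x < p k i w < y.
  apply: eventually_all_seq => x _; apply: eventually_all_seq => y _.
  have [/dyadic_between_near[k0 hk]|nex] := pselect (exists2 z, transformed_range w z & x < z < y).
    by exists k0 => k kk _; exact: hk.
  by exists 0%N => k _ /nex.
exists (maxn k1 k2) => k; rewrite geq_max => /andP[kk1 kk2].
have D0 : transformed_range w 0.
  by rewrite -(grid_point0 hS (2%:R ^- k) w); exact: dyadic_point_range.
have D1 x : transformed_range w x -> 0 <= x <= 1 by exact: transformed_range_itv.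
rewrite (nb_gaps_class_count D0 D1) //; apply: cell_count_class_count => //.
- by move=> i j ij; exact: (grid_point_ndec hS (step_gt0 k) w ij).
- exact: (grid_point0 hS).
- by move=> i; exact: dyadic_point_range.
- exact: h1.
- by move=> x y xt yt; exact: h2.
Qed.

(** For each [w] the gap count is the eventual value of the cell counts, which are measurable. *)
Lemma measurable_nb_gaps (n r : nat) (y : nat -> Omega -> R) : (0 < r)%N ->
  (forall j, (j < n)%N -> measurable_fun setT (y j)) ->
  forall m, measurable [set w | nb_gaps (closed_range S w)
    (fun B => count (fun x => x \in B) [seq y j w | j <- iota 0 n]) r = m].
Proof.
move=> r0 my m; pose K w := nb_gaps (closed_range S w)
    (fun B => count (fun x => x \in B) [seq y j w | j <- iota 0 n]) r.
pose c k w := cell_count (fun i => p k i w) (4 ^ k)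
  [seq y j w | j <- iota 0 n & `[< in_gap (transformed_range w) (y j w) >]] r.
have ev w : exists k0, forall k, (k0 <= k)%N -> c k w = K w.
  have [k0 hk] := cell_count_nb_gaps w [seq y j w | j <- iota 0 n] r0.
  by exists k0 => k /hk h; rewrite /K -h /c filter_map.
rewrite (_ : [set w | _] = \bigcup_k0 \bigcap_k [set w | c (k0 + k)%N w == m]); last first.
  apply/seteqP; split=> w /=.
    by move=> <-; have [k0 hk] := ev w; exists k0 => // k _ /=; rewrite hk ?leq_addr.
  move=> [k0 _ h]; have [k1 hk] := ev w; have := h k1 I; rewrite /= hk ?leq_addl // => /eqP <- //.
apply: bigcupT_measurable => k0; apply: bigcapT_measurable => k.
apply: (@measurable_cells _ _ R n (4 ^ (k0 + k)) r (p (k0 + k)%N) y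
  (fun j => [set w | in_gap (transformed_range w) (y j w)]) (pred1 m)) => //.
- by move=> i; exact: measurable_dyadic_point.
- by move=> j jn; apply: measurable_in_gap; exact: my.
Qed.

End Dyadic.

(** * Sample points fall in gaps almost surely; law of the gap count *)

Lemma prb_bigcup_le (d : measure_display) (Omega : measurableType d) (R : realType)
    (P : probability Omega R) (E : nat -> set Omega) (b : R) :
  (forall k, measurable (E k)) -> {homo E : k l / (k <= l)%N >-> k `<=` l} ->
  (forall k, prb P (E k) <= b) -> prb P (\bigcup_k E k) <= b.
Proof.
move=> mE ndE hb; have mU : measurable (\bigcup_k E k) by exact: bigcupT_measurable.
have h : nondecreasing_seq E by move=> k l kl; apply/subsetPset; exact: ndE.
have hc := @nondecreasing_cvg_mu _ _ _ P E mE mU h.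
rewrite -lee_fin prbE //; apply: (cvge_to_le hc).
by apply: nearW => k; rewrite /= -prbE // lee_fin.
Qed.

Lemma min1_le (R : realType) (x : R) : 0 <= x -> Num.min 1 x <= 2 * (1 - expR (- x)).
Proof.
move=> x0; have h : expR (- x) <= (1 + x)^-1.
  by rewrite expRN lef_pV2 ?posrE ?expR_gt0 ?expR_ge1Dx // ltr_pwDl.
have h1 : 0 < 1 + x by rewrite ltr_pwDl.
apply: (@le_trans _ _ (2 * (1 - (1 + x)^-1))); last by rewrite ler_pM2l // lerD2l lerN2.
rewrite (_ : 2 * _ = 2 * x / (1 + x)); last by field; rewrite gt_eqF.
rewrite ler_pdivlMr //; have [x1|x1] := leP 1 x; first by rewrite mul1r mulrDl mul1r lerD2r.
by rewrite mulrDr mulr1 mulrDl mul1r lerD2l ler_piMr // ltW.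
Qed.

Lemma measurable_exists (d : measure_display) (T : measurableType d) (A : nat -> set T) (Q : set nat) :
  (forall j, Q j -> measurable (A j)) -> measurable [set w | exists2 j, Q j & A j w].
Proof. by move=> mA; exact: bigcup_measurable. Qed.

Lemma sum3_le (R : realType) (a b c t : R) : a <= t -> b <= t -> c <= t -> a + (b + c) <= 3 * t.
Proof. by move=> *; lra. Qed.

Section Sample.
Context d (Omega : measurableType d) (R : realType) (P : probability Omega R).
Variables (S : R -> Omega -> R) (nu : {measure set R -> \bar R}).
Hypothesis hS : driftless_subordinator P S nu.
(** A frame for both compositions: on the event [D], of probability [q], the sample consists of [n]
    points of []0, 1]], enumerated by [x] measurably with respect to the sample alone. *)
Variables (G : set (set Omega)) (n r : nat) (x : nat -> Omega -> R) (D : set Omega) (C q : R).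
Hypothesis mG : G `<=` measurable.
Hypotheses (hG : independent_systems P (sigma_generated `[0, +oo[%classic S) <<s G>>) (mD : <<s G>> D).
Hypothesis mx : forall j, (j < n)%N -> measurable_fun setT (x j : g_sigma_algebraType G -> R).
Hypotheses (C_ge0 : 0 <= C) (x_itv : forall w, D w -> forall j, (j < n)%N -> 0 < x j w <= 1).
Hypothesis x_density : forall a b, a <= b ->
  prb P [set w | D w /\ exists2 j, (j < n)%N & a <= x j w <= b] <= C * (b - a).
Hypothesis x_law : forall (p : nat -> R) l (Q : pred nat), (forall i, p i <= p i.+1) ->
  p 0%N = 0 -> (forall i, 0 <= p i < 1) ->
  prb P [set w | D w /\ Q (cell_count p l [seq x j w | j <- iota 0 n] r)] =
  q * occupancy r [seq (p i.+1 - p i) / (1 - p i) | i <- iota 0 l] n (fun k => (Q k)%:R).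
Hypothesis r_gt0 : (0 < r)%N.
Implicit Types (k i j m T : nat) (w : Omega) (Q : pred nat).

Let p := dyadic_point S.
Let range := transformed_range S.
Let sub : subordinator P S. by case: hS. Qed.
Let F : set (set Omega) := \bigcup_(t in `[0, +oo[%classic) preimage_set_system setT (S t) measurable.
Let OF : measurableType _ := g_sigma_algebraType F.
Let OG : measurableType _ := g_sigma_algebraType G.

Let mF : F `<=` measurable.
move=> A [t]; rewrite /= in_itv /= andbT => t0 [B mB <-].
exact: (subordinator_measurable sub).
Qed.

Let subG : <<s G>> `<=` @measurable _ Omega.
by apply: smallest_sub => //; exact: sigma_algebra_measurable. Qed.

Let mxO j : (j < n)%N -> measurable_fun setT (x j).
by move=> jn _ B mB; apply: subG; exact: (mx jn measurableT mB). Qed.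

Let mDO : measurable D. exact: subG. Qed.

Let mSF (t : R) : 0 <= t -> measurable_fun setT (S t : OF -> R).
move=> t0 _ B mB; apply: sub_sigma_algebra; exists t; first by rewrite /= in_itv /= andbT.
by exists B.
Qed.

Let step_gt0 k : 0 < 2%:R ^- k :> R. by rewrite invr_gt0 exprn_gt0. Qed.

Let mpF k i : measurable_fun setT (p k i : OF -> R).
apply: measurable_funB => //; apply: measurableT_comp => //; apply: measurableT_comp => //.
by apply: mSF; rewrite mulr_ge0 // ltW.
Qed.

Let mp1 k i : measurable_fun setT (fun z : OF * OG => p k i z.1).
by apply: (measurableT_comp (mpF k i)); exact: measurable_fst. Qed.

Let mx2 j : (j < n)%N -> measurable_fun setT (fun z : OF * OG => x j z.2).
by move=> jn; apply: (measurableT_comp (mx jn)); exact: measurable_snd. Qed.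

Let mD2 : measurable [set z : OF * OG | D z.2].
have := @measurable_snd _ _ OF OG measurableT (D : set OG) mD; rewrite setTI; exact.
Qed.

Let eps m : R := (2 * m.+1%:R)^-1.

Let near_set (e : R) (y : nat -> R) M : set Omega :=
  [set w | D w /\ exists2 j, (j < n)%N & exists2 i, (i <= M)%N & `|y i - x j w| < e].

Let m_lt_abs (e : R) (y : R) j : (j < n)%N -> measurable [set w | `|y - x j w| < e].
move=> jn; apply: measurable_lt_set => //; apply: measurableT_comp => //.
by apply: measurable_funB => //; exact: mxO.
Qed.

Let m_itv (a b : R) : measurable [set w | D w /\ exists2 j, (j < n)%N & a <= x j w <= b].
apply: measurableI => //; apply: (@measurable_exists _ _ (fun j => [set w | a <= x j w <= b])) => j jn.
rewrite (_ : [set w | _] = [set w | a <= x j w] `&` [set w | x j w <= b]).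
  by apply: measurableI; apply: measurable_le_set => //; exact: mxO.
by apply/seteqP; split=> w /=; [move=> /andP[] | move=> [-> ->]].
Qed.

Let m_near e y M : measurable (near_set e y M).
apply: measurableI => //.
apply: (@measurable_exists _ _ (fun j => [set w | exists2 i, (i <= M)%N & `|y i - x j w| < e])) => j jn.
apply: (@measurable_exists _ _ (fun i => [set w | `|y i - x j w| < e])) => i _.
exact: m_lt_abs.
Qed.

(** Neighbourhoods of close grid points overlap, so the next point enlarges their union by at most
    the smaller of [2 e] and the distance to the previous point. *)
Let prb_near e y M : 0 < e -> (forall i, y i <= y i.+1) ->
  prb P (near_set e y M) <= C * (2 * e + \sum_(i < M) Num.min (2 * e) (y i.+1 - y i)).
move=> e0 y_ndec; elim: M => [|M IH].
  rewrite big_ord0 addr0. apply: (@le_trans _ _ (C * ((y 0%N + e) - (y 0%N - e)))); last first.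
    by rewrite ler_wpM2l //; apply: le_of_eq; ring.
  apply: le_trans (x_density _); last by lra.
  apply: le_prb => // w [Dw [j jn [i]]]; rewrite leqn0 => /eqP ->; rewrite distrC ltr_distl => /andP[h1 h2].
  by split=> //; exists j => //; rewrite !ltW.
pose a := Num.max (y M + e) (y M.+1 - e); pose b := y M.+1 + e.
have ab : a <= b by rewrite ge_max lerD2r y_ndec /b lerD2l; lra.
have sub' : near_set e y M.+1 `<=` near_set e y M `|`
    [set w | D w /\ exists2 j, (j < n)%N & a <= x j w <= b].
  move=> w [Dw [j jn [i iM h]]].
  have [[i' i'M h']|nex] := pselect (exists2 i, (i <= M)%N & `|y i - x j w| < e).
    by left; split=> //; exists j => //; exists i'.
  right; split=> //; exists j => //. have iM1 : i = M.+1.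
    apply/eqP; rewrite eqn_leq iM leqNgt; apply/negP; rewrite ltnS => h'; apply: nex; by exists i.
  rewrite iM1 distrC ltr_distl in h; case/andP: h => h1 h2.
  rewrite ge_max (ltW h1) (ltW h2) !andbT leNgt; apply/negP => h3; apply: nex; exists M => //.
  rewrite distrC ltr_distl h3 andbT; apply: le_lt_trans h1; rewrite lerD2r; exact: y_ndec.
have mN := m_near e y.
apply: le_trans (le_prb P (mN M.+1) (measurableU _ _ (mN M) (m_itv a b)) sub') _.
apply: le_trans (prbU P (mN M) (m_itv a b)) _.
apply: le_trans (lerD IH (x_density ab)) _.
rewrite -mulrDr ler_wpM2l // big_ord_recr /= [leRHS]addrA lerD2l le_min; apply/andP; split.
  have : y M.+1 - e <= a by rewrite le_max lexx orbT. rewrite /b; lra.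
have : y M + e <= a by rewrite le_max lexx.
rewrite /b; lra.
Qed.

Let xi k i w : R := S (2%:R ^- k * i.+1%:R) w - S (2%:R ^- k * i%:R) w.

Let xi_ge0 k i w : 0 <= xi k i w.
rewrite subr_ge0; apply: (subordinator_nondecreasing sub).
  by rewrite mulr_ge0 // ltW.
by rewrite ler_pM2l // ler_nat.
Qed.

Let p_diff k i w : p k i.+1 w - p k i w <= xi k i w.
rewrite /p /dyadic_point /grid_point.
have -> : 1 - expR (- S (2%:R ^- k * i.+1%:R) w) - (1 - expR (- S (2%:R ^- k * i%:R) w)) =
    expR (- S (2%:R ^- k * i%:R) w) * (1 - expR (- xi k i w)).
  by rewrite mulrBr mulr1 -expRD (_ : - S (2%:R ^- k * i%:R) w - xi k i w =
    - S (2%:R ^- k * i.+1%:R) w); rewrite /xi; ring.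
have h1 : 1 - expR (- xi k i w) <= xi k i w by rewrite lerBlDl -lerBlDr expR_ge1Dx.
have h0 : 0 <= 1 - expR (- xi k i w) by rewrite subr_ge0 -[leRHS]expR0 ler_expR oppr_le0.
apply: le_trans h1; rewrite ler_piMl // -[leRHS]expR0 ler_expR oppr_le0.
by apply: (subordinator_ge0 hS); rewrite mulr_ge0 // ltW.
Qed.

Let bexp k i (c : R) : 0 <= c -> bmfun (fun w => expR (- (c * xi k i w))).
move=> c0; split.
  apply: measurableT_comp => //; apply: measurableT_comp => //; apply: measurable_funM => //.
  by apply: measurable_funB; apply: (subordinator_measurable sub); rewrite mulr_ge0 // ltW.
exists 1 => w; rewrite ger0_norm ?expR_ge0 // -[leRHS]expR0 ler_expR oppr_le0 mulr_ge0 //.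
Qed.

Let E k m T : set Omega :=
  [set w | D w /\ exists2 j, (j < n)%N & exists2 i, (i <= T * 2 ^ k)%N & `|p k i w - x j w| < eps m].

Let CE k m T : set (OF * OG) := [set z | D z.2 /\ exists2 j, (j < n)%N &
  exists2 i, (i <= T * 2 ^ k)%N & `|p k i z.1 - x j z.2| < eps m].

Let mCE k m T : measurable (CE k m T).
apply: measurableI => //.
apply: (@measurable_exists _ _ (fun j => [set z : OF * OG | exists2 i, (i <= T * 2 ^ k)%N &
  `|p k i z.1 - x j z.2| < eps m])) => j jn.
apply: (@measurable_exists _ _ (fun i => [set z : OF * OG | `|p k i z.1 - x j z.2| < eps m])) => i _.
apply: measurable_lt_set => //; apply: measurableT_comp => //.
by apply: measurable_funB; [exact: mp1 | exact: mx2].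
Qed.

Let mE k m T : measurable (E k m T).
apply: measurableI => //.
apply: (@measurable_exists _ _ (fun j => [set w | exists2 i, (i <= T * 2 ^ k)%N &
  `|p k i w - x j w| < eps m])) => j jn.
apply: (@measurable_exists _ _ (fun i => [set w | `|p k i w - x j w| < eps m])) => i _.
apply: measurable_lt_set => //; apply: measurableT_comp => //.
by apply: measurable_funB; [exact: (measurable_dyadic_point hS) | exact: mxO].
Qed.

Let Phi (c : R) : R := laplace_exp nu c.
Hypothesis Phi_ge0 : forall c, 0 <= c -> 0 <= Phi c.

(** The expected length of the neighbourhood of the grid. Since [min (1, x) <= 2 (1 - e^-x)], it is
    governed by [Phi(m) / m], which tends to 0 without drift; the bound does not depend on the
    mesh. *)
Let prb_E k m T : prb P (E k m T) <= C * (m.+1%:R^-1 + 2 * T%:R * (Phi m.+1%:R / m.+1%:R)).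
have -> : prb P (E k m T) = mean P (fun w : Omega => prb P [set w' | CE k m T (w, w')]).
  exact: (prb_decoupling mF mG hG (mCE k m T)).
have m0 : 0 < m.+1%:R :> R by rewrite ltr0n.
have e0 : 0 < eps m by rewrite invr_gt0 mulr_gt0.
have e2 : 2 * eps m = m.+1%:R^-1 by rewrite /eps; field; rewrite gt_eqF.
pose M := (T * 2 ^ k)%N.
pose g w := C * (m.+1%:R^-1 + \sum_(i < M) 2 * m.+1%:R^-1 * (1 + -1 * expR (- (m.+1%:R * xi k i w)))).
have bt i : bmfun (fun w => 2 * m.+1%:R^-1 * (1 + -1 * expR (- (m.+1%:R * xi k i w)))).
  apply: bmfunZ; apply: bmfunD; first exact: bmfun_cst.
  by apply: bmfunZ; apply: bexp; exact: ltW.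
have bs : bmfun (fun w => \sum_(i < M) 2 * m.+1%:R^-1 * (1 + -1 * expR (- (m.+1%:R * xi k i w)))).
  by apply: bmfun_sum => i _; exact: bt.
have bg : bmfun g.
  by apply: bmfunZ; apply: bmfunD => //; exact: bmfun_cst.
apply: (@le_trans _ _ (mean P g)).
  apply: le_mean => //; first exact: (bmfun_section P mF mG (mCE k m T)).
  move=> w; have := @prb_near (eps m) (fun i => p k i w) M e0 (fun i => grid_point_ndec hS (step_gt0 k) w (leqnSn i)).
  move/le_trans; apply; rewrite /g ler_wpM2l // e2 lerD2l; apply: ler_sum => i _.
  have h1 := p_diff k i w; have h2 := xi_ge0 k i w.
  have h3 : Num.min m.+1%:R^-1 (p k i.+1 w - p k i w) <= m.+1%:R^-1 * Num.min 1 (m.+1%:R * xi k i w).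
    rewrite minr_pMr ?invr_ge0 ?(ltW m0) // mulr1 mulKf ?gt_eqF // le_min ge_min lexx /=.
    by rewrite ge_min h1 orbT.
  apply: le_trans h3 _; rewrite -mulrA mulrCA ler_pM2l ?invr_gt0 // mulN1r.
  by apply: min1_le; rewrite mulr_ge0 // ltW.
rewrite /g meanZ; last by apply: bmfunD => //; exact: bmfun_cst.
rewrite ler_wpM2l // meanD //; last exact: bmfun_cst.
rewrite mean_cst lerD2l mean_sum; last by move=> i _; exact: bt.
have step i : mean P (fun w => 2 * m.+1%:R^-1 * (1 + -1 * expR (- (m.+1%:R * xi k i w)))) <=
    2 * m.+1%:R^-1 * (2%:R ^- k * Phi m.+1%:R).
  rewrite meanZ; last first.
    apply: bmfunD; first exact: bmfun_cst. by apply: bmfunZ; apply: bexp; exact: ltW.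
  rewrite meanD ?mean_cst; last 2 first.
  - exact: bmfun_cst.
  - by apply: bmfunZ; apply: bexp; exact: ltW. rewrite meanZ; last by apply: bexp; exact: ltW.
  rewrite (mean_increment_exp hS (step_gt0 k)) ?(ltW m0) // ler_wpM2l ?mulr_ge0 ?invr_ge0 ?(ltW m0) //.
  by rewrite mulN1r lerBlDl -lerBlDr expR_ge1Dx.
apply: (@le_trans _ _ (\sum_(i < M) (2 * m.+1%:R^-1 * (2%:R ^- k * Phi m.+1%:R)))).
  by apply: ler_sum => i _; exact: step.
rewrite sumr_const card_ord -[X in X <= _]mulr_natr /M natrM natrX; apply: le_of_eq.
by field; rewrite expf_neq0 // gt_eqF.
Qed.

Let Ft T : set Omega := [set w | D w /\ exists2 j, (j < n)%N & p 0%N T w <= x j w].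

Let mFt T : measurable (Ft T).
apply: measurableI => //; apply: (@measurable_exists _ _ (fun j => [set w | p 0%N T w <= x j w])) => j jn.
by apply: measurable_le_set; [exact: (measurable_dyadic_point hS) | exact: mxO].
Qed.

Let prb_Ft T : prb P (Ft T) <= C * expR (- (T%:R * Phi 1)).
pose CF : set (OF * OG) := [set z | D z.2 /\ exists2 j, (j < n)%N & p 0%N T z.1 <= x j z.2].
have mCF : measurable CF.
  apply: measurableI => //; apply: (@measurable_exists _ _
    (fun j => [set z : OF * OG | p 0%N T z.1 <= x j z.2])) => j jn.
  by apply: measurable_le_set; [exact: mp1 | exact: mx2].
have -> : prb P (Ft T) = mean P (fun w : Omega => prb P [set w' | CF (w, w')]).
  exact: (prb_decoupling mF mG hG mCF).
have ST w : 0 <= S T%:R w by apply: (subordinator_ge0 hS).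
have be : bmfun (fun w => expR (- (1 * S T%:R w))).
  split.
    apply: measurableT_comp => //; apply: measurableT_comp => //; apply: measurable_funM => //.
    exact: (subordinator_measurable sub).
  by exists 1 => w; rewrite ger0_norm ?expR_ge0 // -[leRHS]expR0 ler_expR oppr_le0 mul1r.
apply: (@le_trans _ _ (mean P (fun w => C * expR (- (1 * S T%:R w))))).
  apply: le_mean; first exact: (bmfun_section P mF mG mCF).
    exact: bmfunZ.
  move=> w; have e : p 0%N T w = 1 - expR (- S T%:R w).
    by rewrite /p /dyadic_point /grid_point expr0 invr1 mul1r.
  have p1 : p 0%N T w <= 1 by rewrite e lerBlDr lerDl expR_ge0.
  apply: (@le_trans _ _ (C * (1 - p 0%N T w))); last first.
    by rewrite e ler_wpM2l // mul1r; apply: le_of_eq; ring.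
  apply: le_trans (x_density p1); apply: le_prb => //.
    apply: measurableI => //; apply: (@measurable_exists _ _ (fun j => [set w' | p 0%N T w <= x j w'])) => j jn.
    by apply: measurable_le_set => //; exact: mxO.
  move=> w' [Dw [j jn h]]; split=> //; exists j => //; rewrite h.
  by have /andP[] := x_itv Dw jn.
rewrite meanZ // ler_wpM2l //.
have [_ _ lk] := hS; rewrite /mean lk // mul0r add0r; exact: lexx.
Qed.

Hypothesis Phi1 : 0 < Phi 1.
Hypothesis driftless : forall e : R, 0 < e -> exists m0, forall m, (m0 <= m)%N -> Phi m.+1%:R / m.+1%:R <= e.

Let bad : set Omega := [set w | D w /\ exists2 j, (j < n)%N & ~ in_gap (range w) (x j w)].

Let mbad : measurable bad.
apply: measurableI => //; apply: (@measurable_exists _ _ (fun j => [set w | ~ in_gap (range w) (x j w)])) => j jn.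
by apply: measurableC; apply: (measurable_in_gap hS); exact: mxO.
Qed.

Let bad_sub m T : bad `<=` Ft T `|` \bigcup_k E k m T.
move=> w [Dw [j jn nin]].
have [xT|Tx] := leP (p 0%N T w) (x j w); first by left; split=> //; exists j.
right.
have [k [i near]] : exists k i, `|p k i w - x j w| < eps m.
  apply: contrapT => nex; apply: nin; apply/(in_gap_dyadic hS); have /andP[x0 _] := x_itv Dw jn.
  split; first exact: ltW; last by exists 0%N, T.
  exists (2 * m.+1).-1 => k i; rewrite leNgt; apply/negP => h; apply: nex; exists k, i.
  by rewrite /eps -natrM (_ : (2 * m.+1 = (2 * m.+1).-1.+1)%N) // prednK // muln_gt0.
exists k => //; split=> //; exists j => //.
have [iT|Ti] := leqP i (T * 2 ^ k); first by exists i.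
exists (T * 2 ^ k)%N => //.
have eT : p k (T * 2 ^ k) w = p 0%N T w by have := dyadic_refine S 0 k T w; rewrite add0n.
have pi : p k (T * 2 ^ k) w <= p k i w by exact: (grid_point_ndec hS (step_gt0 k) w (ltnW Ti)).
apply: le_lt_trans near; rewrite ger0_norm; last by rewrite subr_ge0 eT ltW.
by apply: le_trans (ler_norm _); rewrite lerD2r.
Qed.

(** A sample point in no gap is either beyond time [T] or arbitrarily close to dyadic points before
    [T]. One picks [T] first and [m] next; the events increase with [k], so the uniform bound passes
    to their union. *)
Lemma prb_bad : prb P bad = 0.
Proof.
have mU m T : measurable (\bigcup_k E k m T) by apply: bigcupT_measurable => k.
have bU m T : prb P (\bigcup_k E k m T) <= C * (m.+1%:R^-1 + 2 * T%:R * (Phi m.+1%:R / m.+1%:R)).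
  apply: prb_bigcup_le => [k|k l kl w|k]; [exact: mE | | exact: prb_E].
  move=> [Dw [j jn [i iT h]]]; split=> //; exists j => //; exists (i * 2 ^ (l - k))%N.
    by rewrite -{2}(subnKC kl) expnD mulnA leq_mul2r iT orbT.
  by have := dyadic_refine S k (l - k) i w; rewrite subnKC // -/p => ->.
have b m T : prb P bad <= C * expR (- (T%:R * Phi 1)) +
    C * (m.+1%:R^-1 + 2 * T%:R * (Phi m.+1%:R / m.+1%:R)).
  apply: le_trans (lerD (prb_Ft T) (bU m T)); apply: le_trans (prbU P (mFt T) (mU m T)).
  apply: le_prb; [exact: mbad | by apply: measurableU; [exact: mFt | exact: mU] | exact: bad_sub].
apply/eqP; rewrite eq_le prb_ge0 andbT; apply/ler_addgt0Pl => e e0; rewrite addr0.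
have C1 : 0 < C + 1 by rewrite ltr_wpDl.
have e3 : 0 < e / (3 * (C + 1)) by rewrite divr_gt0 // mulr_gt0.
have [T hT] : exists T, expR (- (T%:R * Phi 1)) <= e / (3 * (C + 1)).
  have hb := archi_boundP (ltW (divr_gt0 (divr_gt0 ltr01 e3) Phi1)).
  exists (Num.bound (1 / (e / (3 * (C + 1))) / Phi 1)).
  rewrite expRN invf_ple ?posrE ?expR_gt0 //.
  move: hb; rewrite ltr_pdivrMr // div1r => /ltW h; apply: le_trans h _.
  by apply: le_trans (expR_ge1Dx _); rewrite lerDr.
have T1 : 0 < 2 * T%:R + 1 :> R by rewrite ltr_wpDl // mulr_ge0.
have e4 : 0 < e / (3 * (C + 1)) / (2 * T%:R + 1) by rewrite divr_gt0.
have [m0 hm0] := driftless e4.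
have hb := archi_boundP (ltW (divr_gt0 ltr01 e3)).
pose m := maxn m0 (Num.bound (1 / (e / (3 * (C + 1))))).
have h1 : m.+1%:R^-1 <= e / (3 * (C + 1)).
  rewrite invf_ple ?posrE ?ltr0n //; rewrite div1r in hb; apply: ltW; apply: lt_le_trans hb _.
  by rewrite ler_nat /m div1r leqW // leq_maxr.
have h2 : 2 * T%:R * (Phi m.+1%:R / m.+1%:R) <= e / (3 * (C + 1)).
  apply: (@le_trans _ _ ((2 * T%:R + 1) * (e / (3 * (C + 1)) / (2 * T%:R + 1)))); last first.
    by rewrite mulrC divfK // gt_eqF.
  apply: ler_pM; [exact: mulr_ge0 | | by rewrite lerDl | exact/hm0/leq_maxl].
  by apply: divr_ge0 => //; apply: Phi_ge0; exact: ler0n.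
apply: le_trans (b m T) _.
apply: (@le_trans _ _ ((C + 1) * (3 * (e / (3 * (C + 1)))))); last first.
  by apply: le_of_eq; field; rewrite gt_eqF.
rewrite -mulrDr; apply: ler_pM => //; first by rewrite !addr_ge0 ?expR_ge0 ?invr_ge0 ?mulr_ge0 ?Phi_ge0.
  by rewrite lerDl.
exact: sum3_le.
Qed.

Let K w : nat := nb_gaps (closed_range S w) (fun B => count (fun y => y \in B) [seq x j w | j <- iota 0 n]) r.

Let cells k w : nat := cell_count (fun i => p k i w) (4 ^ k) [seq x j w | j <- iota 0 n] r.

Let good_cells k w : nat := cell_count (fun i => p k i w) (4 ^ k)
  [seq x j w | j <- iota 0 n & `[< in_gap (range w) (x j w) >]] r.

Let good_cells_near w : exists k0, forall k, (k0 <= k)%N -> good_cells k w = K w.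
have [k0 hk] := cell_count_nb_gaps hS w [seq x j w | j <- iota 0 n] r_gt0.
by exists k0 => k /hk h; rewrite /K -h /good_cells filter_map.
Qed.

Let m_good_cells k Q : measurable [set w | Q (good_cells k w)].
apply: (@measurable_cells _ _ R n (4 ^ k) r (p k) x (fun j => [set w | in_gap (range w) (x j w)]) Q) => //.
- by move=> i; exact: (measurable_dyadic_point hS).
- by move=> j jn; apply: (measurable_in_gap hS); exact: mxO.
Qed.

Let CC k Q : set (OF * OG) := [set z | D z.2 /\
  Q (cell_count (fun i => p k i z.1) (4 ^ k) [seq x j z.2 | j <- iota 0 n] r)].

Let mCC k Q : measurable (CC k Q).
apply: measurableI => //.
have := @measurable_cells _ _ R n (4 ^ k) r (fun i (z : OF * OG) => p k i z.1)
  (fun j z => x j z.2) (fun=> setT) Q (fun i => mp1 k i) (fun j jn => mx2 jn) (fun _ _ => measurableT).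
congr measurable; apply/funext => z /=; congr (is_true (Q (cell_count _ _ (map _ _) _))).
by rewrite (_ : (fun j => _) = xpredT) ?filter_predT //; apply/funext => j; apply/asboolP.
Qed.

Lemma prb_cells k Q : prb P [set w | D w /\ Q (cells k w)] =
  q * cell_law (fun j => expR (- (2%:R ^- k * Phi j%:R))) r (4 ^ k) n (fun i => (Q i)%:R).
Proof.
transitivity (mean P (fun w : Omega => prb P [set w' | CC k Q (w, w')])).
  exact: (prb_decoupling mF mG hG (mCC k Q)).
rewrite -(mean_occupancy hS r (step_gt0 k)) -meanZ; last exact: (bmfun_occupancy hS r (step_gt0 k)).
apply: eq_mean => w; rewrite -x_law //.
- by move=> i; exact: (grid_point_ndec hS (step_gt0 k) w (leqnSn i)).
- exact: (grid_point0 hS).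
- by move=> i; exact: (grid_point_itv hS (step_gt0 k)).
Qed.

Let mK : forall m, measurable [set w | K w = m].
by apply: (measurable_nb_gaps hS r_gt0) => j jn; exact: mxO. Qed.

(** Outside the null event [bad], removing the points that lie in no gap changes nothing. The cell
    counts so reduced are eventually equal to the gap count for every [w], and dominated convergence
    applies. *)
Lemma cvg_cell_law Q : q * cell_law (fun j => expR (- (2%:R ^- k * Phi j%:R))) r (4 ^ k) n (fun i => (Q i)%:R)
  @[k --> \oo] --> prb P [set w | D w /\ Q (K w)].
Proof.
have mQK : measurable [set w | Q (K w)].
  rewrite (_ : [set w | _] = \bigcup_(m in [set m | Q m]) [set w | K w = m]).
    by apply: bigcup_measurable => m _; exact: mK.
  by apply/seteqP; split=> w /= => [h|[m hm ->] //]; exists (K w).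
pose A k : set Omega := [set w | D w /\ Q (good_cells k w)].
have mA k : measurable (A k) by apply: measurableI => //; exact: m_good_cells.
have mB k : measurable [set w | D w /\ Q (cells k w)].
  apply: measurableI => //. have := @measurable_cells _ _ R n (4 ^ k) r (p k) x (fun=> setT) Q
    (measurable_dyadic_point hS k) mxO (fun _ _ => measurableT).
  congr measurable; apply/funext => w /=; congr (is_true (Q (cell_count _ _ (map _ _) _))).
  by rewrite (_ : (fun j => _) = xpredT) ?filter_predT //; apply/funext => j; apply/asboolP.
have off w k : ~ bad w -> A k w <-> D w /\ Q (cells k w).
  move=> nb; split=> -[Dw h]; split=> //; move: h; rewrite /good_cells /cells.
  - rewrite (_ : [seq j <- iota 0 n | `[< in_gap (range w) (x j w) >]] = iota 0 n) //.
    apply/all_filterP/allP => j; rewrite mem_iota /= add0n => jn; apply/asboolP.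
    by apply: contrapT => h; apply: nb; split=> //; exists j.
  - rewrite (_ : [seq j <- iota 0 n | `[< in_gap (range w) (x j w) >]] = iota 0 n) //.
    apply/all_filterP/allP => j; rewrite mem_iota /= add0n => jn; apply/asboolP.
    by apply: contrapT => h; apply: nb; split=> //; exists j.
have eqAB k : prb P [set w | D w /\ Q (cells k w)] = prb P (A k).
  apply/eqP; rewrite eq_le; apply/andP; split.
  - rewrite -[leRHS]addr0 -prb_bad; apply: le_trans (prbU P (mA k) mbad).
    apply: le_prb => //; first exact: measurableU.
    by move=> w h; have [b|nb] := pselect (bad w); [right | left; apply/(off w k nb)].
  - rewrite -[leRHS]addr0 -prb_bad; apply: le_trans (prbU P (mB k) mbad).
    apply: le_prb => //; first exact: measurableU.
    by move=> w h; have [b|nb] := pselect (bad w); [right | left; apply/(off w k nb)].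
have -> : (fun k => q * cell_law (fun j => expR (- (2%:R ^- k * Phi j%:R))) r (4 ^ k) n (fun i => (Q i)%:R)) =
    (fun k => mean P (\1_(A k))).
  by apply/funext => k; rewrite -prb_cells eqAB mean_indic.
rewrite -mean_indic; last exact: measurableI.
apply: (@mean_cvg _ _ _ P _ _ 1) => [k|k w|w].
- exact: measurable_indic.
- by rewrite indicE; case: (_ \in _); rewrite ?normr1 ?normr0.
have [k0 hk] := good_cells_near w.
apply: cvg_near_cst; exists k0 => // k /= kk.
by rewrite !indicE; congr (nat_of_bool _)%:R; apply/idP/idP; rewrite !inE /A /= hk.
Qed.

End Sample.

(** * The composition of a uniform sample *)

Lemma prb_exists_le (d : measure_display) (Omega : measurableType d) (R : realType)
    (P : probability Omega R) (A : nat -> set Omega) (c : R) n :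
  (forall j, measurable (A j)) -> (forall j, prb P (A j) <= c) ->
  prb P [set w | exists2 j, (j < n)%N & A j w] <= n%:R * c.
Proof.
move=> mA hA; elim: n => [|m IH].
  rewrite mul0r (_ : [set w | _] = set0) ?/prb ?measure0 //. by apply/seteqP; split=> w // [].
have mm k : measurable [set w | exists2 j, (j < k)%N & A j w] by apply: measurable_exists => j _.
apply: (@le_trans _ _ (prb P [set w | exists2 j, (j < m)%N & A j w] + prb P (A m))).
  apply: le_trans (prbU P (mm m) (mA m)); apply: le_prb => //; first exact: measurableU.
  move=> w [j]; rewrite ltnS leq_eqVlt => /predU1P[-> ?|jm ?]; [by right | by left; exists j].
by rewrite -natr1 mulrDl mul1r lerD.
Qed.

Section UniformComposition.
Context d (Omega : measurableType d) (R : realType) (P : probability Omega R).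
Variables (S : R -> Omega -> R) (nu : {measure set R -> \bar R}).
Hypothesis hS : driftless_subordinator P S nu.
Variables (u : forall n : nat, 'I_n -> Omega -> R) (r : nat).
Arguments u : clear implicits.
Hypothesis hu : forall n : nat, iid_uniform P (u n).
Hypothesis huS : forall n : nat, independent_systems P
  (sigma_generated `[0, +oo[%classic S) (sigma_generated setT (u n)).
Hypothesis r_gt0 : (0 < r)%N.
Let Phi (c : R) : R := laplace_exp nu c.
Hypotheses (Phi_ge0 : forall c, 0 <= c -> 0 <= Phi c) (Phi0 : Phi 0 = 0) (Phi1 : 0 < Phi 1).
Hypothesis driftless : forall e : R, 0 < e -> exists m0, forall m, (m0 <= m)%N -> Phi m.+1%:R / m.+1%:R <= e.
Implicit Types (n m i j k : nat) (w : Omega) (Q : pred nat).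

Definition uniform_parts n w : nat := nb_gaps (closed_range S w) (sample_count (u n) w) r.
Let K := uniform_parts.

(** Extension of the sample to all natural indices, with the default value 0 from [n] on. *)
Let x n j w : R := if insub j is Some i then u n i w else 0.

Let xE n w : [seq x n j w | j <- iota 0 n] = [seq u n v w | v <- enum 'I_n].
rewrite -val_enum_ord -map_comp; apply: eq_map => i /=.
by rewrite /x valK.
Qed.

Let sample_countE n w : sample_count (u n) w = (fun B => count (fun y => y \in B) [seq x n j w | j <- iota 0 n]).
apply/funext => B; rewrite /sample_count xE count_map -sum1_count -sum1_card big_enum_cond /=.
by apply: eq_bigl => j; rewrite inE.
Qed.

Let G n : set (set Omega) := \bigcup_(i in setT) preimage_set_system setT (u n i) measurable.

Let mG n : G n `<=` measurable.
by move=> A [i _ [B mB <-]]; case: (hu n) => mu _ _; exact: mu. Qed.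

Let mx n j : (j < n)%N -> measurable_fun setT (x n j : g_sigma_algebraType (G n) -> R).
move=> jn _ B mB; apply: sub_sigma_algebra; exists (Ordinal jn) => //; exists B => //.
by rewrite /x; congr (_ `&` _); apply/funext => w; rewrite /= (insubT (fun j => j < n)%N jn).
Qed.

Let mxO n j : measurable_fun setT (x n j).
by rewrite /x; case: (insub j) => // i; case: (hu n). Qed.

(** An event of probability 1 that excludes the value 0 and the values outside [[0, 1]]. *)
Let D n : set Omega := [set w | [forall i : 'I_n, 0 < u n i w <= 1]].

Let DE n : D n = \bigcap_(i in [set: 'I_n]) (u n i @^-1` `]0, 1]%classic).
apply/seteqP; split=> w /=; first by move=> /forallP h i _; rewrite /= in_itv /=; exact: h.
by move=> h; apply/forallP => i; have := h i I; rewrite /= in_itv.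
Qed.

Let mD n : <<s G n>> (D n).
rewrite DE; have : @measurable _ (g_sigma_algebraType (G n)) (\bigcap_(i in [set: 'I_n]) (u n i @^-1` `]0, 1]%classic)).
  apply: fin_bigcap_measurable; first exact: finite_finset.
  move=> i _; apply: sub_sigma_algebra; exists i => //; exists `]0, 1]%classic => //.
  by rewrite setTI.
exact.
Qed.

Let mDO n : measurable (D n).
rewrite DE; apply: fin_bigcap_measurable; first exact: finite_finset.
by move=> i _; rewrite -[X in measurable X]setTI; case: (hu n) => mu _ _; exact: mu.
Qed.

Let prb_itv n (i : 'I_n) (a b : R) : a <= b -> prb P (u n i @^-1` `[a, b]%classic) <= b - a.
move=> ab; rewrite -lee_fin prbE; last first.
  by rewrite -[X in measurable X]setTI; case: (hu n) => mu _ _; exact: mu.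
rewrite (prb_uniform (hu n)) //.
have : (lebesgue_measure (`[a, b]%classic `&` `[0%R, 1%R]%classic : set R) <= lebesgue_measure (`[a, b]%classic : set R))%E.
  by apply: le_measure; rewrite ?inE //; exact: measurableI.
move/le_trans; apply; rewrite lebesgue_measure_itv /= lte_fin; case: ltP => // ba.
by rewrite lee_fin subr_ge0.
Qed.

Let density n (a b : R) : a <= b ->
  prb P [set w | D n w /\ exists2 j, (j < n)%N & a <= x n j w <= b] <= n%:R * (b - a).
move=> ab; pose A i := if insub i is Some i' then u n i' @^-1` `[a, b]%classic else set0.
have mA i : measurable (A i).
  by rewrite /A; case: insub => // i'; rewrite -[X in measurable X]setTI; case: (hu n) => mu _ _; exact: mu.
apply: le_trans (prb_exists_le n mA (c := b - a) _); last first.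
  move=> j; rewrite /A; case: insub => [i'|]; first exact: prb_itv.
  by rewrite /prb measure0 subr_ge0.
apply: le_prb.
- apply: measurableI => //; apply: (@measurable_exists _ _ (fun j => [set w | a <= x n j w <= b])) => j jn.
  have := mxO n j measurableT (measurable_itv `[a, b]); rewrite setTI; congr measurable.
- exact: measurable_exists.
move=> w [_ [j jn h']]; exists j => //; rewrite /A; move: h'; rewrite /x; case: insubP => [i _ _|].
  by rewrite /= in_itv.
by rewrite jn.
Qed.

Let prb_D n : prb P (D n) = 1.
pose B j := if insub j is Some i then u n i @^-1` (~` `]0, 1]%classic) else set0.
have mB j : measurable (B j).
  rewrite /B; case: insub => // i.
  by rewrite -[X in measurable X]setTI; case: (hu n) => mu _ _; apply: mu => //; exact: measurableC.
have B0 j : prb P (B j) <= 0.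
  rewrite /B; case: insub => [i|]; last by rewrite /prb measure0.
  rewrite /prb (prb_uniform (hu n)); last exact: measurableC.
  have -> // : lebesgue_measure (~` `]0, 1]%classic `&` `[0, 1]%classic : set R) = 0%E.
  apply/eqP; rewrite eq_le measure_ge0 andbT -(lebesgue_measure_set1 (0 : R)).
  apply: le_measure; rewrite ?inE //; first by apply: measurableI => //; exact: measurableC.
  move=> y [/= h]; rewrite !in_itv /= in h * => /andP[y0 y1]; apply/eqP; rewrite eq_le y0 andbT.
  by rewrite leNgt; apply/negP => y0'; apply: h; rewrite y0' y1.
have mE : measurable [set w | exists2 j, (j < n)%N & B j w] by apply: measurable_exists => j _.
apply/eqP; rewrite eq_le prb_le1 //=.
have : prb P setT <= prb P (D n) + prb P [set w | exists2 j, (j < n)%N & B j w].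
  apply: le_trans (prbU P (mDO n) mE); apply: le_prb => //; first exact: measurableU.
  move=> w _; have [|/forallP nD] := boolP [forall i : 'I_n, 0 < u n i w <= 1]; first by left.
  right; have [v hi] : exists v, ~ (0 < u n v w <= 1).
    by apply/existsNP => h; apply: nD => v; exact: h.
  by exists v => //; rewrite /B valK /= in_itv.
rewrite {1}/prb probability_setT /= => h; apply: le_trans h _.
rewrite gerDl; apply: le_trans (prb_exists_le n mB B0) _; by rewrite mulr0.
Qed.

Let law n (p : nat -> R) l Q : (forall i, p i <= p i.+1) -> p 0%N = 0 -> (forall i, 0 <= p i < 1) ->
  prb P [set w | D n w /\ Q (cell_count p l [seq x n j w | j <- iota 0 n] r)] =
  1 * occupancy r [seq (p i.+1 - p i) / (1 - p i) | i <- iota 0 l] n (fun k => (Q k)%:R).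
move=> p_ndec p0 p01.
have pge0 i : 0 <= p i by case/andP: (p01 i).
have plt1 i : p i < 1 by case/andP: (p01 i).
have [mA] := uniform_cell_count (hu n) p_ndec pge0 plt1 l Q r_gt0.
rewrite p0 subr0 expr1n => <-; rewrite p0 in mA.
set A := [set w | _] in mA *.
have e w : D n w -> A w <-> Q (cell_count p l [seq x n j w | j <- iota 0 n] r).
  move=> Dw; rewrite /A /= xE; split=> [/andP[]//|->]; rewrite andbT.
  by apply/forallP => i; move/forallP: Dw => /(_ i)/andP[].
rewrite (_ : [set w | D n w /\ _] = D n `&` A); last first.
  by apply/seteqP; split=> w /= [Dw] /(e w Dw).
have mDA : measurable (D n `&` A) by exact: measurableI.
apply/eqP; rewrite eq_le; apply/andP; split.
  by apply: le_prb => //; move=> w [].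
have mnD : measurable (~` D n) by exact: measurableC.
have nD0 : prb P (~` D n) = 0.
  by apply: EFin_inj; rewrite prbE // probability_setC // -prbE // prb_D subee.
rewrite -[leRHS]addr0 -nD0; apply: le_trans (prbU P mDA mnD).
by apply: le_prb => //; [exact: measurableU | move=> w Aw; have [|] := pselect (D n w); [left|right]].
Qed.

Let KE n w : K n w = nb_gaps (closed_range S w)
  (fun B => count (fun y => y \in B) [seq x n j w | j <- iota 0 n]) r.
by rewrite /K /uniform_parts sample_countE. Qed.

Let mK n m : measurable [set w | K n w = m].
have -> : [set w | K n w = m] = [set w | nb_gaps (closed_range S w)
    (fun B => count (fun y => y \in B) [seq x n j w | j <- iota 0 n]) r = m].
  by apply/seteqP; split=> w /=; rewrite KE.
exact: (measurable_nb_gaps hS r_gt0 (fun j (_ : (j < n)%N) => mxO n j)).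
Qed.

Lemma measurable_uniform_parts n m : measurable [set w | uniform_parts n w = m].
Proof. exact: mK. Qed.

Let F k j : R := expR (- (2%:R ^- k * Phi j%:R)).

Let cvg_pred n Q : cell_law (F k) r (4 ^ k) n (fun i => (Q i)%:R) @[k --> \oo] --> prb P [set w | Q (K n w)].
have x_itv w : D n w -> forall j, (j < n)%N -> 0 < x n j w <= 1.
  by move=> /forallP h j jn; rewrite /x insubT.
have := cvg_cell_law hS (@mG n) (@huS n) (@mD n) (@mx n) (ler0n R n) x_itv (@density n) (@law n) r_gt0
  Phi_ge0 Phi1 driftless (Q := Q).
have -> : (fun k => 1 * cell_law (fun j => expR (- (2%:R ^- k * Phi j%:R))) r (4 ^ k) n (fun i => (Q i)%:R)) =
  (fun k => cell_law (F k) r (4 ^ k) n (fun i => (Q i)%:R)) by apply/funext => k; rewrite mul1r.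
have mQ : measurable [set w | Q (K n w)].
  rewrite (_ : [set w | _] = \bigcup_(m in [set m | Q m]) [set w | K n w = m]).
    by apply: bigcup_measurable => m _; exact: mK.
  by apply/seteqP; split=> w /= => [h|[m hm ->] //]; exists (K n w).
move=> h; suff <- : prb P [set w | D n w /\ Q (nb_gaps (closed_range S w)
    (fun B => count (fun y => y \in B) [seq x n j w | j <- iota 0 n]) r)] = prb P [set w | Q (K n w)] by [].
have -> : [set w | D n w /\ Q (nb_gaps (closed_range S w)
    (fun B => count (fun y => y \in B) [seq x n j w | j <- iota 0 n]) r)] = D n `&` [set w | Q (K n w)].
  by apply/funext => w; rewrite /setI /= KE.
have mDA : measurable (D n `&` [set w | Q (K n w)]) by exact: measurableI.
have mnD : measurable (~` D n) by exact: measurableC.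
have nD0 : prb P (~` D n) = 0.
  by apply: EFin_inj; rewrite prbE // probability_setC // -prbE // prb_D subee.
apply/eqP; rewrite eq_le; apply/andP; split.
  by apply: le_prb => //; move=> w [].
rewrite -[leRHS]addr0 -nD0; apply: le_trans (prbU P mDA mnD).
by apply: le_prb => //; [exact: measurableU | move=> w Aw; have [|] := pselect (D n w); [left|right]].
Qed.

Definition part_law n m : R := prb P [set w | uniform_parts n w = m].

Lemma part_law_ge0 n m : 0 <= part_law n m.
Proof. exact: prb_ge0. Qed.

Lemma uniform_parts_le n w : (uniform_parts n w <= n)%N.
Proof.
have D0 : transformed_range S w 0.
  by rewrite -(grid_point0 hS 1 w); exists (1 * 0%:R); rewrite //= in_itv /= mulr0 lexx.
rewrite -/(K n w) KE.
have -> : closed_range S w = closure (transformed_range S w) by [].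
rewrite (nb_gaps_class_count D0 (@transformed_range_itv _ _ _ _ _ _ hS w)) // /class_count.
rewrite (leq_trans (size_undup _)) // size_map size_filter (leq_trans (count_size _ _)) //.
by rewrite size_filter (leq_trans (count_size _ _)) // size_map size_iota.
Qed.

Let mean_fun n (h : nat -> R) : mean P (fun w => h (K n w)) = part_mean part_law h n.
have e w : h (K n w) = \sum_(m < n.+1) h m * \1_[set w | K n w = m] w.
  have Kn : (K n w < n.+1)%N by rewrite ltnS; exact: uniform_parts_le.
  rewrite (bigD1 (Ordinal Kn)) //= indicE mem_set // mulr1 big1 ?addr0 // => i.
  rewrite -val_eqE /= indicE => ne; rewrite memNset ?mulr0 // => /= e.
  by rewrite -e eqxx in ne.
rewrite (eq_mean P e) mean_sum; last first.
  by move=> m _; apply: bmfunZ; apply: bmfun_indic; exact: mK.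
apply: eq_bigr => m _; rewrite meanZ; last by apply: bmfun_indic; exact: mK.
by rewrite mean_indic 1?mulrC //; exact: mK.
Qed.

Lemma mean_uniform_parts n (h : nat -> R) : mean P (fun w => h (uniform_parts n w)) = part_mean part_law h n.
Proof. exact: mean_fun. Qed.

Lemma part_law_sum n : part_mean part_law (fun=> 1) n = 1.
Proof. by rewrite -mean_fun mean_cst. Qed.

Lemma cvg_part_mean n (h : nat -> R) :
  cell_law (F k) r (4 ^ k) n h @[k --> \oo] --> part_mean part_law h n.
Proof.
have e k : cell_law (F k) r (4 ^ k) n h =
    \sum_(m < n.+1) h m * cell_law (F k) r (4 ^ k) n (fun i => (i == m)%:R).
  rewrite -cell_law_sum; apply: eq_cell_law => // i.
  rewrite -ltnS => ni; rewrite (bigD1 (Ordinal ni)) //= eqxx mulr1 big1 ?addr0 // => j.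
  by rewrite -val_eqE /= eq_sym => /negbTE ->; rewrite mulr0.
have -> : (fun k => cell_law (F k) r (4 ^ k) n h) =
    (fun k => \sum_(m < n.+1) h m * cell_law (F k) r (4 ^ k) n (fun i => (i == m)%:R)).
  by apply/funext => k; exact: e.
rewrite /part_mean; apply: cvgr_sum => m _; rewrite mulrC; apply: cvgMr.
have := @cvg_pred n (pred1 (nat_of_ord m)).
rewrite (_ : [set w | pred1 (nat_of_ord m) (K n w)] = [set w | K n w = m]) //.
by apply/seteqP; split=> w /eqP.
Qed.

Lemma part_law_rec (h : nat -> R) n : \sum_(i < n) rate nu n i * (part_mean part_law h n -
  part_mean part_law (fun k => h ((n - i == r) + k)%N) i) = 0.
Proof.
(* The limiting recursion holds for bounded functions; only the values of [h] up to [n] enter, so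
   truncation is harmless. *)
pose h' k := if (k <= n)%N then h k else 0.
pose M : R := \sum_(k < n.+1) `|h k|.
have hM k : `|h' k| <= M.
  rewrite /h'; case: leqP => kn; last by rewrite normr0 /M sumr_ge0.
  by rewrite /M (bigD1 (Ordinal (kn : (k < n.+1)%N))) //= lerDl sumr_ge0.
have w_ge0 k i j : 0 <= cell_weight (F k) i j.
  by apply: (cell_weight_ge0 hS); rewrite invr_gt0 exprn_gt0.
have := @cell_law_recursion _ nu r r_gt0 w_ge0 Phi0 Phi1 (fun j => Phi_ge0 (ler0n R j))
  (fun n h => part_mean part_law h n) n h' M hM (fun j h _ _ => @cvg_part_mean j h).
move=> e; rewrite -[RHS]e; apply: eq_bigr => i _; congr (_ * (_ - _)).
  by apply: eq_bigr => k _; rewrite /h' -ltnS ltn_ord.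
apply: eq_bigr => k _; rewrite /h' (shift_le r_gt0) //; first exact: ltnW.
by rewrite -ltnS.
Qed.

End UniformComposition.

(** * The composition of a Poisson sample *)

Section PoissonComposition.
Context d (Omega : measurableType d) (R : realType) (P : probability Omega R).
Variables (S : R -> Omega -> R) (nu : {measure set R -> \bar R}).
Hypothesis hS : driftless_subordinator P S nu.
Variables (N : Omega -> set R) (rho : R) (r : nat).
Hypotheses (rho_gt0 : 0 < rho) (hN : poisson_process P rho N).
Hypothesis hNS : independent_systems P
  (sigma_generated `[0, +oo[%classic S) (sigma_generated measurable (atom_count N)).
Hypothesis r_gt0 : (0 < r)%N.
Let Phi (c : R) : R := laplace_exp nu c.
Hypotheses (Phi_ge0 : forall c, 0 <= c -> 0 <= Phi c) (Phi1 : 0 < Phi 1).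
Hypothesis driftless : forall e : R, 0 < e -> exists m0, forall m, (m0 <= m)%N -> Phi m.+1%:R / m.+1%:R <= e.
Implicit Types (n m i j k : nat) (w : Omega) (Q : pred nat).

Definition poisson_parts w : nat := nb_gaps (closed_range S w) ((atom_count N)^~ w) r.
Definition atoms w : nat := atom_count N `[0, 1]%classic w.
Let K := poisson_parts.

(** The atoms in increasing order. Sorting makes the [j]-th atom measurable: to compare it with [t]
    is to count the atoms up to [t]. *)
Let s w : seq R := sort <=%R (enum_fset (fset_set (N w))).
Let x j w : R := nth 0 (s w) j.

Let finN w : finite_set (N w). exact: (poisson_process_finite hN). Qed.
Let finNA w (A : set R) : finite_set (N w `&` A).
by apply: sub_finite_set (finN w) => y []. Qed.

Let perm_s w : perm_eq (s w) (enum_fset (fset_set (N w))).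
by rewrite perm_sort. Qed.

Let mem_s w y : (y \in s w) = (y \in N w).
by rewrite (perm_mem (perm_s w)) in_fset_set //; exact: finN. Qed.

Let atom_countE (A : set R) w : atom_count N A w = count (fun y => y \in A) (s w).
rewrite (permP (perm_s w)) -size_filter /atom_count.
have -> : fset_set (N w `&` A) = [fset y in [seq y <- enum_fset (fset_set (N w)) | y \in A]]%fset.
  apply/fsetP => y; rewrite !inE in_fset_set // mem_filter; apply/idP/andP.
    rewrite inE => -[Ny Ay]; split; first by rewrite inE. by rewrite in_fset_set ?inE.
  by case=> hA; rewrite in_fset_set // => hy; rewrite inE; split; rewrite -inE.
by rewrite card_fseq undup_id // filter_uniq // fset_uniq.
Qed.

Let size_s w : size (s w) = atoms w.
rewrite /atoms atom_countE; apply/esym/eqP; rewrite -all_count; apply/allP => y.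
by rewrite mem_s !inE => /(poisson_process_support hN).
Qed.

Let G : set (set Omega) := \bigcup_(A in measurable) preimage_set_system setT (atom_count N A) measurable.

Let mG : G `<=` measurable.
by move=> A [B mB [Y mY <-]]; exact: (poisson_process_measurable hN). Qed.

Let mcount (A : set R) n : measurable A -> <<s G>> [set w | atom_count N A w = n].
move=> mA; apply: sub_sigma_algebra; exists A => //; exists [set n] => //.
by rewrite setTI.
Qed.

Let count_le (t : R) j w : (j < atoms w)%N -> (x j w <= t) = (j < atom_count N `]-oo, t]%classic w)%N.
rewrite -size_s => js; have sorted_s : sorted <=%O (s w) by apply: sort_le_sorted.
rewrite atom_countE.
have -> : count (fun y => y \in `]-oo, t]%classic) (s w) = count (<= t)%O (s w).
  by apply: eq_count => y; apply/idP/idP; rewrite inE /= in_itv.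
case: (ltnP j (count (<= t)%O (s w))) => h; first by rewrite /x (nth_count_le 0 sorted_s h).
by apply/negbTE; rewrite -ltNge; apply: nth_count_gt => //; rewrite h.
Qed.

Let mcount_lt (A : set R) j : measurable A -> <<s G>> [set w | (j < atom_count N A w)%N].
move=> mA; apply: sub_sigma_algebra; exists A => //; exists [set n | (j < n)%N] => //.
by rewrite setTI.
Qed.

Let mx j : measurable_fun setT (x j : g_sigma_algebraType G -> R).
apply: (measurability _ (RGenOInfty.measurableE R)).
move=> _ [_ [t ->] <-]; rewrite setTI.
rewrite (_ : _ @^-1` _ = ~` [set w | x j w <= t]); last first.
  by apply/seteqP; split=> w /=; rewrite in_itv /= andbT ltNge => /negP.
apply: measurableC.
rewrite (_ : [set w | x j w <= t] = ([set w | (j < atoms w)%N] `&` [set w | (j < atom_count N `]-oo, t]%classic w)%N])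
    `|` (~` [set w | (j < atoms w)%N] `&` [set w | 0 <= t])).
  apply: measurableU; apply: measurableI.
  - exact: mcount_lt.
  - exact: mcount_lt.
  - by apply: measurableC; exact: mcount_lt.
  - case: (0 <= t); first by rewrite (_ : [set _ | _] = setT) //; apply/seteqP; split.
    by rewrite (_ : [set _ | _] = set0) //; apply/seteqP; split.
apply/seteqP; split=> w /=.
  case: (ltnP j (atoms w)) => h; first by rewrite count_le // => h'; left.
  by rewrite /x nth_default ?size_s // => h'; right; split.
move=> [[h]|[/negP]]; first by rewrite count_le.
by rewrite -leqNgt => h; rewrite /x nth_default ?size_s.
Qed.

Let subG : <<s G>> `<=` @measurable _ Omega.
by apply: smallest_sub => //; exact: sigma_algebra_measurable. Qed.

Let mxO j : measurable_fun setT (x j).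
by move=> _ B mB; apply: subG; exact: (mx j measurableT mB). Qed.

(** Equality of the two counts excludes an atom at 0, a null event. *)
Let D n : set Omega := [set w | atoms w = n] `&` [set w | atom_count N `]0, 1]%classic w = n].

Let mD n : <<s G>> (D n).
have : @measurable _ (g_sigma_algebraType G) (D n) by apply: measurableI; apply: mcount.
exact.
Qed.

Let mDO n : measurable (D n). exact: (subG (mD n)). Qed.

Let split01 w : atoms w = (atom_count N [set 0%R] w + atom_count N `]0%R, 1%R]%classic w)%N.
rewrite /atoms -(atom_countU hN); last first.
  by apply/seteqP; split=> y //= [->]; rewrite in_itv /= ltxx.
congr (atom_count N _ w); apply/seteqP; split=> y /=; rewrite !in_itv /=.
  by rewrite le_eqVlt => /andP[/predU1P[<-|->] ->]; [left|right].
by move=> [->|/andP[/ltW -> ->]] //; rewrite lexx ler01.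
Qed.

Let mem_itv j w : (j < atoms w)%N -> x j w \in s w.
by move=> jn; apply: mem_nth; rewrite size_s. Qed.

Let x_itv n w : D n w -> forall j, (j < n)%N -> 0 < x j w <= 1.
move=> [/= an a1] j jn; have xs : x j w \in s w by apply: mem_itv; rewrite an.
have Nx : N w (x j w) by move: xs; rewrite mem_s inE.
have := poisson_process_support hN Nx; rewrite /= in_itv /= => /andP[x0 ->]; rewrite andbT lt_neqAle x0 andbT.
apply/eqP => x0'.
have : atom_count N [set 0] w = 0%N by move: (split01 w); rewrite an a1 => /eqP; rewrite -{1}(add0n n) eqn_add2r => /eqP.
rewrite atom_countE => /eqP; rewrite -leqn0 leqNgt -has_count => /negP; apply.
by apply/hasP; exists (x j w) => //; rewrite inE /= -x0'.
Qed.

Let prb_pos (A : set R) : measurable A -> A `<=` `[0, 1]%classic ->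
  prb P [set w | (0 < atom_count N A w)%N] <= rho * fine (lebesgue_measure A).
move=> mA A01.
have e := prb_atom_count hN 0 rho_gt0 mA A01.
have mE : measurable [set w | atom_count N A w = 0%N] by apply: subG; exact: mcount.
have -> : [set w | (0 < atom_count N A w)%N] = ~` [set w | atom_count N A w = 0%N].
  by apply/seteqP; split=> w /=; rewrite lt0n => /eqP.
rewrite /prb probability_setC // -prbE // e /poisson_w expr0 fact0 divr1 mul1r /=.
by rewrite lerBlDl -lerBlDr expR_ge1Dx.
Qed.

Let density n (a b : R) : a <= b ->
  prb P [set w | D n w /\ exists2 j, (j < n)%N & a <= x j w <= b] <= rho * (b - a).
move=> ab; pose A : set R := `[a, b]%classic `&` `[0, 1]%classic.
have mA : measurable A by exact: measurableI.
apply: (@le_trans _ _ (rho * fine (lebesgue_measure A))); last first.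
  rewrite ler_pM2l // -[leRHS]/(fine (b - a)%:E) fine_le //.
  - rewrite ge0_fin_numE //; apply: (@le_lt_trans _ _ (lebesgue_measure (`[a, b]%classic : set R))).
      by apply: le_measure; rewrite ?inE // => y [].
    by rewrite lebesgue_measure_itv /= lte_fin; case: ifP => _; rewrite ?ltry // -EFinB ltry.
  - have : (lebesgue_measure A <= lebesgue_measure (`[a, b]%classic : set R))%E.
      by apply: le_measure; rewrite ?inE // => y [].
    move/le_trans; apply; rewrite lebesgue_measure_itv /= lte_fin; case: ltP => // ba.
    by rewrite lee_fin subr_ge0.
apply: le_trans (prb_pos mA _); last by move=> y [].
apply: le_prb.
- apply: measurableI => //; apply: (@measurable_exists _ _ (fun j => [set w | a <= x j w <= b])) => j jn.
  by have := mxO j measurableT (measurable_itv `[a, b]); rewrite setTI; congr measurable.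
- by apply: subG; exact: mcount_lt.
move=> w [[/= an _] [j jn h]]; have xs : x j w \in s w by apply: mem_itv; rewrite an.
rewrite atom_countE -has_count; apply/hasP; exists (x j w) => //.
have Nx : N w (x j w) by move: xs; rewrite mem_s inE.
by rewrite inE; split; [rewrite /= in_itv | exact: (poisson_process_support hN Nx)].
Qed.

Let prb_zero : prb P [set w | (0 < atom_count N [set 0%R] w)%N] = 0.
apply/eqP; rewrite eq_le prb_ge0 andbT; apply: le_trans (prb_pos _ _) _ => //.
  by move=> y /= ->; rewrite in_itv /= lexx ler01.
by rewrite lebesgue_measure_set1 mulr0.
Qed.

Let m_zero : measurable [set w | (0 < atom_count N [set 0%R] w)%N].
by apply: subG; exact: mcount_lt. Qed.

Let xE n w : D n w -> [seq x j w | j <- iota 0 n] = s w.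
by move=> [/= an _]; rewrite -an -size_s; exact: mkseq_nth. Qed.

Let prb_off (A B : set Omega) : measurable A -> measurable B ->
  (forall w, atom_count N [set 0%R] w = 0%N -> A w <-> B w) -> prb P A = prb P B.
have key (A' B' : set Omega) : measurable A' -> measurable B' ->
    (forall w, atom_count N [set 0%R] w = 0%N -> A' w -> B' w) -> prb P A' <= prb P B'.
  move=> mA mB AB; rewrite -[leRHS]addr0 -prb_zero; apply: le_trans (prbU P mB m_zero).
  apply: le_prb => //; first exact: measurableU.
  by move=> w Aw; case: (posnP (atom_count N [set 0] w)) => h; [left; exact: AB | right].
move=> mA mB AB; apply/eqP; rewrite eq_le !key //; by move=> w h; case: (AB w h).
Qed.

Let law n (p : nat -> R) l Q : (forall i, p i <= p i.+1) -> p 0%N = 0 -> (forall i, 0 <= p i < 1) ->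
  prb P [set w | D n w /\ Q (cell_count p l [seq x j w | j <- iota 0 n] r)] =
  poisson_w rho n * occupancy r [seq (p i.+1 - p i) / (1 - p i) | i <- iota 0 l] n (fun k => (Q k)%:R).
move=> p_ndec p0 p01.
have pge0 i : 0 <= p i by case/andP: (p01 i).
have plt1 i : p i < 1 by case/andP: (p01 i).
have [mA] := poisson_cell_count hN r p_ndec pge0 plt1 rho_gt0 n l Q.
rewrite p0 subr0 mulr1 => <-; rewrite p0 in mA.
have cE w : cell_count p l (enum_fset (fset_set (N w))) r = cell_count p l (s w) r.
  by apply: eq_bigr => i _; rewrite (permP (perm_s w)).
apply: prb_off => //.
  rewrite (_ : [set w | _] = D n `&` [set w | (atom_count N `]0, 1]%classic w == n) &&
    Q (cell_count p l (enum_fset (fset_set (N w))) r)]). exact: measurableI.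
  apply/seteqP; split=> w /= [Dw]; rewrite cE (xE Dw) => h; split=> //; last by case/andP: h.
  by case: Dw => _ /= ->; rewrite eqxx.
move=> w z0; rewrite /= cE; split=> [[Dw]|/andP[/eqP a1 h]].
  by rewrite (xE Dw) => ->; rewrite andbT; case: Dw => _ /= ->.
have Dw : D n w by split=> //=; rewrite split01 z0 a1.
by split=> //; rewrite (xE Dw).
Qed.

Let KE n w : atoms w = n -> K w = nb_gaps (closed_range S w)
  (fun B => count (fun y => y \in B) [seq x j w | j <- iota 0 n]) r.
move=> an; rewrite -an -size_s -[map _ _]/(mkseq (nth 0 (s w)) (size (s w))) mkseq_nth.
by rewrite /K /poisson_parts; congr nb_gaps; apply/funext => B; exact: atom_countE.
Qed.

Lemma measurable_poisson_atoms n : measurable [set w | atoms w = n].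
Proof. by apply: subG; exact: mcount. Qed.

Lemma measurable_poisson_parts m : measurable [set w | poisson_parts w = m].
Proof.
rewrite (_ : [set w | _] = \bigcup_n ([set w | atoms w = n] `&` [set w | nb_gaps (closed_range S w)
  (fun B => count (fun y => y \in B) [seq x j w | j <- iota 0 n]) r = m])).
  apply: bigcupT_measurable => n; apply: measurableI; first exact: measurable_poisson_atoms.
  exact: (measurable_nb_gaps hS r_gt0 (fun j (_ : (j < n)%N) => mxO j)).
apply/seteqP; split=> w /=.
  by move=> h; exists (atoms w) => //; split=> //=; rewrite -(KE (erefl _)).
by move=> [n _ [/= an]]; rewrite -(KE an).
Qed.

Lemma prb_atoms n : prb P [set w | atoms w = n] = poisson_w rho n.
Proof.
rewrite /atoms (prb_atom_count hN n rho_gt0) // lebesgue_measure_itv /= lte_fin ltr01 /=.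
by rewrite oppr0 addr0 mulr1.
Qed.

Lemma poisson_parts_le w : (poisson_parts w <= atoms w)%N.
Proof.
have D0 : transformed_range S w 0.
  by rewrite -(grid_point0 hS 1 w); exists (1 * 0%:R); rewrite //= in_itv /= mulr0 lexx.
rewrite -/(K w) (KE (erefl _)).
have -> : closed_range S w = closure (transformed_range S w) by [].
rewrite (nb_gaps_class_count D0 (@transformed_range_itv _ _ _ _ _ _ hS w)) // /class_count.
rewrite (leq_trans (size_undup _)) // size_map size_filter (leq_trans (count_size _ _)) //.
by rewrite size_filter (leq_trans (count_size _ _)) // size_map size_iota.
Qed.

Let F k j : R := expR (- (2%:R ^- k * Phi j%:R)).

(** Given [n] atoms, the gap count is a limit of the same cell laws as for a uniform sample of size
    [n]; hence the two laws agree. *)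
Lemma prb_poisson_parts n Q (L : R) :
  cell_law (F k) r (4 ^ k) n (fun i => (Q i)%:R) @[k --> \oo] --> L ->
  prb P [set w | atoms w = n /\ Q (poisson_parts w)] = poisson_w rho n * L.
Proof.
move=> hL.
have h := cvg_cell_law hS mG hNS (mD n) (fun j (_ : (j < n)%N) => @mx j) (ltW rho_gt0) (@x_itv n)
  (@density n) (@law n) r_gt0 Phi_ge0 Phi1 driftless (Q := Q).
have mQ : measurable [set w | Q (K w)].
  rewrite (_ : [set w | _] = \bigcup_(m in [set m | Q m]) [set w | K w = m]).
    by apply: bigcup_measurable => m _; exact: measurable_poisson_parts.
  by apply/seteqP; split=> w /= => [hq|[m hm ->] //]; exists (K w).
have h' : poisson_w rho n * cell_law (F k) r (4 ^ k) n (fun i => (Q i)%:R)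
  @[k --> \oo] --> poisson_w rho n * L by exact: cvgMr.
rewrite -(cvg_unique _ h h') //; apply: prb_off.
- by apply: measurableI => //; exact: measurable_poisson_atoms.
- rewrite (_ : [set w | _] = D n `&` [set w | Q (K w)]); first exact: measurableI.
  by apply/seteqP; split=> w /= [Dw]; rewrite -?(KE (proj1 Dw)) ?(KE (proj1 Dw)).
move=> w z0; split=> [[an q]|[[/= an a1]]].
  split; last by rewrite -(KE an). by split=> //=; rewrite -an split01 z0.
by rewrite -(KE an).
Qed.

End PoissonComposition.

(** * Integration against a measure with a density *)

Section Density.
Variables (R : realType).
Notation T := (Real.sort R).
Notation mu := (@lebesgue_measure R).
Variables (nu : {measure set R -> \bar R}) (D : set R) (f : R -> R).
Hypotheses (mD : measurable D) (mf : measurable_fun D f) (f_ge0 : forall x, D x -> 0 <= f x).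
Hypothesis nu_density : forall A, measurable A -> A `<=` D ->
  nu A = (\int[mu]_(x in A) (f x)%:E)%E.

Let mef : measurable_fun D (EFin \o f). exact/measurable_EFinP. Qed.

Let integral_density_indic E : measurable E ->
  (\int[nu]_(x in D) (\1_E x)%:E = \int[mu]_(x in D) ((\1_E x)%:E * (f x)%:E))%E.
move=> mE; rewrite integral_indic // nu_density ?subIsetr //; last exact: measurableI.
rewrite setIC integral_mkcondr; apply: eq_integral => x _.
by rewrite patchE indicE; case: ifPn => xE; rewrite ?mul1e ?mul0e.
Qed.

Import HBNNSimple.

Let integral_density_nnsfun (k : {nnsfun T >-> R}) :
  (\int[nu]_(x in D) (k x)%:E = \int[mu]_(x in D) ((k x)%:E * (f x)%:E))%E.
have mk c : measurable_fun D (fun x : R => (c * \1_(k @^-1` [set c]) x)%:E).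
  by apply/measurable_EFinP/measurable_funTS; exact: measurableT_comp.
under [LHS]eq_integral do rewrite fimfunE -fsumEFin//.
rewrite [LHS]ge0_integral_fsum//; last first.
  by move=> n x _; rewrite EFinM nnfun_muleindic_ge0.
under [RHS]eq_integral.
  move=> x xD; rewrite fimfunE -fsumEFin// muleC ge0_mule_fsumr; last first.
    by move=> r; rewrite EFinM nnfun_muleindic_ge0.
  over.
rewrite [RHS]ge0_integral_fsum//; last 2 first.
  - by move=> r; apply: emeasurable_funM => //; exact: mk.
  - move=> n x Dx; rewrite mule_ge0 ?lee_fin ?f_ge0 //.
    by have := nnfun_muleindic_ge0 k n x; rewrite -EFinM lee_fin.
apply: eq_fsbigr => r; rewrite inE => -[x _ xr].
have r0 : 0 <= r by rewrite -xr.
have mi : measurable (k @^-1` [set r]) by exact: measurable_sfunP.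
rewrite (eq_integral (fun x => r%:E * (\1_(k @^-1` [set r]) x)%:E)%E) //.
rewrite ge0_integralZl //; last first.
  by apply/measurable_EFinP/measurable_funTS; exact: measurable_indic.
rewrite integral_density_indic // -ge0_integralZl //.
- by apply: eq_integral => y _; rewrite muleA muleC EFinM.
- apply: emeasurable_funM => //.
  by apply/measurable_EFinP/measurable_funTS; exact: measurable_indic.
- by move=> y Dy; rewrite mule_ge0 // lee_fin ?f_ge0.
Qed.

Lemma integral_density (k : T -> \bar R) : measurable_fun setT k -> (forall x, 0 <= k x)%E ->
  (\int[nu]_(x in D) k x = \int[mu]_(x in D) (k x * (f x)%:E))%E.
Proof.
move=> mk k0.
pose k_ := nnsfun_approx measurableT mk.
have nd (m n : nat) : (m <= n)%N -> forall x : R, k_ m x <= k_ n x.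
  by move=> mn x; exact/lefP/nd_nnsfun_approx.
have mk_ n : measurable_fun D (fun x : R => (k_ n x)%:E).
  exact/measurable_EFinP/measurable_funTS.
transitivity (lim (\int[nu]_(x in D) (k_ n x)%:E @[n --> \oo])%E).
  rewrite -monotone_convergence//=.
  - apply: eq_integral => ? /[!inE] xD; apply/esym/cvg_lim => //=.
    exact: cvg_nnsfun_approx.
  - by move=> n ? _; rewrite lee_fin.
  - by move=> x _ m n mn; rewrite lee_fin; exact: nd.
rewrite [RHS](_ : _ = lim
    (\int[mu]_(x in D) ((k_ n x)%:E * (f x)%:E)%E @[n --> \oo])%E); last first.
  rewrite -monotone_convergence//=.
  - apply: eq_integral => x /[!inE] xD; apply/esym/cvg_lim => //.
    apply: cvgeZr => //; exact: cvg_nnsfun_approx.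
  - by move=> n; apply: emeasurable_funM => //; exact: mk_.
  - by move=> n x Dx; rewrite mule_ge0 // lee_fin ?f_ge0.
  - by move=> x Dx m n mn; rewrite lee_wpmul2r ?lee_fin ?f_ge0 //; exact: nd.
by apply: congr_lim; apply/funext => n /=; exact: integral_density_nnsfun.
Qed.

End Density.

(** * Tails and exponential moments of the Lévy measure *)

Section Conditions.
Variables (R : realType) (nu : {measure set R -> \bar R}).

Definition levy_tail (y : R) : R := fine (nu `[y, +oo[%classic).

Lemma condition_L_bound : condition_L nu -> exists c eps C y1 : R,
  [/\ 0 < eps, 0 < C, 0 < y1 & forall y, 0 < y < y1 ->
    `|levy_tail y + ln y - c| <= C * expR (eps * ln y)].
Proof.
move=> [c [eps [eps0 /eqaddOP /bigO_exP[C C0 h]]]].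
have [e /= e0 he] := h.
exists (c - euler_constant), eps, C, e; split => // y /andP[y0 ye].
have := he y; rewrite /= sub0r normrN (gtr0_norm y0) => /(_ ye y0).
rewrite /= (ger0_norm (powR_ge0 _ _)) /powR gt_eqF // !fctE => hy.
apply: le_trans hy; rewrite le_eqVlt; apply/orP; left; apply/eqP; congr `|_|.
by rewrite /levy_tail; ring.
Qed.

Lemma condition_R_bound : condition_R nu -> exists eps C y1 : R,
  [/\ 0 < eps, 0 < C & forall y, y1 < y -> levy_tail y <= C * expR (- (eps * y))].
Proof.
move=> [eps eps0 /eqOP /bigO_exP[C C0 [y1 [_ h]]]].
exists eps, C, y1; split => // y /h /=.
rewrite (ger0_norm (expR_ge0 _)); apply: le_trans; exact: ler_norm.
Qed.

End Conditions.
Section LevyTail.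
Variables (R : realType) (nu : {measure set R -> \bar R}).
Hypothesis hnu : levy_measure nu.

Let pos_ray : measurable (`]0, +oo[%classic : set R).
exact: measurable_itv. Qed.

Let mmin : measurable_fun setT (fun y : R => (Num.min 1 y)%:E).
by apply/measurable_EFinP; exact: measurable_minr. Qed.

(** Markov's inequality for the function [min 1 y]. *)
Lemma levy_tail_lty (a : R) : 0 < a -> (nu `[a, +oo[%classic < +oo)%E.
Proof.
move=> a0; have m0 : 0 < Num.min 1 a by rewrite lt_min ltr01.
have h : ((Num.min 1 a)%:E * nu `[a, +oo[%classic < +oo)%E.
  apply: le_lt_trans (levy_measure_integrable hnu). rewrite -(@integral_cst _ _ _ nu) //.
  apply: (@le_trans _ _ (\int[nu]_(y in `[a, +oo[) (Num.min 1 y)%:E)%E).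
    apply: ge0_le_integral => //.
    - by move=> y _; rewrite lee_fin ltW.
    - exact: measurable_funTS.
    - by move=> y; rewrite /= in_itv /= andbT => ay; rewrite lee_fin le_min2.
  apply: ge0_subset_integral => //.
  - exact: measurable_funTS.
  - move=> y; rewrite /= in_itv /= andbT => y0.
    by rewrite lee_fin le_min ler01 ltW.
  - by move=> y; rewrite /= !in_itv /= !andbT; exact: lt_le_trans.
move: h; rewrite ltey; case: (nu _) (measure_ge0 nu `[a, +oo[%classic) => [x|//|//] _ /=.
  by rewrite ltry.
by rewrite gt0_muley // lte_fin.
Qed.

Lemma levy_tailE (a : R) : 0 < a -> nu `[a, +oo[%classic = (levy_tail nu a)%:E.
Proof. by move=> a0; rewrite fineK // ge0_fin_numE // levy_tail_lty. Qed.

Lemma levy_tail_ge0 a : 0 <= levy_tail nu a.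
Proof. exact: fine_ge0. Qed.

Lemma le_levy_tail (a b : R) : 0 < a -> a <= b -> levy_tail nu b <= levy_tail nu a.
Proof.
move=> a0 ab; rewrite -lee_fin -!levy_tailE ?(lt_le_trans a0) //.
rewrite le_measure ?inE // => y; rewrite /= !in_itv /= !andbT.
exact: le_trans.
Qed.

Lemma expR_sub1_le_min (dl y N : R) : 0 < dl -> 1 <= N -> 0 < y -> y <= N ->
  expR (dl * y) - 1 <= (1 + dl) * expR (dl * N) * Num.min 1 y.
Proof.
move=> dl0 N1 y0 yN.
have e1 : expR (dl * y) <= expR (dl * N) by rewrite ler_expR ler_pM2l.
have e0 : 0 < expR (dl * y) by exact: expR_gt0.
rewrite minEle; case: ifPn => h1.
  rewrite mulr1 mulrDl mul1r; have : 0 <= dl * expR (dl * N) by rewrite mulr_ge0 ?expR_ge0 ?ltW.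
  lra.
apply: (@le_trans _ _ (dl * y * expR (dl * y))).
  have := expR_ge1Dx (- (dl * y)); rewrite expRN => h.
  have h2 : expR (dl * y) * (1 + - (dl * y)) <= expR (dl * y) * (expR (dl * y))^-1.
    by rewrite ler_pM2l.
  by move: h2; rewrite divff ?gt_eqF // mulrDr mulr1 => h2; lra.
rewrite mulrAC ler_pM2r //; apply: ler_pM => //; first exact: ltW.
by rewrite lerDr.
Qed.

(** Half of the exponent of the tail is kept. Beyond [N] the integrand lies below a sum of steps
    [c n] on [[N + n, +oo[], whose integrals are bounded by a geometric series of ratio [e^(- dl)];
    below [N] it is comparable with [min 1 y]. *)
Lemma levy_tail_exp_integrable (eps C y1 : R) : 0 < eps ->
  (forall y, y1 < y -> levy_tail nu y <= C * expR (- (eps * y))) ->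
  nu.-integrable `]0, +oo[ (EFin \o (fun y => expR (eps / 2 * y) - 1)).
Proof.
move=> eps0 hR; set dl := eps / 2.
have dl0 : 0 < dl by rewrite divr_gt0.
have epsE : eps = 2 * dl by rewrite /dl; field.
pose N : nat := (Num.truncn `|y1|).+1.
have Ny1 : y1 < N%:R by rewrite (le_lt_trans (ler_norm _)) // truncnS_gt.
have N1 : 1 <= N%:R :> R by rewrite ler1n.
pose c n : R := expR (dl * (N + n).+1%:R).
pose k y : \bar R := (((1 + dl) * expR (dl * N%:R) * Num.min 1 y)%:E +
  \sum_(0 <= n <oo) (c n)%:E * (\1_(`[(N + n)%:R, +oo[%classic) y)%:E)%E.
have mI n : measurable_fun (`]0%R, +oo[%classic : set R)
    (fun y => (c n)%:E * (\1_(`[(N + n)%:R, +oo[%classic : set R) y)%:E)%E.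
  apply: measurable_funeM; apply/measurable_EFinP/measurable_funTS. exact: measurable_indic.
have I0 n y : (0 <= (c n)%:E * (\1_(`[(N + n)%:R, +oo[%classic : set R) y)%:E)%E.
  by rewrite mule_ge0 // lee_fin ?expR_ge0.
have mm : measurable_fun (`]0%R, +oo[%classic : set R)
    (fun y => ((1 + dl) * expR (dl * N%:R) * Num.min 1 y)%:E).
  apply/measurable_EFinP; apply: measurable_funM => //.
  by apply/measurable_EFinP; exact: measurable_funTS.
have mS : measurable_fun (`]0%R, +oo[%classic : set R) (fun y => \sum_(0 <= n <oo)
    (c n)%:E * (\1_(`[(N + n)%:R, +oo[%classic : set R) y)%:E)%E.
  by apply: ge0_emeasurable_sum => // n y _ _; exact: I0.
have C0 : 0 < (1 + dl) * expR (dl * N%:R) by rewrite mulr_gt0 ?expR_gt0 // addr_gt0.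
have min0 y : (`]0%R, +oo[%classic : set R) y -> 0 <= Num.min 1 y.
  by rewrite /= in_itv /= andbT => y0; rewrite le_min ler01 ltW.
have me : measurable_fun (`]0%R, +oo[%classic : set R) (EFin \o (fun y => expR (dl * y) - 1)).
  apply/measurable_EFinP/measurable_funTS; apply: measurable_funB => //.
  exact: measurableT_comp.
apply/integrableP; split => //.
apply: (@le_lt_trans _ _ (\int[nu]_(y in `]0%R, +oo[) k y)%E).
  apply: ge0_le_integral => //.
  - exact: measurableT_comp.
  - exact: emeasurable_funD. move=> y; rewrite /= in_itv /= andbT => y0.
  rewrite ger0_norm; last by rewrite subr_ge0 -expR0 ler_expR mulr_ge0 // ltW.
  have m0 : 0 <= Num.min 1 y by rewrite le_min ler01 ltW. have [yN|Ny] := leP y N%:R.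
    apply: (@le_trans _ _ ((1 + dl) * expR (dl * N%:R) * Num.min 1 y)%:E).
      by rewrite lee_fin expR_sub1_le_min.
    by rewrite /k leeDl // nneseries_ge0.
  pose n := Num.truncn (y - N%:R).
  have /andP[n1 n2] : n%:R <= y - N%:R < n.+1%:R by rewrite truncn_itv // subr_ge0 ltW.
  apply: (@le_trans _ _ ((c n)%:E * (\1_(`[(N + n)%:R, +oo[%classic : set R) y)%:E)%E).
    rewrite indicE mem_set /=; last by rewrite in_itv /= andbT natrD; lra.
    rewrite mule1 lee_fin lerBlDr (@le_trans _ _ (c n)) ?lerDl //.
    by rewrite ler_expR ler_pM2l // -addnS natrD; lra.
  apply: (@le_trans _ _ (\sum_(0 <= n <oo) (c n)%:E * (\1_(`[(N + n)%:R, +oo[%classic) y)%:E)%E).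
    rewrite (nneseriesD1 (n := n)) //. by rewrite leeDl // nneseries_ge0.
  by rewrite /k leeDr // lee_fin mulr_ge0 // ltW.
rewrite ge0_integralD //; last 2 first.
- by move=> y /min0 h; rewrite lee_fin mulr_ge0 // ltW.
- by move=> y _; rewrite nneseries_ge0.
rewrite lte_add_pinfty //.
  under eq_integral do rewrite EFinM.
  rewrite ge0_integralZl // ?lee_fin ?(ltW C0) //; last exact: measurable_funTS.
  by rewrite lte_mul_pinfty ?lee_fin ?(ltW C0) //; exact: levy_measure_integrable.
rewrite integral_nneseries //.
pose K := `|C| * expR dl.
apply: (@le_lt_trans _ _ (\sum_(0 <= n <oo) (K * expR (- dl) ^+ n)%:E)%E).
  apply: lee_nneseries => n _ //.
    by move=> _; apply: integral_ge0 => y _; exact: I0.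
  rewrite ge0_integralZl ?lee_fin ?expR_ge0 //; last first.
    by apply/measurable_EFinP/measurable_funTS; exact: measurable_indic.
  rewrite integral_indic //. have Nn : 0 < (N + n)%:R :> R by rewrite ltr0n.
  rewrite setIidl; last first.
    by move=> y; rewrite /= !in_itv /= !andbT; exact: lt_le_trans.
  rewrite levy_tailE // -EFinM lee_fin.
  have h1 : levy_tail nu (N + n)%:R <= `|C| * expR (- (eps * (N + n)%:R)).
    apply: (@le_trans _ _ (C * expR (- (eps * (N + n)%:R)))).
      by apply: hR; rewrite (lt_le_trans Ny1) // ler_nat leq_addr.
    by rewrite ler_wpM2r ?expR_ge0 // ler_norm.
  apply: (@le_trans _ _ (c n * (`|C| * expR (- (eps * (N + n)%:R))))).
    by rewrite ler_wpM2l ?expR_ge0.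
  rewrite /K mulrCA -!mulrA ler_wpM2l // -expRM_natl -!expRD ler_expR epsE -natr1 natrD.
  have : 0 <= dl * N%:R by rewrite mulr_ge0 // ltW. lra.
have q1 : `|expR (- dl)| < 1 by rewrite ger0_norm ?expR_ge0 // expR_lt1 oppr_lt0.
have := @cvg_geometric_series _ K _ q1 => hc.
rewrite (_ : (\sum_(0 <= n <oo) _)%E = (K * (1 - expR (- dl))^-1)%:E) ?ltry //.
apply/cvg_lim => //.
rewrite (_ : (fun n => _) = EFin \o series (geometric K (expR (- dl)))); last first.
  by apply/funext => n; rewrite /= /series /= -sumEFin.
by apply: cvg_EFin; [exact: nearW|exact: hc].
Qed.

End LevyTail.

(** * Harmonic numbers, logarithms and weights *)

Section HarmonicBounds.
Variable R : realType.
Implicit Types (n k : nat).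

Lemma hsumS n : hsum R n.+1 = hsum R n + n.+1%:R^-1.
Proof. by rewrite /hsum big_ord_recr. Qed.

Lemma harmonic_le_ln n : (0 < n)%N -> hsum R n <= 1 + ln n%:R.
Proof.
elim: n => // -[|n] IH _.
  by rewrite hsumS /hsum big_ord0 add0r invr1 ln1 addr0.
rewrite hsumS; apply: (le_trans (lerD (IH isT) (lexx _))).
rewrite -addrA lerD2l.
have n0 : 0 < n.+1%:R :> R by [].
have n1 : 0 < n.+2%:R :> R by [].
have : ln (n.+1%:R / n.+2%:R : R) <= - n.+2%:R^-1.
  have -> : - n.+2%:R^-1 = n.+1%:R / n.+2%:R - 1 :> R.
    by rewrite -[n.+2%:R]natr1; have := n1; rewrite -[n.+2%:R]natr1 => n2; field; rewrite gt_eqF //.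
  by rewrite -ler_expR lnK ?posrE ?divr_gt0 // (le_trans _ (expR_ge1Dx _)) // addrC subrK.
have aux (x y c : R) : x - y <= - c -> x + c <= y by lra.
by rewrite ln_div ?posrE //; exact: aux.
Qed.

Lemma ln_le_harmonic n : ln n.+1%:R <= hsum R n.
Proof.
elim: n => [|n IH]; first by rewrite ln1 /hsum big_ord0.
rewrite hsumS; move: (hsum R n) IH => hn IH.
have n0 : 0 < n.+1%:R :> R by [].
have n1 : 0 < n.+2%:R :> R by [].
have : ln (n.+2%:R / n.+1%:R : R) <= n.+1%:R^-1.
  have h : n.+2%:R / n.+1%:R = 1 + n.+1%:R^-1 :> R.
    by rewrite -[n.+2%:R]natr1 mulrDl divff ?gt_eqF // mul1r.
  by rewrite -ler_expR lnK ?posrE ?divr_gt0 // h expR_ge1Dx.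
rewrite ln_div ?posrE // => h.
by rewrite -lerBlDl; apply: le_trans h; rewrite lerB.
Qed.

(** The first [k] terms are at most 1 and the others at most [1 / k]; this is enough for
    [H n = o(n)]. *)
Lemma harmonic_le_split n k : (0 < k)%N -> hsum R n <= k%:R + n%:R / k%:R.
Proof.
move=> k0; rewrite /hsum.
apply: (@le_trans _ _ (\sum_(j < n) ((j < k)%N%:R + k%:R^-1))).
  apply: ler_sum => j _; case: ltnP => jk.
    by rewrite (@le_trans _ _ 1) // ?invf_le1 ?ler1n // lerDl invr_ge0.
  by rewrite add0r lef_pV2 ?posrE ?ltr0n // ler_nat ltnW.
rewrite big_split /= sumr_const card_ord -[X in _ + X <= _]mulr_natl lerD2r.
rewrite -natr_sum ler_nat.
have -> : (\sum_(j < n) (j < k))%N = \sum_(j < n | (j < k)%N) 1%N.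
  by rewrite [RHS]big_mkcond; apply: eq_bigr => j _; case: (j < k)%N.
rewrite sum1_card -[leqRHS]card_ord.
have [nk|kn] := leqP n k.
  by rewrite (leq_trans (max_card _)) // card_ord card_ord.
rewrite -(@card_in_image _ _ (fun j : 'I_n => inord j : 'I_k.-1.+1)).
  by rewrite (leq_trans (max_card _)) // !card_ord prednK.
move=> i j ik jk /(congr1 val) /=; move: ik jk; rewrite !unfold_in => ik jk.
by rewrite !inordK ?prednK // => /val_inj.
Qed.

Lemma weight_ge_expR (dl : R) n : 0 <= dl -> expR (- (dl * hsum R n)) <= weight dl n.
Proof.
move=> dl0; elim: n => [|n IH].
  by rewrite weight0 /hsum big_ord0 mulr0 oppr0 expR0.
have den : 0 < n.+1%:R + dl by rewrite ltr_wpDr.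
have -> : weight dl n.+1 = weight dl n * (n.+1%:R / (n.+1%:R + dl)).
  by rewrite {1}/weight big_ord_recr.
rewrite hsumS mulrDr opprD expRD ler_pM ?expR_ge0 //.
rewrite expRN -[leRHS]invrK invf_div lef_pV2 ?posrE ?expR_gt0 ?divr_gt0 //.
by rewrite (le_trans _ (expR_ge1Dx _)) // mulrDl divff ?gt_eqF.
Qed.

Lemma expR_ln_le_weight (dl : R) n : 0 <= dl -> (0 < n)%N ->
  expR (- (dl * ln n%:R)) <= expR dl * weight dl n.
Proof.
move=> dl0 n0; apply: (@le_trans _ _ (expR dl * expR (- (dl * hsum R n)))).
  rewrite -expRD ler_expR. have := ler_wpM2l dl0 (harmonic_le_ln n0); lra.
by rewrite ler_wpM2l ?expR_ge0 // weight_ge_expR.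
Qed.

End HarmonicBounds.

(** * Derivative of the tail and lower bound for the density *)

Section Density2.
Variables (R : realType) (nu : {measure set R -> \bar R}) (f : R -> R).
Hypotheses (f_ge0 : forall y, 0 < y -> 0 <= f y) (f_cont : {in `]0, +oo[, continuous f}).
Hypothesis f_dens : forall A : set R, measurable A -> A `<=` `]0, +oo[%classic ->
  nu A = (\int[lebesgue_measure]_(y in A) (f y)%:E)%E.
Notation mu := lebesgue_measure.
Implicit Types (g h : R -> R) (a b y z : R).

Lemma continuous_within_itv h a b : 0 < a -> (forall y, 0 < y -> {for y, continuous h}) ->
  {within `[a, b], continuous h}.
Proof.
move=> a0 hc; apply: continuous_in_subspaceT => y.
rewrite inE /= in_itv /= => /andP[ay _]; apply: hc.
exact: lt_le_trans ay.
Qed.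

Lemma is_derive_primitive h a : 0 < a -> (forall y, 0 < y -> {for y, continuous h}) ->
  forall y, a < y -> is_derive y 1 (fun z => \int[mu]_(t in `[a, z]) h t) (h y).
Proof.
move=> a0 hc y ay.
have i : mu.-integrable `[a, y + 1] (EFin \o h).
  apply: continuous_compact_integrable; first exact: segment_compact.
  exact: continuous_within_itv.
have y1 : y < y + 1 by rewrite ltrDl.
have [d e] := continuous_FTC1_closed y1 i ay (hc _ (lt_trans a0 ay)).
exact: (DeriveDef d (etrans (esym (derive1E _ _)) e)).
Qed.

Let f_pos y : 0 < y -> {for y, continuous f}.
by move=> y0; apply: f_cont; rewrite in_itv /= y0. Qed.

Let sub_pos a b : 0 < a -> (`[a, b]%classic : set R) `<=` `]0, +oo[%classic.
by move=> a0 y; rewrite /= !in_itv /= andbT => /andP[ay _]; exact: lt_le_trans ay.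
Qed.

Lemma integral_density_itv g a b : 0 < a -> measurable_fun setT g -> (forall y, 0 < y -> 0 <= g y) ->
  (\int[nu]_(y in `[a, b]) (g y)%:E = \int[mu]_(y in `[a, b]) (g y * f y)%:E)%E.
Proof.
move=> a0 mg g0.
have mD : measurable (`[a, b]%classic : set R) by exact: measurable_itv.
have mf : measurable_fun (`[a, b]%classic : set R) f.
  apply: subspace_continuous_measurable_fun => //. exact: continuous_within_itv.
pose k y : \bar R := (Num.max 0 (g y))%:E.
have kE y : (`[a, b]%classic : set R) y -> k y = (g y)%:E.
  move=> /(sub_pos a0); rewrite /= in_itv /= andbT => y0.
  by rewrite /k; congr EFin; apply/max_idPr; exact: g0.
transitivity (\int[nu]_(y in `[a, b]) k y)%E.
  by apply: eq_integral => y; rewrite inE => /kE.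
transitivity (\int[mu]_(y in `[a, b]) (k y * (f y)%:E))%E.
  apply: (@integral_density R nu _ f mD mf) => [y ab|A mA AD||y].
  - by apply: f_ge0; have := sub_pos a0 ab; rewrite /= in_itv /= andbT.
  - by apply: f_dens => // y /AD; exact: sub_pos.
  - by apply/measurable_EFinP; exact: measurable_maxr.
  - by rewrite lee_fin le_max lexx.
by apply: eq_integral => y; rewrite inE => /kE ->; rewrite EFinM.
Qed.

Lemma Rintegral_density_itv g a b : 0 < a -> measurable_fun setT g -> (forall y, 0 < y -> 0 <= g y) ->
  \int[nu]_(y in `[a, b]) g y = \int[mu]_(y in `[a, b]) (g y * f y).
Proof. by move=> a0 mg g0; rewrite /Rintegral integral_density_itv. Qed.

Hypothesis hnu : levy_measure nu.

Lemma levy_tail_incr a y : 0 < a -> a <= y ->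
  levy_tail nu a - levy_tail nu y = \int[mu]_(t in `[a, y]) f t.
Proof.
move=> a0 ay; have y0 : 0 < y by exact: lt_le_trans ay.
have i : mu.-integrable `[a, y] (EFin \o f).
  apply: continuous_compact_integrable; first exact: segment_compact.
  exact: continuous_within_itv.
have mf : measurable_fun (`[a, y]%classic : set R) (EFin \o f) by exact: measurable_int i.
have e : nu `[a, +oo[%classic = (nu `[a, y[%classic + nu `[y, +oo[%classic)%E.
  rewrite -measureU //.
    congr (nu _); rewrite -itv_bndbnd_setU ?bnd_simp //.
  by apply/seteqP; split => // z [] /=; rewrite !in_itv /= andbT => /andP[_]; rewrite ltNge => /negP.
have e2 : nu `[a, y[%classic = (\int[mu]_(t in `[a, y]) f t)%:E.
  rewrite f_dens //; last by move=> z; rewrite /= !in_itv /= andbT => /andP[az _]; exact: lt_le_trans az.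
  rewrite integral_itv_bndo_bndc.
    by rewrite fineK //; exact: integrable_fin_num i.
  apply: measurable_funS mf => // z; rewrite /= !in_itv /= => /andP[-> /ltW]. by [].
move: e; rewrite e2 !levy_tailE // -EFinD => -[->]; ring.
Qed.

Lemma is_derive_levy_tail y : 0 < y -> is_derive y 1 (levy_tail nu) (- f y).
Proof.
move=> y0; have a0 : 0 < y / 2 by rewrite divr_gt0.
have ay : y / 2 < y by rewrite gtr_pMr // invf_lt1 ?ltr1n.
have h := is_derive_primitive a0 f_pos ay.
have hc : is_derive y 1 (fun z => levy_tail nu (y / 2) - \int[mu]_(t in `[y / 2, z]) f t) (- f y).
  by have := is_deriveB (is_derive_cst (levy_tail nu (y / 2)) y 1) h; rewrite sub0r.
apply: (near_eq_is_derive _ hc) => //.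
near=> z.
rewrite -(@levy_tail_incr (y / 2) z) //; first by rewrite subKr.
rewrite ltW //; near: z; exact: lt_nbhsr.
Unshelve. all: by end_near. Qed.

End Density2.
Section LevyFacts.
Variables (R : realType) (nu : {measure set R -> \bar R}) (f : R -> R).
Hypotheses (hnu : levy_measure nu) (f_ge0 : forall y, 0 < y -> 0 <= f y).
Hypothesis f_cont : {in `]0, +oo[, continuous f}.
Hypothesis f_dens : forall A : set R, measurable A -> A `<=` `]0, +oo[%classic ->
  nu A = (\int[lebesgue_measure]_(y in A) (f y)%:E)%E.
Notation mu := lebesgue_measure.
Variable dl0 : R.
Hypotheses (dl0_gt0 : 0 < dl0) (nu_exp : exp_integrable nu dl0).
Implicit Types (g h : R -> R) (a b y z : R).

Let f_pos y : 0 < y -> {for y, continuous f}.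
by move=> y0; apply: f_cont; rewrite in_itv /= y0. Qed.

Let subitv a b : 0 < a -> (`[a, b]%classic : set R) `<=` `]0, +oo[%classic.
by move=> a0 y; rewrite /= !in_itv /= andbT => /andP[ay _]; exact: lt_le_trans ay.
Qed.

Lemma le_levy_int_itv g a b : 0 < a -> levy_dom dl0 g -> (forall y, 0 < y -> 0 <= g y) ->
  \int[nu]_(y in `[a, b]) g y <= levy_int nu g.
Proof.
move=> a0 gd g0; have gi := levy_dom_integrable nu_exp gd.
rewrite /levy_int /Rintegral fine_le //.
- apply: integrable_fin_num => //; apply: integrableS gi => //.
  exact: subitv.
- exact: integrable_fin_num.
apply: ge0_subset_integral => //; last exact: subitv.
- exact: measurable_int gi.
- by move=> y; rewrite /= in_itv /= andbT => /g0; rewrite lee_fin.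
Qed.

Lemma cvg_levy_int_itv g : levy_dom dl0 g -> (forall y, 0 < y -> 0 <= g y) ->
  (\int[nu]_(y in `[k.+1%:R^-1, k.+1%:R]) g y) @[k --> \oo] --> levy_int nu g.
Proof.
move=> gd g0; have gi := levy_dom_integrable nu_exp gd.
pose F k : set R := `[k.+1%:R^-1, k.+1%:R]%classic.
have Fpos k : F k `<=` `]0, +oo[%classic by apply: subitv; rewrite invr_gt0.
have FU : \bigcup_k F k = `]0%R, +oo[%classic.
  apply/seteqP; split => [y [k _ /Fpos]//|y]; rewrite /= in_itv /= andbT => y0.
  pose k := maxn (Num.truncn y) (Num.truncn y^-1); exists k => //.
  rewrite /F /= in_itv /=; apply/andP; split.
    rewrite -[leRHS]invrK lef_pV2 ?posrE ?invr_gt0 //.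
    by rewrite (le_trans (ltW (truncnS_gt _))) // ler_nat ltnS leq_maxr.
  by rewrite (le_trans (ltW (truncnS_gt _))) // ler_nat ltnS leq_maxl.
rewrite /levy_int /Rintegral; apply: fine_cvg.
rewrite fineK; last exact: integrable_fin_num.
rewrite -FU; apply: (@ge0_nondecreasing_set_cvg_integral _ _ _ F).
- move=> m n mn; apply/subsetPset => y; rewrite /F /= !in_itv /= => /andP[h1 h2].
  rewrite (le_trans _ h1) ?(le_trans h2) ?ler_nat //. by rewrite lef_pV2 ?posrE // ler_nat.
- by move=> k; exact: measurable_itv.
- by move=> k; apply: measurable_int (integrableS _ _ (Fpos k) gi) => //; exact: measurable_itv.
- by move=> k y /Fpos; rewrite /= in_itv /= andbT => /g0; rewrite lee_fin.
Qed.

(** A vanishing density would make every tail 0, against the logarithmic divergence at 0. *)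
Lemma density_pos c eps C y1 : 0 < eps -> 0 < y1 ->
  (forall y, 0 < y < y1 -> `|levy_tail nu y + ln y - c| <= C * expR (eps * ln y)) ->
  exists2 y0, 0 < y0 & 0 < f y0.
Proof.
move=> eps0 y10 hL; apply: contrapT => hf.
have f0 y : 0 < y -> f y = 0.
  move=> y0; apply/eqP; rewrite eq_le f_ge0 // andbT leNgt; apply/negP => fy.
  by apply: hf; exists y.
have T0 y : 0 < y -> levy_tail nu y = 0.
  move=> y0; rewrite /levy_tail f_dens //.
    rewrite (eq_integral (cst 0%E)) ?integral0 // => z; rewrite inE /= in_itv /= andbT => yz.
    by rewrite f0 // (lt_le_trans y0).
  by move=> z; rewrite /= !in_itv /= !andbT; exact: lt_le_trans.
(* At [y = e^-t] the assumption would force [|t + c| <= |C|]; the term [|ln y1|] keeps [y] below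
   [y1]. *)
pose t := `|c| + `|C| + 1 + `|ln y1|.
have e0 : 0 < expR (- t) by exact: expR_gt0.
have t0 : 0 < t.
  have := normr_ge0 c; have := normr_ge0 C; have := normr_ge0 (ln y1); rewrite /t; lra.
have ey : expR (- t) < y1.
  rewrite -[ltRHS]lnK ?posrE // ltr_expR /t. have := ler_norm (- ln y1); rewrite normrN.
  have := normr_ge0 c; have := normr_ge0 C; lra.
have := hL (expR (- t)); rewrite e0 ey => /(_ isT).
rewrite T0 // add0r expRK => h.
have h1 : `|- t - c| <= `|C|.
  apply: (le_trans h); apply: (@le_trans _ _ (`|C| * expR (eps * - t))).
    by rewrite ler_wpM2r ?expR_ge0 // ler_norm.
  by rewrite ler_piMr // -expR0 ler_expR mulrN oppr_le0 mulr_ge0 // ltW.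
have := ler_norm (- (- t - c)); rewrite normrN.
have := ler_norm (- c); rewrite normrN => h2 h3.
have h4 : t + c <= `|C| by rewrite (le_trans _ h1) // (le_trans _ h3) // opprB opprK addrC.
have h5 : `|c| + `|C| + 1 <= t by rewrite lerDl.
have := le_trans h5 (_ : t <= `|C| - c); rewrite lerBrDr => /(_ h4); lra.
Qed.

(** By continuity the density stays above half of [f y0] on a segment, and the increment of [kappa]
    is the integral of [k] over it. *)
Lemma density_minor y0 : 0 < y0 -> 0 < f y0 -> exists al be eta,
  [/\ 0 < al, al < be, 0 < eta & forall k kappa : R -> R, levy_dom dl0 k ->
  (forall y, 0 < y -> 0 <= k y) ->
  (forall y, al <= y <= be -> is_derive y 1 kappa (k y)) ->
  (forall y, derivable k y 1) ->
  eta * (kappa be - kappa al) <= levy_int nu k].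
Proof.
move=> y00 fy0.
have /cvgrPdist_lt /(_ (f y0 / 2)) := f_pos y00.
rewrite divr_gt0 // => /(_ isT) [e /= e0 he].
pose d := Num.min (e / 2) (y0 / 2).
have d0 : 0 < d by rewrite lt_min !divr_gt0.
have dy : d <= y0 / 2 by rewrite ge_min lexx orbT.
have de : d <= e / 2 by rewrite ge_min lexx.
have hf y : y0 <= y <= y0 + d -> f y0 / 2 <= f y.
  move=> /andP[h1 h2]; have := he y; rewrite /= => /(_ _).
  have ye : `|y0 - y| < e by rewrite distrC ger0_norm ?subr_ge0 //; lra.
  by move=> /(_ ye) /(le_lt_trans (ler_norm _)); lra.
exists y0, (y0 + d), (f y0 / 2); split => //.
- by rewrite ltrDl.
- by rewrite divr_gt0.
move=> k kappa kd k0 dk k'.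
apply: le_trans (le_levy_int_itv (y0 + d) y00 kd k0).
have mk : measurable_fun setT k by have [] := kd.
rewrite (@Rintegral_density_itv _ _ f) //.
have ky y : {for y, continuous k}.
  by apply/differentiable_continuous/derivable1_diffP; exact: k'.
have kc : {within `[y0, y0 + d], continuous k}.
  by apply: continuous_subspaceT => y; exact: ky.
have lt : y0 < y0 + d by rewrite ltrDl.
have kappad y : y0 <= y <= y0 + d -> derivable kappa y 1 by move=> /dk [].
have kappac y : y0 <= y <= y0 + d -> {for y, continuous kappa}.
  by move=> /kappad h; apply/differentiable_continuous/derivable1_diffP.
have FTC := @continuous_FTC2 _ k kappa y0 (y0 + d) lt kc.
have -> : kappa (y0 + d) - kappa y0 = \int[mu]_(y in `[y0, y0 + d]) k y.
  rewrite /Rintegral FTC //.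
  - split.
    + by move=> y; rewrite in_itv /= => /andP[h1 h2]; apply: kappad; rewrite !ltW.
    + by apply: cvg_at_right_filter; apply: kappac; rewrite lexx ltW.
    + by apply: cvg_at_left_filter; apply: kappac; rewrite lexx ltW.
  - move=> y; rewrite in_itv /= => /andP[h1 h2]; rewrite derive1E.
    by have [] := dk y _; rewrite ?(ltW h1) ?(ltW h2).
have ik : mu.-integrable `[y0, y0 + d] (EFin \o k).
  by apply: continuous_compact_integrable => //; exact: segment_compact.
rewrite -RintegralZl //.
apply: le_Rintegral => //.
- apply: continuous_compact_integrable; first exact: segment_compact.
  apply: (@continuous_within_itv _ (fun y => f y0 / 2 * k y)) => // y yp.
  by apply: continuousM; [exact: cst_continuous|exact: ky].
- apply: continuous_compact_integrable; first exact: segment_compact.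
  apply: (@continuous_within_itv _ (fun y => k y * f y)) => // y yp.
  by apply: continuousM; [exact: ky|exact: f_pos].
move=> y; rewrite /= in_itv /= => yy; rewrite mulrC ler_wpM2l ?hf //.
by rewrite k0 // (lt_le_trans y00) //; case/andP: yy.
Qed.

End LevyFacts.

(** * The rate of removing a part of size [r] *)

Section RateLimit.
Variables (R : realType) (nu : {measure set R -> \bar R}) (f : R -> R).
Hypotheses (hnu : levy_measure nu) (f_ge0 : forall y, 0 < y -> 0 <= f y).
Hypothesis f_cont : {in `]0, +oo[, continuous f}.
Hypothesis f_dens : forall A : set R, measurable A -> A `<=` `]0, +oo[%classic ->
  nu A = (\int[lebesgue_measure]_(y in A) (f y)%:E)%E.
Notation mu := lebesgue_measure.
Variable dl0 : R.
Hypotheses (dl0_gt0 : 0 < dl0) (nu_exp : exp_integrable nu dl0).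
Variables (c eps C y1 : R).
Hypotheses (eps0 : 0 < eps) (C0 : 0 < C) (y10 : 0 < y1).
Hypothesis hL : forall y, 0 < y < y1 -> `|levy_tail nu y + ln y - c| <= C * expR (eps * ln y).
Implicit Types (d : nat -> R) (n r s k i : nat) (a b y z x : R).

Let X y : R := 1 - expR (- y).

Let X_itv y : 0 < y -> 0 < X y < 1.
by move=> y0; rewrite subr_gt0 expR_lt1 oppr_lt0 y0 /= gtrBl expR_gt0.
Qed.

(** Up to a constant, [- ln (1 - e^-y)] is the tail of the measure with density [e^-y / (1 - e^-y)],
    for which the rate from [n] to [n - r] is exactly [1 / r], a Beta integral. [theta] is the
    deviation from this model. *)
Let theta y : R := levy_tail nu y + ln (X y) - c.

Lemma ln_expR_sub y : 0 < y -> ln y - y <= ln (1 - expR (- y)) <= ln y.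
Proof.
move=> y0; have /andP[x0 _] := X_itv y0.
have h : X y <= y by have := expR_ge1Dx (- y); rewrite /X; lra.
rewrite ler_ln ?posrE // h andbT -[leLHS]expRK ler_ln ?posrE ?expR_gt0 //.
rewrite expRB lnK ?posrE // ler_pdivrMr ?expR_gt0 // mulrBl mul1r -expRD addNr expR0.
by have := expR_ge1Dx y; lra.
Qed.

(** Near 0 condition (L) applies, [y] and [1 - e^-y] being comparable there. Away from 0 the
    deviation is bounded and [1 - e^-y] is bounded below. *)
Lemma log_tail_bound : exists e' K : R, [/\ 0 < e', e' <= 1, 0 < K &
  forall y, 0 < y -> `|theta y| <= K * expR (e' * ln (X y))].
Proof.
pose e' := Num.min eps 1; pose y2 := Num.min (y1 / 2) 1.
have e'0 : 0 < e' by rewrite lt_min eps0 ltr01.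
have e'1 : e' <= 1 by rewrite ge_min lexx orbT.
have e'e : e' <= eps by rewrite ge_min lexx.
have y20 : 0 < y2 by rewrite lt_min ltr01 divr_gt0.
have y21 : y2 <= 1 by rewrite ge_min lexx orbT.
have y2y : y2 < y1.
  by rewrite (@le_lt_trans _ _ (y1 / 2)) ?ge_min ?lexx // gtr_pMr // invf_lt1 ?ltr1n.
pose K1 := (C + 1) * expR e'.
pose B := levy_tail nu y2 + `|ln (X y2)| + `|c|.
pose K2 := B * expR (- (e' * ln (X y2))).
have K10 : 0 < K1 by rewrite mulr_gt0 ?expR_gt0 // addr_gt0.
have B0 : 0 <= B by rewrite !addr_ge0 ?levy_tail_ge0.
have K20 : 0 <= K2 by rewrite mulr_ge0 ?expR_ge0.
exists e', (K1 + K2); split => //; first by rewrite ltr_pwDl.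
move=> y y0; have /andP[x0 x1] := X_itv y0.
have E0 := expR_ge0 (e' * ln (X y)).
have [yy|yy] := leP y y2.
  apply: (@le_trans _ _ (K1 * expR (e' * ln (X y)))); last by rewrite ler_wpM2r // lerDl.
  have ly : ln y <= 0 by rewrite -ln1 ler_ln ?posrE // (le_trans yy).
  have /andP[h1 h2] := ln_expR_sub y0. have e1 : expR (eps * ln y) <= expR (e' * ln y).
    by rewrite ler_expR ler_wnM2r.
  have e2 : y <= expR (e' * ln y).
    rewrite -[leLHS]lnK ?posrE // ler_expR -[leLHS]mul1r ler_wnM2r //.
  have e3 : expR (e' * ln y) <= expR e' * expR (e' * ln (X y)).
    rewrite -expRD ler_expR -{2}[e']mulr1 -mulrDr ler_pM2l //.
    have : y <= 1 by exact: le_trans y21. by rewrite -/(X y) in h1 *; lra.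
  have e4 : `|ln (X y) - ln y| <= y by rewrite ler0_norm ?subr_le0 // opprB lerBlDr -lerBlDl.
  have -> : theta y = (levy_tail nu y + ln y - c) + (ln (X y) - ln y) by rewrite /theta; ring.
  apply: (le_trans (ler_normD _ _)). apply: (@le_trans _ _ ((C + 1) * expR (e' * ln y))).
    rewrite mulrDl mul1r lerD // ?(le_trans e4) //.
    by rewrite (le_trans (hL _)) ?y0 ?(le_lt_trans yy) // ler_pM2l.
  by rewrite /K1 -mulrA ler_pM2l // addr_gt0.
apply: (@le_trans _ _ (K2 * expR (e' * ln (X y)))); last by rewrite ler_wpM2r // lerDr ltW.
have /andP[x20 x21] := X_itv y20.
have xx : X y2 <= X y by rewrite lerD2l lerN2 ler_expR lerN2 ltW.
have lx : ln (X y2) <= ln (X y) by rewrite ler_ln.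
have lx0 : ln (X y) <= 0 by rewrite -ln1 ler_ln ?posrE // ltW.
apply: (@le_trans _ _ B).
  rewrite /theta /B (le_trans (ler_normD _ _)) // normrN lerD2r (le_trans (ler_normD _ _)) //.
  rewrite lerD ?(ger0_norm (levy_tail_ge0 _ _)) ?le_levy_tail ?(ltW yy) //.
  by rewrite !ler0_norm ?(le_trans lx) // lerN2.
rewrite /K2 -mulrA ler_peMr // -expRD -expR0 ler_expR addrC subr_ge0 ler_pM2l //.
Qed.

(** [bin_point] and [bin_tail] are the probabilities that exactly [s], respectively at least [s], of
    the [n] points are removed by time [y]. *)
Definition bin_point s n y : R := thinning y (delta R (n - s)) n.
Definition bin_tail s n y : R := thinning y (fun i => (i <= n - s)%N%:R) n.

Lemma bin_pointE s n y : (s <= n)%N ->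
  bin_point s n y = 'C(n, s)%:R * expR (- y) ^+ (n - s) * X y ^+ s.
Proof. by move=> sn; rewrite /bin_point thinning_delta ?leq_subr // subKn // bin_sub. Qed.

Lemma bin_point_ge0 s n y : 0 <= y -> 0 <= bin_point s n y.
Proof. by move=> y0; apply: thinning_ge0 => // k _; exact: ler0n. Qed.

Lemma bin_tail_itv s n y : 0 <= y -> 0 <= bin_tail s n y <= 1.
Proof.
move=> y0; apply/andP; split; first by apply: thinning_ge0 => // k _; exact: ler0n.
rewrite -(thinning_cst y 1 n); apply: le_thinning => // k _.
by rewrite lern1 leq_b1.
Qed.

Lemma is_derive_bin_tail s n y : (0 < s)%N -> (s <= n)%N ->
  is_derive y 1 (bin_tail s n) ((n - s).+1%:R * bin_point s.-1 n y).
Proof.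
move=> s0 sn; apply: is_derive_eq (is_derive_thinning y _ n) _.
have ns : (n - s.-1 = (n - s).+1)%N by lia.
rewrite /bin_point ns /thinning -newton_opZ -mulN1r -newton_opZ; apply: eq_newton_opr => i _.
rewrite /thinning_gen /delta; case: i => [|i]; first by rewrite mul0r !mulr0.
rewrite /= eqSS; have [->|ne] := eqVneq (n - s)%N i; first by rewrite ltnn leqnn /=; ring.
have -> : (i < n - s)%N = (i <= n - s)%N by rewrite ltn_neqAle eq_sym ne.
by rewrite /=; ring.
Qed.

Lemma is_derive_bin_point s n y : (0 < s)%N -> (s <= n)%N ->
  is_derive y 1 (bin_point s n)
    ((n - s).+1%:R * bin_point s.-1 n y - (n - s)%:R * bin_point s n y).
Proof.
move=> s0 sn; apply: is_derive_eq (is_derive_thinning y _ n) _.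
have ns : (n - s.-1 = (n - s).+1)%N by lia.
rewrite /bin_point ns /thinning -!newton_opZ -newton_opB -mulN1r -newton_opZ.
apply: eq_newton_opr => i _; rewrite /thinning_gen /delta.
case: i => [|i]; first by rewrite mul0r !mulr0 sub0r; case: (n - s)%N => [|m]; rewrite ?mul0r ?mulr0 ?oppr0.
rewrite /= eqSS; have [e|ne] := eqVneq (n - s)%N i.
  rewrite e; have -> : (i == i.+1) = false by apply/negbTE; rewrite neq_ltn ltnSn.
  by rewrite /=; ring.
have [e|ne2] := eqVneq (n - s)%N i.+1; first by rewrite e /=; ring.
by rewrite /=; ring.
Qed.

Lemma bin_point_pred s n y : (0 < s)%N -> (s <= n)%N ->
  X y * ((n - s).+1%:R * bin_point s.-1 n y) = s%:R * expR (- y) * bin_point s n y.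
Proof.
move=> s0 sn; have ns : (n - s.-1 = (n - s).+1)%N by lia.
rewrite !bin_pointE //; last by rewrite (leq_trans (leq_pred _)).
have e : (n - s).+1%:R * 'C(n, s.-1)%:R = s%:R * 'C(n, s)%:R :> R.
  rewrite -!natrM; congr _%:R; have := mul_bin_left n s.-1. by rewrite prednK // ns.
rewrite ns exprS; have -> : X y ^+ s = X y * X y ^+ s.-1 by rewrite -exprS prednK.
transitivity (X y * ((n - s).+1%:R * 'C(n, s.-1)%:R) *
  (expR (- y) * expR (- y) ^+ (n - s)) * X y ^+ s.-1); first by ring.
by rewrite e; ring.
Qed.

(** A factor [n X] costs a shift of the number of removed points by one and the constant [2 s],
    because [n <= 2 (n - s)]. *)
Lemma bin_point_mulX s n y : (0 < s)%N -> (s.*2 <= n)%N -> 0 < y ->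
  n%:R * X y * ((n - s).+1%:R * bin_point s.-1 n y) <= s.*2%:R * ((n - s)%:R * bin_point s n y).
Proof.
move=> s0 sn y0; have sn' : (s <= n)%N by rewrite (leq_trans _ sn) // -addnn leq_addr.
have q1 : expR (- y) <= 1 by rewrite expR_le1 oppr_le0 ltW.
rewrite -mulrA bin_point_pred // !mulrA; apply: ler_wpM2r.
  by rewrite bin_point_ge0 // ltW.
apply: (@le_trans _ _ (n%:R * s%:R)); first by rewrite ler_piMr // mulr_ge0 ?ler0n.
rewrite -!natrM ler_nat.
by move: sn; clear; rewrite -addnn; nia.
Qed.

Lemma thinning_infty d n y : 0 <= y -> `|thinning y d n - d 0%N| <=
  (\sum_(i < n.+1) 'C(n, i)%:R * `|d i - d 0%N|) * expR (- y).
Proof.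
move=> y0.
have q0 : 0 <= expR (- y) by exact: expR_ge0.
have q1 : expR (- y) <= 1 by rewrite expR_le1 oppr_le0.
have -> : thinning y d n - d 0%N = thinning y (fun i => d i - d 0%N) n.
  by rewrite -[in LHS](thinning_cst y (d 0%N) n) /thinning -newton_opB.
rewrite thinningE mulr_suml (le_trans (ler_norm_sum _ _ _)) //; apply: ler_sum => i _.
have [->|i0] := posnP (i : nat); first by rewrite subrr normr0 !mulr0 normr0 mul0r.
rewrite normrM [leRHS]mulrAC ler_wpM2r // ger0_norm; last first.
  by rewrite !mulr_ge0 ?exprn_ge0 // subr_ge0.
rewrite -mulrA ler_wpM2l //.
apply: (@le_trans _ _ (expR (- y) * 1)); last by rewrite mulr1.
apply: ler_pM; rewrite ?exprn_ge0 ?subr_ge0 //; last by rewrite exprn_ile1 ?subr_ge0 // gerBl.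
by rewrite -[leRHS]expr1 ler_wiXn2l.
Qed.

Lemma rate_levy_int n i : (i < n)%N ->
  rate nu n i = levy_int nu (fun y => thinning y (delta R i) n).
Proof.
move=> ni; rewrite /rate -/(levy_op nu (delta R i) n) (levy_opE dl0_gt0 nu_exp).
rewrite -mulN1r -(levy_intZ nu_exp); last exact: levy_dom_thinning.
by apply: eq_levy_int => y _; rewrite {1}/delta (ltn_eqF ni) sub0r mulN1r opprK.
Qed.

Lemma norm_derive_increment (h dh k dk : R -> R) a b : a <= b ->
  (forall z, a <= z <= b -> is_derive z 1 h (dh z)) ->
  (forall z, a <= z <= b -> is_derive z 1 k (dk z)) ->
  (forall z, a <= z <= b -> `|dh z| <= dk z) -> `|h b - h a| <= k b - k a.
Proof.
move=> ab hd kd hk; rewrite ler_norml; apply/andP; split; last first.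
  apply: (le_derive_increment ab hd kd) => z /hk; exact: le_trans (ler_norm _).
rewrite -[h b - h a]opprB lerN2.
have := @le_derive_increment _ (fun z => - h z) (fun z => - dh z) k dk a b ab.
have -> : - h b - - h a = h a - h b by ring.
apply => // z zab; first by have := hd _ zab => ?; exact: is_deriveN.
by apply: le_trans (hk _ zab); rewrite -normrN ler_norm.
Qed.

Lemma is_derive_sum3 (f1 f2 f3 : R -> R) (d1 d2 d3 c0 c1 c2 : R) y :
  is_derive y 1 f1 d1 -> is_derive y 1 f2 d2 -> is_derive y 1 f3 d3 ->
  is_derive y 1 (fun z => c0 * (f1 z + (c1 * f2 z + c2 * f3 z))) (c0 * (d1 + (c1 * d2 + c2 * d3))).
Proof.
move=> h1 h2 h3.
have -> : (fun z => c0 * (f1 z + (c1 * f2 z + c2 * f3 z))) =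
  c0 \*: (f1 + (c1 \*: f2 + c2 \*: f3)) by [].
exact: is_deriveZ (is_deriveD h1 (is_deriveD (is_deriveZ c1 h2) (is_deriveZ c2 h3))).
Qed.

Lemma is_derive_sum_mul (f1 f2 f3 f4 : R -> R) (d1 d2 d3 d4 c0 : R) y :
  is_derive y 1 f1 d1 -> is_derive y 1 f2 d2 -> is_derive y 1 f3 d3 -> is_derive y 1 f4 d4 ->
  is_derive y 1 (fun z => f1 z + f2 z * f3 z - c0 * f4 z)
    (d1 + (f2 y * d3 + d2 * f3 y) - c0 * d4).
Proof.
move=> h1 h2 h3 h4.
have -> : (fun z => f1 z + f2 z * f3 z - c0 * f4 z) = f1 + f2 * f3 - c0 \*: f4 by [].
have := is_deriveB (is_deriveD h1 (is_deriveM h2 h3)) (is_deriveZ c0 h4).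
by rewrite /GRing.scale /= [f3 y * d2]mulrC.
Qed.

Lemma is_derive_log_tail y : 0 < y -> is_derive y 1 theta (- f y + expR (- y) / X y).
Proof.
move=> y0; have /andP[x0 _] := X_itv y0.
have dX : is_derive y 1 X (expR (- y)).
  have h := is_derive_expRN 1 y.
  have -> : X = cst 1 - (fun z => expR (- (1 * z))) by apply/funext => z; rewrite /X !fctE mul1r.
  by apply: is_derive_eq; rewrite sub0r mul1r mulN1r opprK.
have dl := is_derive1_comp (is_derive1_ln x0) dX.
have dT := is_derive_levy_tail f_cont f_dens hnu y0.
have -> : theta = levy_tail nu + (@ln R \o X) - cst c by [].
by apply: is_derive_eq; rewrite subr0 /GRing.scale /= mulrC.
Qed.

(** Integration by parts. The rate minus [1 / r] is the integral of [- g theta'], hence of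
    [g' theta]. Here [g'] is a difference of two nonnegative functions [D s] of mass at most 1, and
    the bound on [theta] only shifts [s]. *)
Lemma rate_log_bound : exists e' K : R, [/\ 0 < e', e' <= 1, 0 < K & forall n r,
  (0 < r)%N -> (r.+1.*2 <= n)%N ->
  `|rate nu n (n - r) - r%:R^-1| <= K * (4 * r%:R + 4) * expR (- (e' * ln n%:R))].
Proof.
have [e' [K [e0 e1 K0 hK]]] := log_tail_bound.
exists e', K; split => // n r r0 rn.
have [n0 rn' rn2 rn3 rn4] : [/\ (0 < n)%N, (r < n)%N, (r.*2 <= n)%N, (r.+1 <= n)%N & (r.+2 <= n)%N].
  by move: rn r0; clear; rewrite -!addnn => h1 h2; split; lia.
have rle : (1 + (r.*2.+1 + r.+1.*2) <= 4 * r + 4)%N by clear; rewrite -!addnn; lia.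
have rle2 : 4 * r%:R + 4 = (4 * r + 4)%N%:R :> R by rewrite natrD natrM.
pose g := bin_point r n.
pose N := expR (- (e' * ln n%:R)).
have N0 : 0 < N by exact: expR_gt0.
(* From [t^e' <= 1 + t] at [t = n X], where [0 < e' <= 1]. *)
have xpow y : 0 < y -> expR (e' * ln (X y)) <= N * (1 + n%:R * X y).
  move=> y0; have /andP[x0 x1] := X_itv y0.
  have t0 : 0 < n%:R * X y by rewrite mulr_gt0 // ltr0n.
  have -> : expR (e' * ln (X y)) = N * expR (e' * ln (n%:R * X y)).
    by rewrite /N -expRD lnM ?posrE ?ltr0n //; congr expR; ring.
  rewrite ler_pM2l //; have [t1|t1] := leP (n%:R * X y) 1.
    rewrite (@le_trans _ _ 1) ?lerDl ?(ltW t0) // expR_le1.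
    by rewrite mulr_ge0_le0 ?(ltW e0) // -ln1 ler_ln ?posrE.
  apply: (@le_trans _ _ (n%:R * X y)); last by rewrite lerDr.
  by rewrite -[leRHS]lnK ?posrE // ler_expR ler_piMl // ln_ge0 // ltW.
pose D s y : R := (n - s).+1%:R * bin_point s.-1 n y.
have hD s y : (0 < s)%N -> (s <= n)%N -> is_derive y 1 (bin_tail s n) (D s y).
  by move=> s0 sn; exact: is_derive_bin_tail.
have D0 s y : 0 < y -> 0 <= D s y by move=> y0; rewrite mulr_ge0 // bin_point_ge0 // ltW.
have DS s y : (s < n)%N -> (n - s)%:R * bin_point s n y = D s.+1 y.
  by move=> sn; rewrite /D /= -subSn.
pose g' y := D r y - D r.+1 y.
have dg y : is_derive y 1 g (g' y).
  by rewrite /g' -DS //; apply: is_derive_bin_point => //; exact: ltnW.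
(* [D s] is the derivative of [bin_tail s], which grows by at most 1; the coefficients add up to
   [1 + (2 r + 1) + (2 r + 2) = 4 r + 4]. *)
pose k y := K * N * (D r y + (r.*2.+1%:R * D r.+1 y + r.+1.*2%:R * D r.+2 y)).
have step y : 0 < y -> `|g' y * theta y| <= k y.
  move=> y0; have /andP[x0 x1] := X_itv y0. have h1 : `|g' y| <= D r y + D r.+1 y.
    by rewrite (le_trans (ler_normB _ _)) // !ger0_norm ?D0.
  have h2 : `|theta y| <= K * N * (1 + n%:R * X y).
    by rewrite (le_trans (hK _ y0)) // -mulrA ler_pM2l // xpow.
  rewrite normrM; apply: (le_trans (ler_pM (normr_ge0 _) (normr_ge0 _) h1 h2)).
  have h3 := bin_point_mulX r0 rn2 y0; rewrite -/(D r y) DS // in h3.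
  have h4 := bin_point_mulX (ltn0Sn r) rn y0; rewrite -/(D r.+1 y) DS // in h4.
  have -> : (D r y + D r.+1 y) * (K * N * (1 + n%:R * X y)) =
    K * N * ((1 + n%:R * X y) * (D r y + D r.+1 y)) by ring.
  have KN : 0 <= K * N by rewrite mulr_ge0 // ltW. rewrite /k; apply: (ler_wpM2l KN).
  rewrite mulrDl !mul1r mulrDr -natr1 mulrDl mul1r.
  move: h3 h4; move: (D r y) (D r.+1 y) (D r.+2 y) => u v w h3 h4; lra.
have g0 y : 0 < y -> 0 <= g y by move=> y0; rewrite bin_point_ge0 // ltW.
have theta_le y : 0 < y -> `|theta y| <= K.
  move=> y0; apply: (le_trans (hK _ y0)); have /andP[x0 x1] := X_itv y0.
  rewrite ler_piMr ?(ltW K0) // expR_le1 mulr_ge0_le0 ?(ltW e0) //.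
  by rewrite -ln1 ler_ln ?posrE // ltW.
have gc y : {for y, continuous g}.
  by apply/differentiable_continuous/derivable1_diffP; case: (dg y).
have dgn : delta R (n - r) n = 0.
  by rewrite /delta; case: eqP => // h; move: rn' r0 h; clear; lia.
have dg0 : delta R (n - r) 0 = 0.
  by rewrite /delta; case: eqP => // h; move: rn' r0 h; clear; lia.
have gdom : levy_dom dl0 g.
  have -> : g = fun y => -1 * (delta R (n - r) n - thinning y (delta R (n - r)) n).
    by apply/funext => y; rewrite dgn sub0r mulN1r opprK.
  by apply: levy_domZ; exact: levy_dom_thinning.
have mg : measurable_fun setT g by have [] := gdom.
pose E := K * (4 * r%:R + 4) * N.
pose Q := bin_tail r n.
have main a b : 0 < a -> a <= b -> `|\int[nu]_(y in `[a, b]) g y - r%:R^-1| <=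
    E + (K * `|g b| + K * `|g a| + r%:R^-1 * (`|Q b - 1| + `|Q a|)).
  move=> a0 ab; have b0 : 0 < b by exact: lt_le_trans ab.
  have a20 : 0 < a / 2 by rewrite divr_gt0.
  have a2 : a / 2 < a by rewrite gtr_pMr // invf_lt1 ?ltr1n.
  have hc y : 0 < y -> {for y, continuous (fun z => g z * f z)}.
    move=> y0; apply: continuousM; first exact: gc. by apply: f_cont; rewrite in_itv /= y0.
  (* Based at [a / 2], so that the primitive is differentiable at [a] too. *)
  pose G z : R := \int[mu]_(t in `[a / 2, z]) (g t * f t).
  have iG : mu.-integrable `[a / 2, b] (EFin \o (fun t => g t * f t)).
    apply: continuous_compact_integrable; first exact: segment_compact.
    exact: continuous_within_itv.
  have GE : G b - G a = \int[nu]_(y in `[a, b]) g y.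
    rewrite (Rintegral_density_itv f_ge0 f_cont f_dens) //.
    rewrite /G (Rintegral_itvB iG) ?bnd_simp ?(ltW a2) //. rewrite Rintegral_itv_obnd_cbnd //.
    apply: integrableS iG => // y; rewrite /= !in_itv /= => /andP[h1 ->].
    by rewrite andbT (le_trans (ltW a2)) // ltW.
  (* An antiderivative of [g' theta]: the terms containing [f] cancel, and [Q / r] is the primitive
     of [g] against the model density. *)
  pose W y := G y + g y * theta y - r%:R^-1 * Q y.
  pose B y := K * N * (bin_tail r n y + (r.*2.+1%:R * bin_tail r.+1 n y + r.+1.*2%:R * bin_tail r.+2 n y)).
  have hW : `|W b - W a| <= B b - B a.
    apply: (@norm_derive_increment W (fun y => g' y * theta y) B k a b ab) => y /andP[ay yb].
    - have y0 : 0 < y by exact: lt_le_trans ay.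
      have /andP[x0 _] := X_itv y0. have d1 : is_derive y 1 G (g y * f y).
        by apply: (is_derive_primitive a20 hc); exact: lt_le_trans ay.
      have d2 := dg y; have d3 := is_derive_log_tail y0. have d4 := hD r y r0 (ltnW rn').
      have e : g y * f y + (g y * (- f y + expR (- y) / X y) + g' y * theta y) - r%:R^-1 * D r y =
          g' y * theta y.
        have := bin_point_pred y r0 (ltnW rn'); rewrite -/(D r y) -/(g y) => h.
        have -> : D r y = r%:R * expR (- y) * g y / X y.
          by rewrite -h mulrAC divff ?mul1r // gt_eqF.
        by field; rewrite gt_eqF // pnatr_eq0 -lt0n.
      by rewrite -e; exact: is_derive_sum_mul d1 d2 d3 d4.
    - have d1 := hD r y r0 (ltnW rn').
      have d2 := hD r.+1 y isT rn3; have d3 := hD r.+2 y isT rn4.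
      exact: is_derive_sum3 d1 d2 d3.
    by apply: step; exact: lt_le_trans ay.
  have hB : B b - B a <= E.
    rewrite /B -mulrBr /E -[K * (_ + _) * N]mulrAC; apply: ler_wpM2l; first by rewrite mulr_ge0 // ltW.
    have d1 s : bin_tail s n b - bin_tail s n a <= 1.
      have /andP[_ h1] := bin_tail_itv s n (ltW b0).
      have /andP[h2 _] := bin_tail_itv s n (ltW a0). by rewrite lerBlDr (le_trans h1) // lerDl.
    have -> : bin_tail r n b + (r.*2.+1%:R * bin_tail r.+1 n b + r.+1.*2%:R * bin_tail r.+2 n b) -
      (bin_tail r n a + (r.*2.+1%:R * bin_tail r.+1 n a + r.+1.*2%:R * bin_tail r.+2 n a)) =
      (bin_tail r n b - bin_tail r n a) + (r.*2.+1%:R * (bin_tail r.+1 n b - bin_tail r.+1 n a) +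
      r.+1.*2%:R * (bin_tail r.+2 n b - bin_tail r.+2 n a)) by ring.
    apply: (@le_trans _ _ (1 + (r.*2.+1%:R * 1 + r.+1.*2%:R * 1))).
      by rewrite !lerD ?ler_wpM2l ?ler0n.
    by rewrite !mulr1 rle2 -natrD -[1]/(1%:R) -natrD ler_nat.
  have -> : \int[nu]_(y in `[a, b]) g y - r%:R^-1 = (W b - W a) +
      (- (g b * theta b) + g a * theta a + r%:R^-1 * ((Q b - 1) - Q a)).
    by rewrite -GE /W; ring.
  apply: (le_trans (ler_normD _ _)); apply: lerD; first exact: le_trans hW hB.
  apply: (le_trans (ler_normD _ _)); apply: lerD.
    apply: (le_trans (ler_normD _ _)); rewrite normrN !normrM ![K * _]mulrC.
    by apply: lerD; apply: ler_wpM2l => //; exact: theta_le.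
  rewrite normrM ger0_norm ?invr_ge0 // ler_wpM2l ?invr_ge0 //. exact: ler_normB.
pose hk k : R := k.+1%:R^-1.
pose Mg := \sum_(i < n.+1) 'C(n, i)%:R * `|delta R (n - r) i - delta R (n - r) 0%N|.
pose MQ := \sum_(i < n.+1) 'C(n, i)%:R * `|(i <= n - r)%N%:R - (0 <= n - r)%N%:R : R|.
have qk j : expR (- j.+1%:R) <= hk j.
  rewrite expRN /hk lef_pV2 ?posrE ?expR_gt0 //.
  by rewrite (le_trans _ (expR_ge1Dx _)) // lerDr.
have main2 j : `|\int[nu]_(y in `[j.+1%:R^-1, j.+1%:R]) g y - r%:R^-1| <=
    E + (K * (Mg * hk j) + K * `|g (hk j)| + r%:R^-1 * (MQ * hk j + `|Q (hk j)|)).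
  apply: (le_trans (main _ _ _ _)).
  - by rewrite invr_gt0.
  - by rewrite (@le_trans _ _ 1) ?invf_le1 ?ler1n.
  rewrite lerD2l; apply: lerD; [rewrite lerD2r|apply: ler_wpM2l => //; rewrite lerD2r].
    apply: ler_wpM2l; first exact: ltW.
    have ge : g j.+1%:R = thinning j.+1%:R (delta R (n - r)) n - delta R (n - r) 0.
      by rewrite dg0 subr0.
    rewrite ge; apply: (le_trans (thinning_infty _ _ (ler0n _ _))); apply: ler_wpM2l; last exact: qk.
    by apply: sumr_ge0 => i _; rewrite mulr_ge0.
  apply: (le_trans (@thinning_infty (fun i => (i <= n - r)%N%:R) n _ (ler0n _ _))); apply: ler_wpM2l; last exact: qk.
  by apply: sumr_ge0 => i _; rewrite mulr_ge0.
have hk0 : hk x @[x --> \oo] --> (0 : R) by exact: cvg_harmonic.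
have gk : `|g (hk x)| @[x --> \oo] --> (0 : R).
  have e : g 0 = 0 by rewrite /g /bin_point thinning0.
  by rewrite -[X in _ --> X](normr0 R) -e; apply: cvg_norm; apply: continuous_cvg hk0; exact: gc.
have Qk : `|Q (hk x)| @[x --> \oo] --> (0 : R).
  have e : Q 0 = 0.
    rewrite /Q /bin_tail thinning0 leqNgt ltn_subrL r0 n0 //.
  rewrite -[X in _ --> X](normr0 R) -e; apply: cvg_norm; apply: continuous_cvg hk0.
  by apply/differentiable_continuous/derivable1_diffP; case: (hD r 0 r0 (ltnW rn')).
rewrite rate_levy_int; last by rewrite ltn_subrL r0 n0.
have lim := cvg_levy_int_itv nu_exp gdom g0.
have lim1 : `|\int[nu]_(y in `[x.+1%:R^-1, x.+1%:R]) g y - r%:R^-1| @[x --> \oo] -->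
    `|levy_int nu g - r%:R^-1|.
  by apply: cvg_norm; apply: cvgB => //; exact: cvg_cst.
have lim2 : (E + (K * (Mg * hk x) + K * `|g (hk x)| + r%:R^-1 * (MQ * hk x + `|Q (hk x)|)))
    @[x --> \oo] --> E.
  have z : E + (K * (Mg * 0) + K * 0 + r%:R^-1 * (MQ * 0 + 0)) = E by ring.
  rewrite -[X in _ --> X]z; apply: cvgD; first exact: cvg_cst. apply: cvgD; [apply: cvgD|].
  - by apply: cvgMr; apply: cvgMr.
  - by apply: cvgMr. by apply: cvgMr; apply: cvgD => //; apply: cvgMr.
exact: (ler_cvg_to lim1 lim2 (nearW _ main2)).
Qed.

End RateLimit.

(** * Consequences of the two tail conditions for the Laplace exponent *)

Section LevyMeasure.
Variables (R : realType) (nu : {measure set R -> \bar R}).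
Hypotheses (hnu : levy_measure nu) (hdens : has_continuous_density nu) (hL : condition_L nu).
Hypothesis hR : condition_R nu.

Lemma levy_exp_integrable : exists2 dl0 : R, 0 < dl0 &
  exp_integrable nu dl0.
Proof.
have [eps [C [y1 [e0 C0 h]]]] := condition_R_bound hR.
exists (eps / 2); first by rewrite divr_gt0.
exact: levy_tail_exp_integrable h.
Qed.

Variable dl0 : R.
Hypotheses (dl0_gt0 : 0 < dl0) (nu_exp : exp_integrable nu dl0).

Lemma levy_minor : exists al be eta : R,
  [/\ 0 < al, al < be, 0 < eta & forall k kappa : R -> R, levy_dom dl0 k ->
  (forall y, 0 < y -> 0 <= k y) ->
  (forall y, al <= y <= be -> is_derive y 1 kappa (k y)) ->
  (forall y, derivable k y 1) ->
  eta * (kappa be - kappa al) <= levy_int nu k].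
Proof.
have [f [f0 fc fd]] := hdens.
have [c [eps [C [y1 [e0 C0 y10 h]]]]] := condition_L_bound hL.
have [y0 y00 fy0] := density_pos f0 fd e0 y10 h.
exact: (density_minor f0 fc fd nu_exp y00 fy0).
Qed.

Lemma levy_rate_log_bound : exists e' K : R, [/\ 0 < e', e' <= 1, 0 < K & forall n r,
  (0 < r)%N -> (r.+1.*2 <= n)%N ->
  `|rate nu n (n - r) - r%:R^-1| <= K * (4 * r%:R + 4) * expR (- (e' * ln n%:R))].
Proof.
have [f [f0 fc fd]] := hdens.
have [c [eps [C [y1 [e0 C0 y10 h]]]]] := condition_L_bound hL.
exact: (rate_log_bound hnu f0 fc fd dl0_gt0 nu_exp e0 C0 y10 h).
Qed.

Lemma levy_part_rate r : (0 < r)%N -> exists2 dl : R, 0 < dl & exists C, forall n, (0 < n)%N ->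
  `|part_rate nu r n - r%:R^-1| <= C * weight dl n.
Proof.
move=> r0; have [e' [K [e0 e1 K0 h]]] := levy_rate_log_bound.
exists e' => //.
pose B (i : nat) := `|part_rate nu r i - r%:R^-1| / weight e' i.
have w0 n : 0 < weight e' n by rewrite weight_gt0 // ltW.
have B0 i : 0 <= B i by rewrite divr_ge0 // ltW.
pose C1 := K * (4 * r%:R + 4) * expR e'.
have C10 : 0 <= C1 by rewrite !mulr_ge0 ?addr_ge0 ?mulr_ge0 ?expR_ge0 ?ler0n // ltW.
(* The finitely many [n] below [2 (r + 1)] are covered by their own ratios [B n]. *)
exists (C1 + \sum_(i < r.+1.*2) B i) => n n0.
have S0 : 0 <= \sum_(i < r.+1.*2) B i by rewrite sumr_ge0.
have [rn|nr] := leqP r.+1.*2 n.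
  have rn' : (r <= n)%N by rewrite (leq_trans _ rn) // -addnn; lia.
  apply: (@le_trans _ _ (C1 * weight e' n)); last by rewrite ler_wpM2r ?lerDl // ltW.
  rewrite /part_rate rn'; apply: (le_trans (h _ _ r0 rn)).
  rewrite /C1 -[leRHS]mulrA; apply: ler_wpM2l; last exact: expR_ln_le_weight (ltW e0) n0.
  by rewrite mulr_ge0 ?addr_ge0 ?mulr_ge0 ?ler0n // ltW.
apply: (@le_trans _ _ (B n * weight e' n)); first by rewrite /B divfK // gt_eqF.
rewrite ler_wpM2r ?(ltW (w0 n)) // (bigD1 (Ordinal nr)) //= addrCA lerDl addr_ge0 //.
by rewrite sumr_ge0.
Qed.

(** [e^(- n y) (1 - e^-y)] is [1 / (n + 1)] times the probability that exactly one of [n + 1] points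
    is removed. *)
Lemma laplace_exp_incr n :
  laplace_exp nu n.+1%:R - laplace_exp nu n%:R = rate nu n.+1 n / n.+1%:R.
Proof.
rewrite (rate_levy_int dl0_gt0 nu_exp) // /laplace_exp.
have dN k : levy_dom dl0 (fun y : R => 1 - expR (- (k%:R * y))).
  exact: (levy_dom_expN dl0_gt0 (ler0n _ k)).
have dT : levy_dom dl0 (fun y : R => delta R n n.+1 - thinning y (delta R n) n.+1).
  exact: levy_dom_thinning.
rewrite -(levy_intB nu_exp) //.
rewrite mulrC -(levy_intZ nu_exp); last first.
  have := levy_domZ (-1) dT. congr levy_dom; apply/funext => y.
  by rewrite {1}/delta (ltn_eqF (ltnSn n)) sub0r mulN1r opprK.
apply: eq_levy_int => y _.
rewrite thinning_delta // binSn subSnn expr1 -expRM_natl -natr1 mulrDl mul1r opprD expRD.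
by rewrite -mulrA mulKf ?natr1 ?pnatr_eq0 // mulrN; ring.
Qed.

(** The rate of losing exactly one point is bounded, so the increments of [Phi] are [O(1 / n)]. *)
Lemma laplace_exp_harmonic : exists2 C : R, 0 <= C & forall n,
  laplace_exp nu n%:R <= C * hsum R n.
Proof.
have [dl dlp [C h]] := levy_part_rate (isT : (0 < 1)%N).
exists (`|C| + 1) => [|n]; first by rewrite addr_ge0.
elim: n => [|n IH].
  by rewrite /hsum big_ord0 mulr0 laplace_exp0.
rewrite hsumS mulrDr -lerBlDr.
have -> : laplace_exp nu n.+1%:R = laplace_exp nu n%:R + rate nu n.+1 n / n.+1%:R.
  by rewrite -laplace_exp_incr; ring.
rewrite -addrA ler_wnDr // -mulrBl mulr_le0_ge0 ?invr_ge0 //.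
have := h n.+1 isT; rewrite /part_rate subSS subn0 /= invr1 => h1.
have h2 := le_trans (ler_norm _) h1.
have h3 : C * weight dl n.+1 <= `|C|.
  have w0 : 0 <= weight dl n.+1 by rewrite ltW // weight_gt0 // ltW.
  apply: (le_trans (ler_wpM2r w0 (ler_norm C))). by rewrite ler_piMr // weight_le1 // ltW.
rewrite subr_le0; move: h2 h3; rewrite lerBlDr => h2 h3.
by rewrite (le_trans h2) // lerD2r.
Qed.

Lemma levy_total_rate dl : 0 < dl -> exists C : R, forall n,
  laplace_exp nu n%:R * weight dl n <= C.
Proof.
move=> dlp; have [C C0 h] := laplace_exp_harmonic.
exists (C * dl^-1) => n.
have w0 : 0 <= weight dl n by rewrite ltW // weight_gt0 // ltW.
rewrite (le_trans (ler_wpM2r w0 (h n))) // -mulrA ler_wpM2l // mulrC.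
exact: weight_harmonic.
Qed.

Lemma laplace_exp_sublinear e : 0 < e -> exists m0, forall m, (m0 <= m)%N ->
  laplace_exp nu m.+1%:R / m.+1%:R <= e.
Proof.
move=> e0; have [C C0 h] := laplace_exp_harmonic.
pose k := (Num.truncn (2 * C / e)).+1.
pose m0 := (Num.truncn (2 * C * k%:R / e)).+1.
have k0 : (0 < k)%N by [].
exists m0 => m mm; rewrite ler_pdivrMr ?ltr0n //.
apply: (le_trans (h _)); apply: (le_trans (ler_wpM2l C0 (harmonic_le_split R _ k0))).
rewrite mulrDr mulrA.
have h1 : 2 * C * k%:R / e <= m.+1%:R.
  by rewrite (le_trans (ltW (truncnS_gt _))) // ler_nat ltnW.
have h2 : 2 * C / e <= k%:R by rewrite ltW // truncnS_gt.
have kp : 0 < k%:R :> R by rewrite ltr0n.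
have mp : 0 < m.+1%:R :> R by rewrite ltr0n.
move: h1 h2; rewrite !ler_pdivrMr // => h1 h2.
have h3 : 2 * (C * m.+1%:R / k%:R) <= m.+1%:R * e.
  rewrite mulrA ler_pdivrMr //. by have := ler_wpM2r (ltW mp) h2; lra.
lra.
Qed.

Lemma laplace_exp_ge0 (x : R) : 0 <= x -> 0 <= laplace_exp nu x.
Proof.
move=> x0; apply: levy_int_ge0 => y y0.
by rewrite subr_ge0 expR_le1 oppr_le0 mulr_ge0 // ltW.
Qed.

End LevyMeasure.

(** * The Gaussian solution of the heat equation *)

Section Gauss.
Variable R : realType.
Implicit Types (x h m t s z xi : R).

Lemma norm_derive_lip (phi dphi : R -> R) (M a b : R) :
  (forall u, Num.min a b <= u <= Num.max a b -> is_derive u 1 phi (dphi u)) ->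
  (forall u, Num.min a b <= u <= Num.max a b -> `|dphi u| <= M) ->
  `|phi b - phi a| <= M * `|b - a|.
Proof.
wlog ab : a b / a <= b => [hw|] hd hM.
  have [|/ltW ba] := leP a b; first by move=> ab; exact: hw.
  rewrite distrC [X in _ <= _ * X]distrC; apply: hw => // u; rewrite minC maxC; [exact: hd|exact: hM].
move: hd hM; rewrite (min_idPl ab) (max_idPr ab) => hd hM.
rewrite [X in _ <= _ * X]ger0_norm ?subr_ge0 // mulrBr.
apply: (@norm_derive_increment R phi dphi (fun z => M * z) (fun=> M) a b ab) => // z _.
have := is_deriveZ M (is_derive_id z 1).
by rewrite /GRing.scale /= mulr1.
Qed.

Lemma is_derive_half_sqr (c u : R) : is_derive u 1 (fun v => v ^+ 2 / 2 * c) (u * c).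
Proof.
have := is_deriveM (is_deriveM (is_derive_id u 1) (is_derive_id u 1)) (is_derive_cst (2^-1 * c) u 1).
rewrite /GRing.scale /= mulr0 add0r !mulr1.
by congr is_derive; [apply/funext => v; rewrite !fctE|]; field.
Qed.

Lemma is_derive_compose (f g : R -> R) (x a b : R) :
  is_derive (g x) 1 f a -> is_derive x 1 g b -> is_derive x 1 (fun v => f (g v)) (a * b).
Proof. exact: is_derive1_comp. Qed.

Lemma is_derive_inv (u : R) : u != 0 -> is_derive u 1 (fun v : R => v^-1) (- u ^- 2).
Proof.
move=> u0; have := @is_deriveV R id u 1 1 u0 (is_derive_id u 1).
by rewrite /GRing.scale /= mulr1.
Qed.

(** Three successive mean value bounds, with the constant [B] in place of the sharp [B / 6]. *)
Lemma taylor2_bound (f f1 f2 f3 : R -> R) (B : R) :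
  (forall z, is_derive z 1 f (f1 z)) -> (forall z, is_derive z 1 f1 (f2 z)) ->
  (forall z, is_derive z 1 f2 (f3 z)) -> (forall z, `|f3 z| <= B) ->
  forall x h, `|f (x + h) - f x - h * f1 x - h ^+ 2 / 2 * f2 x| <= B * `|h| ^+ 3.
Proof.
move=> d1 d2 d3 hB x h.
have B0 : 0 <= B by exact: le_trans (hB 0).
have sh (g g' : R -> R) (u : R) : (forall z, is_derive z 1 g (g' z)) ->
    is_derive u 1 (fun v => g (x + v)) (g' (x + u)).
  move=> dg; have d : is_derive u 1 (fun v => x + v) 1.
    by have := is_deriveD (is_derive_cst x u 1) (is_derive_id u 1); rewrite add0r.
  have := is_derive1_comp (dg (x + u)) d; by rewrite mulr1.
have le1 (u v : R) : Num.min 0 v <= u <= Num.max 0 v -> `|u| <= `|v|.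
  have [v0|/ltW v0] := leP 0 v; first by move=> /andP[u0 uv]; rewrite !ger0_norm.
  by move=> /andP[vu u0]; rewrite !ler0_norm // lerN2.
have e2 u : `|f2 (x + u) - f2 x| <= B * `|u|.
  have := @norm_derive_lip (fun v => f2 (x + v)) (fun v => f3 (x + v)) B 0 u.
  by rewrite addr0 subr0; apply=> v _; (exact: sh || exact: hB).
have dlin (u c : R) : is_derive u 1 (fun v => v * c) c.
  have := is_deriveM (is_derive_id u 1) (is_derive_cst c u 1).
  by rewrite /GRing.scale /= mulr0 add0r mulr1.
have e1 u : `|f1 (x + u) - u * f2 x - f1 x| <= B * `|u| * `|u|.
  have := @norm_derive_lip (fun v => f1 (x + v) - v * f2 x) (fun v => f2 (x + v) - f2 x) (B * `|u|) 0 u.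
  rewrite addr0 !subr0 mul0r subr0; apply=> v vu.
  by rewrite (le_trans (e2 v)) // ler_wpM2l ?le1.
have e0 := @norm_derive_lip (fun v => f (x + v) - v * f1 x - v ^+ 2 / 2 * f2 x)
  (fun v => f1 (x + v) - f1 x - v * f2 x) (B * `|h| * `|h|) 0 h.
move: e0; rewrite addr0 mul0r expr0n /= !mul0r !subr0 => e0.
have -> : f (x + h) - f x - h * f1 x - h ^+ 2 / 2 * f2 x =
  f (x + h) - h * f1 x - h ^+ 2 / 2 * f2 x - f x by ring.
have -> : B * `|h| ^+ 3 = B * `|h| * `|h| * `|h| by ring.
apply: e0 => u uh.
  exact: (is_deriveB (is_deriveB (sh _ _ u d1) (dlin u (f1 x))) (is_derive_half_sqr (f2 x) u)).
have -> : f1 (x + u) - f1 x - u * f2 x = f1 (x + u) - u * f2 x - f1 x by ring.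
rewrite (le_trans (e1 u)) // -!mulrA ler_wpM2l // ler_pM ?le1 //.
Qed.

Definition gauss_cdf z : R := fine (normal_prob 0 1 `]-oo, z]%classic).
Definition gauss_pdf x : R := normal_pdf 0 1 x.

Lemma gauss_pdfE x : gauss_pdf x = normal_peak 1 * expR (- (x ^+ 2 / 2)).
Proof.
rewrite /gauss_pdf normal_pdfE ?oner_neq0 // /normal_fun subr0.
by congr (_ * expR _); rewrite expr1n mulNr.
Qed.

Lemma gauss_cdfE z : normal_prob 0 1 `]-oo, z]%classic = (gauss_cdf z)%:E.
Proof. by rewrite /gauss_cdf fineK // fin_num_measure. Qed.

Lemma gauss_cdf_itv z : 0 <= gauss_cdf z <= 1.
Proof. by rewrite -!lee_fin -gauss_cdfE measure_ge0 probability_le1. Qed.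

Lemma is_derive_gauss_cdf x : is_derive x 1 gauss_cdf (gauss_pdf x).
Proof.
have x1 : x < x + 1 by rewrite ltrDl.
have i : lebesgue_measure.-integrable [set` Interval -oo%O (BRight (x + 1))]
    (EFin \o gauss_pdf).
  by apply: integrableS (integrable_normal_pdf 0 1) => //; exact: measurable_itv.
have c : {for x, continuous gauss_pdf} by exact: continuous_normal_pdf.
have [d e] := continuous_FTC1 x1 i (ltNyr _) c.
exact: (DeriveDef d (etrans (esym (derive1E _ _)) e)).
Qed.

(** The derivative of the density, and up to the factor [1 / (2 t)] the time derivative of
    [heat]. *)
Definition gauss_q x : R := - (x * gauss_pdf x).
Definition gauss_r x : R := (x ^+ 2 - 1) * gauss_pdf x.

Lemma is_derive_gauss_pdf x : is_derive x 1 gauss_pdf (gauss_q x).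
Proof.
have dsq := is_derive_half_sqr (-1) x.
have := is_deriveZ (normal_peak 1) (is_derive_compose (g := fun v : R => v ^+ 2 / 2 * -1) (is_derive_expR (x ^+ 2 / 2 * -1)) dsq).
have -> : normal_peak 1 \*: (fun v : R => expR (v ^+ 2 / 2 * -1)) = gauss_pdf.
  by apply/funext => v; rewrite gauss_pdfE /= /GRing.scale /= mulrN1.
by congr is_derive; rewrite /gauss_q gauss_pdfE /GRing.scale /= !mulrN1; move: (expR _) => e'; ring.
Qed.

Lemma is_derive_gauss_q x : is_derive x 1 gauss_q (gauss_r x).
Proof.
have := is_deriveN (is_deriveM (is_derive_id x 1) (is_derive_gauss_pdf x)).
by congr is_derive; rewrite /gauss_r /gauss_q /GRing.scale /=; ring.
Qed.

(** One constant for every derivative in use: with [y = x^2 / 2], the polynomial [1 + 2 y + 4 y^2]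
    is at most [19 e^y]. *)
Definition gauss_bound : R := 19 * normal_peak 1.

Lemma gauss_pdf_bound x : 0 <= (1 + x ^+ 2 + x ^+ 4) * gauss_pdf x <= gauss_bound.
Proof.
have p0 : 0 <= normal_peak 1 :> R by exact: normal_peak_ge0.
have y0 : 0 <= x ^+ 2 / 2 by rewrite divr_ge0 // sqr_ge0.
rewrite gauss_pdfE mulrCA [gauss_bound]mulrC; have := y0.
have -> : 1 + x ^+ 2 + x ^+ 4 = 1 + 2 * (x ^+ 2 / 2) + 4 * (x ^+ 2 / 2) ^+ 2 by field.
move: (x ^+ 2 / 2) => y {}y0.
have E0 : 0 < expR y by exact: expR_gt0.
have h1 : y + 1 <= expR y by rewrite addrC expR_ge1Dx.
have h2 : y ^+ 2 <= 4 * expR y.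
  have -> : expR y = expR (y / 2) ^+ 2 by rewrite -expRM_natl; congr expR; field.
  have h3 := expR_ge1Dx (y / 2). have h4 : 0 <= 1 + y / 2 by rewrite addr_ge0 // divr_ge0.
  have h5 : (1 + y / 2) ^+ 2 <= expR (y / 2) ^+ 2 by rewrite lerXn2r ?nnegrE ?expR_ge0.
  have h6 : (1 + y / 2) ^+ 2 = 1 + y + y ^+ 2 / 4 by field. by rewrite h6 in h5; lra.
have s0 : 0 <= y ^+ 2 by exact: sqr_ge0.
rewrite !mulr_ge0 ?expR_ge0 //=; last by lra.
rewrite ler_wpM2l // expRN ler_pdivrMr //; lra.
Qed.

Lemma gauss_pdf_ge0 x : 0 <= gauss_pdf x.
Proof. exact: normal_pdf_ge0. Qed.

Lemma gauss_bound_le x (c : R) : `|c| <= 1 + x ^+ 2 + x ^+ 4 -> `|c * gauss_pdf x| <= gauss_bound.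
Proof.
move=> hc; have /andP[_ h] := gauss_pdf_bound x.
by rewrite normrM (ger0_norm (gauss_pdf_ge0 x)) (le_trans _ h) // ler_wpM2r ?gauss_pdf_ge0.
Qed.

Lemma gauss_bounds x : [/\ `|gauss_pdf x| <= gauss_bound, `|gauss_q x| <= gauss_bound,
  `|gauss_r x| <= gauss_bound & `|x * gauss_r x| <= gauss_bound].
Proof.
have s2 : 0 <= x ^+ 2 by exact: sqr_ge0.
have s4 : x ^+ 4 = (x ^+ 2) ^+ 2 by ring.
have n2 : `|x| ^+ 2 = x ^+ 2 by rewrite real_normK ?num_real.
have h1 := sqr_ge0 (`|x| - 1); have h2 := sqr_ge0 (x ^+ 2 - 1).
have h3 := sqr_ge0 (`|x| ^+ 2 - `|x|).
have x0 := normr_ge0 x.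
have e1 : `|x| <= 1 + x ^+ 2.
  move: h1; rewrite sqrrB1 n2 => h1; have := sqr_ge0 `|x|; rewrite n2; nra.
have e2 : `|x ^+ 2 - 1| <= 1 + x ^+ 2 by rewrite ler_norml; apply/andP; split; lra.
have s4' : 0 <= x ^+ 4 by rewrite s4 sqr_ge0.
split.
- rewrite -[gauss_pdf x]mul1r; apply: gauss_bound_le; rewrite normr1; lra.
- rewrite /gauss_q normrN; apply: gauss_bound_le; lra.
- apply: gauss_bound_le; lra.
rewrite /gauss_r mulrA; apply: gauss_bound_le; rewrite normrM.
apply: (@le_trans _ _ (`|x| * (1 + x ^+ 2))); first by rewrite ler_wpM2l.
rewrite s4 -n2; move: (`|x|) x0 => y y0; nra.
Qed.

Lemma gauss_bound_ge0 : 0 <= gauss_bound.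
Proof. by have [h _ _ _] := gauss_bounds 0; exact: le_trans h. Qed.

Lemma gauss_cdf_lip x z : `|gauss_cdf x - gauss_cdf z| <= gauss_bound * `|x - z|.
Proof.
apply: (@norm_derive_lip _ gauss_pdf) => u _; first exact: is_derive_gauss_cdf.
by have [] := gauss_bounds u.
Qed.

Lemma gauss_q_lip x z : `|gauss_q x - gauss_q z| <= gauss_bound * `|x - z|.
Proof.
apply: (@norm_derive_lip _ gauss_r) => u _; first exact: is_derive_gauss_q.
by have [] := gauss_bounds u.
Qed.

Lemma le_gauss_cdf x z : x <= z -> gauss_cdf x <= gauss_cdf z.
Proof.
move=> xz; apply: (@ge0_derive_nondecreasing _ _ gauss_pdf) => // u _; first exact: is_derive_gauss_cdf.
exact: gauss_pdf_ge0.
Qed.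

(* [rsqrt t] is [t ^ (-1/2)]. *)
Definition rsqrt t : R := expR (- (ln t / 2)).

Lemma rsqrt_gt0 t : 0 < rsqrt t. Proof. exact: expR_gt0. Qed.

Lemma rsqrt_sqr t : 0 < t -> rsqrt t ^+ 2 = t^-1.
Proof.
move=> t0; rewrite /rsqrt -expRM_natl -[t in RHS]lnK ?posrE // -expRN.
by congr expR; field.
Qed.

Lemma le_rsqrt s t : 0 < s -> s <= t -> rsqrt t <= rsqrt s.
Proof.
move=> s0 st; rewrite ler_expR lerN2 ler_pM2r // ler_ln ?posrE //.
exact: lt_le_trans st.
Qed.

Lemma rsqrt_le1 t : 1 <= t -> rsqrt t <= 1.
Proof. by move=> t1; rewrite expR_le1 oppr_le0 divr_ge0 // ln_ge0. Qed.

Lemma is_derive_rsqrt t : 0 < t -> is_derive t 1 rsqrt (- (rsqrt t / (2 * t))).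
Proof.
move=> t0; have d1 := is_deriveZ (- 2^-1) (is_derive1_ln t0).
have := is_derive_compose (g := fun v => - 2^-1 * ln v) (is_derive_expR (- 2^-1 * ln t)) d1.
have -> : (fun v => expR (- 2^-1 * ln v)) = rsqrt.
  by apply/funext => v; rewrite /rsqrt; congr expR; ring.
congr is_derive; rewrite /GRing.scale /= /rsqrt.
have -> : - 2^-1 * ln t = - (ln t / 2) by ring.
by field; rewrite gt_eqF.
Qed.

(* The solution of the heat equation [d/dt = 1/2 d^2/dm^2] started from the
   indicator function of [`]0, +oo[]. *)
Definition heat m t : R := gauss_cdf (m * rsqrt t).

Lemma is_derive_scaled (g g' : R -> R) m t : 0 < t -> (forall z, is_derive z 1 g (g' z)) ->
  is_derive t 1 (fun v => g (m * rsqrt v))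
    (g' (m * rsqrt t) * (- (m * rsqrt t / (2 * t)))).
Proof.
move=> t0 dg; have d1 := is_deriveZ m (is_derive_rsqrt t0).
have := is_derive_compose (g := fun v => m * rsqrt v) (dg (m * rsqrt t)) d1.
by congr is_derive; rewrite /GRing.scale /= mulrN mulrA.
Qed.

Lemma is_derive_heat_time m t : 0 < t ->
  is_derive t 1 (heat m) (gauss_q (m * rsqrt t) / (2 * t)).
Proof.
move=> t0; have := is_derive_scaled m t0 is_derive_gauss_cdf.
by congr is_derive; rewrite /gauss_q; ring.
Qed.

(** The derivative in time produces a factor [m], absorbed by the bound on [x * gauss_r x]; so the
    estimate is uniform in [m]. *)
Lemma heat_second_lip m s t t' : 1 <= s -> s <= t -> s <= t' ->
  `|gauss_q (m * rsqrt t') / t' - gauss_q (m * rsqrt t) / t| <=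
  2 * gauss_bound * rsqrt s ^+ 3 * `|t' - t|.
Proof.
move=> s1 st st'.
have s0 : 0 < s by exact: lt_le_trans s1.
have w0 := rsqrt_gt0 s.
pose dphi u := (gauss_r (m * rsqrt u) * (- (m * rsqrt u / (2 * u)))) * u^-1
  + gauss_q (m * rsqrt u) * (- u ^- 2).
have pos u : Num.min t t' <= u <= Num.max t t' -> s <= u.
  by move=> /andP[h _]; apply: le_trans h; rewrite le_min st.
apply: (@norm_derive_lip (fun u => gauss_q (m * rsqrt u) / u) dphi) => u /pos su.
  have u0 : 0 < u by exact: lt_le_trans su. have d1 := is_derive_scaled m u0 is_derive_gauss_q.
  have u1 : u != 0 by rewrite gt_eqF. have d2 := is_derive_inv u1. have := is_deriveM d1 d2.
  by congr is_derive; rewrite /dphi /GRing.scale /=; ring.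
have u0 : 0 < u by exact: lt_le_trans su.
have -> : dphi u = - (u^-1) ^+ 2 * (gauss_q (m * rsqrt u) +
    (m * rsqrt u * gauss_r (m * rsqrt u)) / 2).
  by rewrite /dphi; field; rewrite gt_eqF.
have [_ b1 _ b2] := gauss_bounds (m * rsqrt u).
rewrite normrM normrN normrX normfV (ger0_norm (ltW u0)) mulrC.
apply: ler_pM => //; first by rewrite exprn_ge0 // invr_ge0 ltW.
  rewrite (le_trans (ler_normD _ _)) // normrM normfV (@ger0_norm _ 2) //.
  have := gauss_bound_ge0; lra.
have us : u^-1 <= s^-1 by rewrite lef_pV2 ?posrE.
apply: (@le_trans _ _ (s^-1 ^+ 2)); first by rewrite lerXn2r ?nnegrE ?invr_ge0 // ltW.
rewrite -rsqrt_sqr // -exprM ler_wiXn2l //; [exact: ltW|exact: rsqrt_le1].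
Qed.

(** By the heat equation the second-order term in [xi] and the first-order term in time share one
    factor, whence the single coefficient [xi^2 + (t' - t)]. The lower bound [s] on both times gives
    an error uniform in [m]. *)
Lemma heat_step m xi s t t' : 1 <= s -> s <= t -> s <= t' ->
  `|heat (m - xi) t' - heat m t + xi * (rsqrt t * gauss_pdf (m * rsqrt t))
    - (xi ^+ 2 + (t' - t)) * (gauss_q (m * rsqrt t) / (2 * t))| <=
  gauss_bound * rsqrt s ^+ 3 *
    (`|xi| ^+ 3 + `|xi| * `|t' - t| + (t' - t) ^+ 2).
Proof.
move=> s1 st st'; have s0 : 0 < s by exact: lt_le_trans s1.
have t0 : 0 < t by exact: lt_le_trans st.
set w := rsqrt t; set w0 := rsqrt s; set B := gauss_bound.
have wp : 0 < w by exact: rsqrt_gt0.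
have w0p : 0 < w0 by exact: rsqrt_gt0.
have ww : w <= w0 by exact: le_rsqrt.
have B0 : 0 <= B by exact: gauss_bound_ge0.
have w3 : 0 <= w0 ^+ 3 by rewrite exprn_ge0 // ltW.
have w2 : w ^+ 2 = t^-1 by exact: rsqrt_sqr.
(* The step is decomposed into a move in space at time [t] ([eA]), followed by a move in time at the
   new position ([eB]). *)
have eA : `|heat (m - xi) t - heat m t + xi * (w * gauss_pdf (m * w))
    - xi ^+ 2 * (gauss_q (m * w) / (2 * t))| <= B * w0 ^+ 3 * `|xi| ^+ 3.
  have := taylor2_bound is_derive_gauss_cdf is_derive_gauss_pdf is_derive_gauss_q
    (fun z => let: And4 _ _ h _ := gauss_bounds z in h) (m * w) (- (xi * w)).
  have -> : m * w + - (xi * w) = (m - xi) * w by ring.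
  rewrite -/(heat (m - xi) t) -/(heat m t) => h. apply: le_trans (le_trans h _).
    rewrite le_eqVlt; apply/orP; left; apply/eqP; congr `|_|. rewrite invfM -w2; ring.
  rewrite normrN normrM (ger0_norm (ltW wp)) exprMn -/B [leRHS]mulrAC -[leRHS]mulrA.
  apply: ler_wpM2l => //; apply: ler_wpM2l; first by rewrite exprn_ge0.
  by rewrite lerXn2r ?nnegrE // ltW.
have eB : `|heat (m - xi) t' - heat (m - xi) t - (t' - t) * (gauss_q (m * w) / (2 * t))| <=
    B * w0 ^+ 3 * (`|xi| * `|t' - t| + (t' - t) ^+ 2).
  pose phi u := heat (m - xi) u - u * (gauss_q (m * w) / (2 * t)).
  pose dphi u := gauss_q ((m - xi) * rsqrt u) / (2 * u) - gauss_q (m * w) / (2 * t).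
  have e (x1 x2 c : R) : x1 - x2 - (t' - t) * c = (x1 - t' * c) - (x2 - t * c) by ring.
  rewrite e; change (`|phi t' - phi t| <= B * w0 ^+ 3 * (`|xi| * `|t' - t| + (t' - t) ^+ 2)).
  have -> : B * w0 ^+ 3 * (`|xi| * `|t' - t| + (t' - t) ^+ 2) =
    B * w0 ^+ 3 * (`|xi| + `|t' - t|) * `|t' - t|.
    have -> : (t' - t) ^+ 2 = `|t' - t| ^+ 2 by rewrite real_normK ?num_real. by ring.
  have bnd u : Num.min t t' <= u <= Num.max t t' -> s <= u /\ `|u - t| <= `|t' - t|.
    move=> /andP[h1 h2]; split; first by apply: le_trans h1; rewrite le_min st.
    move: h1 h2; have [tt|/ltW tt] := leP t t' => h1 h2.
      by rewrite !ger0_norm ?subr_ge0 // lerD2r.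
    by rewrite !ler0_norm ?subr_le0 // lerN2 lerD2r.
  apply: (@norm_derive_lip phi dphi) => u /bnd[su ut].
    have u0 : 0 < u by exact: lt_le_trans su.
    apply: is_deriveB; first exact: is_derive_heat_time.
    have := is_deriveM (is_derive_id u 1) (is_derive_cst (gauss_q (m * w) / (2 * t)) u 1).
    by rewrite /GRing.scale /= mulr0 add0r mulr1.
  have u0 : 0 < u by exact: lt_le_trans su.
  have us : u^-1 <= w0 ^+ 2 by rewrite rsqrt_sqr // lef_pV2 ?posrE.
  have l1 : `|gauss_q ((m - xi) * rsqrt u) - gauss_q (m * rsqrt u)| <= B * (`|xi| * w0).
    apply: (le_trans (gauss_q_lip _ _)); apply: ler_wpM2l => //.
    rewrite -mulrBl addrAC subrr add0r mulNr normrN normrM ler_wpM2l //.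
    by rewrite ger0_norm ?(ltW (rsqrt_gt0 _)) // le_rsqrt.
  have l2 := @heat_second_lip m s t u s1 st su.
  have e1 (q1 q2 q3 : R) : q1 / (2 * u) - q3 / (2 * t) = ((q1 - q2) / u + (q2 / u - q3 / t)) / 2.
    by field; rewrite !gt_eqF.
  rewrite /dphi (e1 _ (gauss_q (m * rsqrt u)) _).
  rewrite normrM normfV (@ger0_norm _ 2) // ler_pdivrMr // (le_trans (ler_normD _ _)) //.
  have l3 : `|(gauss_q ((m - xi) * rsqrt u) - gauss_q (m * rsqrt u)) / u| <=
      B * (`|xi| * w0) * w0 ^+ 2.
    by rewrite normrM normfV (ger0_norm (ltW u0)) ler_pM // invr_ge0 ltW.
  have l4 : `|gauss_q (m * rsqrt u) / u - gauss_q (m * rsqrt t) / t| <=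
      2 * B * w0 ^+ 3 * `|t' - t|.
    apply: (le_trans l2); rewrite -/B -/w0; apply: ler_wpM2l => //.
    by rewrite -mulrA mulr_ge0 // mulr_ge0.
  have c0 : 0 <= B * w0 ^+ 3 * `|xi| by rewrite mulr_ge0 // mulr_ge0.
  have e3 : B * (`|xi| * w0) * w0 ^+ 2 = B * w0 ^+ 3 * `|xi| by ring.
  rewrite e3 in l3; have := lerD l3 l4; lra.
have := le_trans (ler_normD _ _) (lerD eA eB).
rewrite -mulrDr => h; apply: le_trans (le_trans h _); last by rewrite addrA.
rewrite le_eqVlt; apply/orP; left; apply/eqP; congr `|_|.
move: (heat _ _) (heat _ _) (heat _ _) (_ / (2 * t)) (w * _) => x1 x2 x3 x4 x5.
by ring.
Qed.

Lemma heat_lip m xi s t t' : 1 <= s -> s <= t -> s <= t' ->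
  `|heat (m - xi) t' - heat m t| <= gauss_bound * rsqrt s * (`|xi| + `|t' - t|).
Proof.
move=> s1 st st'; have s0 : 0 < s by exact: lt_le_trans s1.
have t0 : 0 < t by exact: lt_le_trans st.
set w0 := rsqrt s; set B := gauss_bound.
have w0p : 0 < w0 by exact: rsqrt_gt0.
have B0 : 0 <= B by exact: gauss_bound_ge0.
have eA : `|heat (m - xi) t - heat m t| <= B * w0 * `|xi|.
  rewrite (le_trans (gauss_cdf_lip _ _)) // -mulrBl addrAC subrr add0r mulNr normrN normrM.
  rewrite -mulrA [w0 * _]mulrC -/B; apply: ler_wpM2l => //; apply: ler_wpM2l => //.
  by rewrite ger0_norm ?(ltW (rsqrt_gt0 _)) // le_rsqrt.
have eB : `|heat (m - xi) t' - heat (m - xi) t| <= B * w0 * `|t' - t|.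
  apply: (@norm_derive_lip _ (fun u => gauss_q ((m - xi) * rsqrt u) / (2 * u))) => u /andP[h1 _].
    apply: is_derive_heat_time; apply: lt_le_trans h1; rewrite lt_min t0.
    exact: lt_le_trans st'.
  have su : s <= u by apply: le_trans h1; rewrite le_min st.
  have u0 : 0 < u by exact: lt_le_trans su.
  have [_ b _ _] := gauss_bounds ((m - xi) * rsqrt u). rewrite normrM; apply: ler_pM => //.
  have us : u^-1 <= w0.
    apply: (@le_trans _ _ (w0 ^+ 2)); first by rewrite rsqrt_sqr // lef_pV2 ?posrE.
    by rewrite -[leRHS]expr1 ler_wiXn2l ?(ltW w0p) // rsqrt_le1.
  rewrite normfV ger0_norm ?mulr_ge0 ?(ltW u0) //; apply: le_trans us.
  by rewrite lef_pV2 ?posrE ?mulr_gt0 // ler_peMl ?(ltW u0) // ler1n.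
have e (x y z : R) : x - y = (z - y) + (x - z) by ring.
by rewrite (e _ _ (heat (m - xi) t)) (le_trans (ler_normD _ _)) // mulrDr lerD.
Qed.

End Gauss.

(** * Convergence in distribution by Gaussian smoothing *)

Section GaussTails.
Variable R : realType.
Implicit Types (x z e : R).

Lemma gauss_cdf_right e : 0 < e -> exists2 z : R, 0 < z & 1 - e <= gauss_cdf z.
Proof.
move=> e0.
have F : (normal_prob 0 1 `]-oo, (n%:R : R)]%classic) @[n --> \oo] -->
    normal_prob (0:R) 1 (\bigcup_n `]-oo, (n%:R : R)]%classic).
  apply: nondecreasing_cvg_mu => [n||m n mn]; first exact: measurable_itv.
    by apply: bigcup_measurable => n _; exact: measurable_itv.
  by apply/subsetPset => y; rewrite /= !in_itv /= => h; rewrite (le_trans h) // ler_nat.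
have U : \bigcup_n `]-oo, (n%:R : R)]%classic = setT.
  apply/seteqP; split => // y _; exists (Num.truncn y).+1 => //=.
  by rewrite in_itv /= ltW // truncnS_gt.
have {F} F : gauss_cdf (n%:R : R) @[n --> \oo] --> (1 : R).
  have := fine_cvg (_ : _ --> (1 : R)%:E); apply. by move: F; rewrite U probability_setT.
have /cvgrPdist_le /(_ e e0) [n _ hn] := F.
exists n.+1%:R => //; have := hn n.+1 (leqnSn n); rewrite /= ler_norml => /andP[_ h].
by lra.
Qed.

Lemma gauss_cdf_left e : 0 < e -> exists2 z : R, 0 < z & gauss_cdf (- z) <= e.
Proof.
move=> e0.
have F : (normal_prob 0 1 `]-oo, (- n%:R : R)]%classic) @[n --> \oo] -->
    normal_prob (0:R) 1 (\bigcap_n `]-oo, (- n%:R : R)]%classic).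
  apply: nonincreasing_cvg_mu => [|n||m n mn].
  - by rewrite (le_lt_trans (probability_le1 _ _)) ?ltry //; exact: measurable_itv.
  - exact: measurable_itv.
  - by apply: bigcap_measurable => // n _; exact: measurable_itv.
  by apply/subsetPset => y; rewrite /= !in_itv /= => h; rewrite (le_trans h) // lerN2 ler_nat.
have U : \bigcap_n `]-oo, (- n%:R : R)]%classic = set0.
  apply/seteqP; split => // y /(_ (Num.truncn (- y)).+1 I) /=.
  by rewrite in_itv /= lerNr leNgt truncnS_gt.
have {F} F : gauss_cdf (- n%:R : R) @[n --> \oo] --> (0 : R).
  have := fine_cvg (_ : _ --> (0 : R)%:E); apply. by move: F; rewrite U measure0.
have /cvgrPdist_le /(_ e e0) [n _ hn] := F.
exists n.+1%:R => //; have := hn n.+1 (leqnSn n); rewrite /= sub0r normrN ler_norml => /andP[_ h].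
exact: h.
Qed.

End GaussTails.

Section Smoothing.
Context d (Omega : measurableType d) (R : realType) (P : probability Omega R).
Implicit Types (x z e eta : R).

Lemma measurable_gauss_cdf : measurable_fun setT (@gauss_cdf R).
Proof.
apply: continuous_measurable_fun => x.
by apply/differentiable_continuous/derivable1_diffP; case: (is_derive_gauss_cdf x).
Qed.

Lemma bmfun_gauss (W : Omega -> R) x e : measurable_fun setT W ->
  bmfun (fun w => gauss_cdf ((x - W w) / e)).
Proof.
move=> mW; split.
  apply: measurableT_comp; first exact: measurable_gauss_cdf.
  by apply: measurable_funM => //; exact: measurable_funB.
exists 1 => w; have /andP[a b] := gauss_cdf_itv ((x - W w) / e); by rewrite ger0_norm.
Qed.

(** When [W <= x] the argument of [gauss_cdf] is at least [eta / e], hence at least [z]. *)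
Lemma prb_gauss_upper (W : Omega -> R) x eta e z : measurable_fun setT W -> 0 < e -> 0 <= z ->
  z * e <= eta ->
  prb P [set w | W w <= x] <= mean P (fun w => gauss_cdf ((x + eta - W w) / e)) + (1 - gauss_cdf z).
Proof.
move=> mW e0 z0 ze.
have mA : measurable [set w | W w <= x] by exact: measurable_le_set.
have bg := bmfun_gauss (x + eta) e mW.
rewrite -(mean_indic P mA) -(mean_cst P (1 - gauss_cdf z)) -meanD //; last exact: bmfun_cst.
apply: le_mean => [||w].
- exact: bmfun_indic.
- by apply: bmfunD => //; exact: bmfun_cst.
have /andP[g0 _] := gauss_cdf_itv ((x + eta - W w) / e).
have /andP[_ g1] := gauss_cdf_itv z.
rewrite indicE; case: (boolP (_ \in _)) => [|_]; last by rewrite addr_ge0 // subr_ge0.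
rewrite inE /= => Wx.
have h : gauss_cdf z <= gauss_cdf ((x + eta - W w) / e).
  by apply: le_gauss_cdf; rewrite ler_pdivlMr //; lra.
by move: h; move: (gauss_cdf _) (gauss_cdf _) => u v h; lra.
Qed.

Lemma prb_gauss_lower (W : Omega -> R) x eta e z : measurable_fun setT W -> 0 < e ->
  z * e <= eta ->
  mean P (fun w => gauss_cdf ((x - eta - W w) / e)) - gauss_cdf (- z) <= prb P [set w | W w <= x].
Proof.
move=> mW e0 ze.
have mA : measurable [set w | W w <= x] by exact: measurable_le_set.
have bg := bmfun_gauss (x - eta) e mW.
rewrite lerBlDr -(mean_indic P mA) -(mean_cst P (gauss_cdf (- z))) -meanD; last 2 first.
- exact: bmfun_indic.
- exact: bmfun_cst.
apply: le_mean => [||w] //.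
  by apply: bmfunD; [exact: bmfun_indic|exact: bmfun_cst].
have /andP[_ g1] := gauss_cdf_itv ((x - eta - W w) / e).
have /andP[g0 _] := gauss_cdf_itv (- z).
rewrite indicE; case: (boolP (_ \in _)) => [_|].
  by rewrite (le_trans g1) // lerDl.
rewrite notin_setE /= => /negP; rewrite -ltNge => Wx; rewrite add0r.
apply: le_gauss_cdf; rewrite ler_pdivrMr //; lra.
Qed.

(* Replacing the indicator function by a Gaussian one of width [e] changes the
   argument by at most [eta], up to a tail of order [eta / e]. *)
Lemma cvg_prb_gauss (T : Type) (F : set_system T) (FF : ProperFilter F) (W : T -> Omega -> R) x :
  (\forall i \near F, measurable_fun setT (W i)) ->
  (forall e y, 0 < e -> mean P (fun w => gauss_cdf ((y - W i w) / e)) @[i --> F] -->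
     heat y (1 + e ^+ 2)) ->
  prb P [set w | W i w <= x] @[i --> F] --> gauss_cdf x.
Proof.
move=> mW hW; apply/cvgrPdist_le => del del0.
have del4 : 0 < del / 4 by rewrite divr_gt0.
have B0 : 0 <= gauss_bound R by exact: gauss_bound_ge0.
have [z1 z10 hz1] := gauss_cdf_right del4.
have [z2 z20 hz2] := gauss_cdf_left del4.
pose B := gauss_bound R + 1.
have B1 : 0 < B by rewrite ltr_wpDl.
pose eta := del / (4 * B).
have eta0 : 0 < eta by rewrite divr_gt0 // mulr_gt0.
pose z := z1 + z2.
have z0 : 0 < z by rewrite addr_gt0.
pose X := `|x| + eta.
have X0 : 0 < X by rewrite ltr_wpDl.
(* Small against [eta / z], so that a shift by [eta] costs only a Gaussian tail beyond [z]; small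
   against [eta / X], so that replacing the time [1 + e^2] by 1 changes [heat] little on
   [[- X, X]]. *)
pose e := Num.min (eta / z) (Num.min 1 (eta / X)).
have e0 : 0 < e by rewrite /e !lt_min (divr_gt0 eta0 z0) (divr_gt0 eta0 X0) ltr01.
have ez : z * e <= eta.
  by rewrite mulrC -ler_pdivlMr // ge_min lexx.
have e1 : e <= 1 by rewrite !ge_min lexx orbT.
have eX : e * X <= eta by rewrite -ler_pdivlMr // !ge_min lexx !orbT.
pose y := rsqrt (1 + e ^+ 2).
have y1 : 1 - e <= y <= 1.
  apply/andP; split; last first.
    by apply: rsqrt_le1; rewrite lerDl sqr_ge0.
  have p : 0 < 1 + e ^+ 2 by rewrite ltr_pwDl // sqr_ge0.
  have h := rsqrt_sqr p; have yp : 0 < y by exact: rsqrt_gt0. have h2 : 1 - e ^+ 2 <= y ^+ 2.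
    rewrite h -(ler_pM2r p) mulVf ?gt_eqF // -subr_sqr expr1n -exprM.
    by rewrite gerBl exprn_even_ge0.
  rewrite leNgt; apply/negP => hy. have : y ^+ 2 < (1 - e) ^+ 2.
    by rewrite ltrXn2r ?nnegrE ?(ltW yp) // ltW // (lt_trans yp).
  rewrite ltNge => /negP; apply; apply: le_trans h2. by rewrite expr2; nra.
have near_heat v : `|v| <= X -> `|heat v (1 + e ^+ 2) - gauss_cdf v| <= del / 4.
  move=> vX; rewrite (le_trans (gauss_cdf_lip _ _)) //.
  have -> : v * rsqrt (1 + e ^+ 2) - v = - (v * (1 - y)) by rewrite -/y; ring.
  rewrite normrN normrM [X in _ * (_ * X)]ger0_norm ?subr_ge0; last by case/andP: y1.
  have h : `|v| * (1 - y) <= eta.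
    apply: le_trans eX; rewrite mulrC ler_pM ?subr_ge0 //; last by case/andP: y1 => h _; lra.
    by case/andP: y1.
  apply: (@le_trans _ _ (B * eta)); first by rewrite ler_pM // ?lerDl // mulr_ge0 // subr_ge0; case/andP: y1.
  by rewrite /eta; apply: le_of_eq; field; rewrite gt_eqF.
have near_x v : `|v - x| <= eta -> `|gauss_cdf v - gauss_cdf x| <= del / 4.
  move=> vx; rewrite (le_trans (gauss_cdf_lip _ _)) //.
  apply: (@le_trans _ _ (B * eta)); first by rewrite ler_pM // lerDl.
  by rewrite /eta; apply: le_of_eq; field; rewrite gt_eqF.
have a1 : `|x + eta| <= X by rewrite (le_trans (ler_normD _ _)) // lerD2l ger0_norm // ltW.
have a2 : `|x - eta| <= X by rewrite (le_trans (ler_normB _ _)) // lerD2l ger0_norm // ltW.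
have b1 := near_heat _ a1; have b2 := near_heat _ a2.
have c1 : `|gauss_cdf (x + eta) - gauss_cdf x| <= del / 4.
  by apply: near_x; rewrite addrAC subrr add0r ger0_norm // ltW.
have c2 : `|gauss_cdf (x - eta) - gauss_cdf x| <= del / 4.
  by apply: near_x; rewrite addrAC subrr add0r normrN ger0_norm // ltW.
have /cvgrPdist_le /(_ _ del4) n1 := hW e (x + eta) e0.
have /cvgrPdist_le /(_ _ del4) n2 := hW e (x - eta) e0.
have z1z : gauss_cdf z1 <= gauss_cdf z by apply: le_gauss_cdf; rewrite lerDl ltW.
have z2z : gauss_cdf (- z) <= gauss_cdf (- z2) by apply: le_gauss_cdf; rewrite lerN2 lerDr ltW.
near=> i.
have mWi : measurable_fun setT (W i) by near: i.
have u := prb_gauss_upper x mWi e0 (ltW z0) ez.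
have l := prb_gauss_lower x mWi e0 ez.
have m1 : `|heat (x + eta) (1 + e ^+ 2) - mean P (fun w => gauss_cdf ((x + eta - W i w) / e))| <= del / 4.
  by near: i.
have m2 : `|heat (x - eta) (1 + e ^+ 2) - mean P (fun w => gauss_cdf ((x - eta - W i w) / e))| <= del / 4.
  by near: i.
move: u l m1 m2 b1 b2 c1 c2 hz1 hz2 z1z z2z.
move: (prb _ _) (mean _ _) (mean _ _) (heat _ _) (heat _ _) => p u1 u2 h1 h2.
move: (gauss_cdf x) (gauss_cdf (x + eta)) (gauss_cdf (x - eta)) (gauss_cdf z) (gauss_cdf (- z)).
move=> g g1 g2 gz gz' u l; rewrite !ler_norml => /andP[m1 m1'] /andP[m2 m2'].
move=> /andP[b1 b1'] /andP[b2 b2'] /andP[c1 c1'] /andP[c2 c2'] hz1 hz2 zz1 zz2.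
clear - u l m1 m1' m2 m2' b1 b1' b2 b2' c1 c1' c2 c2' hz1 hz2 zz1 zz2.
by apply/andP; split; lra.
Unshelve. all: by end_near. Qed.

End Smoothing.

(** * The heat equation along the chain *)

Section ChainCLT.
Variable R : realType.
Variables (nu : {measure set R -> \bar R}) (dl0 : R).
Hypotheses (dl0_gt0 : 0 < dl0) (nu_exp : exp_integrable nu dl0) (Phi1 : 0 < laplace_exp nu 1).
Variable r : nat.
Variable pi : nat -> nat -> R.
Hypotheses (pi_ge0 : forall n k, 0 <= pi n k) (pi_sum : forall n, part_mean pi (fun=> 1) n = 1).
Hypothesis pi_rec : forall h n, (0 < n)%N -> \sum_(i < n) rate nu n i *
  (part_mean pi h n - part_mean pi (fun k => h ((n - i == r) + k)%N) i) = 0.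
Let a := part_expect pi.
Let V := part_variance pi.
Let xi n i : R := (n - i == r)%N%:R + a i - a n.
Variable CM : R.
Hypothesis moments : forall n, \sum_(i < n) rate nu n i *
  (`|xi n i| ^+ 3 + `|xi n i| * `|V i - V n| + (V i - V n) ^+ 2) <= CM.
Implicit Types (n i k : nat) (m s : R).

Lemma part_variance_ge0 n : 0 <= V n.
Proof. by apply: sumr_ge0 => k _; rewrite mulr_ge0 // sqr_ge0. Qed.

(** From [(1 - e^-z)^n <= 1 - e^-z]; the bound is the value at [n = 1]. It allows a bounded error
    per jump to be absorbed by [hsum]. *)
Lemma levy_op_harmonic_ge n : (0 < n)%N ->
  laplace_exp nu 1 <= levy_op nu (@hsum R) n.
Proof.
case: n => // n _.
have d1 := levy_dom_potential dl0_gt0 (delta R 0) n.+1.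
have d2 := levy_dom_id dl0_gt0.
rewrite (levy_op_harmonic dl0_gt0 nu_exp) /levy_pot -(levy_intB nu_exp) //.
apply: (le_levy_int nu_exp).
- exact: levy_dom_expN.
- exact: levy_domB.
move=> y y0; rewrite mul1r.
have := @le_derive_increment _ (fun z => potential z (delta R 0) n.+1)
  (fun z => thinning z (delta R 0) n.+1) (fun z => z + expR (- (1 * z)))
  (fun z => 1 - expR (- (1 * z))) 0 y (ltW y0).
rewrite potential0 subr0 mulr0 oppr0 expR0 add0r => h.
suff : potential y (delta R 0) n.+1 <= y + expR (- (1 * y)) - 1 by rewrite mul1r; lra.
apply: h => z /andP[z0 _].
- exact: is_derive_potential.
- have := is_deriveD (is_derive_id z 1) (is_derive_expRN 1 z).
  by rewrite mulN1r.
rewrite thinning_delta // expr0 bin0 !mul1r subn0 exprS ler_piMr ?subr_ge0 ?expR_le1 ?oppr_le0 //.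
by rewrite exprn_ile1 ?subr_ge0 ?expR_le1 ?oppr_le0 // gerBl expR_ge0.
Qed.

Lemma laplace_exp_gt0 n : (0 < n)%N -> 0 < laplace_exp nu n%:R.
Proof.
move=> n0; apply: lt_le_trans Phi1 _; apply: (le_levy_int nu_exp).
- exact: levy_dom_expN.
- exact: levy_dom_expN.
by move=> y y0; rewrite lerD2l lerN2 ler_expR lerN2 ler_pM2r // ler1n.
Qed.

(* The drift and the heat equation cancel the first two orders of the expansion of
   [heat] along a transition of the chain, so the errors accumulate only like the
   potential of a constant, that is [hsum]. *)
Theorem chain_heat : exists2 C : R, 0 <= C & forall s n m, 1 <= s ->
  `|part_mean pi (fun k => heat (m - (k%:R - a n)) s) n - heat m (s + V n)| <=
  C * rsqrt s ^+ 3 * hsum R n.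
Proof.
pose CM' := `|CM|.
have B0 : 0 <= gauss_bound R by exact: gauss_bound_ge0.
pose C := gauss_bound R * CM' / laplace_exp nu 1.
have C0 : 0 <= C by apply: divr_ge0 (ltW Phi1); exact: mulr_ge0 B0 (normr_ge0 _).
exists C => // s n m s1; set w3 := rsqrt s ^+ 3.
have w30 : 0 <= w3 by rewrite exprn_ge0 // ltW // rsqrt_gt0.
elim/ltn_ind: n m => -[_|n IH] m.
  have pi0 : pi 0%N 0%N = 1.
    by have := pi_sum 0; rewrite /part_mean big_ord1 mulr1.
  have a0 : a 0%N = 0 by rewrite /a /part_expect /part_mean big_ord1 mulr0.
  have V0 : V 0%N = 0.
    by rewrite /V /part_variance /part_mean big_ord1 -/a -/(a 0%N) a0 subrr expr0n mulr0.
  rewrite /part_mean big_ord1 pi0 a0 V0 /= subrr subr0 mul1r addr0 subrr normr0.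
  by rewrite /hsum big_ord0 mulr0.
have Phi0 := laplace_exp_gt0 (ltn0Sn n).
set N := n.+1 in IH Phi0 *.
pose F i x := part_mean pi (fun k => heat (x - (k%:R - a i)) s) i.
have rec := pi_rec (fun k => heat (m - (k%:R - a N)) s) (ltn0Sn n).
have shift (i : nat) : part_mean pi (fun k => heat (m - (((N - i == r) + k)%N%:R - a N)) s) i = F i (m - xi N i).
  apply: eq_part_mean => k.
  have e : m - (((N - i == r) + k)%N%:R - a N) = m - xi N i - (k%:R - a i).
    by rewrite natrD /xi; move: (a N) (a i) (k%:R) (_%:R) => x1 x2 x3 x4; ring.
  by rewrite e.
pose t := s + V N.
have st : s <= t by rewrite lerDl part_variance_ge0.
have st' i : s <= s + V i by rewrite lerDl part_variance_ge0.
pose g1 := rsqrt t * gauss_pdf (m * rsqrt t).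
pose g2 := gauss_q (m * rsqrt t) / (2 * t).
pose err i := heat (m - xi N i) (s + V i) - heat m t + xi N i * g1
  - (xi N i ^+ 2 + (V i - V N)) * g2.
have errb i : `|err i| <= gauss_bound R * w3 *
    (`|xi N i| ^+ 3 + `|xi N i| * `|V i - V N| + (V i - V N) ^+ 2).
  have := heat_step m (xi N i) s1 st (st' i).
  have -> : s + V i - t = V i - V N by rewrite /t; ring. exact.
(* Centring of [xi] kills the term in [g1], and the equation of the variance kills the term in [g2];
   only the errors of the heat step remain. *)
have s1' : \sum_(i < N) rate nu N i * xi N i = 0 := sum_rate_xi pi_sum pi_rec N.
have s2' : \sum_(i < N) rate nu N i * (xi N i ^+ 2 + (V i - V N)) = 0.
  have e : \sum_(i < N) rate nu N i * (V N - V i) = \sum_(i < N) rate nu N i * xi N i ^+ 2.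
    exact: sum_rate_variance pi_sum pi_rec N.
  under eq_bigr do rewrite -[V _ - V N]opprB mulrDr mulrN.
  by rewrite big_split /= sumrN e subrr.
have main : laplace_exp nu N%:R * (F N m - heat m t) =
    \sum_(i < N) rate nu N i * ((F i (m - xi N i) - heat (m - xi N i) (s + V i)) + err i).
  rewrite -(sum_rate dl0_gt0 nu_exp) mulr_suml.
  have -> : \sum_(i < N) rate nu N i * (F N m - heat m t) =
      \sum_(i < N) (rate nu N i * (F N m - heat m t) + (rate nu N i * xi N i) * g1
        - (rate nu N i * (xi N i ^+ 2 + (V i - V N))) * g2) -
      \sum_(i < N) rate nu N i * (part_mean pi (fun k => heat (m - (k%:R - a N)) s) N -
        part_mean pi (fun k => heat (m - (((N - i == r) + k)%N%:R - a N)) s) i).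
    rewrite rec subr0 big_split big_split /= sumrN -!mulr_suml s1' s2'.
    by rewrite !mul0r subr0 addr0.
  rewrite -sumrB; apply: eq_bigr => i _; rewrite shift -/(F N m) /err.
  move: (F _ _) (F _ _) (heat _ _) (heat _ _) => x1 x2 x3 x4; ring.
rewrite -/(F N m) -/t -(ler_pM2l Phi0).
have -> : laplace_exp nu N%:R * `|F N m - heat m t| =
    `|laplace_exp nu N%:R * (F N m - heat m t)|.
  by rewrite normrM (ger0_norm (ltW Phi0)).
rewrite main; apply: (le_trans (ler_norm_sum _ _ _)).
apply: (@le_trans _ _ (\sum_(i < N) (C * w3 * (rate nu N i * hsum R i) +
    gauss_bound R * w3 * (rate nu N i *
    (`|xi N i| ^+ 3 + `|xi N i| * `|V i - V N| + (V i - V N) ^+ 2))))).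
  apply: ler_sum => i _; have r0 := rate_ge0 dl0_gt0 nu_exp (ltn_ord i).
  rewrite normrM (ger0_norm r0) [X in _ <= X + _]mulrCA [X in _ <= _ + X]mulrCA -mulrDr.
  apply: ler_wpM2l => //; apply: (le_trans (ler_normD _ _)); apply: lerD; last exact: errb.
  exact: IH.
rewrite big_split /= -!mulr_sumr.
(* The sum of [H] after the jump falls short of [Phi(n) H n] by [Phi(A) H], at least [Phi(1)]; this
   deficit pays for the error of the jump. *)
have hh : \sum_(i < N) rate nu N i * hsum R i =
    laplace_exp nu N%:R * hsum R N - levy_op nu (@hsum R) N.
  rewrite (levy_op_rate dl0_gt0 nu_exp) -(sum_rate dl0_gt0 nu_exp) mulr_suml -sumrB.
  by apply: eq_bigr => i _; ring.
have hl := levy_op_harmonic_ge (ltn0Sn n).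
have hm : gauss_bound R * w3 * \sum_(i < N) rate nu N i *
    (`|xi N i| ^+ 3 + `|xi N i| * `|V i - V N| + (V i - V N) ^+ 2) <= gauss_bound R * w3 * CM'.
  apply: (ler_wpM2l (mulr_ge0 B0 w30)); apply: le_trans (moments N) _; exact: ler_norm.
have hc : gauss_bound R * w3 * CM' = C * w3 * laplace_exp nu 1.
  by rewrite /C; move: (laplace_exp nu 1) Phi1 => p p0; field; rewrite gt_eqF.
rewrite hh; rewrite hc in hm.
have h5 : C * w3 * laplace_exp nu 1 <= C * w3 * levy_op nu (@hsum R) N.
  exact: (ler_wpM2l (mulr_ge0 C0 w30)).
have aux (x p h g c D : R) : g <= x * c -> x * c <= x * D -> x * (p * h - D) + g <= p * (x * h).
  by move=> h1 h2; rewrite mulrBr [p * (x * h)]mulrCA; lra.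
exact: aux hm h5.
Qed.

End ChainCLT.

(** * Mixing over a Poisson number of atoms *)

Lemma log_shift_le (R : realType) (h l D r : R) : h <= 1 + l -> l - r <= 4 * D + 1 ->
  h <= 4 * D + (2 + r).
Proof. by lra. Qed.

Lemma heat_error_le (R : realType) (al be c1 c2 c ch B u3 u1 l : R) : 0 <= al -> 0 <= be ->
  0 <= c1 -> 0 <= c2 -> 0 <= c -> 0 <= ch -> 0 <= B -> 0 <= u3 -> 0 <= u1 -> 0 <= l ->
  3 * (ch * u3 * 4 + B * u1 * (4 * al + 4 * be)) +
  (ch * u3 * (2 + l) + B * u1 * (al + c + c1 + (be + c + c2))) <=
  (ch + B) * (30 + 13 * al + 13 * be + 2 * c + c1 + c2) * (u3 * (l + 1) + u1).
Proof.
move=> al0 be0 c10 c20 c0 ch0 B0 u30 u10 l0.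
have p1 : 0 <= B * u3 * (l + 1) by rewrite !mulr_ge0 // addr_ge0.
have p2 : 0 <= ch * u1 by rewrite mulr_ge0.
have p3 : 0 <= ch * u3 by rewrite mulr_ge0.
have p4 : 0 <= B * u1 by rewrite mulr_ge0.
have p5 : 0 <= ch * u3 * l by rewrite mulr_ge0.
have p6 : ch * u3 * 14 + ch * u3 * l <= 30 * (ch * u3 * (l + 1)) by lra.
pose T := 13 * al + 13 * be + 2 * c + c1 + c2.
have T0 : 0 <= T by rewrite /T; lra.
have q1 : 0 <= ch * u3 * (l + 1) by rewrite mulr_ge0 // addr_ge0.
have q2 := mulr_ge0 T0 q1; have q3 := mulr_ge0 T0 p4; have q4 := mulr_ge0 T0 p1.
have q5 := mulr_ge0 T0 p2.
have -> : 3 * (ch * u3 * 4 + B * u1 * (4 * al + 4 * be)) +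
  (ch * u3 * (2 + l) + B * u1 * (al + c + c1 + (be + c + c2))) =
  ch * u3 * 14 + ch * u3 * l + T * (B * u1) by rewrite /T; ring.
have -> : (ch + B) * (30 + 13 * al + 13 * be + 2 * c + c1 + c2) * (u3 * (l + 1) + u1) =
  30 * (ch * u3 * (l + 1)) + 30 * (ch * u1) + 30 * (B * u3 * (l + 1)) + 30 * (B * u1) +
  T * (ch * u3 * (l + 1)) + T * (ch * u1) + T * (B * u3 * (l + 1)) + T * (B * u1) by rewrite /T; ring.
lra.
Qed.

Lemma sqr_split_le (R : realType) (t x z p D : R) : t <= (x + z) ^+ 2 -> x ^+ 2 <= p * (4 * D) ->
  t <= 8 * p * D + 2 * z ^+ 2.
Proof.
have -> : (x + z) ^+ 2 = 2 * x ^+ 2 + 2 * z ^+ 2 - (x - z) ^+ 2 by ring.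
have := sqr_ge0 (x - z); move: ((x - z) ^+ 2) (x ^+ 2) (z ^+ 2) => a b c.
have -> : p * (4 * D) = 4 * (p * D) by ring.
have -> : 8 * p * D = 8 * (p * D) by ring.
lra.
Qed.

Lemma variance_mean (d : measure_display) (Omega : measurableType d) (R : realType)
    (P : probability Omega R) (X : Omega -> R) :
  fine 'V_P[X] = mean P (fun w => (X w - mean P X) ^+ 2).
Proof.
rewrite /variance unlock /covariance /mean !unlock; congr fine.
Qed.

Section PoissonMixture.
Context d (Omega : measurableType d) (R : realType) (P : probability Omega R).
Variables (M K : Omega -> nat) (rho : R) (pi : nat -> nat -> R).
Hypotheses (rho_ge1 : 1 <= rho) (mM : forall n, measurable [set w | M w = n]).
Hypotheses (mK : forall k, measurable [set w | K w = k]) (KM : forall w, (K w <= M w)%N).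
Hypothesis lawM : forall n, prb P [set w | M w = n] = poisson_w rho n.
Hypothesis lawK : forall n k, prb P [set w | M w = n /\ K w = k] = poisson_w rho n * pi n k.
Implicit Types (n k : nat) (g h phi : nat -> R).

Let rho_gt0 : 0 < rho. exact: lt_le_trans rho_ge1. Qed.

Let mnat (X : Omega -> nat) g : (forall n, measurable [set w | X w = n]) ->
  measurable_fun setT (fun w => g (X w)).
move=> mX; apply: (@measurable_comp _ _ _ _ _ _ setT g setT X) => //.
move=> _ Y mY; rewrite setTI.
have -> : X @^-1` Y = \bigcup_(n in Y) [set w | X w = n].
  by apply/seteqP; split => [w Yw|w [n Yn /= e]]; [exists (X w)|rewrite /preimage /= e].
by apply: bigcup_measurable => n _; exact: mX.
Qed.

Let mgM g : measurable_fun setT (fun w => g (M w)). exact: mnat. Qed.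
Let mgK g : measurable_fun setT (fun w => g (K w)). exact: mnat. Qed.

Let U : \bigcup_n [set w | M w = n] = setT.
by apply/seteqP; split => // w _; exists (M w). Qed.

Let tM : trivIset setT (fun n => [set w | M w = n]).
by move=> i j _ _ [w [/= <- <-]]. Qed.

Lemma integral_mixture phi : (forall k, 0 <= phi k) ->
  (\int[P]_w (phi (K w))%:E = \int[P]_w (part_mean pi phi (M w))%:E)%E.
Proof.
move=> phi0.
have pm0 w : 0 <= part_mean pi phi (M w).
  apply: sumr_ge0 => k _; apply: mulr_ge0 => //. have [z|nz] := eqVneq (poisson_w rho (M w)) 0.
    by move: z => /eqP; rewrite /poisson_w; rewrite gt_eqF // mulr_gt0 ?expR_gt0 // divr_gt0 ?exprn_gt0 // ltr0n fact_gt0.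
  have p0 : 0 < poisson_w rho (M w) by rewrite lt0r nz -lawM prb_ge0.
  by rewrite -(pmulr_rge0 _ p0) -lawK prb_ge0.
rewrite -U !ge0_integral_bigcup //; last 4 first.
- by apply/measurable_EFinP; rewrite U; exact: (mgM (part_mean pi phi)).
- by move=> w _; rewrite lee_fin.
- by apply/measurable_EFinP; rewrite U; exact: mgK.
- by move=> w _; rewrite lee_fin.
congr (limn _); apply/funext => m; apply: eq_bigr => n _.
have mA := mM n; set A := [set w | M w = n] in mA *.
have mB k : measurable [set w | M w = n /\ K w = k] by exact: (measurableI _ _ (mM n) (mK k)).
have bB k : bmfun (fun w => phi k * \1_[set w | M w = n /\ K w = k] w).
  by apply: bmfunZ; exact: bmfun_indic.
transitivity (\int[P]_w (\sum_(k < n.+1) phi k * \1_[set w | M w = n /\ K w = k] w)%:E)%E.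
  rewrite integral_mkcond; apply: eq_integral => w _; rewrite patchE.
  case: ifPn => [|/negP]; rewrite inE /A /= => Mw; congr EFin.
    have Kn : (K w < n.+1)%N by rewrite ltnS -Mw. rewrite (bigD1 (Ordinal Kn)) //= big1 ?addr0.
      by rewrite indicE mem_set //= mulr1.
    move=> i /eqP ik; rewrite indicE memNset ?mulr0 //= => -[_ e]. by apply: ik; apply/val_inj.
  by rewrite big1 // => i _; rewrite indicE memNset ?mulr0 //= => -[e _].
rewrite -mean_EFin; last exact: bmfun_sum.
rewrite [RHS](eq_integral (cst (part_mean pi phi n)%:E)); last first.
  by move=> w; rewrite inE /A /= => ->.
rewrite mean_sum // integral_cst //.
have e : P A = (poisson_w rho n)%:E by rewrite -lawM (prbE P mA).
rewrite [X in _ = (_ * X)%E]e -EFinM; congr EFin.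
rewrite /part_mean mulr_suml; apply: eq_bigr => k _.
by rewrite meanZ ?mean_indic ?lawK //; [ring|exact: bmfun_indic].
Qed.

(** A class integrable under the Poisson law and closed under linear combinations; all estimates in
    terms of [D] below stay in it. *)
Definition lin_growth g := exists C, forall n, `|g n| <= C * n.+1%:R.

Let wM n : poisson_w rho n.+1 * n.+1%:R = rho * poisson_w rho n.
rewrite /poisson_w factS natrM exprS invfM; field.
by rewrite nat1r !pnatr_eq0 /= -lt0n fact_gt0.
Qed.

Let w0 n : 0 <= poisson_w rho n. by rewrite -lawM prb_ge0. Qed.

Let sumw m : \sum_(n < m) poisson_w rho n <= 1.
have mB : measurable [set w | (M w < m)%N].
  have -> : [set w | (M w < m)%N] = [set w | exists2 j, (j < m)%N & M w = j].
    by apply/seteqP; split => [w /= h|w /= [j jm e]]; [exists (M w)|rewrite e].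
  by apply: measurable_exists => j _; exact: mM.
apply: le_trans (prb_le1 P mB).
under eq_bigr do rewrite -lawM -(mean_indic P (mM _)).
rewrite -mean_sum; last by move=> i _; exact: bmfun_indic.
rewrite -(mean_indic P mB); apply: le_mean => [||w].
- by apply: bmfun_sum => i _; exact: bmfun_indic.
- exact: bmfun_indic.
rewrite indicE; case: (boolP (_ \in _)); rewrite ?inE ?notin_setE /= => h.
  rewrite (bigD1 (Ordinal h)) //= indicE mem_set //= big1 ?addr0 // => i /eqP ik.
  rewrite indicE memNset //= => e; by apply: ik; apply/val_inj.
rewrite big1 // => i _; rewrite indicE memNset //= => e; apply: h.
by rewrite e.
Qed.

Lemma integral_poisson_le g C : (forall n, 0 <= g n) ->
  (forall m, \sum_(n < m) poisson_w rho n * g n <= C) ->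
  (\int[P]_w (g (M w))%:E <= C%:E)%E.
Proof.
move=> g0 hC; rewrite -U ge0_integral_bigcup //; last 2 first.
- by apply/measurable_EFinP; rewrite U; exact: mgM.
- by move=> w _; rewrite lee_fin.
apply: lime_le; first by apply: is_cvg_nneseries => n _ _; apply: integral_ge0 => w _; rewrite lee_fin.
apply: nearW => m; rewrite big_mkord.
rewrite (_ : \big[_/_]_(i < m) _ = (\sum_(n < m) poisson_w rho n * g n)%:E).
  by rewrite lee_fin.
rewrite -sumEFin; apply: eq_bigr => n _.
rewrite -lawM mulrC EFinM (prbE P (mM n)) -integral_cst //.
by apply: eq_integral => w; rewrite inE /= => ->.
Qed.

(** A two-sided measure of the deviation of [n + 1] from [rho]. Its mean is at most 3 and, up to a
    factor 4, it dominates the square of [ln ((n + 1) / rho)]: this is how the concentration of the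
    number of atoms enters. *)
Let D n : R := n.+1%:R / rho + rho / n.+1%:R.

Let D_ge0 n : 0 <= D n. by rewrite addr_ge0 // divr_ge0 // ltW. Qed.

(** The factors [n / rho] and [rho / (n + 1)] shift the Poisson weights by one index, so each
    contributes at most 1; the third unit is [1 / rho <= 1]. *)
Let Dle : (\int[P]_w (D (M w))%:E <= 3%:E)%E.
apply: integral_poisson_le => [n|m]; first exact: D_ge0.
have h1 : \sum_(n < m) poisson_w rho n * (n%:R / rho) <= 1.
  case: m => [|m]; first by rewrite big_ord0.
  rewrite big_ord_recl mul0r mulr0 add0r; apply: le_trans (sumw m).
  apply: ler_sum => i _; rewrite lift0 mulrA wM mulrAC divff ?mul1r //. by rewrite gt_eqF.
have h2 : \sum_(n < m) poisson_w rho n * (rho / n.+1%:R) <= 1.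
  apply: le_trans (sumw m.+1); rewrite big_ord_recl; rewrite -[leLHS]add0r; apply: lerD => //.
  apply: ler_sum => i _; rewrite lift0 mulrA ler_pdivrMr ?ltr0n //. by rewrite wM mulrC.
have h3 : \sum_(n < m) poisson_w rho n * rho^-1 <= 1.
  rewrite -mulr_suml; apply: le_trans (sumw m); rewrite ler_piMr ?invf_le1 //.
  by apply: sumr_ge0.
have -> : \sum_(n < m) poisson_w rho n * D n =
  \sum_(n < m) poisson_w rho n * (n%:R / rho) +
  \sum_(n < m) poisson_w rho n * rho^-1 + \sum_(n < m) poisson_w rho n * (rho / n.+1%:R).
  rewrite -!big_split; apply: eq_bigr => n _ /=; rewrite -!mulrDr; congr (_ * _).
  by rewrite /D -natr1 mulrDl mul1r.
lra.
Qed.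

Lemma lin_growth_integrable g : lin_growth g -> P.-integrable setT (EFin \o (fun w => g (M w))).
Proof.
move=> [C hC].
have iD : P.-integrable setT (EFin \o (fun w => D (M w))).
  apply/integrableP; split; first by apply/measurable_EFinP; exact: mgM.
  rewrite (eq_integral (fun w => (D (M w))%:E)); first by rewrite (le_lt_trans Dle) ?ltry.
  by move=> w _ /=; rewrite ger0_norm.
apply: (le_integrable _ _ _ (integrableZl measurableT (C * rho) iD)) => //.
  by apply/measurable_EFinP; exact: mgM.
move=> w _; rewrite /= lee_fin; apply: le_trans (ler_norm _).
apply: (le_trans (hC _)).
have C0 : 0 <= C by have := le_trans (normr_ge0 _) (hC 0%N); rewrite mulr1.
rewrite -mulrA ler_wpM2l // /D mulrDr mulrCA divff ?gt_eqF // mulr1 lerDl.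
by rewrite mulr_ge0 ?divr_ge0 // ltW.
Qed.

Definition atom_mean g : R := fine (\int[P]_w (g (M w))%:E)%E.

Lemma lin_growthD g h : lin_growth g -> lin_growth h -> lin_growth (fun n => g n + h n).
Proof.
move=> [C hC] [C' hC']; exists (C + C') => n.
by rewrite (le_trans (ler_normD _ _)) // mulrDl lerD.
Qed.

Lemma lin_growthZ c g : lin_growth g -> lin_growth (fun n => c * g n).
Proof. by move=> [C hC]; exists (`|c| * C) => n; rewrite normrM -mulrA ler_wpM2l. Qed.

Lemma lin_growth_cst c : lin_growth (fun=> c).
Proof. by exists `|c| => n; rewrite ler_peMr // ler1n. Qed.

Lemma lin_growth_D : lin_growth D.
Proof.
exists (1 + rho) => n; rewrite ger0_norm // mulrDl mul1r; apply: lerD.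
  by rewrite ler_piMr // invf_le1.
by rewrite ler_wpM2l ?(ltW rho_gt0) // (@le_trans _ _ 1) ?invf_le1 ?ler1n.
Qed.

Lemma atom_meanD g h : lin_growth g -> lin_growth h ->
  atom_mean (fun n => g n + h n) = atom_mean g + atom_mean h.
Proof.
move=> lg lh; rewrite /atom_mean -fineD ?integrable_fin_num //; try exact: lin_growth_integrable.
congr fine; rewrite -integralD //; exact: lin_growth_integrable.
Qed.

Lemma atom_meanZ c g : lin_growth g -> atom_mean (fun n => c * g n) = c * atom_mean g.
Proof.
move=> lg; have ig := lin_growth_integrable lg.
rewrite /atom_mean; under eq_integral do rewrite EFinM.
by rewrite integralZl // fineM // integrable_fin_num.
Qed.

Lemma atom_mean_cst c : atom_mean (fun=> c) = c.
Proof. by rewrite /atom_mean integral_cst // [X in (_ * X)%E]probability_setT mule1. Qed.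

Lemma le_atom_mean g h : lin_growth g -> lin_growth h -> (forall n, g n <= h n) ->
  atom_mean g <= atom_mean h.
Proof.
move=> lg lh gh; rewrite /atom_mean fine_le ?integrable_fin_num //; try exact: lin_growth_integrable.
by apply: le_integral => //; try exact: lin_growth_integrable; move=> w _; rewrite lee_fin.
Qed.

Lemma lin_growth_le g h : (forall n, `|g n| <= h n) -> lin_growth h -> lin_growth g.
Proof.
move=> gh [C hC]; exists C => n; apply: le_trans (hC n).
by rewrite (le_trans (gh n)) // ler_norm.
Qed.

Lemma atom_mean_norm_le g c x y : 0 <= x -> (forall n, `|g n - c| <= x * D n + y) ->
  `|atom_mean g - c| <= 3 * x + y.
Proof.
move=> x0 h.
have lD : lin_growth (fun n => x * D n + y).
  by apply: lin_growthD; [apply: lin_growthZ; exact: lin_growth_D|exact: lin_growth_cst].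
have lgc : lin_growth (fun n => g n - c) by exact: lin_growth_le h lD.
have lg : lin_growth g.
  have -> : g = fun n => (g n - c) + c by apply/funext => n; rewrite subrK.
  by apply: lin_growthD => //; exact: lin_growth_cst.
have e : atom_mean g - c = atom_mean (fun n => g n - c).
  by rewrite atom_meanD ?atom_mean_cst //; exact: lin_growth_cst.
have D3 : atom_mean (fun n => x * D n + y) <= 3 * x + y.
  rewrite atom_meanD ?atom_mean_cst; [|apply: lin_growthZ; exact: lin_growth_D|exact: lin_growth_cst].
  rewrite lerD2r atom_meanZ; last exact: lin_growth_D.
  rewrite mulrC ler_wpM2r // -lee_fin /atom_mean fineK ?Dle //.
  by rewrite integrable_fin_num //; exact: lin_growth_integrable lin_growth_D.
rewrite e; apply: le_trans D3; rewrite ler_norml; apply/andP; split; last first.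
  by apply: le_atom_mean => // n; rewrite (le_trans (ler_norm _)).
rewrite lerNl -mulN1r -atom_meanZ //; apply: le_atom_mean => //; first exact: lin_growthZ.
by move=> n; rewrite mulN1r (le_trans _ (h n)) // -normrN ler_norm.
Qed.

Let L n : R := ln n.+1%:R - ln rho.

(** [D n] is [e^L + e^(-L)], and [t^2 <= 4 e^t] for [t >= 0]. *)
Let L_sqr n : L n ^+ 2 <= 4 * D n.
have n0 : 0 < n.+1%:R :> R by [].
have e1 : expR (L n) = n.+1%:R / rho by rewrite expRB !lnK ?posrE.
have e2 : expR (- L n) = rho / n.+1%:R by rewrite /L opprB expRB !lnK ?posrE.
have key (t : R) : 0 <= t -> t ^+ 2 <= 4 * expR t.
  move=> t0; have h := expR_ge1Dx (t / 2).
  have -> : expR t = expR (t / 2) ^+ 2 by rewrite -expRM_natl; congr expR; field.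
  have h4 : 0 <= 1 + t / 2 by rewrite addr_ge0 // divr_ge0.
  have h5 : (1 + t / 2) ^+ 2 <= expR (t / 2) ^+ 2 by rewrite lerXn2r ?nnegrE ?expR_ge0.
  have h6 : (1 + t / 2) ^+ 2 = 1 + t + t ^+ 2 / 4 by field. by rewrite h6 in h5; lra.
rewrite /D -e1 -e2 mulrDr; have [t0|/ltW t0] := leP 0 (L n).
  by rewrite (le_trans (key _ t0)) // lerDl mulr_ge0 // expR_ge0.
rewrite -sqrrN (le_trans (key _ _)) ?oppr_ge0 // lerDr mulr_ge0 // expR_ge0.
Qed.

Let L_norm n : `|L n| <= 4 * D n + 1.
have h := L_sqr n; have s := sqr_ge0 (`|L n| - 1).
have n2 : `|L n| ^+ 2 = L n ^+ 2 by rewrite real_normK ?num_real.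
have a0 := normr_ge0 (L n); have l2 := sqr_ge0 (L n).
move: s; rewrite sqrrB1 n2; move: (`|L n|) (L n ^+ 2) (D n) h a0 l2 => x y z h a0 l2 s.
rewrite -mulr_natr in s; lra.
Qed.

Let a n := part_expect pi n.
Let V n := part_variance pi n.
Variables (alpha beta C CH : R).
Hypotheses (C_ge0 : 0 <= C) (CH_ge0 : 0 <= CH) (a_asymp : forall n, `|a n - alpha * ln n.+1%:R| <= C).
Hypothesis V_asymp : forall n, `|V n - beta * ln n.+1%:R| <= C.
Hypothesis V_shift : forall n c, part_mean pi (fun k => (k%:R - c) ^+ 2) n = V n + (a n - c) ^+ 2.
Hypothesis V_ge0 : forall n, 0 <= V n.
Hypothesis heat_chain : forall s n m, 1 <= s ->
  `|part_mean pi (fun k => heat (m - (k%:R - a n)) s) n - heat m (s + V n)| <=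
  CH * rsqrt s ^+ 3 * hsum R n.

Let A := mean P (fun w => (K w)%:R).
Let v := fine 'V_P[fun w => (K w)%:R : R].

(** [13 = 3 * 4 + 1]: the mean of [D] is at most 3, and [|L| <= 4 D + 1]. *)
Let C1 := 13 * `|alpha| + C.
Let C2 := 24 * alpha ^+ 2 + 2 * (C + C1) ^+ 2 + 13 * `|beta| + C.

Let log_dev (g : nat -> R) (c : R) : (forall n, `|g n - c * ln n.+1%:R| <= C) ->
  forall n, `|g n - c * ln rho| <= `|c| * `|L n| + C.
move=> h n; have -> : g n - c * ln rho = c * L n + (g n - c * ln n.+1%:R) by rewrite /L; ring.
by rewrite (le_trans (ler_normD _ _)) // normrM lerD2l.
Qed.

Let log_devD (g : nat -> R) (c : R) : (forall n, `|g n - c * ln n.+1%:R| <= C) ->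
  forall n, `|g n - c * ln rho| <= 4 * `|c| * D n + (`|c| + C).
move=> h n; apply: (le_trans (log_dev h n)).
have := ler_wpM2l (normr_ge0 c) (L_norm n); move: (`|c|) (D n) => x y; lra.
Qed.

Lemma poisson_mixture_expect : `|A - alpha * ln rho| <= C1.
Proof.
have -> : A = atom_mean a.
  rewrite /A /mean unlock /atom_mean; congr fine.
  exact: (@integral_mixture (fun k => k%:R) (fun k => ler0n _ k)).
have h := @atom_mean_norm_le a (alpha * ln rho) (4 * `|alpha|) (`|alpha| + C) _ (log_devD a_asymp).
apply: (le_trans (h _)); first by rewrite mulr_ge0.
by rewrite /C1; lra.
Qed.

Let dev n : `|a n - A| <= `|alpha| * `|L n| + (C + C1).
have -> : a n - A = (a n - alpha * ln rho) - (A - alpha * ln rho) by ring.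
rewrite (le_trans (ler_normB _ _)) // addrA lerD ?log_dev //; exact: poisson_mixture_expect.
Qed.

Let dev2 n : `|V n + (a n - A) ^+ 2 - beta * ln rho| <=
  (4 * `|beta| + 8 * alpha ^+ 2) * D n + (`|beta| + C + 2 * (C + C1) ^+ 2).
have h1 := log_devD V_asymp n.
have h2 : (a n - A) ^+ 2 <= 8 * alpha ^+ 2 * D n + 2 * (C + C1) ^+ 2.
  have -> : (a n - A) ^+ 2 = `|a n - A| ^+ 2 by rewrite real_normK ?num_real.
  have h3 : `|a n - A| ^+ 2 <= (`|alpha| * `|L n| + (C + C1)) ^+ 2.
    by rewrite lerXn2r ?nnegrE ?(le_trans _ (dev n)).
  have h4 : (`|alpha| * `|L n|) ^+ 2 <= alpha ^+ 2 * (4 * D n).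
    by rewrite exprMn !real_normK ?num_real // ler_wpM2l ?sqr_ge0 // L_sqr.
  exact: sqr_split_le h3 h4.
have h0 := sqr_ge0 (a n - A).
have -> : V n + (a n - A) ^+ 2 - beta * ln rho = (V n - beta * ln rho) + (a n - A) ^+ 2 by ring.
rewrite (le_trans (ler_normD _ _)) // (ger0_norm h0).
move: h1 h2; move: (`|V n - _|) ((a n - A) ^+ 2) (`|beta|) (D n) (alpha ^+ 2) ((C + C1) ^+ 2).
by move=> x1 x2 x3 x4 x5 x6; lra.
Qed.

(** Conditioning on the number of atoms: mean conditional variance plus variance of the conditional
    mean. The latter is bounded, since [a n] is within [|alpha| |L n|] of [A] up to a constant. *)
Let vE : v = atom_mean (fun n => V n + (a n - A) ^+ 2).
have h0 k : 0 <= (k%:R - A) ^+ 2 by exact: sqr_ge0.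
rewrite /v variance_mean -/A {1}/mean unlock /atom_mean; congr fine.
rewrite (integral_mixture h0).
by apply: eq_integral => w _; rewrite V_shift.
Qed.

Lemma poisson_mixture_variance : `|v - beta * ln rho| <= C2.
Proof.
rewrite vE.
have h := @atom_mean_norm_le (fun n => V n + (a n - A) ^+ 2) (beta * ln rho)
  (4 * `|beta| + 8 * alpha ^+ 2) (`|beta| + C + 2 * (C + C1) ^+ 2) _ dev2.
apply: (le_trans (h _)); first by rewrite addr_ge0 // mulr_ge0 // sqr_ge0.
rewrite /C2; move: (`|beta|) (alpha ^+ 2) ((C + C1) ^+ 2) => x1 x2 x3; lra.
Qed.

Lemma poisson_mixture_variance_ge0 : 0 <= v.
Proof.
rewrite vE /atom_mean fine_ge0 //; apply: integral_ge0 => w _.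
by rewrite lee_fin addr_ge0 // sqr_ge0.
Qed.

(** For each number of atoms the chain estimate is recentred from the mean and variance at [n] to
    [A] and [v] by [heat_lip]; the shifts are affine in [D n], hence bounded on average. *)
Lemma poisson_mixture_heat s m : 1 <= s ->
  `|mean P (fun w => heat (m - ((K w)%:R - A)) s) - heat m (s + v)| <=
  (CH + gauss_bound R) * (30 + 13 * `|alpha| + 13 * `|beta| + 2 * C + C1 + C2) *
  (rsqrt s ^+ 3 * (ln rho + 1) + rsqrt s).
Proof.
move=> s1.
have B0 : 0 <= gauss_bound R by exact: gauss_bound_ge0.
have l0 : 0 <= ln rho by exact: ln_ge0.
have sp : 0 < rsqrt s by exact: rsqrt_gt0.
set w1 := rsqrt s; set w3 := w1 ^+ 3.
have w30 : 0 <= w3 by rewrite exprn_ge0 // ltW.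
have w10 : 0 <= w1 by exact: ltW.
have -> : mean P (fun w => heat (m - ((K w)%:R - A)) s) =
    atom_mean (part_mean pi (fun k => heat (m - (k%:R - A)) s)).
  rewrite /mean unlock /atom_mean; congr fine.
  apply: (@integral_mixture (fun k => heat (m - (k%:R - A)) s)) => k.
  by have /andP[] := gauss_cdf_itv ((m - (k%:R - A)) * rsqrt s).
pose x := CH * w3 * 4 + gauss_bound R * w1 * (4 * `|alpha| + 4 * `|beta|).
pose y := CH * w3 * (2 + ln rho) + gauss_bound R * w1 * ((`|alpha| + C + C1) + (`|beta| + C + C2)).
have Bw := mulr_ge0 B0 w10; have Cw := mulr_ge0 CH_ge0 w30.
have x0 : 0 <= x.
  apply: addr_ge0; first exact: mulr_ge0.
  by apply: mulr_ge0 => //; apply: addr_ge0; exact: mulr_ge0.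
have h n : `|part_mean pi (fun k => heat (m - (k%:R - A)) s) n - heat m (s + v)| <= x * D n + y.
  have e1 := heat_chain n (m - (a n - A)) s1.
  have e2 : part_mean pi (fun k => heat (m - (a n - A) - (k%:R - a n)) s) n =
      part_mean pi (fun k => heat (m - (k%:R - A)) s) n.
    apply: eq_part_mean => k; have e : m - (a n - A) - (k%:R - a n) = m - (k%:R - A) by ring.
    by rewrite e.
  rewrite e2 in e1. have e3 := @heat_lip _ m (a n - A) s (s + v) (s + V n) s1.
  rewrite !lerDl poisson_mixture_variance_ge0 V_ge0 in e3; have {}e3 := e3 isT isT.
  have e4 : s + V n - (s + v) = (V n - beta * ln rho) - (v - beta * ln rho) by ring.
  have e5 : `|a n - A| <= 4 * `|alpha| * D n + (`|alpha| + C + C1).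
    have -> : a n - A = (a n - alpha * ln rho) - (A - alpha * ln rho) by ring.
    rewrite (le_trans (ler_normB _ _)) // addrA lerD ?log_devD //; exact: poisson_mixture_expect.
  have e6 : `|s + V n - (s + v)| <= 4 * `|beta| * D n + (`|beta| + C + C2).
    rewrite e4 (le_trans (ler_normB _ _)) // addrA lerD ?log_devD //; exact: poisson_mixture_variance.
  have e7 : hsum R n <= 4 * D n + (2 + ln rho).
    have hn : hsum R n <= 1 + ln n.+1%:R.
      by apply: le_trans (harmonic_le_ln R (ltn0Sn n)); rewrite harmonic_le.
    exact: (log_shift_le hn (le_trans (ler_norm _) (L_norm n))).
  have f1 := ler_wpM2l (mulr_ge0 CH_ge0 w30) e7.
  have f2 := ler_wpM2l (mulr_ge0 B0 w10) (lerD e5 e6).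
  have t (p q u : R) : p - q = (p - u) + (u - q) by ring.
  rewrite (t _ _ (heat (m - (a n - A)) (s + V n))) (le_trans (ler_normD _ _)) //.
  apply: le_trans (lerD (le_trans e1 f1) (le_trans e3 f2)) _.
  by apply: le_of_eq; rewrite /x /y; ring.
apply: (le_trans (atom_mean_norm_le x0 h)).
have C10 : 0 <= C1 by exact: le_trans poisson_mixture_expect.
have C20 : 0 <= C2 by exact: le_trans poisson_mixture_variance.
exact: heat_error_le.
Qed.

End PoissonMixture.

(** * From heat estimates to asymptotic normality *)

Lemma cube_scale_le (R : realType) (b l s w : R) : 0 < b -> 0 < w -> w ^+ 2 = s^-1 -> 0 < s ->
  1 <= l -> b * l <= 2 * s -> w ^+ 3 * (l + 1) <= 4 / b * w.
Proof.
move=> b0 w0 ws s0 l1 h; rewrite exprSr ws mulrAC ler_pM2r // mulrC ler_pdivrMr //.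
rewrite mulrAC ler_pdivlMr // mulrC.
have : b * (l + 1) <= b * (2 * l) by rewrite ler_pM2l //; lra.
lra.
Qed.

Section NormalLimit.
Context d (Omega : measurableType d) (R : realType) (P : probability Omega R).

Lemma rsqrtM (s t : R) : 0 < s -> 0 < t -> rsqrt (s * t) = rsqrt s * rsqrt t.
Proof. by move=> s0 t0; rewrite /rsqrt lnM ?posrE // -expRD; congr expR; ring. Qed.

Lemma rsqrt_sqrt (t : R) : 0 < t -> Num.sqrt t * rsqrt t = 1.
Proof.
move=> t0; have p : 0 <= Num.sqrt t * rsqrt t.
  by rewrite mulr_ge0 ?sqrtr_ge0 // ltW // rsqrt_gt0.
apply/eqP; rewrite -(@pexpr_eq1 _ _ 2) // exprMn sqr_sqrtr ?(ltW t0) //.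
by rewrite rsqrt_sqr // divff // gt_eqF.
Qed.

Lemma rsqrt_pow2 (e : R) : 0 < e -> rsqrt (e ^+ 2) = e^-1.
Proof.
move=> e0; rewrite /rsqrt lnXn // -[e in RHS]lnK ?posrE // -expRN; congr expR.
by rewrite -mulr_natr; field.
Qed.

(** Smoothing at width [e] after normalisation is smoothing at variance [s = e^2 v] before it, and
    by scaling the limit is [heat y (1 + e^2)]. As [l] is at most of order [s], the error is of
    order [s^(-1/2)]. *)
Lemma cvg_prb_heat (T : Type) (F : set_system T) (FF : ProperFilter F) (X : T -> Omega -> R)
    (A v l : T -> R) (beta C : R) : 0 < beta -> 0 <= C ->
  (\forall i \near F, measurable_fun setT (X i)) ->
  (forall M : R, \forall i \near F, M <= l i) ->
  (\forall i \near F, `|v i - beta * l i| <= C) ->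
  (\forall i \near F, forall s m, 1 <= s ->
    `|mean P (fun w => heat (m - (X i w - A i)) s) - heat m (s + v i)| <=
    C * (rsqrt s ^+ 3 * (l i + 1) + rsqrt s)) ->
  forall x, prb P [set w | (X i w - A i) / Num.sqrt (v i) <= x] @[i --> F] --> gauss_cdf x.
Proof.
move=> beta0 C0 mX linf hv hheat x.
apply: (@cvg_prb_gauss _ _ _ P T F FF (fun i w => (X i w - A i) / Num.sqrt (v i))).
  near=> i; apply: measurable_funM => //; apply: measurable_funB => //. by near: i.
move=> e y e0; apply/cvgrPdist_le => del del0.
pose C3 := C * (4 / (beta * e ^+ 2) + 1) + 1.
have e20 : 0 < e ^+ 2 by rewrite exprn_gt0.
have be : 0 < beta * e ^+ 2 by rewrite mulr_gt0.
have C30 : 0 < C3 by rewrite /C3 ltr_wpDl // mulr_ge0 // addr_ge0 // divr_ge0 // ltW.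
pose eta := del / C3.
have eta0 : 0 < eta by rewrite divr_gt0.
have M1 := linf (2 * C / beta); have M2 := linf 1.
have M3 := linf (2 / (beta * e ^+ 2)).
have M4 := linf (2 / (beta * e ^+ 2) / eta ^+ 2).
near=> i.
have l1 : 1 <= l i by near: i.
have l2 : 2 * C / beta <= l i by near: i.
have l4 : 2 / (beta * e ^+ 2) / eta ^+ 2 <= l i by near: i.
have l3 : 2 / (beta * e ^+ 2) <= l i by near: i.
have hvi : `|v i - beta * l i| <= C by near: i.
have h : forall s m, 1 <= s ->
    `|mean P (fun w => heat (m - (X i w - A i)) s) - heat m (s + v i)| <=
    C * (rsqrt s ^+ 3 * (l i + 1) + rsqrt s) by near: i.
move: l2 l3 l4; rewrite !ler_pdivrMr ?exprn_gt0 // => l2 l3 l4.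
have vl : beta * l i <= 2 * v i.
  by move: hvi; rewrite ler_norml => /andP[h1 _]; move: h1 l2; rewrite [l i * beta]mulrC; lra.
have v0 : 0 < v i.
  by have := mulr_gt0 beta0 (lt_le_trans ltr01 l1); lra.
pose s := e ^+ 2 * v i.
have s0 : 0 < s by rewrite mulr_gt0.
have vle : beta * e ^+ 2 * l i <= 2 * s.
  have -> : beta * e ^+ 2 * l i = e ^+ 2 * (beta * l i) by ring.
  have -> : 2 * s = e ^+ 2 * (2 * v i) by rewrite /s; ring. by rewrite ler_pM2l.
have s1 : 1 <= s by move: l3 vle; rewrite mulrC; lra.
have se : 1 <= s * eta ^+ 2.
  have := ler_wpM2r (ltW (exprn_gt0 2 eta0)) vle.
  by move: l4; rewrite [l i * _ * _]mulrAC [l i * (beta * _)]mulrC mulrAC; lra.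
have ws : rsqrt s <= eta.
  rewrite -(@ler_pXn2r _ 2) ?nnegrE ?(ltW eta0) ?(ltW (rsqrt_gt0 _)) //.
  by rewrite rsqrt_sqr // -[leLHS]mul1r ler_pdivrMr // mulrC.
have := h s (y * Num.sqrt (v i)) s1.
have q1 : mean P (fun w => heat (y * Num.sqrt (v i) - (X i w - A i)) s) =
    mean P (fun w => gauss_cdf ((y - (X i w - A i) / Num.sqrt (v i)) / e)).
  apply: eq_mean => w; rewrite /heat; congr gauss_cdf.
  rewrite /s rsqrtM // rsqrt_pow2 // mulrCA [RHS]mulrC; congr (_ * _).
  rewrite mulrBl -mulrA rsqrt_sqrt // mulr1; congr (_ - _ * _).
  apply: (mulfI (_ : Num.sqrt (v i) != 0)); first by rewrite gt_eqF // sqrtr_gt0.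
  by rewrite rsqrt_sqrt // divff // gt_eqF // sqrtr_gt0.
have q2 : heat (y * Num.sqrt (v i)) (s + v i) = heat y (1 + e ^+ 2).
  rewrite /heat; congr gauss_cdf; have -> : s + v i = (1 + e ^+ 2) * v i by rewrite /s; ring.
  rewrite rsqrtM // ?addr_gt0 //; have := rsqrt_sqrt v0.
  move: (rsqrt (1 + _)) (rsqrt (v i)) (Num.sqrt (v i)) => z1 z2 z3 z.
  by transitivity (y * z1 * (z3 * z2)); [ring | rewrite z mulr1].
rewrite q1 q2 distrC => hh; apply: (le_trans hh).
have w0 := rsqrt_gt0 s.
have w3 : rsqrt s ^+ 3 * (l i + 1) <= 4 / (beta * e ^+ 2) * rsqrt s.
  exact: (cube_scale_le be w0 (rsqrt_sqr s0) s0 l1 vle).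
apply: (@le_trans _ _ (C3 * rsqrt s)).
  rewrite /C3 mulrDl mul1r -mulrA mulrDl mul1r.
  have h5 : C * (rsqrt s ^+ 3 * (l i + 1) + rsqrt s) <=
    C * (4 / (beta * e ^+ 2) * rsqrt s + rsqrt s) by apply: (ler_wpM2l C0); rewrite lerD2r; exact: w3.
  by apply: (le_trans h5); rewrite lerDl ltW.
by rewrite mulrC -ler_pdivlMr.
Unshelve. all: by end_near. Qed.

Lemma asymptotically_normal_of_heat (T : Type) (F : set_system T) (FF : ProperFilter F)
    (X : T -> Omega -> R) (l : T -> R) (beta C : R) : 0 < beta -> 0 <= C ->
  (\forall i \near F, measurable_fun setT (X i)) ->
  (forall M : R, \forall i \near F, M <= l i) ->
  (\forall i \near F, `|fine 'V_P[X i] - beta * l i| <= C) ->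
  (\forall i \near F, forall s m, 1 <= s ->
    `|mean P (fun w => heat (m - (X i w - mean P (X i))) s) - heat m (s + fine 'V_P[X i])| <=
    C * (rsqrt s ^+ 3 * (l i + 1) + rsqrt s)) ->
  asymptotically_normal P F X.
Proof.
move=> beta0 C0 mX linf hv hheat.
have mW : \forall i \near F, measurable_fun setT
    (fun w => (X i w - fine 'E_P[X i]) / Num.sqrt (fine 'V_P[X i])).
  near=> i; apply: measurable_funM => //; apply: measurable_funB => //. by near: i.
split => // x _.
suff h : P [set w | (X i w - fine 'E_P[X i]) / Num.sqrt (fine 'V_P[X i]) <= x] @[i --> F] -->
    (gauss_cdf x)%:E by rewrite -gauss_cdfE in h; exact: h.
apply/fine_cvgP; split.
  near=> i; have mi : measurable_fun setT
      (fun w => (X i w - fine 'E_P[X i]) / Num.sqrt (fine 'V_P[X i])) by near: i.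
  by rewrite fin_num_measure //; exact: measurable_le_set.
exact: (@cvg_prb_heat T F FF X (fun i => fine 'E_P[X i]) (fun i => fine 'V_P[X i])
  l beta C beta0 C0 mX linf hv hheat x).
Unshelve. all: by end_near. Qed.

End NormalLimit.

Lemma eqaddO_near (R : realType) (T : Type) (F : filter_on T) (f g : T -> R) (C : R) :
  (\forall i \near F, `|f i - g i| <= C) -> f = g +O_F (cst (1 : R)).
Proof.
move=> h; apply/eqaddOP/bigO_exP; exists (`|C| + 1); first by rewrite ltr_wpDl.
by apply: filterS h => i hi; rewrite /= normr1 mulr1 (le_trans hi) // (le_trans (ler_norm _)) // lerDl.
Qed.

(** * Limits of both compositions of the subordinator *)

Section Composition.
Context (R : realType) (d : measure_display) (Omega : measurableType d) (P : probability Omega R).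
Variables (S : R -> Omega -> R) (nu : {measure set R -> \bar R}) (r : nat).
Variable u : forall n : nat, 'I_n -> Omega -> R.
Arguments u : clear implicits.
Hypotheses (hS : driftless_subordinator P S nu) (hdens : has_continuous_density nu)
  (hL : condition_L nu) (hR : condition_R nu) (hr : (0 < r)%N).
Hypothesis hu : forall n : nat, iid_uniform P (u n).
Hypothesis huS : forall n : nat, independent_systems P
  (sigma_generated `[0, +oo[%classic S) (sigma_generated setT (u n)).

Let m := levy_moment nu.
Let a := (m 1%N * r%:R)^-1.
Let b := m 2%N / (r%:R ^+ 2 * m 1%N ^+ 3) + (r%:R * m 1%N)^-1.
Let pi := part_law P S u r.

Lemma levy_composition : [/\ 0 < m 1%N, 0 < laplace_exp nu 1,
  (forall e : R, 0 < e -> exists m0, forall k, (m0 <= k)%N ->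
     laplace_exp nu k.+1%:R / k.+1%:R <= e) &
  exists C CH : R, [/\ 0 <= C, 0 <= CH,
    forall n, `|part_expect pi n - a * ln n.+1%:R| <= C,
    forall n, `|part_variance pi n - b * ln n.+1%:R| <= C &
    forall s n x, 1 <= s ->
      `|part_mean pi (fun k => heat (x - (k%:R - part_expect pi n)) s) n -
        heat x (s + part_variance pi n)| <= CH * rsqrt s ^+ 3 * hsum R n]].
Proof.
have hnu : levy_measure nu by case: hS.
have [dl0 dl0_gt0 nu_exp] := levy_exp_integrable hnu hR.
have [al [be [eta [al0 alb eta0 minor]]]] := levy_minor hdens hL nu_exp.
have rate_lim := levy_part_rate hnu hdens hL dl0_gt0 nu_exp hr.
have total := levy_total_rate hnu hdens hL dl0_gt0 nu_exp.
have sub := laplace_exp_sublinear hnu hdens hL dl0_gt0 nu_exp.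
have Phi1 : 0 < laplace_exp nu 1 := laplace1_gt0 dl0_gt0 al0 alb eta0 minor.
have m1_gt0 : 0 < levy_int nu (fun y => y) := m1_gt0 dl0_gt0 nu_exp al0 alb eta0 minor.
have Phi_ge0 := @laplace_exp_ge0 R nu.
have Phi0 := laplace_exp0 nu.
have psum : forall n, part_mean pi (fun=> 1) n = 1 := part_law_sum hS hu hr.
have prec0 := part_law_rec hS hu huS hr Phi_ge0 Phi0 Phi1 sub.
have prec : forall h n, (0 < n)%N -> \sum_(i < n) rate nu n i *
    (part_mean pi h n - part_mean pi (fun k => h ((n - i == r) + k)%N) i) = 0.
  by move=> h n _; exact: prec0.
split => //.
have [de de0 [ce [Ce hE]]] := part_expect_asymp dl0_gt0 nu_exp al0 alb eta0 minor hr rate_lim psum prec.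
have [dv dv0 [cv [Cv hV]]] := part_variance_asymp dl0_gt0 nu_exp al0 alb eta0 minor hr rate_lim total psum prec.
have [CM hM] := chain_moments dl0_gt0 nu_exp al0 alb eta0 minor hr rate_lim total psum prec.
have [CH CH0 hH] := chain_heat dl0_gt0 nu_exp Phi1 (part_law_ge0 P S u r) psum prec hM.
(* [H n - ln (n + 1)] lies in [[0, 1]], so harmonic numbers may be traded for logarithms at bounded
   cost; [n + 1] keeps the logarithm meaningful at [n = 0]. *)
have log_of (g : nat -> R) (x c C dl : R) : 0 < dl ->
    (forall n, `|g n - x * hsum R n - c| <= C * weight dl n) ->
    forall n, `|g n - x * ln n.+1%:R| <= `|c| + `|C| + `|x|.
  move=> dl1 h n. have hw : C * weight dl n <= `|C|.
    have w0 : 0 <= weight dl n by rewrite ltW // weight_gt0 // ltW.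
    apply: (le_trans (ler_wpM2r w0 (ler_norm C))). by rewrite ler_piMr // weight_le1 // ltW.
  have hd : `|hsum R n - ln n.+1%:R| <= 1.
    have h1 := ln_le_harmonic R n. have h2 : hsum R n <= 1 + ln n.+1%:R.
      by apply: le_trans (harmonic_le_ln R (ltn0Sn n)); rewrite harmonic_le.
    by rewrite ger0_norm ?subr_ge0 // lerBlDr.
  have -> : g n - x * ln n.+1%:R = (c + (g n - x * hsum R n - c)) +
    x * (hsum R n - ln n.+1%:R) by ring.
  rewrite (le_trans (ler_normD _ _)) // lerD //.
    by rewrite (le_trans (ler_normD _ _)) // lerD2l (le_trans (h n)).
  by rewrite normrM ler_piMr.
have r0 : r%:R != 0 :> R by rewrite pnatr_eq0 -lt0n.
have m10 : levy_int nu (fun y => y) != 0 by rewrite gt_eqF.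
have aE : r%:R^-1 / levy_int nu (fun y => y) = a by rewrite /a invfM mulrC.
have bE : (r%:R^-1 + levy_int nu (fun y => y ^+ 2) *
    (r%:R^-1 / levy_int nu (fun y => y)) ^+ 2) / levy_int nu (fun y => y) = b.
  rewrite /b /m -[levy_moment nu 1]/(levy_int nu (fun y => y)).
  rewrite -[levy_moment nu 2]/(levy_int nu (fun y => y ^+ 2)).
  move: (levy_int nu _) (levy_int nu _) m10 => x1 x2 x0; field. by rewrite x0 r0.
pose C := (`|ce| + `|Ce| + `|a|) + (`|cv| + `|Cv| + `|b|).
exists C, CH; split => //.
- by rewrite /C !addr_ge0.
- move=> n; rewrite -aE in hE *; apply: (le_trans (log_of _ _ _ _ _ de0 hE n)).
  by rewrite /C -aE lerDl !addr_ge0.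
- move=> n; rewrite -bE; apply: (le_trans (log_of _ _ _ _ _ dv0 hV n)).
  by rewrite /C -bE lerDr !addr_ge0.
Qed.

Let b_gt0 : 0 < m 1%N -> 0 < b.
move=> m1; have m2 : 0 <= m 2%N by apply: (@levy_int_ge0 _ nu) => y _; exact: sqr_ge0.
rewrite /b ltr_wpDl ?invr_gt0 ?mulr_gt0 ?ltr0n //.
by rewrite divr_ge0 // mulr_ge0 ?sqr_ge0 // exprn_ge0 // ltW.
Qed.

Let K (n : nat) := nb_parts S (u n) r.

Let mK n : measurable_fun setT (K n).
by apply: measurable_natr => k; exact: (measurable_uniform_parts hS hu hr). Qed.

Let meanK n h : mean P (fun w => h (uniform_parts S u r n w)) = part_mean pi h n.
exact: (mean_uniform_parts hS hu hr). Qed.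

Let expectK n : mean P (K n) = part_expect pi n.
exact: (meanK n (fun k => k%:R)). Qed.

Let varK n : fine 'V_P[K n] = part_variance pi n.
by rewrite variance_mean expectK; exact: (meanK n (fun k => (k%:R - part_expect pi n) ^+ 2)). Qed.

Lemma uniform_composition_limits : [/\ asymptotically_normal P \oo K,
  (fun n : nat => fine 'E_P[K n]) = (fun n : nat => a * ln n%:R) +O_ \oo (cst (1 : R)) &
  (fun n : nat => fine 'V_P[K n]) = (fun n : nat => b * ln n%:R) +O_ \oo (cst (1 : R))].
Proof.
have [m1 Phi1 sub [C [CH [C0 CH0 hE hV hH]]]] := levy_composition.
(* The estimates so far are in [ln (n + 1)]; for [n >= 1] the passage to [ln n] costs at most 1. *)
have lnS n : (0 < n)%N -> `|ln n.+1%:R - ln n%:R| <= 1 :> R.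
  move=> n0; have np : 0 < n%:R :> R by rewrite ltr0n.
  have h : ln n.+1%:R <= ln n%:R + n%:R^-1 :> R.
    rewrite -[leRHS]expRK ler_ln ?posrE ?expR_gt0 // expRD lnK ?posrE //.
    have := ler_wpM2l (ltW np) (expR_ge1Dx (n%:R^-1)).
    by rewrite mulrDr mulr1 divff ?gt_eqF // natr1.
  have h2 : n%:R^-1 <= 1 :> R by rewrite invf_le1 // ler1n. rewrite ger0_norm; first by lra.
  by rewrite subr_ge0 ler_ln ?posrE ?ltr0n // ler_nat.
have shift (x y c : R) n : (0 < n)%N -> `|x - c * ln n.+1%:R| <= C -> `|x - c * ln n%:R| <= C + `|c|.
  move=> n0 h; have -> : x - c * ln n%:R = (x - c * ln n.+1%:R) + c * (ln n.+1%:R - ln n%:R) by ring.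
  by rewrite (le_trans (ler_normD _ _)) // lerD // normrM ler_piMr // lnS.
split.
- apply: (@asymptotically_normal_of_heat _ _ _ P _ _ _ K (fun n => ln n.+1%:R) b (C + CH)) => //.
  + exact: b_gt0.
  + exact: addr_ge0.
  + exact: nearW.
  + move=> M; near=> n.
    rewrite -[leLHS]expRK ler_ln ?posrE ?expR_gt0 //.
    apply: (@le_trans _ _ (Num.truncn (expR M)).+1%:R); first by rewrite ltW // truncnS_gt.
    by rewrite ler_nat ltnS; near: n; exact: nbhs_infty_ge.
  + by apply: nearW => n; rewrite varK (le_trans (hV n)) // lerDl.
  + apply: nearW => n s x s1; rewrite varK expectK.
    rewrite (meanK n (fun k => heat (x - (k%:R - part_expect pi n)) s)).
    apply: (le_trans (hH s n x s1)). have w0 : 0 <= rsqrt s by rewrite ltW // rsqrt_gt0.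
    have w3 : 0 <= rsqrt s ^+ 3 by rewrite exprn_ge0. have h2 : hsum R n <= ln n.+1%:R + 1.
      by rewrite addrC; apply: le_trans (harmonic_le_ln R (ltn0Sn n)); rewrite harmonic_le.
    rewrite -mulrA; apply: ler_pM => //; first by rewrite mulr_ge0 // harmonic_ge0.
      by rewrite lerDr.
    by rewrite (le_trans (ler_wpM2l w3 h2)) // lerDl.
- apply: (@eqaddO_near _ _ _ _ _ (C + `|a|)); near=> n.
  rewrite -/(mean P (K n)) expectK; apply: shift => //. by near: n; exact: nbhs_infty_gt.
apply: (@eqaddO_near _ _ _ _ _ (C + `|b|)); near=> n.
rewrite varK; apply: shift => //.
by near: n; exact: nbhs_infty_gt.
Unshelve. all: by end_near. Qed.

Variable N : R -> Omega -> set R.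
Hypothesis hN : forall rho : R, 0 < rho -> poisson_process P rho (N rho).
Hypothesis hNS : forall rho : R, 0 < rho -> independent_systems P
  (sigma_generated `[0, +oo[%classic S) (sigma_generated measurable (atom_count (N rho))).
Let Kp (rho : R) := nb_parts_poissonised S (N rho) r.

Let mKp rho : 0 < rho -> measurable_fun setT (Kp rho).
move=> rho0; apply: measurable_natr => k.
exact: (measurable_poisson_parts hS (hN rho0) hr).
Qed.

Let joint_law rho n k : 0 < rho -> prb P [set w | atoms (N rho) w = n /\ poisson_parts S (N rho) r w = k] =
  poisson_w rho n * pi n k.
move=> rho0; have [m1 Phi1 sub _] := levy_composition.
have Phi_ge0 := @laplace_exp_ge0 R nu.
have -> : [set w | atoms (N rho) w = n /\ poisson_parts S (N rho) r w = k] =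
    [set w | atoms (N rho) w = n /\ pred1 k (poisson_parts S (N rho) r w)].
  by apply/seteqP; split => w /= [h1 h2]; split => //; apply/eqP.
have c := @cvg_part_mean _ _ _ P S nu hS u r hu huS hr Phi_ge0 Phi1 sub n (fun i => (i == k)%:R).
rewrite (prb_poisson_parts (Q := pred1 k) hS rho0 (hN rho0) (hNS rho0) hr Phi_ge0 Phi1 sub c).
congr (_ * _); rewrite -(meanK n (fun i => (i == k)%:R)).
have mA := measurable_uniform_parts hS hu hr n k.
rewrite /pi /part_law -(mean_indic P mA); apply: eq_mean => w.
by rewrite indicE; congr (nat_of_bool _)%:R; apply/eqP/idP; rewrite inE.
Qed.

Lemma poisson_composition_limits : [/\ asymptotically_normal P +oo Kp,
  (fun rho : R => fine 'E_P[Kp rho]) = (fun rho : R => a * ln rho) +O_ +oo (cst (1 : R)) &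
  (fun rho : R => fine 'V_P[Kp rho]) = (fun rho : R => b * ln rho) +O_ +oo (cst (1 : R))].
Proof.
have [m1 Phi1 sub [C [CH [C0 CH0 hE hV hH]]]] := levy_composition.
have psum : forall n, part_mean pi (fun=> 1) n = 1 := part_law_sum hS hu hr.
have vshift := part_variance_shift psum.
have vge0 := part_variance_ge0 (part_law_ge0 P S u r).
have pos rho : 1 <= rho -> 0 < rho :> R by exact: lt_le_trans.
have args rho (rho1 : 1 <= rho) := conj
  (measurable_poisson_atoms (hN (pos rho rho1)))
  (conj (measurable_poisson_parts hS (hN (pos rho rho1)) hr)
  (conj (poisson_parts_le hS (hN (pos rho rho1)) hr)
  (conj (prb_atoms (pos rho rho1) (hN (pos rho rho1)))
   (fun n k => joint_law n k (pos rho rho1))))).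
pose C1 := 13 * `|a| + C.
pose C2 := 24 * a ^+ 2 + 2 * (C + C1) ^+ 2 + 13 * `|b| + C.
have hEp rho : 1 <= rho -> `|mean P (Kp rho) - a * ln rho| <= C1.
  move=> rho1; have [h1 [h2 [h3 [h4 h5]]]] := args rho rho1.
  exact: (poisson_mixture_expect rho1 h1 h2 h3 h4 h5 hE).
have hVp rho : 1 <= rho -> `|fine 'V_P[Kp rho] - b * ln rho| <= C2.
  move=> rho1; have [h1 [h2 [h3 [h4 h5]]]] := args rho rho1.
  exact: (poisson_mixture_variance rho1 h1 h2 h3 h4 h5 hE hV vshift).
have near1 : \forall rho \near +oo, (1 : R) <= rho by exact: nbhs_pinfty_ge.
have C10 : 0 <= C1 by rewrite addr_ge0 // mulr_ge0.
have C20 : 0 <= C2.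
  apply: addr_ge0 => //; apply: addr_ge0; last by apply: mulr_ge0.
  apply: addr_ge0; last by apply: mulr_ge0 => //; exact: sqr_ge0.
  by apply: mulr_ge0 => //; exact: sqr_ge0.
split.
- pose B := (CH + gauss_bound R) * (30 + 13 * `|a| + 13 * `|b| + 2 * C + C1 + C2).
  have B0 : 0 <= B.
    apply: mulr_ge0; first by apply: addr_ge0 => //; exact: gauss_bound_ge0.
    apply: addr_ge0 => //; apply: addr_ge0 => //. apply: addr_ge0; last by apply: mulr_ge0.
    apply: addr_ge0; last by apply: mulr_ge0. by apply: addr_ge0 => //; apply: mulr_ge0.
  apply: (@asymptotically_normal_of_heat _ _ _ P _ _ _ Kp (@ln R) b (C2 + B)).
  + exact: b_gt0.
  + exact: addr_ge0.
  + by apply: filterS near1 => rho rho1; exact: mKp (pos _ rho1).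
  + move=> M; apply: filterS (nbhs_pinfty_ge (num_real (expR M))) => rho h.
    by rewrite -[leLHS]expRK ler_ln ?posrE ?expR_gt0 // (lt_le_trans (expR_gt0 M) h).
  + by apply: filterS near1 => rho rho1; rewrite (le_trans (hVp _ rho1)) // lerDl.
  + apply: filterS near1 => rho rho1 s x s1.
    have [h1 [h2 [h3 [h4 h5]]]] := args rho rho1.
    apply: (le_trans (poisson_mixture_heat rho1 h1 h2 h3 h4 h5 C0 CH0 hE hV vshift vge0 hH x s1)).
    apply: ler_wpM2r; last by rewrite lerDr.
    have w0 : 0 <= rsqrt s by rewrite ltW // rsqrt_gt0.
    by rewrite addr_ge0 // mulr_ge0 ?exprn_ge0 // addr_ge0 // ln_ge0.
- by apply: (@eqaddO_near _ _ _ _ _ C1); apply: filterS near1 => rho; exact: hEp.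
by apply: (@eqaddO_near _ _ _ _ _ C2); apply: filterS near1 => rho; exact: hVp.
Qed.

End Composition.

Theorem theorem13 (R : realType) (d : measure_display)
    (Omega : measurableType d) (P : probability Omega R)
    (S : R -> Omega -> R) (nu : {measure set R -> \bar R})
    (u : forall n : nat, 'I_n -> Omega -> R)
    (N : R -> Omega -> set R) (r : nat)
    (hS : driftless_subordinator P S nu)
    (hdens : has_continuous_density nu)
    (hL : condition_L nu) (hR : condition_R nu)
    (hu : forall n : nat, iid_uniform P (u n))
    (huS : forall n : nat, independent_systems P
      (sigma_generated `[0, +oo[%classic S) (sigma_generated setT (u n)))
    (hN : forall rho : R, 0 < rho -> poisson_process P rho (N rho))
    (hNS : forall rho : R, 0 < rho -> independent_systems P
      (sigma_generated `[0, +oo[%classic S)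
      (sigma_generated measurable (atom_count (N rho))))
    (hr : (1 <= r)%N) :
  let m := levy_moment nu in
  let K (n : nat) := nb_parts S (u n) r in
  let Kp (rho : R) := nb_parts_poissonised S (N rho) r in
  let a := (m 1%N * r%:R)^-1 in
  let b := m 2%N / (r%:R ^+ 2 * m 1%N ^+ 3) + (r%:R * m 1%N)^-1 in
  [/\ asymptotically_normal P \oo K,
      (fun n : nat => fine 'E_P[K n]) =
        (fun n : nat => a * ln n%:R) +O_ \oo (cst (1 : R)) &
      (fun n : nat => fine 'V_P[K n]) =
        (fun n : nat => b * ln n%:R) +O_ \oo (cst (1 : R))] /\
  [/\ asymptotically_normal P +oo Kp,
      (fun rho : R => fine 'E_P[Kp rho]) =
        (fun rho : R => a * ln rho) +O_ +oo (cst (1 : R)) &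
      (fun rho : R => fine 'V_P[Kp rho]) =
        (fun rho : R => b * ln rho) +O_ +oo (cst (1 : R))].
Proof.
split; first exact: (uniform_composition_limits hS hdens hL hR hr hu huS).
exact: (poisson_composition_limits hS hdens hL hR hr hu huS hN hNS).
Qed.
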